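(* Let $S(t_1,t_2)$ be a real analytic function, not identically zero, defined on a neighborhood of the origin in $\mathbb{R}^2$, with $S(0,0)=0$ and $\nabla S(0,0)=(0,0)$. Let $H=S_{t_1t_1}S_{t_2t_2}-(S_{t_1t_2})^2$ be its Hessian determinant, assume $H(0,0)=0$ and $H$ not identically zero. Let $\eta$, $\eta'$ be the integrability exponents of $S$ and $H$ respectively, and assume $\frac{2\eta'}{1+2\eta'}\ge\eta$. For a bump function $\phi$ let \[ Tf(x_1,x_2,x_3)=\int_{\mathbb{R}^2} f(x_1-t_1,x_2-t_2,x_3-S(t_1,t_2))\,\phi(t_1,t_2)\,dt_1\,dt_2 .\] Then there is a neighborhood $U$ of the origin such that if $\phi$ is supported in $U$, then $T$ is bounded from $L^p(\mathbb{R}^3)$ to $L^q(\mathbb{R}^3)$ for all $(\frac1p,\frac1q)$ in the interior of the trapezoid in the $xy$-plane bounded by the lines $y=x$, $y=x-\frac{\eta}{\eta+1}$, $y=\frac x3$ and $y=3x-2$.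
   Context: $T$ is initially defined on Schwartz functions on $\mathbb{R}^3$; $\phi$ is a smooth compactly supported function on $\mathbb{R}^2$. Integrability exponent: for a real analytic $g$ near the origin of $\mathbb{R}^2$ with $g(0,0)=0$, not identically zero, there exist $0<\eta_g\le1$, $k\in\{0,1\}$ and a neighborhood $U$ of the origin such that for every neighborhood $V\subset U$ of the origin there are $b_V,c_V>0$ with $b_V\delta^{\eta_g}|\ln\delta|^k<m(\{t\in V:|g(t)|<\delta\})<c_V\delta^{\eta_g}|\ln\delta|^k$ for $0<\delta<\frac12$ ($m$ = Lebesgue measure); equivalently $\eta_g$ is the supremum of the $\epsilon>0$ for which $|g|^{-\epsilon}$ is integrable near the origin. $\eta=\eta_S$, $\eta'=\eta_H$. *)

(* Defs.v *)
From HB Require Import structures.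
From mathcomp Require Import all_boot all_order all_algebra.
From mathcomp Require Import all_classical all_reals all_analysis.
Set Implicit Arguments. Unset Strict Implicit. Unset Printing Implicit Defensive.
Import Order.TTheory GRing.Theory Num.Theory.
Import numFieldNormedType.Exports.
Local Open Scope classical_set_scope.
Local Open Scope ring_scope.

Section defs.
Variable R : realType.

Definition leb2 := ((@lebesgue_measure R) \x (@lebesgue_measure R))%E.
Definition leb3 := (leb2 \x (@lebesgue_measure R))%E.

Definition d1 (f : R * R -> R) : R * R -> R :=
  fun t => derive1 (fun s => f (s, t.2)) t.1.
Definition d2 (f : R * R -> R) : R * R -> R :=
  fun t => derive1 (fun s => f (t.1, s)) t.2.

Definition hessian (S : R * R -> R) : R * R -> R :=
  fun t => d1 (d1 S) t * d2 (d2 S) t - (d1 (d2 S) t) ^+ 2.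

Definition analytic_near0 (f : R * R -> R) : Prop :=
  exists2 r : R, 0 < r & exists c : nat -> nat -> R,
    forall t : R * R, `|t.1| < r -> `|t.2| < r ->
      cvgn (fun n => \sum_(i < n) \sum_(j < n) `|c i j| * `|t.1| ^+ i * `|t.2| ^+ j)
      /\ (fun n => \sum_(i < n) \sum_(j < n) c i j * t.1 ^+ i * t.2 ^+ j) @ \oo --> f t.

Definition zero_near0 (f : R * R -> R) : Prop := \forall t \near (0 : R * R), f t = 0.

Definition sq0 (r : R) : set (R * R) := [set t | `|t.1| < r /\ `|t.2| < r].

Definition neg_pow_integrable_near0 (g : R * R -> R) (e : R) : Prop :=
  exists2 r : R, 0 < r &
    leb2.-integrable (sq0 r)
      (fun t => if g t == 0 then +oo%E else (`|g t| `^ (- e))%:E).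

Definition integrability_exponent (g : R * R -> R) : R :=
  sup [set e : R | 0 < e /\ neg_pow_integrable_near0 g e].

Fixpoint iterD {V : normedModType R} (vs : seq V) (f : V -> R) : V -> R :=
  match vs with
  | [::] => f
  | v :: vs' => fun x => 'D_v (iterD vs' f) x
  end.

Definition smooth_fun {V : normedModType R} (f : V -> R) : Prop :=
  forall (vs : seq V) (x : V), differentiable (iterD vs f) x.

Definition bump_function (phi : R * R -> R) : Prop :=
  smooth_fun phi /\ compact (closure [set t | phi t != 0]).

Definition schwartz (f : R * R * R -> R) : Prop :=
  smooth_fun f /\
  forall (vs : seq (R * R * R)) (N : nat), exists C : R,
    forall x, (1 + `|x|) ^+ N * `|iterD vs f x| <= C.

Definition Top (S phi : R * R -> R) (f : R * R * R -> R) : R * R * R -> R :=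
  fun x => fine (\int[leb2]_t
     ((f (x.1.1 - t.1, x.1.2 - t.2, x.2 - S t) * phi t)%:E))%E.

Definition LpLq_bounded (T : (R * R * R -> R) -> (R * R * R -> R)) (p q : R) : Prop :=
  exists C : R, forall f, schwartz f ->
    (Lnorm leb3 q%:E (fun x => (T f x)%:E)
       <= C%:E * Lnorm leb3 p%:E (fun x => (f x)%:E))%E.

Definition trapezoid_interior (eta x y : R) : Prop :=
  [/\ y < x, x - eta / (eta + 1) < y, x / 3 < y & 3 * x - 2 < y].

End defs.

(* Main.v *)
(** Only the size of the kernel matters, so everything reduces to averages [u] over a piece [A] of
    the graph of the indicator of a set [E] of measure [V] with open vertical slices.  Where the
    Hessian determinant satisfies [|H| >= d] on [A] there are three bounds: [u <= |A|],
    [\int u = |A| V] and, up to epsilons, [\int u^4 <= C d^-1 V^3].  The last one is proved by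
    bounding [u^4] from below by an integral over triples of points of the graph of the determinant
    spanned by their normals, and that integral from above by an area inequality: an analytic map of
    the plane has few separated preimages, by comparison with polynomials and a dimension count.

    Put [b = 2 (x - y)].  Interpolation on the shell [|H| ~ d] gives [d^(e (1 - b) - b / 4)] as soon
    as [|{|H| <= d}| <= C d^e], and the hypothesis on the exponents says precisely that
    [b / 4 < eta' (1 - b)].  The shells can then be summed, and two nearby exponents [x] on the same
    horizontal line allow the level sets of [f] to be summed as well.

    The sublevel bound has to hold on one neighbourhood for all [e < eta'].  This is so unless zeros
    of order [k > 1 / eta'] of the functions [H(x, .)] cluster at the origin off the axis; but by
    Weierstrass division such zeros come in whole curves, which forces [eta' <= 1 / k]. *)
Require Import Defs.
From HB Require Import structures.
From mathcomp Require Import all_boot all_order all_algebra.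
From mathcomp Require Import all_classical all_reals all_analysis.
From mathcomp Require Import measurable_realfun.
From mathcomp Require Import ring lra zify.
Set Implicit Arguments. Unset Strict Implicit. Unset Printing Implicit Defensive.
Import Order.TTheory GRing.Theory Num.Theory.
Import numFieldNormedType.Exports.
Local Open Scope classical_set_scope.
Local Open Scope ring_scope.

(** * Polynomial functions and the number of their common zeros *)

(** Every loss has to stay below an arbitrarily small power. So the multiplicity in the area
    inequality may only grow like a power of the logarithm of the smallest Jacobian: separated
    preimages number at most [(k + 1)^2] when the comparison polynomials have degree [k], and [k] is
    about the number of binary digits of accuracy required. The inequality is used twice. For the
    gradient map, whose Jacobian is [H], it bounds the measure of the points of [A] with gradient in
    a rotated rectangle by about [d^-1] times the area of the rectangle. Gradients over a set of
    measure [u] are then spread out: a typical triple has determinant at least about [u d], and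
    three points with one determinant give the fourth power. For the map [x -> (S(x - z0) - S(x -
    z1), S(x - z0) - S(x - z2))], whose Jacobian is that determinant, it produces the product of
    three slices of [E]. With weights [1 - a - b], [a], [b] on the three bounds, the conditions
    [a > 0], [b > 0], [a + b < 1] are three sides of the trapezoid; the fourth enters through the
    exponents. *)

Section polynomials.
Variable R : realType.
Implicit Types (P Q : R * R -> R) (t : R * R).

(** The index bounds the total degree. The inductive form allows a polynomial to be absorbed into a
    weighted sum of monomials one variable at a time. *)
Inductive polyf : nat -> (R * R -> R) -> Prop :=
| polyf_cst n c : polyf n (fun=> c)
| polyf_x n P : polyf n P -> polyf n.+1 (fun t => t.1 * P t)
| polyf_y n P : polyf n P -> polyf n.+1 (fun t => t.2 * P t)
| polyf_add n P Q : polyf n P -> polyf n Q -> polyf n (fun t => P t + Q t)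
| polyf_scale n c P : polyf n P -> polyf n (fun t => c * P t).

Lemma polyf_le n m P : (n <= m)%N -> polyf n P -> polyf m P.
Proof.
move=> nm Pn; elim: Pn m nm => {n P}
    [n c|n P Pn IH|n P Pn IH|n P Q Pn IHP Qn IHQ|n c P Pn IH] [|m] nm //.
- exact: polyf_cst.
- exact: polyf_cst.
- by apply: polyf_x; apply: IH.
- by apply: polyf_y; apply: IH.
- by apply: polyf_add; [apply: IHP|apply: IHQ].
- by apply: polyf_add; [apply: IHP|apply: IHQ].
- by apply: polyf_scale; apply: IH.
- by apply: polyf_scale; apply: IH.
Qed.

Lemma polyf_sub n P Q : polyf n P -> polyf n Q -> polyf n (fun t => P t - Q t).
Proof.
move=> Pn Qn; rewrite (_ : (fun t => _) = (fun t => P t + (-1) * Q t)).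
  by apply: polyf_add => //; apply: polyf_scale.
by apply/funext => t; rewrite mulN1r.
Qed.

Lemma polyf_sum n (I : Type) (r : seq I) (F : I -> R * R -> R) :
  (forall i, polyf n (F i)) -> polyf n (fun t => \sum_(i <- r) F i t).
Proof.
move=> Fn; elim: r => [|i r IH].
  by rewrite (_ : (fun t => _) = fun=> 0);
    [exact: polyf_cst|apply/funext => t; rewrite big_nil].
rewrite (_ : (fun t => _) = fun t => F i t + \sum_(i <- r) F i t);
  last by apply/funext => t; rewrite big_cons.
exact: polyf_add.
Qed.

Lemma polyf_mul n m P Q : polyf n P -> polyf m Q ->
  polyf (n + m) (fun t => P t * Q t).
Proof.
move=> Pn; elim: Pn m Q => {n P}
    [n c|n P Pn IH|n P Pn IH|n P P' Pn IHP Qn IHQ|n c P Pn IH] m Q Qm.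
- by apply: (@polyf_le m); [exact: leq_addl|exact: polyf_scale].
- rewrite addSn; have := polyf_x (IH _ _ Qm).
  by under eq_fun do rewrite mulrA.
- rewrite addSn; have := polyf_y (IH _ _ Qm).
  by under eq_fun do rewrite mulrA.
- have := polyf_add (IHP _ _ Qm) (IHQ _ _ Qm).
  by under eq_fun do rewrite -mulrDl.
- have := polyf_scale c (IH _ _ Qm).
  by under eq_fun do rewrite mulrA.
Qed.

Lemma polyf_monomial i j : polyf (i + j) (fun t => t.1 ^+ i * t.2 ^+ j).
Proof.
elim: i => [|i IH].
  elim: j => [|j IH]; first by under eq_fun do rewrite !expr0 mulr1; exact: polyf_cst.
  by have := polyf_y IH; under eq_fun do rewrite !expr0 !mul1r -exprS;
    under [X in _ -> polyf _ X]eq_fun do rewrite expr0 mul1r.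
by rewrite addSn; have := polyf_x IH; under eq_fun do rewrite mulrA -exprS.
Qed.

Lemma polyf_shift n P t0 : polyf n P -> polyf n (fun t => P (t - t0)).
Proof.
elim=> {n P} [n c|n P Pn IH|n P Pn IH|n P P' Pn IHP Qn IHQ|n c P Pn IH].
- exact: polyf_cst.
- rewrite (_ : (fun t => _) = fun t => t.1 * P (t - t0) + (- t0.1) * P (t - t0)).
    by apply: polyf_add; [exact: polyf_x|apply: (@polyf_le n) => //; exact: polyf_scale].
  by apply/funext => t /=; rewrite -mulrDl.
- rewrite (_ : (fun t => _) = fun t => t.2 * P (t - t0) + (- t0.2) * P (t - t0)).
    by apply: polyf_add; [exact: polyf_y|apply: (@polyf_le n) => //; exact: polyf_scale].
  by apply/funext => t /=; rewrite -mulrDl.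
- exact: polyf_add.
- exact: polyf_scale.
Qed.

Section weights.
Variables (N : nat) (p : 'I_N -> R * R) (w : 'I_N -> R).

(** Each variable of [P] moves into the monomial in front of it, so all that is spent is total
    degree, at most [n] of it. *)
Lemma polyf_annihilated n P M : polyf n P ->
  (forall a b, (a + b <= M)%N -> \sum_i w i * ((p i).1 ^+ a * (p i).2 ^+ b) = 0) ->
  forall a b, (a + b + n <= M)%N ->
    \sum_i w i * ((p i).1 ^+ a * (p i).2 ^+ b * P (p i)) = 0.
Proof.
move=> Pn W; elim: Pn => {n P}
    [n c|n P Pn IH|n P Pn IH|n P Q Pn IHP Qn IHQ|n c P Pn IH] a b abn.
- under eq_bigr do rewrite mulrA.
  by rewrite -mulr_suml W ?mul0r//; lia.
- rewrite -[RHS](IH a.+1 b); last by lia.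
  by apply: eq_bigr => i _; rewrite exprS; ring.
- rewrite -[RHS](IH a b.+1); last by lia.
  by apply: eq_bigr => i _; rewrite exprS; ring.
- by under eq_bigr do rewrite mulrDr mulrDr; rewrite big_split/= IHP// IHQ// addr0.
- transitivity (c * \sum_i w i * ((p i).1 ^+ a * (p i).2 ^+ b * P (p i))).
    by rewrite mulr_sumr; apply: eq_bigr => i _; ring.
  by rewrite IH ?mulr0.
Qed.

End weights.

(* Modulo P + e x^m and Q + e y^m every monomial reduces to those with both
   exponents below m, so functions on the common zero set form a space of
   dimension at most m^2. *)
Lemma common_zeros_le N (p : 'I_N -> R * R) n m (e : R) P Q :
  injective p -> polyf n P -> polyf n Q -> (n < m)%N -> e != 0 ->
  (forall i, P (p i) + e * (p i).1 ^+ m = 0) ->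
  (forall i, Q (p i) + e * (p i).2 ^+ m = 0) ->
  (N <= m ^ 2)%N.
Proof.
move=> pinj Pn Qn nm e0 P0 Q0; rewrite leqNgt; apply/negP => mN.
pose A : 'M[R]_(N, m * m) := \matrix_(i, k)
  ((p i).1 ^+ (k %/ m) * (p i).2 ^+ (k %% m)).
(* There are more points than the [m * m] monomials with both exponents below [m], so some nonzero
   weights kill all of these. *)
have : kermx A != 0.
  rewrite kermx_eq0 /row_free; apply/eqP => rA.
  by have := rank_leq_col A; rewrite rA mulnn leqNgt mN.
case/rowV0Pn => v /sub_kermxP vA v0.
pose w i := v 0 i.
have W0 a b : (a < m)%N -> (b < m)%N ->
    \sum_i w i * ((p i).1 ^+ a * (p i).2 ^+ b) = 0.
  move=> am bm; have abm : (a * m + b < m * m)%N by nia.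
  have /rowP/(_ (Ordinal abm)) := vA; rewrite !mxE => vA0; rewrite -[RHS]vA0.
  apply: eq_bigr => i _; rewrite !mxE/= divnMDl ?divn_small ?addn0; [|lia|lia].
  by rewrite modnMDl modn_small.
(* At the points [p i] the power [x^m] equals [- P / e], of degree at most [n < m], so the
   replacement lowers the total degree; likewise for [y^m]. *)
have W M : forall a b, (a + b <= M)%N ->
    \sum_i w i * ((p i).1 ^+ a * (p i).2 ^+ b) = 0.
  elim: M => [|M IH] a b ab; first by apply: W0; lia.
  case: (ltnP a m) => [am|ma].
    case: (ltnP b m) => [bm|mb]; first exact: W0.
    transitivity (- e^-1 * \sum_i w i * ((p i).1 ^+ a * (p i).2 ^+ (b - m) * Q (p i))).
      rewrite mulr_sumr; apply: eq_bigr => i _.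
      have -> : Q (p i) = - (e * (p i).2 ^+ m) by apply/eqP; rewrite -addr_eq0 Q0.
      rewrite -{1}(subnK mb) exprD; field; exact: e0.
    by rewrite (polyf_annihilated Qn IH) ?mulr0//; lia.
  transitivity (- e^-1 * \sum_i w i * ((p i).1 ^+ (a - m) * (p i).2 ^+ b * P (p i))).
    rewrite mulr_sumr; apply: eq_bigr => i _.
    have -> : P (p i) = - (e * (p i).1 ^+ m) by apply/eqP; rewrite -addr_eq0 P0.
    rewrite -{1}(subnK ma) exprD; field; exact: e0.
  by rewrite (polyf_annihilated Pn IH) ?mulr0//; lia.
have {}W k L : polyf k L -> \sum_i w i * L (p i) = 0.
  move=> Lk; rewrite -[RHS](polyf_annihilated Lk (W k) (a := 0) (b := 0))//.
  by apply: eq_bigr => i _; rewrite !expr0 !mul1r.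
move/eqP: v0; apply; apply/rowP => i; rewrite mxE.
(* A vertical or horizontal line through [p j] that misses [p i]. The product over [j != i] vanishes
   at all points except [p i], which forces the weight [w i] to be zero. *)
pose l (j : 'I_N) : R * R -> R :=
  if (p j).1 == (p i).1 then fun t => t.2 - (p j).2 else fun t => t.1 - (p j).1.
have [k kL] : exists k, polyf k (fun t => \prod_(j <- enum 'I_N | j != i) l j t).
  elim: (enum 'I_N) => [|j r [k IH]].
    by exists 0%N; under eq_fun do rewrite big_nil; exact: polyf_cst.
  case: (eqVneq j i) => ji.
    by exists k; subst j; under eq_fun do rewrite big_cons eqxx/=.
  exists (1 + k)%N; under eq_fun do rewrite big_cons ji/=.
  apply: (@polyf_mul 1 k (l j) _ _ IH); rewrite /l; case: ifP => _.
    have -> : (fun t : R * R => t.2 - (p j).2) = fun t => t.2 * 1 - (p j).2.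
      by apply/funext => t; rewrite mulr1.
    by apply: polyf_sub; [apply: polyf_y|]; exact: polyf_cst.
  have -> : (fun t : R * R => t.1 - (p j).1) = fun t => t.1 * 1 - (p j).1.
    by apply/funext => t; rewrite mulr1.
  by apply: polyf_sub; [apply: polyf_x|]; exact: polyf_cst.
have := W _ _ kL; rewrite (bigD1 i)//= [X in _ + X]big1 ?addr0; last first.
  move=> j ji; apply/eqP; rewrite mulf_eq0 prodf_seq_eq0; apply/orP; right.
  apply/hasP; exists j; first by rewrite mem_enum.
  by rewrite ji/= /l; case: ifP; rewrite subrr.
move/eqP; rewrite mulf_eq0 => /orP[/eqP //|].
rewrite prodf_seq_eq0 => /hasP[j _ /andP[ji]].
rewrite /l; case: ifP => [/eqP e1|e1]; rewrite subr_eq0.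
  move=> /eqP e2; move: ji; suff -> : j = i by rewrite eqxx.
  by apply: pinj; rewrite [p j]surjective_pairing [p i]surjective_pairing e1 e2.
by rewrite eq_sym e1.
Qed.

End polynomials.

(** * Newton's method *)

Section newton.
Variable R : realType.
Implicit Types (s t : R * R).

Lemma geometric_small (C th : R) (e : R) : 0 <= th -> th < 1 -> 0 < e ->
  exists n, C * th ^+ n < e.
Proof.
move=> th0 th1 e0.
have /cvgrPdist_lt/(_ e e0)[n _ /(_ n (leqnn n))/=] :
    (fun n => C * th ^+ n) @ \oo --> C * 0.
  by apply: cvgMr; apply: cvg_expr; rewrite ger0_norm.
rewrite mulr0 sub0r normrN => h; exists n; exact: le_lt_trans (ler_norm _) h.
Qed.

Lemma le0_geometric (x C th : R) : 0 <= th -> th < 1 ->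
  (forall n, x <= C * th ^+ n) -> x <= 0.
Proof.
move=> th0 th1 h; rewrite leNgt; apply/negP => x0.
by have [n] := geometric_small C th0 th1 x0; rewrite ltNge h.
Qed.

Lemma geometric_limit (u : nat -> R) (C th : R) : 0 <= th -> th < 1 ->
  (forall n, `|u n.+1 - u n| <= C * th ^+ n) ->
  exists l, forall n, `|u n - l| <= C / (1 - th) * th ^+ n.
Proof.
move=> th0 th1 h; have C0 : 0 <= C.
  by apply: le_trans (le_trans (normr_ge0 _) (h 0%N)) _; rewrite expr0 mulr1.
have th1' : 0 < 1 - th by rewrite subr_gt0.
have d n m : `|u (n + m)%N - u n| <= C / (1 - th) * (th ^+ n - th ^+ (n + m)).
  elim: m => [|m IH]; first by rewrite addn0 !subrr normr0 mulr0.
  rewrite addnS (_ : u (n + m).+1 - u n = (u (n + m).+1 - u (n + m)%N) + (u (n + m)%N - u n)); last by ring.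
  apply: le_trans (ler_normD _ _) _; apply: le_trans (lerD (h _) IH) _.
  rewrite le_eqVlt; apply/orP; left; apply/eqP; rewrite exprS; field.
  by rewrite gt_eqF.
have d' n m : (n <= m)%N -> `|u m - u n| <= C / (1 - th) * th ^+ n.
  move=> nm; rewrite -(subnKC nm); apply: le_trans (d _ _) _.
  rewrite ler_wpM2l ?(divr_ge0 C0 (ltW th1'))// lerBlDr lerDl exprn_ge0//.
have ucvg : cvgn u.
  apply/cauchy_cvgP/cauchyP => e e0.
  have [n hn] := geometric_small (C / (1 - th)) th0 th1 e0.
  exists (u n); exists n => // m /= nm; rewrite -ball_normE/= distrC.
  exact: le_lt_trans (d' _ _ nm) hn.
exists (limn u) => n; rewrite distrC.
have : (fun m => `|u m - u n|) @ \oo --> `|limn u - u n|.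
  by apply: cvg_norm; apply: cvgB => //; exact: cvg_cst.
move/cvg_lim => <- //; apply: limr_le.
  by apply: is_cvg_norm; apply: is_cvgB => //; exact: is_cvg_cst.
by near=> m; apply: d'; near: m; exact: nbhs_infty_ge.
Unshelve. all: by end_near.
Qed.

Definition n1 t : R := `|t.1| + `|t.2|.

Lemma n1_ge0 t : 0 <= n1 t. Proof. by rewrite addr_ge0. Qed.

Lemma n1D s t : n1 (s + t) <= n1 s + n1 t.
Proof.
by rewrite /n1/=; have := ler_normD s.1 t.1; have := ler_normD s.2 t.2; lra.
Qed.

Lemma n1N t : n1 (- t) = n1 t. Proof. by rewrite /n1/= !normrN. Qed.

Lemma n1_dist s t : n1 (s - t) = n1 (t - s).
Proof. by rewrite -n1N opprB. Qed.

Lemma n1_tri u s t : n1 (s - t) <= n1 (s - u) + n1 (u - t).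
Proof. by rewrite -[s - t](subrKA u); exact: n1D. Qed.

Section inverse.
Variables (a b c d : R) (rho Gam : R).
Hypotheses (rho0 : 0 < rho) (det : rho <= `|a * d - b * c|).
Hypotheses (ha : `|a| <= Gam) (hb : `|b| <= Gam) (hc : `|c| <= Gam) (hd : `|d| <= Gam).

(** Cramer's rule for the matrix with rows [(a, b)] and [(c, d)]. *)
Definition inv2 (v : R * R) : R * R :=
  ((d * v.1 - b * v.2) / (a * d - b * c), (a * v.2 - c * v.1) / (a * d - b * c)).

Lemma n1_inv2 v : n1 (inv2 v) <= 2 * Gam / rho * n1 v.
Proof.
have det0 : 0 < `|a * d - b * c| by apply: lt_le_trans det.
have G0 : 0 <= Gam by apply: le_trans ha.
rewrite /n1 /inv2/= !normrM !normfV -mulrDl.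
rewrite ler_pdivrMr//.
have h1 : `|d * v.1 - b * v.2| <= Gam * n1 v.
  apply: le_trans (ler_normB _ _) _; rewrite !normrM /n1 mulrDr.
  by apply: lerD; apply: ler_wpM2r.
have h2 : `|a * v.2 - c * v.1| <= Gam * n1 v.
  apply: le_trans (ler_normB _ _) _; rewrite !normrM /n1 mulrDr addrC.
  by apply: lerD; apply: ler_wpM2r.
apply: le_trans (lerD h1 h2) _; rewrite -/(n1 v).
rewrite (_ : Gam * n1 v + _ = 2 * Gam / rho * n1 v * rho); last by field; rewrite gt_eqF.
by rewrite ler_wpM2l// !mulr_ge0 ?n1_ge0// invr_ge0 ltW.
Qed.

Lemma inv2K v : inv2 (a * v.1 + b * v.2, c * v.1 + d * v.2) = v.
Proof.
have det0 : a * d - b * c != 0 by rewrite -normr_gt0; apply: lt_le_trans det.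
case: v => x y; rewrite /inv2/=; congr pair; field; exact: det0.
Qed.

Lemma inv2Kl v : a * (inv2 v).1 + b * (inv2 v).2 = v.1 /\
  c * (inv2 v).1 + d * (inv2 v).2 = v.2.
Proof.
have det0 : a * d - b * c != 0 by rewrite -normr_gt0; apply: lt_le_trans det.
by case: v => x y; rewrite /inv2/=; split; field; exact: det0.
Qed.

Variables (F G : R * R -> R) (t0 : R * R) (r kap : R).
Hypotheses (r0 : 0 < r) (kap0 : 0 <= kap).
Hypothesis hF : forall s t, n1 (s - t0) <= r -> n1 (t - t0) <= r ->
  `|F s - F t - (a * (s.1 - t.1) + b * (s.2 - t.2))| <= kap * n1 (s - t).
Hypothesis hG : forall s t, n1 (s - t0) <= r -> n1 (t - t0) <= r ->
  `|G s - G t - (c * (s.1 - t.1) + d * (s.2 - t.2))| <= kap * n1 (s - t).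
Hypothesis contr : 8 * Gam * kap <= rho.
Hypothesis start : 4 * Gam * (`|F t0| + `|G t0|) <= rho * r.

Let step t := t - inv2 (F t, G t).
Let x n := iter n step t0.

Let step_contr s t : n1 (s - t0) <= r -> n1 (t - t0) <= r ->
  n1 (step s - step t) <= 2^-1 * n1 (s - t).
Proof.
move=> hs ht.
have -> : step s - step t = - inv2 (F s - F t - (a * (s.1 - t.1) + b * (s.2 - t.2)),
    G s - G t - (c * (s.1 - t.1) + d * (s.2 - t.2))).
  have det0 : a * d - b * c != 0 by rewrite -normr_gt0; apply: lt_le_trans det.
  by rewrite /step /inv2; case: s {hs} => s1 s2; case: t {ht} => t1 t2;
    congr pair => /=; field; exact: det0.
rewrite n1N; apply: le_trans (n1_inv2 _) _; rewrite {1}/n1/=.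
have h := lerD (hF hs ht) (hG hs ht).
have G0 : 0 <= Gam by apply: le_trans ha.
apply: le_trans (ler_wpM2l _ h) _; first by rewrite !mulr_ge0// invr_ge0 ltW.
rewrite -mulrDl mulrA ler_wpM2r ?n1_ge0//.
rewrite (_ : 2 * Gam / rho * _ = (8 * Gam * kap) / rho / 2); last by field; rewrite gt_eqF.
by rewrite ler_pdivrMr// mulVf// ler_pdivrMr// mul1r.
Qed.

Let xP n : n1 (x n.+1 - x n) <= r / 2 * 2^-1 ^+ n /\ n1 (x n - t0) <= r * (1 - 2^-1 ^+ n).
Proof.
elim: n => [|n [IH1 IH2]].
  split; last first.
    by rewrite /x/= subrr expr0 subrr mulr0 /n1 normr0 addr0.
  rewrite /x/= /step expr0 mulr1 addrAC subrr sub0r n1N.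
  apply: le_trans (n1_inv2 _) _; rewrite /n1/=.
  rewrite ler_pdivlMr// mulrAC -mulrA mulrAC ler_pdivrMr// [r * _]mulrC.
  by apply: le_trans start; rewrite le_eqVlt; apply/orP; left; apply/eqP; ring.
have pw : 0 <= (2^-1 : R) ^+ n by rewrite exprn_ge0.
have h2 : n1 (x n.+1 - t0) <= r * (1 - 2^-1 ^+ n.+1).
  apply: le_trans (n1_tri (x n) _ _) _; apply: le_trans (lerD IH1 IH2) _.
  by rewrite exprS; lra.
split => //; apply: le_trans (step_contr _ _) _.
- by apply: le_trans h2 _; rewrite ler_piMr ?(ltW r0)// lerBlDr lerDl exprn_ge0.
- by apply: le_trans IH2 _; rewrite ler_piMr ?(ltW r0)// lerBlDr lerDl.
- by rewrite exprS; move: IH1; rewrite -/(x n.+1); lra.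
Qed.

(** Newton's iteration with a fixed matrix. By [contr] a step contracts by one half, by [start] the
    first one is at most [r / 2], so the iterates stay within [r] of [t0] and converge. The values
    of [F] and [G] are controlled by the length of the next step, hence vanish at the limit. *)
Lemma newton_zero : exists t, [/\ n1 (t - t0) <= r, F t = 0 & G t = 0].
Proof.
have G0 : 0 <= Gam by apply: le_trans ha.
have h2 : (2^-1 : R) < 1 by lra.
have h20 : 0 <= (2^-1 : R) by lra.
have [|l1 hl1] := @geometric_limit (fun n => (x n).1) (r / 2) 2^-1 h20 h2.
  by move=> n; apply: le_trans (xP n).1; rewrite /n1/= lerDl.
have [|l2 hl2] := @geometric_limit (fun n => (x n).2) (r / 2) 2^-1 h20 h2.
  by move=> n; apply: le_trans (xP n).1; rewrite /n1/= lerDr.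
pose l := (l1, l2).
have hl n : n1 (x n - l) <= 2 * r * 2^-1 ^+ n.
  have e2 : r / 2 / (1 - 2^-1) = r by field.
  by move: (hl1 n) (hl2 n); rewrite e2 /n1/=; lra.
have xr n : n1 (x n - t0) <= r.
  by apply: le_trans (xP n).2 _; rewrite ler_piMr ?(ltW r0)// lerBlDr lerDl exprn_ge0.
have lr : n1 (l - t0) <= r.
  rewrite -subr_le0; apply: (@le0_geometric _ (2 * r) 2^-1) => // n.
  by have := n1_tri (x n) l t0; have := hl n; have := xr n; rewrite [n1 (x n - l)]n1_dist; lra.
have Fx n : `|F (x n)| <= Gam * n1 (x n.+1 - x n) /\ `|G (x n)| <= Gam * n1 (x n.+1 - x n).
  have -> : x n.+1 - x n = - inv2 (F (x n), G (x n)).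
    by rewrite /x/= /step addrAC subrr sub0r.
  rewrite n1N; move: (inv2Kl (F (x n), G (x n))); set v := inv2 _ => -[e1 e2].
  rewrite -[F (x n)]e1 -[G (x n)]e2 /n1; split; apply: le_trans (ler_normD _ _) _;
    by rewrite !normrM mulrDr; apply: lerD; apply: ler_wpM2r.
have lin (u v : R) (w : R * R) : `|u| <= Gam -> `|v| <= Gam ->
    `|u * w.1 + v * w.2| <= Gam * n1 w.
  move=> hu hv; apply: le_trans (ler_normD _ _) _; rewrite !normrM mulrDr.
  by apply: lerD; apply: ler_wpM2r.
have K0 : 0 <= Gam + kap by rewrite addr_ge0.
have [hx ht] := (fun n => (xP n).1, fun n => xr n).
have pw n : 0 <= (2^-1 : R) ^+ n by rewrite exprn_ge0.
exists l; split => //.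
- apply/eqP; rewrite -normr_le0; apply: (@le0_geometric _ (Gam * r + (Gam + kap) * (2 * r)) 2^-1) => // n.
  have := hF lr (xr n); have := (Fx n).1; have := lin a b (l - x n) ha hb.
  have := hl n; rewrite n1_dist; have := hx n; move: (pw n).
  set y := n1 (l - x n); set z := n1 (_ - _); set p := _ ^+ n => p0 hz hy /= h1 h3 h4.
  have e : `|F l| <= `|F l - F (x n) - (a * (l1 - (x n).1) + b * (l2 - (x n).2))| +
     (`|F (x n)| + `|a * (l1 - (x n).1) + b * (l2 - (x n).2)|).
    rewrite {1}(_ : F l = (F l - F (x n) - (a * (l1 - (x n).1) + b * (l2 - (x n).2))) +
     (F (x n) + (a * (l1 - (x n).1) + b * (l2 - (x n).2)))); last by ring.
    by apply: le_trans (ler_normD _ _) _; apply: lerD => //; exact: ler_normD.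
  have k1 : Gam * z <= Gam * (r / 2 * p) by apply: ler_wpM2l.
  have k2 : (Gam + kap) * y <= (Gam + kap) * (2 * r * p) by apply: ler_wpM2l.
  have k3 : 0 <= Gam * (r / 2 * p) by rewrite mulr_ge0// mulr_ge0// divr_ge0 ?(ltW r0).
  by move: k1 k2 k3 h1 h3 h4 e; lra.
- apply/eqP; rewrite -normr_le0; apply: (@le0_geometric _ (Gam * r + (Gam + kap) * (2 * r)) 2^-1) => // n.
  have := hG lr (xr n); have := (Fx n).2; have := lin c d (l - x n) hc hd.
  have := hl n; rewrite n1_dist; have := hx n; move: (pw n).
  set y := n1 (l - x n); set z := n1 (_ - _); set p := _ ^+ n => p0 hz hy /= h1 h3 h4.
  have e : `|G l| <= `|G l - G (x n) - (c * (l1 - (x n).1) + d * (l2 - (x n).2))| +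
     (`|G (x n)| + `|c * (l1 - (x n).1) + d * (l2 - (x n).2)|).
    rewrite {1}(_ : G l = (G l - G (x n) - (c * (l1 - (x n).1) + d * (l2 - (x n).2))) +
     (G (x n) + (c * (l1 - (x n).1) + d * (l2 - (x n).2)))); last by ring.
    by apply: le_trans (ler_normD _ _) _; apply: lerD => //; exact: ler_normD.
  have k1 : Gam * z <= Gam * (r / 2 * p) by apply: ler_wpM2l.
  have k2 : (Gam + kap) * y <= (Gam + kap) * (2 * r * p) by apply: ler_wpM2l.
  have k3 : 0 <= Gam * (r / 2 * p) by rewrite mulr_ge0// mulr_ge0// divr_ge0 ?(ltW r0).
  by move: k1 k2 k3 h1 h3 h4 e; lra.
Qed.

End inverse.
End newton.

(** * Counting separated approximate solutions *)

Section tame.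
Variable R : realType.
Implicit Types (s t : R * R) (F G P Q : R * R -> R).

(** [F1] and [F2] are tied to [F] only by a quadratic Taylor remainder on [D], so that functions cut
    off outside [D], differences of translates and polynomials are handled alike, with one
    constant. *)
Definition C11 (Gam : R) (D : set (R * R)) F F1 F2 : Prop :=
  forall s t, D s -> D t ->
  [/\ `|F s - F t - (F1 t * (s.1 - t.1) + F2 t * (s.2 - t.2))| <= Gam * n1 (s - t) ^+ 2,
      `|F1 s - F1 t| <= Gam * n1 (s - t), `|F2 s - F2 t| <= Gam * n1 (s - t),
      `|F1 t| <= Gam & `|F2 t| <= Gam].

(* The parameter k plays the role of log(1/error): analytic functions are
   approximated in C^1 to accuracy 2^-k by polynomials of degree at most k. *)
Definition tame (Gam : R) (D : set (R * R)) F F1 F2 : Prop :=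
  C11 Gam D F F1 F2 /\
  forall k, exists P P1 P2, [/\ polyf k P, C11 Gam D P P1 P2 &
    forall t, D t -> [/\ `|F t - P t| <= Gam * 2^-1 ^+ k,
      `|F1 t - P1 t| <= Gam * 2^-1 ^+ k & `|F2 t - P2 t| <= Gam * 2^-1 ^+ k]].

Lemma expr_lipschitz (b : R) m : exists2 K, 0 < K & forall x y : R,
  `|x| <= b -> `|y| <= b -> `|x ^+ m| <= K /\ `|x ^+ m - y ^+ m| <= K * `|x - y|.
Proof.
elim: m => [|m [K K0 IH]].
  by exists 1 => // x y _ _; rewrite !expr0 normr1 subrr normr0 mul1r.
exists (K * (`|b| + 1)); first by rewrite mulr_gt0// ltr_wpDl.
move=> x y xb yb; have [h1 h2] := IH x y xb yb; have [h3 _] := IH y x yb xb.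
have bb := ler_norm b.
have xb' : `|x| <= `|b| + 1 by lra.
split.
  by rewrite exprS normrM mulrC; apply: ler_pM.
rewrite !exprS (_ : _ - _ = x * (x ^+ m - y ^+ m) + y ^+ m * (x - y)); last by ring.
apply: le_trans (ler_normD _ _) _; rewrite !normrM.
have k1 : `|x| * `|x ^+ m - y ^+ m| <= `|b| * (K * `|x - y|).
  by apply: ler_pM => //; lra.
have k2 : `|y ^+ m| * `|x - y| <= K * `|x - y| by apply: ler_wpM2r.
by move: k1 k2; clear; lra.
Qed.

(** The terms [e x^m] and [e y^m] are the leading terms on which the dimension count rests. The
    constants are what Newton's method asks for with determinant [rho / 2]: with [kap = 5 Gam r] the
    contraction condition is [40 Gam^2 r <= rho / 2], and with starting values at most [3 sig] the
    other condition is [24 Gam sig <= rho r / 2], here an equality. *)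
Lemma perturbed_zero (Gam rho r sig e K b : R) m D P P1 P2 Q Q1 Q2 t0 :
  1 <= Gam -> 0 < rho -> rho <= 1 -> 160 * Gam ^+ 2 * r = rho ->
  sig = rho ^+ 2 / (7680 * Gam ^+ 3) -> 0 < e -> 0 < K ->
  (forall x y : R, `|x| <= b -> `|y| <= b ->
    `|x ^+ m| <= K /\ `|x ^+ m - y ^+ m| <= K * `|x - y|) ->
  e * K <= sig -> e * K <= Gam * r ->
  (forall t, n1 (t - t0) <= r -> D t) -> (forall t, D t -> n1 t <= b) ->
  C11 Gam D P P1 P2 -> C11 Gam D Q Q1 Q2 ->
  rho / 2 <= `|P1 t0 * Q2 t0 - P2 t0 * Q1 t0| ->
  `|P t0| <= 2 * sig -> `|Q t0| <= 2 * sig ->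
  exists t, [/\ n1 (t - t0) <= r, P t + e * t.1 ^+ m = 0 & Q t + e * t.2 ^+ m = 0].
Proof.
move=> Gam1 rho0 rho1 rE sE e0 K0 hK eK1 eK2 hD hb hP hQ hdet P0 Q0.
have G0 : 0 < Gam by lra.
have G2 : 0 < Gam ^+ 2 by rewrite exprn_gt0.
have G3 : 0 < Gam ^+ 3 by rewrite exprn_gt0.
have r0 : 0 < r.
  have : 0 < 160 * Gam ^+ 2 * r by rewrite rE.
  by rewrite pmulr_rgt0// mulr_gt0.
have t0r : n1 (t0 - t0) <= r by rewrite subrr /n1 !normr0 addr0 ltW.
have D0 := hD _ t0r.
have b0 x : n1 x <= b -> `|x.1| <= b /\ `|x.2| <= b.
  by rewrite /n1; have := normr_ge0 x.1; have := normr_ge0 x.2; clear; lra.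
have [_ _ _ a1 a2] := hP _ _ D0 D0; have [_ _ _ a3 a4] := hQ _ _ D0 D0.
pose kap := 5 * Gam * r.
have lin (H H1 H2 : R * R -> R) (c : R * R -> R) : C11 Gam D H H1 H2 ->
    (forall s t, D s -> D t -> `|c s - c t| <= K * n1 (s - t)) ->
    forall s t, n1 (s - t0) <= r -> n1 (t - t0) <= r ->
    `|(H s + e * c s) - (H t + e * c t) - (H1 t0 * (s.1 - t.1) + H2 t0 * (s.2 - t.2))|
       <= kap * n1 (s - t).
  move=> hH hc s t sr tr.
  have [h1 _ _ _ _] := hH _ _ (hD _ sr) (hD _ tr).
  have [_ h2 h3 _ _] := hH _ _ (hD _ tr) D0.
  have hcc := hc _ _ (hD _ sr) (hD _ tr).
  have str : n1 (s - t) <= 2 * r.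
    by have := n1_tri t0 s t; rewrite (n1_dist t0 t); move: sr tr; clear; lra.
  have n0 := n1_ge0 (s - t).
  rewrite (_ : _ - _ = (H s - H t - (H1 t * (s.1 - t.1) + H2 t * (s.2 - t.2))) +
    ((H1 t - H1 t0) * (s.1 - t.1) + (H2 t - H2 t0) * (s.2 - t.2)) + e * (c s - c t)); last by ring.
  apply: le_trans (ler_normD _ _) _.
  apply: le_trans (lerD (ler_normD _ _) (lexx _)) _.
  have k1 : `|(H1 t - H1 t0) * (s.1 - t.1) + (H2 t - H2 t0) * (s.2 - t.2)| <= Gam * r * n1 (s - t).
    apply: le_trans (ler_normD _ _) _; rewrite !normrM [n1 (s - t)]/n1 mulrDr.
    have hh : Gam * n1 (t - t0) <= Gam * r by apply: ler_wpM2l => //; exact: ltW.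
    by apply: lerD; apply: ler_wpM2r => //; [exact: le_trans h2 hh|exact: le_trans h3 hh].
  have k2 : `|e * (c s - c t)| <= Gam * r * n1 (s - t).
    rewrite normrM gtr0_norm//; apply: le_trans (ler_wpM2l (ltW e0) hcc) _.
    by rewrite mulrA ler_wpM2r.
  have k3 : Gam * n1 (s - t) ^+ 2 <= 2 * Gam * r * n1 (s - t).
    rewrite expr2 mulrA ler_wpM2r//.
    by have := ler_wpM2l (ltW G0) str; move: n0; clear; lra.
  have k4 : 0 <= Gam * r * n1 (s - t) by rewrite mulr_ge0// mulr_ge0// ltW.
  by rewrite /kap; move: h1 k1 k2 k3 k4; clear; lra.
apply: (@newton_zero R (P1 t0) (P2 t0) (Q1 t0) (Q2 t0) (rho / 2) Gam
   _ _ a1 a2 a3 a4 (fun t => P t + e * t.1 ^+ m) (fun t => Q t + e * t.2 ^+ m) t0 r kap r0).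
- by rewrite divr_gt0.
- exact: hdet.
- by rewrite mulr_ge0 ?(ltW r0)// mulr_ge0// ltW.
- apply: (lin P P1 P2 (fun t => t.1 ^+ m)) => // s t /hb/b0[s1 _] /hb/b0[t1 _].
  apply: le_trans (hK _ _ s1 t1).2 _.
  by rewrite ler_wpM2l ?(ltW K0)// /n1/= lerDl.
- apply: (lin Q Q1 Q2 (fun t => t.2 ^+ m)) => // u v /hb/b0[_ s1] /hb/b0[_ t1].
  apply: le_trans (hK _ _ s1 t1).2 _.
  by rewrite ler_wpM2l ?(ltW K0)// /n1/= lerDr.
- rewrite /kap (_ : 8 * Gam * _ = (160 * Gam ^+ 2 * r) / 4); last by field.
  by rewrite rE; move: rho0; clear; lra.
- have [t1 t2] := b0 _ (hb _ D0).
  have k1 : `|P t0 + e * t0.1 ^+ m| <= 3 * sig.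
    apply: le_trans (ler_normD _ _) _; rewrite normrM gtr0_norm//.
    have := ler_wpM2l (ltW e0) (hK _ _ t1 t1).1; move: P0 eK1; clear; lra.
  have k2 : `|Q t0 + e * t0.2 ^+ m| <= 3 * sig.
    apply: le_trans (ler_normD _ _) _; rewrite normrM gtr0_norm//.
    have := ler_wpM2l (ltW e0) (hK _ _ t2 t2).1; move: Q0 eK1; clear; lra.
  apply: le_trans (ler_wpM2l _ (lerD k1 k2)) _; first by rewrite mulr_ge0// ltW.
  have -> : r = rho / (160 * Gam ^+ 2) by rewrite -rE; field; rewrite gt_eqF.
  rewrite sE le_eqVlt; apply/orP; left; apply/eqP; field.
  by rewrite gt_eqF.
Qed.

(** Near each [p i] the approximating polynomials of degree [k], perturbed in degree [k + 1], have
    an exact common zero within distance [r]. Points more than [2 r] apart yield different zeros,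
    and those are counted by dimension. *)
Lemma count_separated (Gam b : R) D F F1 F2 G G1 G2 (rho sig r : R) k N
    (p : 'I_N -> R * R) (c1 c2 : R) :
  1 <= Gam -> 0 < rho -> rho <= 1 -> 160 * Gam ^+ 2 * r = rho ->
  sig = rho ^+ 2 / (7680 * Gam ^+ 3) -> (forall t, D t -> n1 t <= b) ->
  tame Gam D F F1 F2 -> tame Gam D G G1 G2 -> Gam * 2^-1 ^+ k <= sig ->
  (forall i t, n1 (t - p i) <= r -> D t) ->
  (forall i, rho <= `|F1 (p i) * G2 (p i) - F2 (p i) * G1 (p i)|) ->
  (forall i, `|F (p i) - c1| <= sig) -> (forall i, `|G (p i) - c2| <= sig) ->
  (forall i j, i != j -> 2 * r < n1 (p i - p j)) ->
  (N <= k.+1 ^ 2)%N.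
Proof.
move=> Gam1 rho0 rho1 rE sE hb [hF apF] [hG apG] hk hD hJ hc1 hc2 sep.
have G0 : 0 < Gam by lra.
have r0 : 0 < r.
  have : 0 < 160 * Gam ^+ 2 * r by rewrite rE.
  by rewrite pmulr_rgt0// mulr_gt0// exprn_gt0.
have G3 : 0 < Gam ^+ 3 by rewrite exprn_gt0.
have sig0 : 0 < sig.
  rewrite sE; apply: divr_gt0; first by rewrite exprn_gt0.
  by move: G3; clear; lra.
(* Passing from [F], [G] to the polynomials changes the Jacobian by at most [4 Gam sig], which
   leaves at least [rho / 2]. *)
have sigG : 4 * Gam * sig <= rho / 2.
  have -> : 4 * Gam * sig = rho * (rho / (1920 * Gam ^+ 2)).
    by rewrite sE; field; rewrite gt_eqF.
  have g1 : 1 <= Gam ^+ 2 by rewrite exprn_ege1.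
  apply: ler_wpM2l; first exact: ltW.
  by rewrite ler_pdivrMr; move: rho1 g1; clear; lra.
have [P [P1 [P2 [Pk hP dP]]]] := apF k; have [Q [Q1 [Q2 [Qk hQ dQ]]]] := apG k.
have [K K0 hK] := expr_lipschitz b k.+1.
pose e := Num.min sig (Gam * r) / K.
have e0 : 0 < e by rewrite divr_gt0// lt_min sig0 mulr_gt0.
have eK : e * K = Num.min sig (Gam * r) by rewrite /e mulfVK// gt_eqF.
have /choice[z hz] : forall i, exists t, [/\ n1 (t - p i) <= r,
    (P t - c1) + e * t.1 ^+ k.+1 = 0 & (Q t - c2) + e * t.2 ^+ k.+1 = 0].
  move=> i; have Di : D (p i) by apply: (hD i); rewrite subrr /n1 !normr0 addr0 ltW.
  have [p0 p1 p2] := dP _ Di; have [q0 q1 q2] := dQ _ Di.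
  have [_ _ _ f1 f2] := hF _ _ Di Di; have [_ _ _ g1 g2] := hG _ _ Di Di.
  have [_ _ _ f1' f2'] := hP _ _ Di Di; have [_ _ _ g1' g2'] := hQ _ _ Di Di.
  have C11c H H1 H2 (c : R) : C11 Gam D H H1 H2 -> C11 Gam D (fun t => H t - c) H1 H2.
    move=> h s t Ds Dt; have [h1 h2 h3 h4 h5] := h _ _ Ds Dt; split => //.
    by rewrite (_ : H s - c - (H t - c) = H s - H t)//; ring.
  apply: (@perturbed_zero Gam rho r sig e K b k.+1 D (fun t => P t - c1) P1 P2 (fun t => Q t - c2) Q1 Q2) => //.
  - by rewrite eK ge_min lexx.
  - by rewrite eK ge_min lexx orbT.
  - exact: hD.
  - exact: C11c.
  - exact: C11c.
  - have : `|(F1 (p i) * G2 (p i) - F2 (p i) * G1 (p i)) -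
        (P1 (p i) * Q2 (p i) - P2 (p i) * Q1 (p i))| <= 4 * Gam * sig.
      rewrite (_ : _ - _ = (F1 (p i) - P1 (p i)) * G2 (p i) + P1 (p i) * (G2 (p i) - Q2 (p i))
        - ((F2 (p i) - P2 (p i)) * G1 (p i) + P2 (p i) * (G1 (p i) - Q1 (p i)))); last by ring.
      apply: le_trans (ler_normB _ _) _.
      apply: le_trans (lerD (ler_normD _ _) (ler_normD _ _)) _; rewrite !normrM.
      have bd (x y : R) : `|x| <= Gam -> `|y| <= Gam * 2^-1 ^+ k -> `|x| * `|y| <= Gam * sig.
        by move=> hx hy; apply: ler_pM => //; exact: le_trans hk.
      have := bd _ _ g2 p1; have := bd _ _ f1' q2; have := bd _ _ g1 p2; have := bd _ _ f2' q1.
      by rewrite ![_ * `|_ - P1 _|]mulrC ![_ * `|_ - P2 _|]mulrC; clear; lra.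
    have := hJ i; move: sigG; set x := F1 _ * _ - _; set y := P1 _ * _ - _ => h1 h2 h3.
    have := ler_normD (x - y) y; rewrite subrK.
    by move: h1 h2 h3; clear; lra.
  - rewrite (_ : P (p i) - c1 = (F (p i) - c1) - (F (p i) - P (p i))); last by ring.
    by apply: le_trans (ler_normB _ _) _; have := hc1 i; move: p0 hk; clear; lra.
  - rewrite (_ : Q (p i) - c2 = (G (p i) - c2) - (G (p i) - Q (p i))); last by ring.
    by apply: le_trans (ler_normB _ _) _; have := hc2 i; move: q0 hk; clear; lra.
apply: (@common_zeros_le R N z k k.+1 e (fun t => P t - c1) (fun t => Q t - c2)) => //.
- move=> i j zij; apply/eqP/negPn/negP => ij; have := sep _ _ ij; rewrite ltNge => /negP; apply.
  apply: le_trans (n1_tri (z i) _ _) _.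
  have [h1 _ _] := hz i; have [h2 _ _] := hz j; rewrite -zij in h2.
  by rewrite (n1_dist (p i)); move: h1 h2; clear; lra.
- by apply: polyf_sub => //; exact: polyf_cst.
- by apply: polyf_sub => //; exact: polyf_cst.
- by rewrite gt_eqF.
- by move=> i; have [] := hz i.
- by move=> i; have [] := hz i.
Qed.

End tame.

(** * Integrals of nonnegative functions *)

Section integration.
Context {d : measure_display} {T : measurableType d} {R : realType}.
Variable mu : {measure set T -> \bar R}.
Local Open Scope ereal_scope.

Import HBNNSimple.

(** The integral of a nonnegative function is a supremum over the simple functions below it, so
    comparison also covers integrands whose measurability is not known. *)
Lemma ge0_integral_mono (D : set T) (f g : T -> \bar R) :
  (forall x, D x -> 0 <= f x) -> (forall x, D x -> f x <= g x) ->
  \int[mu]_(x in D) f x <= \int[mu]_(x in D) g x.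
Proof.
move=> f0 fg; rewrite !ge0_integralE//; last first.
  by move=> x Dx; apply: le_trans (fg _ Dx); exact: f0.
apply: le_ereal_sup => _ [h hf <-]; exists h => // x.
apply: le_trans (hf x) _; rewrite /patch; case: ifPn => // xD.
by apply: fg; rewrite inE in xD.
Qed.

Lemma ge0_integral_subset (A B : set T) (f : T -> \bar R) :
  (forall x, B x -> 0 <= f x) -> A `<=` B ->
  \int[mu]_(x in A) f x <= \int[mu]_(x in B) f x.
Proof.
move=> f0 AB; rewrite integral_mkcond [leRHS]integral_mkcond.
apply: ge0_integral_mono => x _; rewrite /patch.
  by case: ifPn => // /[!inE] /AB; exact: f0.
case: ifPn => [xA|_]; last by case: ifPn => // /[!inE]; exact: f0.
by rewrite ifT// inE; apply: AB; rewrite inE in xA.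
Qed.

End integration.

Section sprod.
Context {d1 d2 : measure_display} {T1 : measurableType d1} {T2 : measurableType d2} {R : realType}.
Variables (m1 : {sigma_finite_measure set T1 -> \bar R}) (m2 : {sigma_finite_measure set T2 -> \bar R}).
(** A name for the product measure on which a sigma-finite structure can be declared, so that it may
    be a factor of a further product. *)
Definition sprod : set (T1 * T2)%type -> \bar R := (m1 \x m2)%E.
HB.instance Definition _ := Measure.on sprod.
Let sprod_sigma_finite : sigma_finite setT sprod.
Proof.
have /sigma_finiteP[F [TF ndF Foo]] := sigma_finiteT m1.
have /sigma_finiteP[G [TG ndG Goo]] := sigma_finiteT m2.
exists (fun n => F n `*` G n).
  apply/seteqP; split => // -[x y] _.
  have [n _ Fnx] : (\bigcup_i F i) x by rewrite -TF.
  have [k _ Gky] : (\bigcup_i G i) y by rewrite -TG.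
  exists (maxn n k) => //; split => /=.
  - by move/subsetPset: (ndF _ _ (leq_maxl n k)); exact.
  - by move/subsetPset: (ndG _ _ (leq_maxr n k)); exact.
move=> k; have [mF Fk] := Foo k; have [mG Gk] := Goo k; split; first exact: measurableX.
by rewrite /sprod product_measure1E// lte_mul_pinfty// ge0_fin_numE.
Qed.
HB.instance Definition _ := Measure_isSigmaFinite.Build _ _ _ sprod sprod_sigma_finite.
Definition sprodm : {sigma_finite_measure set (T1 * T2)%type -> \bar R} := sprod.
End sprod.

(** * Areas of sets in the plane *)

Section plane.
Variable R : realType.
Local Notation leb := (@lebesgue_measure R).

Definition TR2 : measurableType _ := (measurableTypeR R * measurableTypeR R)%type.
Definition TR3 : measurableType _ := (TR2 * measurableTypeR R)%type.
(** As functions on sets, [lam2] and [lam3] unfold to [leb2] and [leb3] of the statement. *)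
Definition lam2 : {sigma_finite_measure set TR2 -> \bar R} := sprodm leb leb.
Definition lam3 : {sigma_finite_measure set TR3 -> \bar R} := sprodm lam2 leb.

Implicit Types (s t p : R * R).

Lemma leb_bounded (A : set R) (y l : R) : 0 <= l -> measurable A ->
  A `<=` `[y, (y + l)%R] -> (leb A <= l%:E)%E.
Proof.
move=> l0 mA AI; apply: (@le_trans _ _ (leb `[y, y + l])).
  by apply: le_measure => //; rewrite inE.
rewrite lebesgue_measure_itv/= lte_fin; case: ifP => _; last by rewrite lee_fin.
by rewrite -EFinB addrAC subrr add0r.
Qed.

Lemma lam2_sections (A : set TR2) (x l1 l2 : R) : 0 <= l1 -> 0 <= l2 ->
  measurable A -> (forall t, A t -> x <= t.1 <= x + l1) ->
  (forall u, exists y, forall t, A t -> t.1 = u -> y <= t.2 <= y + l2) ->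
  (lam2 A <= (l1 * l2)%:E)%E.
Proof.
move=> l10 l20 mA h1 h2; rewrite /lam2 /sprodm/= /sprod /product_measure1.
have le2 u : (leb (xsection A u) <= l2%:E * (\1_(`[x, (x + l1)%R]) u)%:E)%E.
  rewrite indicE; have [uI|uI] := boolP (u \in _).
    rewrite mule1; have [y hy] := h2 u.
    apply: (@leb_bounded _ y) => //; first exact: measurable_xsection.
    by move=> v /xsectionP/hy/(_ erefl)/=; rewrite in_itv.
  rewrite (_ : xsection A u = set0) ?measure0 ?mule0//.
  apply/seteqP; split => // v /xsectionP/h1/= hu; move/negP: uI; apply.
  by rewrite inE/= in_itv.
apply: (@le_trans _ _ (\int[leb]_u (l2%:E * (\1_(`[x, (x + l1)%R]) u)%:E))%E).
  by apply: ge0_integral_mono => u _ /=; [|exact: le2].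
rewrite ge0_integralZl//.
  rewrite integral_indic// setIT mulrC EFinM; apply: lee_wpmul2l => //.
  exact: (@leb_bounded _ x).
by apply/measurable_EFinP; exact: measurable_indic.
Qed.

Definition pgram (a b c d : R) p (s : R) : set TR2 :=
  [set t | `|a * (t.1 - p.1) + b * (t.2 - p.2)| <= s /\
           `|c * (t.1 - p.1) + d * (t.2 - p.2)| <= s].

Lemma measurable_pgram (a b c d : R) p (s : R) : measurable (pgram a b c d p s).
Proof.
have m (u v : R) : measurable_fun [set: TR2] (fun t : TR2 => `|u * (t.1 - p.1) + v * (t.2 - p.2)|).
  apply: measurableT_comp => //; apply: measurable_funD; apply: measurable_funM => //;
    by apply: measurable_funB.
have -> : pgram a b c d p s = [set t : TR2 | `|a * (t.1 - p.1) + b * (t.2 - p.2)| <= s] `&`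
   [set t : TR2 | `|c * (t.1 - p.1) + d * (t.2 - p.2)| <= s] by [].
apply: measurableI; rewrite -[X in measurable X]setTI;
  by apply: (measurable_fun_ler (m _ _) (measurable_cst s)).
Qed.

(** The parallelogram lies in a vertical strip of half-width [(|b| + |d|) s / |det|], and its
    vertical sections have length at most [2 s / max(|b|, |d|)]. The exact area is [4 s^2 / |det|];
    slicing loses a factor two and avoids a linear change of variables. *)
Lemma lam2_pgram (a b c d : R) p (s : R) : 0 <= s -> a * d - b * c != 0 ->
  (lam2 (pgram a b c d p s) <= (8 * s ^+ 2 / `|a * d - b * c|)%:E)%E.
Proof.
move=> s0 det0; set D := a * d - b * c; have D0 : 0 < `|D| by rewrite normr_gt0.
pose l1 := 2 * ((`|b| + `|d|) * s / `|D|).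
pose m := Num.max `|b| `|d|.
have m0 : 0 < m.
  rewrite lt_max !normr_gt0; apply/negPn/negP; rewrite negb_or !negbK => /andP[/eqP b0 /eqP d0].
  by move: det0; rewrite b0 d0 mulr0 mul0r subrr eqxx.
have k1 : 0 <= (`|b| + `|d|) * s / `|D| by rewrite divr_ge0// mulr_ge0// addr_ge0.
apply: (@le_trans _ _ ((l1 * (2 * (s / m)))%:E)).
  apply: (@lam2_sections _ (p.1 - (`|b| + `|d|) * s / `|D|)).
  - by rewrite mulr_ge0.
  - by rewrite mulr_ge0// divr_ge0// ltW.
  - exact: measurable_pgram.
  - move=> t [h1 h2].
    suff : `|t.1 - p.1| <= (`|b| + `|d|) * s / `|D|.
      by rewrite /l1 ler_norml => /andP[]; lra.
    rewrite ler_pdivlMr// -normrM.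
    rewrite (_ : (t.1 - p.1) * D = d * (a * (t.1 - p.1) + b * (t.2 - p.2)) - b * (c * (t.1 - p.1) + d * (t.2 - p.2))); last first.
      by rewrite /D; ring.
    apply: le_trans (ler_normB _ _) _; rewrite !normrM mulrDl addrC.
    by apply: lerD; apply: ler_wpM2l.
  - move=> u; have aux (e f : R) : `|f| = m -> exists y, forall t,
        `|e * (t.1 - p.1) + f * (t.2 - p.2)| <= s -> t.1 = u -> y <= t.2 <= y + 2 * (s / m).
      move=> fm; exists (p.2 - e * (u - p.1) / f - s / m) => t h tu.
      suff : `|t.2 - p.2 + e * (u - p.1) / f| <= s / m.
        by rewrite ler_norml => /andP[]; lra.
      have f0 : f != 0 by rewrite -normr_gt0 fm.
      rewrite ler_pdivlMr// -fm -normrM mulrDl mulfVK// tu in h *.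
      by rewrite (_ : _ + _ = e * (u - p.1) + f * (t.2 - p.2)) //; ring.
    have [bd|db] := leP `|b| `|d|.
      have [|y hy] := aux c d; first by rewrite /m; apply/esym/max_idPr.
      by exists y => t [_ h]; exact: hy.
    have [|y hy] := aux a b; first by rewrite /m; apply/esym/max_idPl/ltW.
    by exists y => t [h _]; exact: hy.
rewrite lee_fin /l1.
rewrite (_ : 2 * _ * (2 * _) = (4 * s ^+ 2 / `|D|) * ((`|b| + `|d|) / m)); last first.
  by field; rewrite !gt_eqF.
rewrite (_ : 8 * s ^+ 2 / `|D| = 4 * s ^+ 2 / `|D| * 2); last by field; rewrite gt_eqF.
apply: ler_wpM2l; first by rewrite divr_ge0// ?(ltW D0)// mulr_ge0// exprn_ge0.
rewrite ler_pdivrMr//.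
have : `|b| <= m by rewrite le_max lexx.
have : `|d| <= m by rewrite le_max lexx orbT.
by clear; lra.
Qed.

End plane.

(** * The area inequality *)

Section area.
Variable R : realType.
Local Notation leb := (@lebesgue_measure R).
Implicit Types (s t p : R * R) (F G : R * R -> R).

Definition jac F1 F2 G1 G2 : R * R -> R := fun t => F1 t * G2 t - F2 t * G1 t.

Section fixed_maps.
Variables (Gam b : R) (D : set (R * R)) (F F1 F2 G G1 G2 : R * R -> R).
Variables (rho r sig : R) (k : nat).
Hypotheses (Gam1 : 1 <= Gam) (rho0 : 0 < rho) (rho1 : rho <= 1).
Hypotheses (rE : 160 * Gam ^+ 2 * r = rho) (sE : sig = rho ^+ 2 / (7680 * Gam ^+ 3)).
Hypothesis hb : forall t, D t -> n1 t <= b.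
Hypotheses (tF : tame Gam D F F1 F2) (tG : tame Gam D G G1 G2).
Hypothesis hk : Gam * 2^-1 ^+ k <= sig.
Local Notation J := (jac F1 F2 G1 G2).

(** For two points with images in one cell the inverse matrix bounds their distance [n] by a
    multiple of [sg + Gam n^2]. As [n <= 2 r] the quadratic term is absorbed, which gives
    [n <= 9 Gam sg / rho] and then [Gam n^2 <= sg]: the map is linear up to [sg], and the Jacobian
    changes by at most [rho]. *)
Lemma local_pgram p t (c1 c2 sg : R) : 0 < sg -> sg <= sig -> D p -> D t ->
  rho <= `|J p| -> n1 (t - p) <= 2 * r ->
  `|F p - c1| <= sg -> `|G p - c2| <= sg -> `|F t - c1| <= sg -> `|G t - c2| <= sg ->
  pgram (F1 p) (F2 p) (G1 p) (G2 p) p (3 * sg) t /\ `|J t| <= 2 * `|J p|.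
Proof.
have gam1 := Gam1; have rho0' := rho0; have rho1' := rho1.
move=> s0 ss Dp Dt Jp tp Fp Gp Ft Gt.
have G0 : 0 < Gam by lra.
have [f1 f2 f3 f4 f5] := tF.1 _ _ Dt Dp; have [g1 g2 g3 g4 g5] := tG.1 _ _ Dt Dp.
have [_ _ _ f4' f5'] := tF.1 _ _ Dp Dt; have [_ _ _ g4' g5'] := tG.1 _ _ Dp Dt.
set n := n1 (t - p) in tp f1 f2 f3 g1 g2 g3 *.
have n0 : 0 <= n by exact: n1_ge0.
have rr : r = rho / (160 * Gam ^+ 2) by rewrite -rE; field; rewrite gt_eqF.
have tri (x y c : R) : `|x - c| <= sg -> `|y - c| <= sg -> `|x - y| <= 2 * sg.
  move=> hx hy; rewrite (_ : x - y = (x - c) - (y - c)); last by ring.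
  by apply: le_trans (ler_normB _ _) _; lra.
have L1 : `|F1 p * (t.1 - p.1) + F2 p * (t.2 - p.2)| <= 2 * sg + Gam * n ^+ 2.
  have := tri _ _ _ Ft Fp; move: f1; set x := F t - F p; set y := F1 p * _ + _ => h1 h2.
  rewrite (_ : y = x - (x - y)); last by ring.
  by apply: le_trans (ler_normB _ _) _; lra.
have L2 : `|G1 p * (t.1 - p.1) + G2 p * (t.2 - p.2)| <= 2 * sg + Gam * n ^+ 2.
  have := tri _ _ _ Gt Gp; move: g1; set x := G t - G p; set y := G1 p * _ + _ => h1 h2.
  rewrite (_ : y = x - (x - y)); last by ring.
  by apply: le_trans (ler_normB _ _) _; lra.
have nle : n <= 2 * Gam / rho * (2 * (2 * sg + Gam * n ^+ 2)).
  have := n1_inv2 rho0 Jp f4 f5 g4 g5 (F1 p * (t.1 - p.1) + F2 p * (t.2 - p.2),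
     G1 p * (t.1 - p.1) + G2 p * (t.2 - p.2)).
  have -> := inv2K rho0 Jp (t - p).
  move/le_trans; apply; rewrite ler_wpM2l ?divr_ge0 ?mulr_ge0 ?(ltW rho0) ?(ltW G0)//.
  by rewrite /n1/=; move: L1 L2; lra.
have nn : Gam * n ^+ 2 * 2 <= n * rho / (40 * Gam).
  have -> : n * rho / (40 * Gam) = Gam * n * (2 * r) * 2 by rewrite rr; field; rewrite gt_eqF.
  by rewrite expr2 mulrA ler_wpM2r// ler_wpM2l// mulr_ge0// ltW.
have n9 : n <= 9 * Gam * sg / rho.
  have : 2 * Gam / rho * (2 * (2 * sg + Gam * n ^+ 2)) <= 8 * Gam * sg / rho + n / 20.
    have -> : 8 * Gam * sg / rho + n / 20 = 2 * Gam / rho * (4 * sg + n * rho / (40 * Gam)).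
      by field; rewrite !gt_eqF.
    rewrite ler_wpM2l ?divr_ge0 ?mulr_ge0 ?(ltW rho0) ?(ltW G0)//.
    by move: nn; lra.
  move=> h; have e : 9 * Gam * sg / rho = 9 / 8 * (8 * Gam * sg / rho) by field; rewrite gt_eqF.
  by rewrite e; move: (le_trans nle h); lra.
have q : Gam * n ^+ 2 <= sg.
  have h : n ^+ 2 <= (9 * Gam * sg / rho) ^+ 2 by rewrite ler_pXn2r// ?nnegrE// (le_trans n0).
  apply: le_trans (ler_wpM2l (ltW G0) h) _.
  have -> : Gam * (9 * Gam * sg / rho) ^+ 2 = sg * (81 * Gam ^+ 3 / rho ^+ 2 * sg) by field; rewrite gt_eqF.
  rewrite ler_piMr ?(ltW s0)//.
  have h2 : 0 <= 81 * Gam ^+ 3 / rho ^+ 2 by rewrite divr_ge0 ?mulr_ge0 ?exprn_ge0 ?(ltW G0) ?(ltW rho0).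
  apply: le_trans (ler_wpM2l h2 ss) _.
  have -> : 81 * Gam ^+ 3 / rho ^+ 2 * sig = 81 / 7680 by rewrite sE; field; rewrite !gt_eqF.
  lra.
split; first by split; move: L1 L2 q; lra.
have : `|J t - J p| <= 4 * Gam * (Gam * n).
  rewrite /jac (_ : _ - _ = (F1 t - F1 p) * G2 t + F1 p * (G2 t - G2 p) -
    ((F2 t - F2 p) * G1 t + F2 p * (G1 t - G1 p))); last by ring.
  apply: le_trans (ler_normB _ _) _.
  apply: le_trans (lerD (ler_normD _ _) (ler_normD _ _)) _; rewrite !normrM.
  have bd (x y : R) : `|x| <= Gam -> `|y| <= Gam * n -> `|x| * `|y| <= Gam * (Gam * n).
    by move=> hx hy; apply: ler_pM.
  have := bd _ _ g5' f2; have := bd _ _ f4 g3; have := bd _ _ g4' f3; have := bd _ _ f5 g2.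
  by rewrite [`|F1 t - _| * _]mulrC [`|F2 t - _| * _]mulrC; lra.
have : 4 * Gam * (Gam * n) <= rho.
  have -> : rho = 4 * Gam * (Gam * (40 * r)) by rewrite rr; field; rewrite gt_eqF.
  rewrite ler_wpM2l ?mulr_ge0 ?(ltW G0)// ler_wpM2l ?(ltW G0)//.
  have : 0 < r by rewrite rr divr_gt0// mulr_gt0// exprn_gt0.
  by move: tp; lra.
have := ler_normD (J t - J p) (J p); rewrite subrK; move: Jp; lra.
Qed.

(** [B] is covered by at most [(k + 1)^2] parallelograms of area at most [72 sg^2 / |J p|], and the
    Jacobian is at most [2 |J p|] on the part of [B] attached to each; the size of the Jacobian
    cancels, leaving [144 sg^2] for each. *)
Lemma cell_area (B : set (TR2 R)) (c1 c2 sg : R) : 0 < sg -> sg <= sig ->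
  (forall t s, B t -> n1 (s - t) <= r -> D s) -> (forall t, B t -> rho <= `|J t|) ->
  (forall t, B t -> `|F t - c1| <= sg) -> (forall t, B t -> `|G t - c2| <= sg) ->
  (\int[lam2 R]_(t in B) `|J t|%:E <= (144 * sg ^+ 2 * (k.+1 ^ 2)%:R)%:E)%E.
Proof.
have gam1 := Gam1; have rho0' := rho0; have rho1' := rho1.
move=> s0 ss hD hJ h1 h2.
have G0 : 0 < Gam by lra.
have r0 : 0 < r.
  have : 0 < 160 * Gam ^+ 2 * r by rewrite rE.
  by rewrite pmulr_rgt0// mulr_gt0// exprn_gt0.
have BD t : B t -> D t.
  by move=> Bt; apply: (hD t t) => //; rewrite subrr /n1 !normr0 addr0 ltW.
pose far := [rel s t : R * R | 2 * r < n1 (s - t)].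
pose fam N := `[< exists s : seq (R * R), [/\ size s = N, (forall t, t \in s -> B t) & pairwise far s] >].
have famle N : fam N -> (N <= k.+1 ^ 2)%N.
  move=> /asboolP[s [sN sB /(pairwiseP 0) sfar]]; subst N.
  have sB' (i : 'I_(size s)) : B (nth 0 s i) by apply: sB; exact: mem_nth.
  apply: (@count_separated R Gam b D F F1 F2 G G1 G2 rho sig r k _ (fun i => nth 0 s i) c1 c2) => //.
  - by move=> i t; apply: hD; exact: sB'.
  - by move=> i; exact: hJ.
  - by move=> i; apply: le_trans ss; exact: h1.
  - by move=> i; apply: le_trans ss; exact: h2.
  - move=> i j ij; have [lt|lt|e] := ltngtP i j; last by move: ij; rewrite -val_eqE/= e eqxx.
      by have := sfar _ _ (ltn_ord i) (ltn_ord j) lt.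
    by rewrite n1_dist; have := sfar _ _ (ltn_ord j) (ltn_ord i) lt.
have fam0 : exists N, fam N by exists 0%N; apply/asboolP; exists [::].
(* A longest list of points of [B] pairwise more than [2 r] apart: its length is bounded by
   [count_separated], and by maximality every point of [B] is within [2 r] of the list. *)
case: (ex_maxnP fam0 famle) => N /asboolP[s [sN sB sfar]] Nmax.
have NK : (N <= k.+1 ^ 2)%N by apply: famle; apply/asboolP; exists s.
have near t : B t -> exists2 p, p \in s & n1 (t - p) <= 2 * r.
  move=> Bt; apply: contrapT => none.
  have : fam N.+1.
    apply/asboolP; exists (t :: s); split => /=; first by rewrite sN.
      by move=> u; rewrite inE => /orP[/eqP ->//|]; exact: sB.
    rewrite sfar andbT; apply/allP => p ps /=; rewrite ltNge; apply/negP => tp.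
    by apply: none; exists p.
  by move/Nmax; rewrite ltnn.
pose Pi p := pgram (F1 p) (F2 p) (G1 p) (G2 p) p (3 * sg).
apply: (@le_trans _ _ (\int[lam2 R]_t (\sum_(p <- s) (2 * `|J p|)%:E * (\1_(Pi p) t)%:E))%E).
  rewrite integral_mkcond; apply: ge0_integral_mono => t _; rewrite /patch.
    by case: ifPn.
  case: ifPn => [/[!inE] Bt|_]; last first.
    by apply: sume_ge0 => p _; rewrite mule_ge0// lee_fin.
  have [p ps tp] := near t Bt; have Bp := sB _ ps.
  have [Pt Jt] := local_pgram s0 ss (BD _ Bp) (BD _ Bt) (hJ _ Bp) tp (h1 _ Bp) (h2 _ Bp) (h1 _ Bt) (h2 _ Bt).
  rewrite (big_rem p)//=; apply: (@le_trans _ _ ((2 * `|J p|)%:E * (\1_(Pi p) t)%:E)%E).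
    by rewrite indicE mem_set// mule1 lee_fin.
  by rewrite leeDl//; apply: sume_ge0 => q _; rewrite mule_ge0// lee_fin.
rewrite ge0_integral_sum//; last first.
  move=> p; apply: measurable_funeM; apply/measurable_EFinP; apply: measurable_indic.
  exact: measurable_pgram.
apply: (@le_trans _ _ (\sum_(p <- s) (144 * sg ^+ 2)%:E)%E); last first.
  rewrite sumEFin lee_fin big_const_seq count_predT sN iter_addr_0 -[_ *+ N]mulr_natr.
  by rewrite ler_wpM2l ?mulr_ge0 ?exprn_ge0 ?(ltW s0)// ler_nat.
rewrite !big_seq; apply: lee_sum => p ps.
rewrite ge0_integralZl//; last by apply/measurable_EFinP; apply: measurable_indic; exact: measurable_pgram.
rewrite integral_indic; [|exact: measurableT|exact: measurable_pgram].
rewrite setIT; have Jp := hJ _ (sB _ ps); have Jp0 : 0 < `|J p| by apply: lt_le_trans Jp.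
have := @lam2_pgram R (F1 p) (F2 p) (G1 p) (G2 p) p (3 * sg).
rewrite -normr_gt0 => /(_ (mulr_ge0 (ler0n _ _) (ltW s0)) Jp0) hP.
apply: (le_trans (lee_wpmul2l _ hP)); first by rewrite lee_fin.
rewrite -EFinM lee_fin -/(J p) le_eqVlt; apply/orP; left; apply/eqP.
by rewrite -/(jac F1 F2 G1 G2 p); field; rewrite gt_eqF.
Qed.

(** The bound for one cell is integrated over all centres [w]. Each [t] in [B] belongs to the cells
    of a set of centres of area [4 sg^2], and only centres in [V1 * V2] occur, whence the constant
    [144 / 4 = 36]. *)
Lemma cell_average (V1 V2 : set R) (B : set (TR2 R)) (sg : R) : 0 < sg -> sg <= sig ->
  measurable V1 -> measurable V2 -> measurable B ->
  measurable_fun [set: TR2 R] F -> measurable_fun [set: TR2 R] G ->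
  measurable_fun [set: TR2 R] J ->
  (forall t s, B t -> n1 (s - t) <= r -> D s) -> (forall t, B t -> rho <= `|J t|) ->
  (forall t w, B t -> `|F t - w| <= sg -> V1 w) ->
  (forall t w, B t -> `|G t - w| <= sg -> V2 w) ->
  (\int[lam2 R]_(t in B) `|J t|%:E <= (36 * (k.+1 ^ 2)%:R)%:E * (leb V1 * leb V2))%E.
Proof.
move=> s0 ss mV1 mV2 mB mF mG mJ hD hJ h1 h2.
pose W : set (TR2 R * TR2 R)%type := [set z | [/\ B z.1, `|F z.1 - z.2.1| <= sg & `|G z.1 - z.2.2| <= sg]].
have mW : measurable W.
  have -> : W = (B `*` setT) `&` [set z : (TR2 R * TR2 R)%type | `|F z.1 - z.2.1| <= sg] `&`
      [set z : (TR2 R * TR2 R)%type | `|G z.1 - z.2.2| <= sg].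
    by apply/seteqP; split => [z [? ? ?]|z [[[? _] ?] ?]].
  apply: measurableI; first (apply: measurableI; first exact: measurableX).
    rewrite -[X in measurable X]setTI; apply: (measurable_fun_ler _ (measurable_cst sg)) => //.
    apply: measurableT_comp => //; apply: measurable_funB.
      exact: (measurableT_comp mF).
    by apply: (measurableT_comp measurable_fst); exact: measurable_snd.
  rewrite -[X in measurable X]setTI; apply: (measurable_fun_ler _ (measurable_cst sg)) => //.
  apply: measurableT_comp => //; apply: measurable_funB.
    exact: (measurableT_comp mG).
  by apply: (measurableT_comp measurable_snd); exact: measurable_snd.
pose h (z : (TR2 R * TR2 R)%type) : \bar R := ((`|J z.1|)%:E * (\1_W z)%:E)%E.
have mh : measurable_fun setT h.
  apply: emeasurable_funM; apply/measurable_EFinP; last exact: measurable_indic.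
  by apply: measurableT_comp => //; exact: (measurableT_comp mJ).
have h0 z : (0 <= h z)%E by rewrite mule_ge0// lee_fin.
have Wt t : B t -> (\int[lam2 R]_w h (t, w) = (4 * sg ^+ 2)%:E * `|J t|%:E)%E.
  move=> Bt; rewrite /h/=.
  pose I := (`[F t - sg, F t + sg] `*` `[G t - sg, G t + sg]) : set (TR2 R).
  have mI : measurable I by apply: measurableX.
  have e w : \1_W (t, w) = \1_I w :> R.
    rewrite !indicE; congr (nat_of_bool _)%:R; apply/idP/idP; rewrite !inE /W /I/= !in_itv/=.
      by move=> [_]; rewrite !ler_distlC; move=> /andP[-> ->] /andP[-> ->].
    move=> [/andP[a1 a2] /andP[a3 a4]]; split => //; rewrite ler_distlC; lra.
  under eq_integral do rewrite e.
  rewrite ge0_integralZl//; last by apply/measurable_EFinP; exact: measurable_indic.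
  rewrite integral_indic// setIT.
  transitivity (`|J t|%:E * (leb `[(F t - sg)%R, (F t + sg)%R] * leb `[(G t - sg)%R, (G t + sg)%R]))%E.
    by congr (_ * _)%E; exact: product_measure1E.
  rewrite !lebesgue_measure_itv/= !lte_fin !ifT; [|lra|lra].
  rewrite -!EFinB -!EFinM; congr EFin; ring.
have Ww w : (\int[lam2 R]_t h (t, w) <= (144 * sg ^+ 2 * (k.+1 ^ 2)%:R)%:E * (\1_(V1 `*` V2) w)%:E)%E.
  rewrite indicE; have [wV|wV] := boolP (w \in _).
    rewrite mule1.
    have cA := @cell_area (ysection W w) w.1 w.2 sg s0 ss.
    apply: le_trans (cA _ _ _ _).
    - rewrite [leRHS]integral_mkcond; apply: ge0_integral_mono => t _; first exact: h0.
      rewrite /patch /h indicE mem_ysection/=; case: ifPn => _; first by rewrite mule1.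
      by rewrite mule0.
    - by move=> t s /ysectionP[/= Bt _ _]; exact: hD.
    - by move=> t /ysectionP[/= Bt _ _]; exact: hJ.
    - by move=> t /ysectionP[].
    - by move=> t /ysectionP[].
  rewrite mule0 integral0_eq// => t _; rewrite /h indicE memNset ?mule0// => -[/= Bt Fw Gw].
  by move/negP: wV; apply; rewrite inE; split; [exact: h1 Bt Fw|exact: h2 Bt Gw].
have : ((4 * sg ^+ 2)%:E * \int[lam2 R]_(t in B) `|J t|%:E <=
    (144 * sg ^+ 2 * (k.+1 ^ 2)%:R)%:E * (leb V1 * leb V2))%E.
  rewrite -ge0_integralZl//; last 2 first.
  - by apply/measurable_EFinP; apply: measurableT_comp => //; exact: measurable_funTS.
  - by rewrite lee_fin mulr_ge0// exprn_ge0// ltW.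
  have -> : (\int[lam2 R]_(t in B) ((4 * sg ^+ 2)%:E * `|J t|%:E) = \int[lam2 R]_t \int[lam2 R]_w h (t, w))%E.
    rewrite integral_mkcond; apply: eq_integral => t _; rewrite /patch; case: ifPn => [/[!inE] Bt|tB].
      by rewrite Wt.
    rewrite integral0_eq// => w _; rewrite /h indicE memNset ?mule0// => -[/= Bt _ _].
    by move/negP: tB; apply; rewrite inE.
  rewrite fubini_tonelli//.
  have e : (leb V1 * leb V2 = \int[lam2 R]_w (\1_(V1 `*` V2) w)%:E)%E.
    rewrite integral_indic ?setIT//; last exact: measurableX.
    by apply/esym; exact: product_measure1E.
  rewrite e -ge0_integralZl//; last 2 first.
  - by apply/measurable_EFinP; apply: measurable_indic; exact: measurableX.
  - by rewrite lee_fin mulr_ge0// mulr_ge0// exprn_ge0// ltW.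
  by apply: ge0_integral_mono => w _; [apply: integral_ge0|exact: Ww].
have s4 : 0 < 4 * sg ^+ 2 by rewrite mulr_gt0// exprn_gt0.
rewrite (_ : 144 * sg ^+ 2 * (k.+1 ^ 2)%:R = (4 * sg ^+ 2) * (36 * (k.+1 ^ 2)%:R)); last by ring.
by rewrite [(4 * sg ^+ 2 * (_ * _))%:E]EFinM -muleA lee_pmul2l// lte_fin.
Qed.

(** [B] is exhausted by the points whose images keep a distance [e n] from the complements of [V1]
    and [V2]; there cells of size [e n / 2] stay inside. Openness makes these parts fill [B]. *)
Lemma area_le (V1 V2 : set R) (B : set (TR2 R)) : open V1 -> open V2 -> measurable B ->
  measurable_fun [set: TR2 R] F -> measurable_fun [set: TR2 R] G ->
  measurable_fun [set: TR2 R] J ->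
  (forall t s, B t -> n1 (s - t) <= r -> D s) -> (forall t, B t -> rho <= `|J t|) ->
  (forall t, B t -> V1 (F t)) -> (forall t, B t -> V2 (G t)) ->
  (\int[lam2 R]_(t in B) `|J t|%:E <= (36 * (k.+1 ^ 2)%:R)%:E * (leb V1 * leb V2))%E.
Proof.
move=> oV1 oV2 mB mF mG mJ hD hJ h1 h2.
have sig0 : 0 < sig.
  have gam1 := Gam1; rewrite sE; apply: divr_gt0; first by rewrite exprn_gt0.
  have : 0 < Gam ^+ 3 by rewrite exprn_gt0//; lra.
  lra.
pose e (n : nat) : R := n.+1%:R^-1.
have e0 n : 0 < e n by rewrite invr_gt0.
pose core (V : set R) n : set R := ~` (\bigcup_(y in ~` V) ball y (e n)).
have mcore V n : measurable (core V n : set (measurableTypeR R)).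
  apply: measurableC; apply: open_measurable; apply: bigcup_open => y _.
  exact: ball_open.
pose Bn n := B `&` (F @^-1` core V1 n `&` G @^-1` core V2 n).
have mBn n : measurable (Bn n : set (TR2 R)).
  apply: measurableI => //; apply: measurableI.
    by rewrite -[X in measurable X]setTI; apply: mF => //; exact: mcore.
  by rewrite -[X in measurable X]setTI; apply: mG => //; exact: mcore.
have core_nd V n m : (n <= m)%N -> core V n `<=` core V m.
  move=> nm x hx [y Vy xy]; apply: hx; exists y => //.
  by apply: le_ball xy; rewrite lef_pV2 ?posrE// ler_nat.
have BU : \bigcup_n Bn n = B.
  apply/seteqP; split => [t [n _ []]//|t Bt].
  have ocore V x : open V -> V x -> exists n, core V n x.
    move=> oV Vx; have [d /= d0 dV] : nbhs x V by exact: open_nbhs_nbhs.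
    have [n nd] : exists n, e n < d.
      exists (Num.truncn d^-1); rewrite invf_plt ?posrE//.
      exact: truncnS_gt.
    exists n => -[y Vy xy]; apply: Vy; apply: dV => /=.
    by rewrite distrC; move: xy; rewrite -ball_normE/=; lra.
  have [n1 hn1] := ocore _ _ oV1 (h1 _ Bt); have [n2 hn2] := ocore _ _ oV2 (h2 _ Bt).
  exists (maxn n1 n2) => //; split => //; split.
    exact: (core_nd _ _ _ (leq_maxl _ _)).
  exact: (core_nd _ _ _ (leq_maxr _ _)).
have cvgB : (\int[lam2 R]_(t in Bn n) `|J t|%:E @[n --> \oo] --> \int[lam2 R]_(t in B) `|J t|%:E)%E.
  rewrite -BU; apply: ge0_nondecreasing_set_cvg_integral => //.
  - move=> n m nm; apply/subsetPset => t [Bt [F1t G1t]]; split => //; split.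
      exact: (core_nd _ _ _ nm).
    exact: (core_nd _ _ _ nm).
  - move=> n; apply: measurable_funTS; apply/measurable_EFinP.
    exact: measurableT_comp.
rewrite -(cvg_lim _ cvgB)//; apply: lime_le; first by apply/cvg_ex; eexists; exact: cvgB.
apply: nearW => n.
pose sg := Num.min sig (e n / 2).
have sgn : sg <= e n / 2 by rewrite ge_min lexx orbT.
have e0n := e0 n.
have sub V x w : open V -> core V n x -> `|x - w| <= sg -> V w.
  move=> oV cx xw; apply: contrapT => Vw; apply: cx; exists w => //.
  by rewrite -ball_normE/= distrC; move: xw sgn e0n; lra.
apply: (@cell_average _ _ _ sg) => //.
- by rewrite lt_min sig0 divr_gt0.
- by rewrite ge_min lexx.
- exact: open_measurable.
- exact: open_measurable.
- by move=> t s [Bt _]; exact: hD.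
- by move=> t [Bt _]; exact: hJ.
- by move=> t w [_ [ct _]]; exact: sub.
- by move=> t w [_ [_ ct]]; exact: sub.
Qed.

End fixed_maps.
(** A degree of about [4 ln (1 / rho)] plus a constant suffices for the accuracy, and the square of
    a logarithm is dominated by any negative power of [rho]. *)
Lemma degree_choice (K e : R) : 0 < K -> 0 < e -> exists2 C : R, 0 < C &
  forall rho : R, 0 < rho -> rho <= 1 -> exists k : nat,
    K * 2^-1 ^+ k <= rho ^+ 2 /\ (k.+1 ^ 2)%:R <= C * rho `^ (- e).
Proof.
move=> K0 e0; pose K' := Num.max K 1.
have K'1 : 1 <= K' by rewrite le_max lexx orbT.
have K'0 : 0 < K' by lra.
have lK0 : 0 <= ln K' by rewrite ln_ge0.
pose A := 2 + 2 * ln K' + 8 / e.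
have A0 : 0 < A by rewrite /A; have : 0 < 8 / e; [rewrite divr_gt0|lra].
exists (A ^+ 2); first by rewrite exprn_gt0.
move=> rho rho0 rho1.
have l0 : ln rho <= 0 by rewrite ln_le0.
pose y := rho `^ (- e / 2).
have y1 : 1 <= y.
  rewrite /y -[leLHS](powRr0 rho); apply: ger_powR; first by rewrite rho0.
  by rewrite mulNr oppr_le0 divr_ge0// ltW.
have ly : - ln rho <= 2 / e * y.
  have : ln y <= y.
    have := @le_ln1Dx R (y - 1); rewrite addrCA subrr addr0.
    by move=> /(_ _)/le_trans; apply; lra.
  rewrite /y ln_powR => h.
  have -> : - ln rho = 2 / e * (- e / 2 * ln rho) by field; rewrite gt_eqF.
  by rewrite ler_wpM2l// divr_ge0// ltW.
pose z := 2 * ln K' - 4 * ln rho.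
have z0 : 0 <= z by rewrite /z; lra.
exists (Num.truncn z).+1; set k := (Num.truncn z).+1.
have zk : z <= k%:R by rewrite ltW// truncnS_gt.
have kz : k%:R <= z + 1 by rewrite /k -natr1 lerD2r truncn_le.
split.
  have h : (2^-1 : R) ^+ k <= expR (- k%:R / 2).
    rewrite (_ : - k%:R / 2 = k%:R * (- 2^-1)); last by ring.
    rewrite expRM_natl ler_pXn2r ?nnegrE ?expR_ge0 ?invr_ge0//.
    by have := expR_ge1Dx (- 2^-1 : R); lra.
  have h2 : expR (- k%:R / 2) <= rho ^+ 2 / K'.
    rewrite -ler_ln ?posrE ?expR_gt0 ?divr_gt0 ?exprn_gt0//.
    rewrite expRK ln_div ?posrE ?exprn_gt0// lnXn// [ln rho *+ 2]mulr2n.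
    by move: zk; rewrite /z; move: (k%:R : R) => kk; clear; lra.
  have KK : K <= K' by rewrite le_max lexx.
  apply: le_trans (ler_pM _ _ KK (le_trans h h2)) _; first exact: ltW.
    by rewrite exprn_ge0.
  by rewrite mulrCA divff ?mulr1// gt_eqF.
have k1 : k.+1%:R <= A * y.
  apply: (@le_trans _ _ (2 + 2 * ln K' + 4 * (2 / e * y))).
    by rewrite -natr1; move: kz ly; rewrite /z; lra.
  have : (2 + 2 * ln K') * 1 <= (2 + 2 * ln K') * y by rewrite ler_wpM2l//; lra.
  by rewrite /A; lra.
have -> : rho `^ (- e) = y ^+ 2.
  by rewrite /y -powR_mulrn ?powR_ge0// -powRrM; congr (_ `^ _); field.
rewrite natrX -exprMn ler_pXn2r ?nnegrE//.
exact: le_trans k1.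
Qed.

(** [C] is chosen from [Gam] and [e] alone, before the maps, the domain and its bound [b]: in the
    main application the maps depend on three arbitrary points of space. *)
Lemma area_eps (Gam e : R) : 1 <= Gam -> 0 < e -> exists2 C : R, 0 < C &
  forall (b : R) D F F1 F2 G G1 G2 (rho : R) (B : set (TR2 R)) (V1 V2 : set R),
  (forall t, D t -> n1 t <= b) -> tame Gam D F F1 F2 -> tame Gam D G G1 G2 ->
  0 < rho -> rho <= 1 -> open V1 -> open V2 -> measurable B ->
  measurable_fun [set: TR2 R] F -> measurable_fun [set: TR2 R] G ->
  measurable_fun [set: TR2 R] (jac F1 F2 G1 G2) ->
  (forall t s, B t -> n1 (s - t) <= (160 * Gam ^+ 2)^-1 -> D s) ->
  (forall t, B t -> rho <= `|jac F1 F2 G1 G2 t|) ->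
  (forall t, B t -> V1 (F t)) -> (forall t, B t -> V2 (G t)) ->
  (\int[lam2 R]_(t in B) `|jac F1 F2 G1 G2 t|%:E <= (C * rho `^ (- e))%:E * (leb V1 * leb V2))%E.
Proof.
move=> Gam1 e0; have G0 : 0 < Gam by lra.
have g3 : 0 < Gam ^+ 3 by rewrite exprn_gt0.
have K0 : 0 < 7680 * Gam ^+ 3 * Gam by apply: mulr_gt0; [move: g3; clear; lra|exact: G0].
have [C C0 hC] := degree_choice K0 e0.
exists (36 * C); first by rewrite mulr_gt0.
move=> b D F F1 F2 G G1 G2 rho B V1 V2 hb tF tG rho0 rho1 oV1 oV2 mB mF mG mJ hD hJ h1 h2.
have [k [k1 k2]] := hC _ rho0 rho1.
have g2 : 0 < 160 * Gam ^+ 2 by rewrite mulr_gt0// exprn_gt0.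
apply: le_trans (@area_le Gam b D F F1 F2 G G1 G2 rho (rho / (160 * Gam ^+ 2))
  (rho ^+ 2 / (7680 * Gam ^+ 3)) k Gam1 rho0 rho1 _ erefl hb tF tG _ V1 V2 B oV1 oV2 mB mF mG mJ _ hJ h1 h2) _.
- by rewrite mulrCA divff ?mulr1// gt_eqF.
- rewrite ler_pdivlMr; last by move: g3; clear; lra.
  by move: k1; rewrite -mulrA mulrC.
- move=> t s Bt ts; apply: (hD t) => //; apply: le_trans ts _.
  by rewrite ler_piMl// invr_ge0 ltW.
- apply: lee_wpmul2r; first by rewrite mule_ge0.
  by rewrite lee_fin -mulrA ler_wpM2l.
Qed.

End area.

(** * A lower bound for determinant integrals *)

Section determinants.
Context {d : measure_display} {T : measurableType d} {R : realType}.
Variables (mu : {measure set T -> \bar R}) (Om : set T) (u M kap : R) (v1 v2 : T -> R).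
Hypotheses (mOm : measurable Om) (Omu : mu Om = u%:E) (u0 : 0 < u).
Hypotheses (mv1 : measurable_fun setT v1) (mv2 : measurable_fun setT v2).
Hypotheses (hv1 : forall y, Om y -> `|v1 y| <= M) (hv2 : forall y, Om y -> `|v2 y| <= M).
Hypotheses (M0 : 0 < M) (kap0 : 0 < kap).
Hypothesis strip : forall c s X Y : R, c ^+ 2 + s ^+ 2 = 1 -> 0 < X -> 0 < Y ->
  (mu (Om `&` [set y | (`|c * v1 y + s * v2 y| < X /\ `|c * v2 y - s * v1 y| < Y)%R])
     <= (kap * X * Y)%:E)%E.

Let dt (w : R * R) y := w.1 * v2 y - w.2 * v1 y.
Let N w := (\int[mu]_(y in Om) `|dt w y|%:E)%E.

Let lower (A : set T) (f : T -> \bar R) (L : R) : measurable A -> 0 <= L ->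
  (forall y, Om y -> 0 <= f y)%E -> (forall y, Om y -> A y -> L%:E <= f y)%E ->
  (L%:E * mu (Om `&` A) <= \int[mu]_(y in Om) f y)%E.
Proof.
move=> mA L0 f0 fL.
have mOA : measurable (Om `&` A) by exact: measurableI.
apply: (@le_trans _ _ (\int[mu]_(y in Om `&` A) f y)%E); last first.
  by apply: ge0_integral_subset => // y [].
rewrite -integral_cst//; apply: ge0_integral_mono => y [] //; exact: fL.
Qed.

Let mlin (c s : R) : measurable_fun setT (fun y => `|c * v1 y + s * v2 y|).
Proof.
by apply: measurableT_comp => //; apply: measurable_funD; apply: measurable_funM.
Qed.

Let mdt (w : R * R) : measurable_fun setT (fun y => `|dt w y|).
Proof.
by apply: measurableT_comp => //; apply: measurable_funB; apply: measurable_funM.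
Qed.

Let mge (f : T -> R) X : measurable_fun setT f -> measurable [set y | X <= f y].
Proof.
move=> mf; rewrite -[X in measurable X]setTI.
exact: (measurable_fun_ler (measurable_cst X) mf).
Qed.

Let mlt (f : T -> R) X : measurable_fun setT f -> measurable [set y | f y < X].
Proof.
move=> mf; rewrite -[X in measurable X]setTI.
exact: (measurable_fun_ltr mf (measurable_cst X)).
Qed.

Let U2 (A B : set T) : measurable A -> measurable B -> (mu (A `|` B) <= mu A + mu B)%E.
Proof. by move=> mA mB; apply: measureU2. Qed.

Let Nlow w X : 0 < X -> (X%:E * mu (Om `&` [set y | X <= `|dt w y|]%R) <= N w)%E.
Proof.
by move=> X0; apply: lower => //; [apply: mge; exact: mdt|exact: ltW].
Qed.

(** Serves to show that the infimum of [N] over unit vectors is positive, so that a unit vector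
    within a factor two of it exists. [X] is chosen so that the strip where [|dt w| < X] has measure
    at most [u / 2]; the bound [M] does not survive in the final estimate. *)
Let N_ge w : w.1 ^+ 2 + w.2 ^+ 2 = 1 -> ((u ^+ 2 / (16 * kap * M))%:E <= N w)%E.
Proof.
move=> w1; pose X := u / (8 * kap * M).
have X0 : 0 < X by rewrite divr_gt0// !mulr_gt0.
have b1 : `|w.1| <= 1 by rewrite -[leRHS]normr1 -ler_sqr ?nnegrE// !real_normK ?num_real//; have := sqr_ge0 w.2; lra.
have b2 : `|w.2| <= 1 by rewrite -[leRHS]normr1 -ler_sqr ?nnegrE// !real_normK ?num_real//; have := sqr_ge0 w.1; lra.
have cov : Om `<=` (Om `&` [set y | X <= `|dt w y|]) `|`
    (Om `&` [set y | `|(- w.2) * v1 y + w.1 * v2 y| < X /\ `|(- w.2) * v2 y - w.1 * v1 y| < 4 * M]).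
  move=> y Oy; have [h|h] := leP X `|dt w y|; [left|right]; split => //; split.
    by move: h; rewrite /dt (_ : _ - _ = - w.2 * v1 y + w.1 * v2 y)//; ring.
  apply: le_lt_trans (ler_normB _ _) _; rewrite !normrM normrN.
  have := ler_pM _ _ b1 (hv1 Oy); have := ler_pM _ _ b2 (hv2 Oy); have := M0.
  by rewrite !mul1r => m0 /(_ (normr_ge0 _) (normr_ge0 _)) ? /(_ (normr_ge0 _) (normr_ge0 _)) ?; lra.
have w1' : (- w.2) ^+ 2 + w.1 ^+ 2 = 1 by rewrite sqrrN addrC.
have M4 : 0 < 4 * M by rewrite mulr_gt0.
have := strip w1' X0 M4.
have -> : kap * X * (4 * M) = u / 2 by rewrite /X; field; rewrite !gt_eqF.
move=> h2.
have m1 : measurable (Om `&` [set y | X <= `|dt w y|]) by apply: measurableI => //; exact: mge.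
have m2 : measurable (Om `&` [set y | `|(- w.2) * v1 y + w.1 * v2 y| < X /\ `|(- w.2) * v2 y - w.1 * v1 y| < 4 * M]).
  apply: measurableI => //; apply: measurableI; apply: mlt => //.
  exact: (mdt (- w.2, w.1)).
have : (u%:E <= mu (Om `&` [set y | X <= `|dt w y|]%R) + (u / 2)%:E)%E.
  rewrite -Omu; apply: le_trans (leeD (lexx _) h2).
  apply: le_trans (U2 m1 m2).
  by apply: le_measure => //; rewrite inE//; exact: measurableU.
have h3 := Nlow w X0; move=> h4.
apply: le_trans h3.
apply: (@le_trans _ _ (X%:E * (u / 2)%:E)%E).
  rewrite -EFinM lee_fin /X le_eqVlt; apply/orP; left; apply/eqP; field.
  by rewrite !gt_eqF.
apply: lee_wpmul2l; first by rewrite lee_fin ltW.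
by rewrite -leeBlDr// -EFinB in h4; apply: le_trans h4; rewrite lee_fin; lra.
Qed.

Let N_fin w : (N w \is a fin_num)%E.
Proof.
rewrite ge0_fin_numE ?integral_ge0//.
apply: (@le_lt_trans _ _ (\int[mu]_(y in Om) (`|w.1| * M + `|w.2| * M)%:E)%E).
  apply: ge0_integral_mono => // y Oy; rewrite lee_fin.
  apply: le_trans (ler_normB _ _) _; rewrite !normrM.
  by apply: lerD; apply: ler_wpM2l => //; [exact: hv2|exact: hv1].
by rewrite integral_cst// Omu -EFinM ltry.
Qed.

Let N_scale (r : R) w : N (r * w.1, r * w.2) = (`|r|%:E * N w)%E.
Proof.
rewrite /N -ge0_integralZl//; last first.
  by apply: measurable_funTS; apply/measurable_EFinP; exact: mdt.
apply: eq_integral => y _; rewrite -EFinM -normrM; congr (`|_|%:E).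
by rewrite /dt/=; ring.
Qed.

(* The unit vector b nearly minimises N, so N (v x) is bounded below through
   the component of v x along b, which is large for half of the x. *)
Lemma det_integral_ge (rho : R) : 0 <= rho -> rho <= u / (64 * kap) ->
  ((u ^+ 3 / (128 * kap))%:E <= \int[mu]_(x in Om) \int[mu]_(y in Om)
     (`|v1 x * v2 y - v2 x * v1 y| * (rho <= `|v1 x * v2 y - v2 x * v1 y|)%R%:R)%:E)%E.
Proof.
move=> rho0 rhou.
have [u0' kap0' M0'] := And3 u0 kap0 M0.
pose S := [set x | exists2 w : R * R, w.1 ^+ 2 + w.2 ^+ 2 = 1 & x = fine (N w)].
pose l := u ^+ 2 / (16 * kap * M).
have l0 : 0 < l by rewrite divr_gt0 ?exprn_gt0// !mulr_gt0.
have Sl x : S x -> l <= x.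
  by move=> [w w1 ->]; rewrite -lee_fin fineK ?N_fin//; exact: N_ge.
have hS : has_inf S.
  split; last by exists l.
  by exists (fine (N (1, 0))); exists (1, 0) => //=; rewrite expr1n expr0n addr0.
have a0 : 0 < inf S by apply: lt_le_trans l0 _; apply: lb_le_inf => //; exact: hS.1.
have [_ [b b1 ->] bS] := inf_adherent a0 hS.
pose be := fine (N b).
have be0 : 0 < be by apply: lt_le_trans l0 _; apply: Sl; exists b.
have beE : N b = be%:E by rewrite fineK ?N_fin.
have min (w : R * R) : w.1 ^+ 2 + w.2 ^+ 2 = 1 -> ((be / 2)%:E <= N w)%E.
  move=> w1; rewrite -[N w]fineK ?N_fin// lee_fin.
  have : inf S <= fine (N w) by apply: ge_inf; [exact: hS.2|exists w].
  by rewrite -/be in bS; lra.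
(* By Markov's inequality [|dt b| >= X] on measure at most [u / 4], and [kap X Y = u / 4]; so on at
   least half of [Om] the component along [b] is at least [Y]. In the product of [Y] with the
   minimum [be / 2] the unknown [be] cancels. *)
pose X := 4 * be / u; pose Y := u ^+ 2 / (16 * be * kap).
have X0 : 0 < X by rewrite divr_gt0// mulr_gt0.
have Y0 : 0 < Y by rewrite divr_gt0// ?exprn_gt0// !mulr_gt0.
pose A1 := [set y | X <= `|dt b y|].
pose A2 := [set y | `|(- b.2) * v1 y + b.1 * v2 y| < X /\ `|(- b.2) * v2 y - b.1 * v1 y| < Y].
pose A3 := [set y | Y <= `|b.1 * v1 y + b.2 * v2 y|].
have mA1 : measurable A1 by apply: mge.
have mA2 : measurable A2 by apply: measurableI; apply: mlt => //; exact: (mdt (- b.2, b.1)).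
have mA3 : measurable A3 by apply: mge.
have h1 : (mu (Om `&` A1) <= (u / 4)%:E)%E.
  have := Nlow b X0; rewrite beE => h.
  have Xi : 0 < X^-1 by rewrite invr_gt0.
  rewrite -(@lee_pmul2l _ X%:E)// -EFinM; apply: le_trans h _.
  by rewrite lee_fin /X le_eqVlt; apply/orP; left; apply/eqP; field; rewrite gt_eqF.
have h2 : (mu (Om `&` A2) <= (u / 4)%:E)%E.
  have b1' : (- b.2) ^+ 2 + b.1 ^+ 2 = 1 by rewrite sqrrN addrC.
  apply: le_trans (strip b1' X0 Y0) _.
  by rewrite lee_fin /X /Y le_eqVlt; apply/orP; left; apply/eqP; field; rewrite !gt_eqF.
have cov : Om `<=` (Om `&` A1) `|` ((Om `&` A2) `|` (Om `&` A3)).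
  move=> y Oy; have [k1|k1] := leP X `|dt b y|; first by left.
  right; have [k2|k2] := leP Y `|b.1 * v1 y + b.2 * v2 y|; first by right.
  left; split => //; split.
    by move: k1; rewrite /dt (_ : _ - _ = - b.2 * v1 y + b.1 * v2 y)//; ring.
  rewrite (_ : _ - _ = - (b.1 * v1 y + b.2 * v2 y)); last by ring.
  by rewrite normrN.
have h3 : ((u / 2)%:E <= mu (Om `&` A3))%E.
  have m1 : measurable (Om `&` A1) by exact: measurableI.
  have m2 : measurable (Om `&` A2) by exact: measurableI.
  have m3 : measurable (Om `&` A3) by exact: measurableI.
  have : (u%:E <= (u / 4)%:E + ((u / 4)%:E + mu (Om `&` A3)))%E.
    rewrite -Omu; apply: le_trans (leeD h1 (leeD h2 (lexx _))).
    apply: le_trans (leeD (lexx _) (U2 m2 m3)).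
    apply: le_trans (U2 m1 (measurableU _ _ m2 m3)).
    by apply: le_measure => //; rewrite inE//; apply: measurableU => //; exact: measurableU.
  rewrite addeA -EFinD -leeBlDl// -EFinB; apply: le_trans; rewrite lee_fin; lra.
pose L := u ^+ 2 / (64 * kap).
have L0 : 0 <= L by rewrite divr_ge0 ?sqr_ge0// mulr_ge0// ltW.
apply: (@le_trans _ _ (L%:E * (u / 2)%:E)%E).
  by rewrite -EFinM lee_fin /L le_eqVlt; apply/orP; left; apply/eqP; field; rewrite gt_eqF.
apply: le_trans (lee_wpmul2l _ h3) _; first by rewrite lee_fin.
apply: lower => // [x Ox|x Ox A3x].
  by apply: integral_ge0 => y _; rewrite lee_fin mulr_ge0.
pose r : R := Num.sqrt (v1 x ^+ 2 + v2 x ^+ 2).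
have r20 : r ^+ 2 = v1 x ^+ 2 + v2 x ^+ 2 by rewrite sqr_sqrtr// addr_ge0 ?sqr_ge0.
have r00 : 0 <= r by exact: sqrtr_ge0.
have rY : Y <= r.
  apply: le_trans A3x _; rewrite -ler_sqr ?nnegrE// real_normK ?num_real// r20.
  have := sqr_ge0 (b.1 * v2 x - b.2 * v1 x).
  rewrite (_ : v1 x ^+ 2 + v2 x ^+ 2 = (b.1 ^+ 2 + b.2 ^+ 2) * (v1 x ^+ 2 + v2 x ^+ 2)); last by rewrite b1 mul1r.
  by lra.
have r0 : 0 < r by apply: lt_le_trans Y0 rY.
have Nv : ((u ^+ 2 / (32 * kap))%:E <= N (v1 x, v2 x))%E.
  have -> : (v1 x, v2 x) = (r * (v1 x / r), r * (v2 x / r)).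
    by congr pair; rewrite mulrCA divff ?mulr1// gt_eqF.
  rewrite (N_scale r (v1 x / r, v2 x / r)) gtr0_norm//.
  apply: (@le_trans _ _ (r%:E * (be / 2)%:E)%E).
    rewrite -EFinM lee_fin; apply: (@le_trans _ _ (Y * (be / 2))).
      by rewrite /Y le_eqVlt; apply/orP; left; apply/eqP; field; rewrite !gt_eqF.
    by rewrite ler_wpM2r// divr_ge0// ltW.
  apply: lee_wpmul2l; first by rewrite lee_fin ltW.
  apply: min => /=; rewrite !expr_div_n -mulrDl -r20.
  by rewrite divff// expf_neq0// gt_eqF.
have md : measurable_fun Om (fun y => (`|dt (v1 x, v2 x) y| * (rho <= `|dt (v1 x, v2 x) y|)%R%:R)%:E).
  apply/measurable_EFinP; apply: measurable_funTS; apply: measurable_funM; first exact: mdt.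
  have -> : (fun y => (rho <= `|dt (v1 x, v2 x) y|)%R%:R) = \1_[set y | rho <= `|dt (v1 x, v2 x) y|] :> (T -> R).
    by apply/funext => y; rewrite indicE; congr (nat_of_bool _)%:R; rewrite mem_setE.
  by apply: measurable_indic; apply: mge; exact: mdt.
(* Discarding determinants below [rho] costs at most [rho u], half of the lower bound for
   [N (v1 x, v2 x)]. *)
have : (N (v1 x, v2 x) <= \int[mu]_(y in Om)
     (`|v1 x * v2 y - v2 x * v1 y| * (rho <= `|v1 x * v2 y - v2 x * v1 y|)%R%:R)%:E + (rho * u)%:E)%E.
  rewrite EFinM -Omu -integral_cst// -ge0_integralD//.
  apply: ge0_integral_mono => // y _; rewrite -EFinD lee_fin /dt/=.
  have [h|h] := leP rho `|v1 x * v2 y - v2 x * v1 y|; first by rewrite mulr1 lerDl.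
  by rewrite mulr0 add0r ltW.
move/(le_trans Nv); rewrite -leeBlDr// -EFinB; apply: le_trans; rewrite lee_fin.
have : rho * u <= u / (64 * kap) * u by rewrite ler_wpM2r// ltW.
have -> : u / (64 * kap) * u = L by rewrite /L; field; rewrite gt_eqF.
have -> : u ^+ 2 / (32 * kap) = 2 * L by rewrite /L; field; rewrite gt_eqF.
lra.
Qed.

End determinants.

(** * Invariance of Lebesgue measure *)

Section invariance.
Variable R : realType.
Local Notation leb := (@lebesgue_measure R).
Local Notation mR := (measurableTypeR R).
Local Open Scope ereal_scope.

Lemma measurable_addr (c : R) : measurable_fun [set: mR] ((fun x : mR => (x + c)%R) : mR -> mR).
Proof. by apply: measurable_funD. Qed.

Lemma leb_addr (c : R) (A : set mR) : measurable A -> leb ((fun x : R => (x + c)%R) @^-1` A) = leb A.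
Proof.
move=> mA; apply/esym.
apply: (@lebesgue_measure_unique R (pushforward leb ((fun x : mR => (x + c)%R) : mR -> mR))) => //.
- exact: measurable_addr.
- move=> mf _ [[a b] _ <-].
  change (leb `]a, b]%classic = leb ((fun x : R => (x + c)%R) @^-1` `]a, b]%classic)).
  rewrite (_ : _ @^-1` _ = `](a - c)%R, (b - c)%R]%classic); last first.
    by apply/seteqP; split => x /=; rewrite !in_itv/= ltrBlDr lerBrDr.
  rewrite !lebesgue_measure_itv/= !lte_fin ltrD2r; case: ifP => // _.
  by rewrite -!EFinB; congr EFin; ring.
Qed.

Lemma integral_addr (c : R) (f : mR -> \bar R) : measurable_fun setT f -> (forall x, 0 <= f x) ->
  \int[leb]_x f (x + c)%R = \int[leb]_x f x.
Proof.
move=> mf f0.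
transitivity (\int[pushforward leb ((fun x : mR => (x + c)%R) : mR -> mR)]_x f x).
  rewrite ge0_integral_pushforward//; last exact: measurable_addr.
by apply: eq_measure_integral => [|mp A mA _]; [exact: measurable_addr|rewrite -[RHS](leb_addr c mA)].
Qed.

Lemma integral_subl (c : R) (f : mR -> \bar R) : measurable_fun setT f -> (forall x, 0 <= f x) ->
  \int[leb]_x f (c - x)%R = \int[leb]_x f x.
Proof.
move=> mf f0; rewrite -(integral_addr c mf f0).
pose g : mR -> \bar R := fun x => f (x + c)%R.
have mg : measurable_fun setT g by apply: (measurableT_comp mf); exact: measurable_addr.
transitivity (\int[leb]_x g (- x)%R); first by apply: eq_integral => x _; rewrite /g addrC.
transitivity (\int[pushforward leb (-%R : mR -> mR)]_x g x).
  rewrite ge0_integral_pushforward//.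
  by move=> x _; exact: f0.
by apply: eq_measure_integral => A mA _; rewrite -[RHS](lebesgue_measureN mA).
Qed.

Let sect1 (f : TR2 R -> \bar R) (x : R) : measurable_fun setT f ->
  measurable_fun [set: mR] (fun y : mR => f (x, y)).
Proof. by move=> mf; apply: (measurableT_comp mf); exact: measurable_pair1. Qed.

Lemma lam2_tonelli (f : TR2 R -> \bar R) : measurable_fun setT f -> (forall t, 0 <= f t) ->
  \int[lam2 R]_t f t = \int[leb]_x \int[leb]_y f (x, y).
Proof. by move=> mf f0; rewrite [LHS]fubini_tonelli1. Qed.

Lemma measurable_lam2_inner (f : TR2 R -> \bar R) : measurable_fun setT f -> (forall t, 0 <= f t) ->
  measurable_fun [set: mR] (fun x : mR => \int[leb]_y f (x, y)).
Proof. by move=> mf f0; exact: (measurable_fun_fubini_tonelli_F _ mf f0). Qed.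

Lemma integral_sub2 (c : TR2 R) (f : TR2 R -> \bar R) : measurable_fun setT f -> (forall t, 0 <= f t) ->
  \int[lam2 R]_t f (t.1 - c.1, t.2 - c.2)%R = \int[lam2 R]_t f t.
Proof.
move=> mf f0; rewrite lam2_tonelli//; last first.
  apply: (measurableT_comp mf); apply: measurable_fun_pair;
    exact: (measurableT_comp (measurable_addr _)).
rewrite [RHS](lam2_tonelli mf f0) -[RHS](integral_addr (- c.1)%R).
- apply: eq_integral => x _ /=.
  by rewrite (integral_addr (- c.2)%R (sect1 (x - c.1)%R mf)).
- exact: measurable_lam2_inner.
- by move=> x; exact: integral_ge0.
Qed.

Lemma integral_subl2 (c : TR2 R) (f : TR2 R -> \bar R) : measurable_fun setT f -> (forall t, 0 <= f t) ->
  \int[lam2 R]_t f (c.1 - t.1, c.2 - t.2)%R = \int[lam2 R]_t f t.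
Proof.
have msub (u : R) : measurable_fun [set: mR] ((fun x : mR => (u - x)%R) : mR -> mR).
  by apply: measurable_funB.
move=> mf f0; rewrite lam2_tonelli//; last first.
  apply: (measurableT_comp mf); apply: measurable_fun_pair;
    exact: (measurableT_comp (msub _)).
rewrite [RHS](lam2_tonelli mf f0) -[RHS](integral_subl c.1).
- apply: eq_integral => x _ /=.
  by rewrite (integral_subl c.2 (sect1 (c.1 - x)%R mf)).
- exact: measurable_lam2_inner.
- by move=> x; exact: integral_ge0.
Qed.

End invariance.

(** * Averages over a graph *)

Lemma measure_indic {d : measure_display} {T : measurableType d} {R : realType}
    (mu : {measure set T -> \bar R}) (A : set T) : measurable A ->
  mu A = (\int[mu]_x (\1_A x)%:E)%E.
Proof. by move=> mA; rewrite integral_indic// setIT. Qed.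

Section hits.
Variable R : realType.
Local Notation leb := (@lebesgue_measure R).
Local Notation mR := (measurableTypeR R).
Local Notation T2 := (TR2 R).
Local Notation T3 := (TR3 R).
Local Open Scope ereal_scope.

Definition sub2 (x y : T2) : T2 := ((x.1 - y.1)%R, (x.2 - y.2)%R).

Lemma measurable_sub2 : measurable_fun [set: (T2 * T2)%type] (fun p : (T2 * T2)%type => sub2 p.1 p.2).
Proof.
have m1 : measurable_fun [set: (T2 * T2)%type] (fun p : (T2 * T2)%type => p.1.1 : mR).
  exact: (measurableT_comp measurable_fst measurable_fst).
have m2 : measurable_fun [set: (T2 * T2)%type] (fun p : (T2 * T2)%type => p.1.2 : mR).
  exact: (measurableT_comp measurable_snd measurable_fst).
have m3 : measurable_fun [set: (T2 * T2)%type] (fun p : (T2 * T2)%type => p.2.1 : mR).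
  exact: (measurableT_comp measurable_fst measurable_snd).
have m4 : measurable_fun [set: (T2 * T2)%type] (fun p : (T2 * T2)%type => p.2.2 : mR).
  exact: (measurableT_comp measurable_snd measurable_snd).
by apply: measurable_fun_pair; apply: measurable_funB.
Qed.

Lemma lam2_subl (x : T2) (A : set T2) : measurable A ->
  lam2 R [set y | A (sub2 x y)] = lam2 R A.
Proof.
move=> mA.
have mB : measurable [set y | A (sub2 x y)].
  have h : measurable_fun [set: T2] (sub2 x).
    exact: (measurableT_comp measurable_sub2 (measurable_pair1 x)).
  by rewrite -[X in measurable X]setTI; exact: h.
rewrite (measure_indic _ mB) (measure_indic _ mA).
rewrite -[RHS](@integral_subl2 R x)//; first by apply/measurable_EFinP; exact: measurable_indic.
Qed.

Lemma lam2_subr (x : T2) (A : set T2) : measurable A ->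
  lam2 R [set y | A (sub2 y x)] = lam2 R A.
Proof.
move=> mA.
have mB : measurable [set y | A (sub2 y x)].
  have h : measurable_fun [set: T2] (sub2^~ x).
    exact: (measurableT_comp measurable_sub2 (measurable_pair2 x)).
  by rewrite -[X in measurable X]setTI; exact: h.
rewrite (measure_indic _ mB) (measure_indic _ mA).
rewrite -[RHS](@integral_sub2 R x)//; first by apply/measurable_EFinP; exact: measurable_indic.
Qed.

Variables (S : T2 -> R) (A : set T2) (E : set T3).
Hypotheses (mS : measurable_fun [set: T2] S) (mA : measurable A) (mE : measurable E).

(** The section at [x] consists of the base points [y = x.1 - t] instead of the parameters [t]. For
    fixed [y] only the slice of [E] over [y] matters, which is what the integrations in [x] need. *)
Definition hits : set (T3 * T2)%type :=
  [set p | A (sub2 p.1.1 p.2) /\ E (p.2, (p.1.2 - S (sub2 p.1.1 p.2))%R)].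

Definition avg (x : T3) : \bar R := lam2 R (xsection hits x).

Lemma measurable_shift_arg : measurable_fun [set: (T3 * T2)%type]
  (fun p : (T3 * T2)%type => sub2 p.1.1 p.2).
Proof.
have h : measurable_fun [set: (T3 * T2)%type] (fun p : (T3 * T2)%type => (p.1.1, p.2) : (T2 * T2)%type).
  apply: measurable_fun_pair; last exact: measurable_snd.
  exact: (measurableT_comp measurable_fst measurable_fst).
exact: (measurableT_comp measurable_sub2 h).
Qed.

Lemma measurable_hits : measurable hits.
Proof.
have -> : hits = (fun p : (T3 * T2)%type => sub2 p.1.1 p.2) @^-1` A `&`
   (fun p : (T3 * T2)%type => (p.2, (p.1.2 - S (sub2 p.1.1 p.2))%R) : T3) @^-1` E by [].
apply: measurableI; rewrite -[X in measurable X]setTI.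
  exact: measurable_shift_arg.
have h : measurable_fun [set: (T3 * T2)%type]
    (fun p : (T3 * T2)%type => (p.2, (p.1.2 - S (sub2 p.1.1 p.2))%R) : T3).
  apply: measurable_fun_pair; first exact: measurable_snd.
  apply: measurable_funB.
    exact: (measurableT_comp measurable_snd measurable_fst).
  exact: (measurableT_comp mS measurable_shift_arg).
exact: h.
Qed.

Lemma measurable_avg : measurable_fun [set: T3] avg.
Proof. by apply: measurable_fun_xsection; exact: measurable_hits. Qed.

Lemma avg_ge0 x : 0 <= avg x. Proof. by []. Qed.

Lemma avg_le x : avg x <= lam2 R A.
Proof.
rewrite -(lam2_subl x.1 mA); apply: le_measure; rewrite ?inE.
- exact: measurable_xsection measurable_hits.
- have h : measurable_fun [set: T2] (sub2 x.1).
    exact: (measurableT_comp measurable_sub2 (measurable_pair1 _)).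
  by rewrite -[X in measurable X]setTI; exact: h.
- by move=> y /xsectionP[].
Qed.

Lemma leb_subr (c : R) (V : set mR) : measurable V -> leb [set x | V (x - c)%R] = leb V.
Proof. by move=> mV; rewrite -[RHS](leb_addr (- c)%R mV). Qed.

Lemma measurable_slice : measurable_fun [set: T2] (fun y : T2 => leb (xsection E y)).
Proof. exact: measurable_fun_xsection. Qed.

(** For fixed [y] and first coordinates, the last coordinate runs over a translate of the slice of
    [E] over [y]. *)
Lemma integral_avg : \int[lam3 R]_x avg x = lam2 R A * lam3 R E.
Proof.
have mH := measurable_hits.
have mI : measurable_fun [set: (T3 * T2)%type] (fun p : (T3 * T2)%type => (\1_hits p)%:E : \bar R).
  by apply/measurable_EFinP; exact: measurable_indic.
transitivity (\int[lam3 R]_x \int[lam2 R]_y (\1_hits (x, y))%:E).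
  apply: eq_integral => x _; rewrite /avg measure_indic; last exact: measurable_xsection.
  apply: eq_integral => y _; rewrite !indicE; congr (nat_of_bool _)%:R%:E.
  by rewrite mem_xsection.
rewrite (fubini_tonelli (fun p : (T3 * T2)%type => (\1_hits p)%:E))//.
transitivity (\int[lam2 R]_y (lam2 R A * leb (xsection E y))); last first.
  rewrite ge0_integralZl//; exact: measurable_slice.
apply: eq_integral => y _.
have mIy : measurable_fun [set: T3] (fun x : T3 => (\1_hits (x, y))%:E : \bar R).
  exact: (measurableT_comp mI (measurable_pair2 y)).
rewrite [LHS](fubini_tonelli1 _ mIy)//= /fubini_F/=.
have mAy : measurable [set x : T2 | A (sub2 x y)].
  have h : measurable_fun [set: T2] (sub2^~ y).
    exact: (measurableT_comp measurable_sub2 (measurable_pair2 y)).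
  by rewrite -[X in measurable X]setTI; exact: h.
transitivity (\int[lam2 R]_x' ((\1_[set x : T2 | A (sub2 x y)] x')%:E * leb (xsection E y))).
  apply: eq_integral => x' _; rewrite indicE; have [|/negP] := boolP (x' \in _); rewrite inE/= => Ax.
    rewrite mul1e -(leb_subr (S (sub2 x' y)) (measurable_xsection y mE)).
    rewrite [RHS]measure_indic; last first.
      rewrite -[X in measurable X]setTI.
      exact: (measurable_addr (- S (sub2 x' y))%R measurableT (measurable_xsection y mE)).
    apply: eq_integral => z _; rewrite !indicE; congr (nat_of_bool _)%:R%:E.
    apply/idP/idP; rewrite !inE/=; first by move=> [_ h]; apply/xsectionP.
    by move=> /xsectionP h; split.
  rewrite mul0e integral0_eq// => z _; rewrite indicE memNset// => -[/= Axy _].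
  exact: Ax.
rewrite ge0_integralZr//; last by apply/measurable_EFinP; exact: measurable_indic.
by congr (_ * _)%E; rewrite -(measure_indic (lam2 R) mAy); exact: lam2_subr.
Qed.

End hits.

(** * Integrals over triples of points *)

Section triple.
Context {d : measure_display} {Y : measurableType d} {R : realType}.
Variable mu : {sigma_finite_measure set Y -> \bar R}.
Local Open Scope ereal_scope.

Definition mu3 : {sigma_finite_measure set (Y * Y * Y)%type -> \bar R} := sprodm (sprodm mu mu) mu.

Lemma triple_tonelli (f : (Y * Y * Y)%type -> \bar R) : measurable_fun setT f -> (forall z, 0 <= f z) ->
  \int[mu3]_z f z = \int[mu]_x \int[mu]_y \int[mu]_w f (x, y, w).
Proof.
move=> mf f0; rewrite [LHS]fubini_tonelli1// [LHS]fubini_tonelli1//.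
  exact: measurable_fun_fubini_tonelli_F.
by move=> z; apply: integral_ge0.
Qed.

Lemma triple_product (e : Y -> \bar R) : measurable_fun setT e -> (forall y, 0 <= e y) ->
  \int[mu3]_z (e z.1.1 * e z.1.2 * e z.2) = \int[mu]_y e y * \int[mu]_y e y * \int[mu]_y e y.
Proof.
move=> me e0; rewrite triple_tonelli//=; last 2 first.
- apply: emeasurable_funM; first apply: emeasurable_funM.
  + exact: (measurableT_comp me (measurableT_comp measurable_fst measurable_fst)).
  + exact: (measurableT_comp me (measurableT_comp measurable_snd measurable_fst)).
  + exact: (measurableT_comp me measurable_snd).
- by move=> z; rewrite !mule_ge0.
have I0 : 0 <= \int[mu]_y e y by exact: integral_ge0.
under eq_integral => x _.
  under eq_integral => y _ do rewrite ge0_integralZl ?mule_ge0//.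
  rewrite ge0_integralZr//; last 2 first.
  - by apply: emeasurable_funM.
  - by move=> y _; rewrite mule_ge0.
  rewrite ge0_integralZl//.
  over.
rewrite ge0_integralZr//; last 2 first.
- by apply: emeasurable_funM.
- by move=> y _; rewrite mule_ge0.
by rewrite ge0_integralZr.
Qed.

End triple.

(** * The quartic estimate, from strips and triangles *)

Section quartic.
Variable R : realType.
Local Notation leb := (@lebesgue_measure R).
Local Notation mR := (measurableTypeR R).
Local Notation T2 := (TR2 R).
Local Notation T3 := (TR3 R).
Variables (S S1 S2 : T2 -> R) (A : set T2) (E : set T3).
Hypotheses (mS : measurable_fun [set: T2] S) (mS1 : measurable_fun [set: T2] S1).
Hypotheses (mS2 : measurable_fun [set: T2] S2).
Hypotheses (mA : measurable A) (mE : measurable E).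
Variables (kap M rho lam Mt : R).
Hypotheses (kap0 : 0 < kap) (M0 : 0 < M) (rho0 : 0 < rho) (lam0 : 0 < lam) (Mt0 : 0 <= Mt).
Hypothesis rholam : rho <= lam / (64 * kap).
Hypothesis Afin : (lam2 R A < +oo)%E.
Hypotheses (hS1 : forall s, A s -> `|S1 s| <= M) (hS2 : forall s, A s -> `|S2 s| <= M).

(** The determinant with rows [(S1 si, S2 si, 1)], up to sign that of three normals of the graph;
    also twice the signed area of the triangle of the three gradients. *)
Definition tri (s0 s1 s2 : T2) : R :=
  (S1 s1 - S1 s0) * (S2 s2 - S2 s0) - (S2 s1 - S2 s0) * (S1 s2 - S1 s0).

Hypothesis strip : forall p1 p2 c s X Y : R, c ^+ 2 + s ^+ 2 = 1 -> 0 < X -> 0 < Y ->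
  (lam2 R (A `&` [set t | (`|c * (S1 t - p1) + s * (S2 t - p2)| < X /\
     `|c * (S2 t - p2) - s * (S1 t - p1)| < Y)%R]) <= (kap * X * Y)%:E)%E.

(** Determinants below [rho] are cut off because the area inequality needs a lower bound on the
    Jacobian. *)
Definition kern (x : T3) (z : (T2 * T2 * T2)%type) : R :=
  let j := `|tri (sub2 x.1 z.1.1) (sub2 x.1 z.1.2) (sub2 x.1 z.2)| in
  j * (rho <= j)%R%:R.

Local Notation H := (hits S A E).
Local Notation e := (fun y : T2 => leb (xsection E y)).

Definition kern3 (p : (T3 * (T2 * T2 * T2))%type) : \bar R :=
  (kern p.1 p.2 * (\1_H (p.1, p.2.1.1) * \1_H (p.1, p.2.1.2) * \1_H (p.1, p.2.2)))%:E.

Hypothesis triangle : forall z,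
  (\int[lam3 R]_x kern3 (x, z) <= Mt%:E * (e z.1.1 * e z.1.2 * e z.2))%E.

Let a (x : T3) : R := fine (avg S A E x).

Let avgE x : avg S A E x = (a x)%:E.
Proof.
rewrite /a fineK// ge0_fin_numE ?avg_ge0//.
by apply: le_lt_trans Afin; exact: avg_le.
Qed.

Lemma kern_ge0 x z : 0 <= kern x z. Proof. by rewrite mulr_ge0. Qed.

Lemma kern3_ge0 p : (0 <= kern3 p)%E.
Proof. by rewrite lee_fin mulr_ge0 ?kern_ge0// !mulr_ge0. Qed.

Lemma measurable_kern3 : measurable_fun [set: (T3 * (T2 * T2 * T2))%type] kern3.
Proof.
pose P := (T3 * (T2 * T2 * T2))%type.
have mz0 : measurable_fun [set: P] (fun p : P => p.2.1.1 : T2).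
  exact: (measurableT_comp measurable_fst (measurableT_comp measurable_fst measurable_snd)).
have mz1 : measurable_fun [set: P] (fun p : P => p.2.1.2 : T2).
  exact: (measurableT_comp measurable_snd (measurableT_comp measurable_fst measurable_snd)).
have mz2 : measurable_fun [set: P] (fun p : P => p.2.2 : T2).
  exact: (measurableT_comp measurable_snd measurable_snd).
have mx : measurable_fun [set: P] (fun p : P => p.1.1 : T2).
  exact: (measurableT_comp measurable_fst measurable_fst).
have ms (f : P -> T2) (F : T2 -> R) : measurable_fun [set: P] f -> measurable_fun [set: T2] F ->
    measurable_fun [set: P] (fun p : P => F (sub2 p.1.1 (f p))).
  move=> mf mF.
  have h : measurable_fun [set: P] (fun p : P => (p.1.1, f p) : (T2 * T2)%type).
    exact: measurable_fun_pair.
  exact: (measurableT_comp mF (measurableT_comp (@measurable_sub2 R) h)).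
have mj : measurable_fun [set: P] (fun p : P => `|tri (sub2 p.1.1 p.2.1.1) (sub2 p.1.1 p.2.1.2) (sub2 p.1.1 p.2.2)|).
  apply: measurableT_comp => //.
  by apply: measurable_funB; apply: measurable_funM; apply: measurable_funB; apply: ms.
have mI (f : P -> T2) : measurable_fun [set: P] f -> measurable_fun [set: P] (fun p : P => \1_H (p.1, f p) : R).
  move=> mf.
  have h : measurable_fun [set: P] (fun p : P => (p.1, f p) : (T3 * T2)%type).
    by apply: measurable_fun_pair.
  have mH : measurable H by exact: measurable_hits.
  rewrite (_ : (fun p : P => _) = \1_((fun p : P => (p.1, f p) : (T3 * T2)%type) @^-1` H)).
    by apply: measurable_indic; rewrite -[X in measurable X]setTI; exact: h.
  by apply/funext => p; rewrite !indicE.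
apply/measurable_EFinP; apply: measurable_funM.
  apply: measurable_funM => //.
  pose W := [set p : P | rho <= `|tri (sub2 p.1.1 p.2.1.1) (sub2 p.1.1 p.2.1.2) (sub2 p.1.1 p.2.2)|].
  have mW : measurable W.
    by rewrite -[X in measurable X]setTI; exact: (measurable_fun_ler (measurable_cst rho) mj).
  rewrite [X in measurable_fun _ X](_ : _ = \1_W); first exact: measurable_indic.
  by apply/funext => p; rewrite indicE; congr (nat_of_bool _)%:R; rewrite mem_setE.
by apply: measurable_funM; [apply: measurable_funM|]; exact: mI.
Qed.

Let restrict_le (Om : set T2) (g h : T2 -> \bar R) : (forall y, Om y -> 0 <= g y <= h y)%E ->
  (forall y, 0 <= h y)%E -> (\int[lam2 R]_(y in Om) g y <= \int[lam2 R]_y h y)%E.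
Proof.
move=> gh h0; rewrite integral_mkcond; apply: ge0_integral_mono => y _; rewrite /patch.
  by case: ifPn => // /[!inE] /gh/andP[].
by case: ifPn => // /[!inE] /gh/andP[].
Qed.

(** For each [y0] in the section, the gradients taken relative to the one at [y0] satisfy the strip
    hypothesis, which is uniform in the centre [(p1, p2)]. The determinant integral contributes
    [u^3 / (128 kap)] and [y0] ranges over a set of measure [u]. *)
Lemma quartic_lower x : lam <= a x ->
  ((a x ^+ 4 / (128 * kap))%:E <= \int[mu3 (lam2 R)]_z kern3 (x, z))%E.
Proof.
have [k0 r0 l0] := And3 kap0 rho0 lam0.
move=> lx; set u := a x; have u0 : 0 < u by apply: lt_le_trans lx.
pose Om := xsection H x.
have mH : measurable H by exact: measurable_hits.
have mOm : measurable Om by exact: measurable_xsection.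
have Omu : lam2 R Om = u%:E by exact: avgE.
have mk3 : measurable_fun [set: (T2 * T2 * T2)%type] (fun z => kern3 (x, z)).
  exact: (measurableT_comp measurable_kern3 (measurable_pair1 x)).
rewrite triple_tonelli//; last by move=> z; exact: kern3_ge0.
have rl : rho <= u / (64 * kap).
  by apply: le_trans rholam _; rewrite ler_wpM2r ?invr_ge0 ?mulr_ge0 ?(ltW k0).
have msub : measurable_fun [set: T2] (fun y => sub2 x.1 y).
  exact: (measurableT_comp (@measurable_sub2 R) (measurable_pair1 _)).
have OmA y : Om y -> A (sub2 x.1 y) by move=> /xsectionP[].
apply: (@le_trans _ _ (\int[lam2 R]_(y0 in Om) (u ^+ 3 / (128 * kap))%:E)%E).
  have -> : (\int[lam2 R]_(y0 in Om) (u ^+ 3 / (128 * kap))%:E = (u ^+ 3 / (128 * kap))%:E * u%:E)%E.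
    by rewrite -Omu; exact: (integral_cst (lam2 R) mOm).
  rewrite -EFinM lee_fin le_eqVlt; apply/orP; left; apply/eqP.
  by field; rewrite gt_eqF.
have kE y0 y1 y2 : Om y0 -> Om y1 -> Om y2 -> kern3 (x, (y0, y1, y2)) = (kern x (y0, y1, y2))%:E.
  by move=> h0 h1 h2; rewrite /kern3/= !indicE !mem_set ?mulr1//; apply/xsectionP.
apply: restrict_le => [y0 Oy0|y0]; last first.
  by apply: integral_ge0 => y1 _; apply: integral_ge0 => y2 _; exact: kern3_ge0.
rewrite lee_fin divr_ge0 ?exprn_ge0 ?mulr_ge0 ?(ltW u0) ?(ltW k0)//=.
set s0 := sub2 x.1 y0.
have M20 : 0 < 2 * M by have := M0; lra.
have bd (F : T2 -> R) : (forall s, A s -> `|F s| <= M) -> forall y, Om y -> `|F (sub2 x.1 y) - F s0| <= 2 * M.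
  move=> hF y Oy; apply: le_trans (ler_normB _ _) _.
  by have := hF _ (OmA _ Oy); have := hF _ (OmA _ Oy0); lra.
have mv (F : T2 -> R) : measurable_fun [set: T2] F -> measurable_fun [set: T2] (fun y => F (sub2 x.1 y) - F s0).
  by move=> mF; apply: measurable_funB => //; exact: (measurableT_comp mF msub).
have strip' (c s X Y : R) : c ^+ 2 + s ^+ 2 = 1 -> 0 < X -> 0 < Y ->
  (lam2 R (Om `&` [set y | (`|c * (S1 (sub2 x.1 y) - S1 s0) + s * (S2 (sub2 x.1 y) - S2 s0)| < X /\
     `|c * (S2 (sub2 x.1 y) - S2 s0) - s * (S1 (sub2 x.1 y) - S1 s0)| < Y)%R]) <= (kap * X * Y)%:E)%E.
  move=> cs X0 Y0; apply: le_trans (strip (S1 s0) (S2 s0) cs X0 Y0).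
  set A' := A `&` _.
  have mA' : measurable A'.
    have mm (f g : T2 -> R) (b b' : R) : measurable_fun [set: T2] f -> measurable_fun [set: T2] g ->
        measurable_fun [set: T2] (fun t => `|b * f t + b' * g t|).
      by move=> mf mg; apply: measurableT_comp => //; apply: measurable_funD; apply: measurable_funM.
    have m1 : measurable_fun [set: T2] (fun t => S1 t - S1 s0) by apply: measurable_funB.
    have m2 : measurable_fun [set: T2] (fun t => S2 t - S2 s0) by apply: measurable_funB.
    apply: measurableI => //; apply: measurableI; rewrite -[X in measurable X]setTI.
      exact: (measurable_fun_ltr (mm _ _ c s m1 m2) (measurable_cst X)).
    have := (measurable_fun_ltr (mm _ _ c (- s) m2 m1) (measurable_cst Y)).
    by under eq_fun do rewrite mulNr; apply.
  rewrite (_ : Om `&` _ = Om `&` [set y | A' (sub2 x.1 y)]); last first.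
    by apply/seteqP; split => y [Oy]; [move=> h; split => //; split => //; exact: OmA|move=> [_ h]].
  have mB : measurable [set y | A' (sub2 x.1 y)] by rewrite -[X in measurable X]setTI; exact: msub.
  rewrite -(lam2_subl x.1 mA'); apply: le_measure; rewrite ?inE//.
  exact: measurableI.
have := @det_integral_ge _ T2 R (lam2 R) Om u (2 * M) kap
  (fun y => S1 (sub2 x.1 y) - S1 s0) (fun y => S2 (sub2 x.1 y) - S2 s0)
  mOm Omu u0 (mv _ mS1) (mv _ mS2) (bd _ hS1) (bd _ hS2) M20 kap0 strip' rho (ltW rho0) rl.
move/le_trans; apply.
apply: restrict_le => [y1 Oy1|y1]; last by apply: integral_ge0 => y2 _; exact: kern3_ge0.
apply/andP; split; first by apply: integral_ge0 => y2 _; rewrite lee_fin mulr_ge0.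
apply: restrict_le => [y2 Oy2|y2]; last exact: kern3_ge0.
by rewrite lee_fin mulr_ge0//= kE// lee_fin /kern/= /tri.
Qed.

(** After integration in [x] and an exchange of integrals, the triangle hypothesis applies to each
    triple and the slices integrate to the measure of [E]. The restriction [lam <= a x] makes the
    cut-off [rho] admissible. *)
Lemma quartic_scheme : (\int[lam3 R]_(x in [set x | (lam <= a x)%R]) (a x ^+ 4)%:E <=
  (128 * kap * Mt)%:E * (lam3 R E * lam3 R E * lam3 R E))%E.
Proof.
have [k0 r0 l0] := And3 kap0 rho0 lam0.
have k1 : 0 <= 128 * kap by rewrite mulr_ge0// ltW.
pose L (x : T3) := (\int[mu3 (lam2 R)]_z kern3 (x, z))%E.
have L0 x : (0 <= L x)%E by apply: integral_ge0 => z _; exact: kern3_ge0.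
have mL : measurable_fun [set: T3] L.
  apply: measurable_fun_fubini_tonelli_F; first exact: measurable_kern3.
  by move=> p; exact: kern3_ge0.
apply: (@le_trans _ _ (\int[lam3 R]_x ((128 * kap)%:E * L x))%E).
  rewrite integral_mkcond; apply: ge0_integral_mono => x _; rewrite /patch.
    by case: ifPn => // _; rewrite lee_fin exprn_ge0// fine_ge0// avg_ge0.
  case: ifPn => [/[!inE]/= lx|_]; last by rewrite mule_ge0.
  have h := lee_wpmul2l _ (quartic_lower lx).
  apply: le_trans (h (128 * kap)%:E _); last by rewrite lee_fin.
  by rewrite -EFinM lee_fin mulrCA divff ?mulr1// gt_eqF// mulr_gt0.
rewrite ge0_integralZl// [(128 * kap * Mt)%:E]EFinM -muleA; apply: lee_wpmul2l; first by rewrite lee_fin.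
rewrite /L (fubini_tonelli kern3 measurable_kern3 kern3_ge0).
have me : measurable_fun [set: T2] e by exact: measurable_slice.
have -> : (lam3 R E = \int[lam2 R]_y e y)%E by [].
rewrite -triple_product// -ge0_integralZl//; last 2 first.
- apply: emeasurable_funM; first apply: emeasurable_funM.
  + exact: (measurableT_comp me (measurableT_comp measurable_fst measurable_fst)).
  + exact: (measurableT_comp me (measurableT_comp measurable_snd measurable_fst)).
  + exact: (measurableT_comp me measurable_snd).
- by move=> z _; rewrite !mule_ge0.
apply: ge0_integral_mono => z _; last exact: triangle.
by apply: integral_ge0 => x _; exact: kern3_ge0.
Qed.

End quartic.

(** * Linear combinations and translates of tame functions *)

Section tame_closure.
Variable R : realType.
Implicit Types (s t y : R * R) (F G : R * R -> R) (D : set (R * R)).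

Lemma C11_lin (Gam : R) D F F1 F2 G G1 G2 (c s k : R) : `|c| <= 1 -> `|s| <= 1 ->
  C11 Gam D F F1 F2 -> C11 Gam D G G1 G2 ->
  C11 (2 * Gam) D (fun t => c * F t + s * G t + k) (fun t => c * F1 t + s * G1 t)
    (fun t => c * F2 t + s * G2 t).
Proof.
move=> hc hs hF hG u t Du Dt.
have [f1 f2 f3 f4 f5] := hF _ _ Du Dt; have [g1 g2 g3 g4 g5] := hG _ _ Du Dt.
have cmb (x y b : R) : `|x| <= b -> `|y| <= b -> `|c * x + s * y| <= 2 * b.
  move=> hx hy; apply: le_trans (ler_normD _ _) _; rewrite !normrM.
  have := ler_pM (normr_ge0 _) (normr_ge0 _) hc hx.
  have := ler_pM (normr_ge0 _) (normr_ge0 _) hs hy.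
  by rewrite !mul1r; lra.
split; rewrite -?mulrA.
- rewrite (_ : _ - _ = c * (F u - F t - (F1 t * (u.1 - t.1) + F2 t * (u.2 - t.2))) +
    s * (G u - G t - (G1 t * (u.1 - t.1) + G2 t * (u.2 - t.2)))); last by ring.
  exact: cmb.
- rewrite (_ : _ - _ = c * (F1 u - F1 t) + s * (G1 u - G1 t)); last by ring.
  exact: cmb.
- rewrite (_ : _ - _ = c * (F2 u - F2 t) + s * (G2 u - G2 t)); last by ring.
  exact: cmb.
- exact: cmb.
- exact: cmb.
Qed.

Lemma tame_lin (Gam : R) D F F1 F2 G G1 G2 (c s k : R) : `|c| <= 1 -> `|s| <= 1 ->
  tame Gam D F F1 F2 -> tame Gam D G G1 G2 ->
  tame (2 * Gam) D (fun t => c * F t + s * G t + k) (fun t => c * F1 t + s * G1 t)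
    (fun t => c * F2 t + s * G2 t).
Proof.
move=> hc hs [hF aF] [hG aG]; split; first exact: C11_lin.
move=> n; have [P [P1 [P2 [Pn hP dP]]]] := aF n; have [Q [Q1 [Q2 [Qn hQ dQ]]]] := aG n.
exists (fun t => c * P t + s * Q t + k), (fun t => c * P1 t + s * Q1 t), (fun t => c * P2 t + s * Q2 t).
have cmb (x y b : R) : `|x| <= b -> `|y| <= b -> `|c * x + s * y| <= 2 * b.
  move=> hx hy; apply: le_trans (ler_normD _ _) _; rewrite !normrM.
  have := ler_pM (normr_ge0 _) (normr_ge0 _) hc hx.
  have := ler_pM (normr_ge0 _) (normr_ge0 _) hs hy.
  by rewrite !mul1r; lra.
split; last 1 first.
- move=> t Dt; have [p0 p1 p2] := dP _ Dt; have [q0 q1 q2] := dQ _ Dt; rewrite -!mulrA; split.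
  + rewrite (_ : _ - _ = c * (F t - P t) + s * (G t - Q t)); last by ring.
    exact: cmb.
  + rewrite (_ : _ - _ = c * (F1 t - P1 t) + s * (G1 t - Q1 t)); last by ring.
    exact: cmb.
  + rewrite (_ : _ - _ = c * (F2 t - P2 t) + s * (G2 t - Q2 t)); last by ring.
    exact: cmb.
- by apply: polyf_add; [apply: polyf_add; apply: polyf_scale|exact: polyf_cst].
- exact: C11_lin.
Qed.

Lemma tame_shift (Gam : R) D F F1 F2 y : tame Gam D F F1 F2 ->
  tame Gam [set t | D (t - y)] (fun t => F (t - y)) (fun t => F1 (t - y)) (fun t => F2 (t - y)).
Proof.
have sh P P1 P2 : C11 Gam D P P1 P2 ->
    C11 Gam [set t | D (t - y)] (fun t => P (t - y)) (fun t => P1 (t - y)) (fun t => P2 (t - y)).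
  move=> h s t Ds Dt; have := h _ _ Ds Dt.
  have -> : s - y - (t - y) = s - t by rewrite opprB addrA subrK.
  have e1 : (s - y).1 - (t - y).1 = s.1 - t.1 by rewrite /=; ring.
  have e2 : (s - y).2 - (t - y).2 = s.2 - t.2 by rewrite /=; ring.
  by rewrite e1 e2.
move=> [hF aF]; split; first exact: sh.
move=> n; have [P [P1 [P2 [Pn hP dP]]]] := aF n.
exists (fun t => P (t - y)), (fun t => P1 (t - y)), (fun t => P2 (t - y)); split.
- exact: polyf_shift.
- exact: sh.
- by move=> t; exact: dP.
Qed.

Lemma tame_subdomain (Gam : R) D D' F F1 F2 : D' `<=` D -> tame Gam D F F1 F2 -> tame Gam D' F F1 F2.
Proof.
move=> DD [hF aF]; split; first by move=> s t Ds Dt; apply: hF; exact: DD.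
move=> n; have [P [P1 [P2 [Pn hP dP]]]] := aF n; exists P, P1, P2; split => //.
- by move=> s t Ds Dt; apply: hP; exact: DD.
- by move=> t /DD; exact: dP.
Qed.

End tame_closure.

(** * The quartic estimate for analytic graphs *)

Section quartic_bound.
Variable R : realType.
Local Notation leb := (@lebesgue_measure R).
Local Notation mR := (measurableTypeR R).
Local Notation T2 := (TR2 R).
Local Notation T3 := (TR3 R).
Variables (Gam b : R) (D : set (R * R)) (S S1 S2 S11 S12 S21 S22 : R * R -> R).
Hypotheses (Gam1 : 1 <= Gam) (hb : forall t, D t -> n1 t <= b).
Hypotheses (tS : tame Gam D S S1 S2) (tS1 : tame Gam D S1 S11 S12) (tS2 : tame Gam D S2 S21 S22).
Hypotheses (mS : measurable_fun [set: T2] S) (mS1 : measurable_fun [set: T2] S1)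
  (mS2 : measurable_fun [set: T2] S2) (mS11 : measurable_fun [set: T2] S11)
  (mS12 : measurable_fun [set: T2] S12) (mS21 : measurable_fun [set: T2] S21)
  (mS22 : measurable_fun [set: T2] S22).
Variable A0 : set (R * R).
Hypothesis hA0 : forall t s, A0 t -> n1 (s - t) <= (160 * (2 * Gam) ^+ 2)^-1 -> D s.
Local Notation H := (jac S11 S12 S21 S22).

Let Gam2 : 1 <= 2 * Gam. Proof. by have := Gam1; lra. Qed.

Let A0D t : A0 t -> D t.
Proof.
move=> At; apply: (hA0 At); rewrite subrr /n1 !normr0 addr0 invr_ge0.
by rewrite mulr_ge0// sqr_ge0.
Qed.

(** The gradient rotated by [(c, s)] still has Jacobian [H]. The area inequality bounds the integral
    of [|H|] over the strip by about [del^-e X Y], and division by [del <= |H|] gives the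
    measure. *)
Lemma strip_bound (e : R) : 0 < e -> exists2 C : R, 1 <= C &
  forall (del : R) (A : set T2), 0 < del -> del <= 1 -> measurable A -> A `<=` A0 ->
  (forall t, A t -> del <= `|H t|) ->
  forall p1 p2 c s X Y : R, c ^+ 2 + s ^+ 2 = 1 -> 0 < X -> 0 < Y ->
  (lam2 R (A `&` [set t | (`|c * (S1 t - p1) + s * (S2 t - p2)| < X /\
     `|c * (S2 t - p2) - s * (S1 t - p1)| < Y)%R]) <= (C * del `^ (- (1 + e)) * X * Y)%:E)%E.
Proof.
move=> e0; have [C C0 hC] := area_eps Gam2 e0.
exists (4 * C + 1); first by lra.
move=> del A del0 del1 mA AA0 hH p1 p2 c s X Y cs X0 Y0.
pose F t := c * S1 t + s * S2 t + (- (c * p1 + s * p2)).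
pose F1 t := c * S11 t + s * S21 t; pose F2 t := c * S12 t + s * S22 t.
pose G t := c * S2 t + (- s) * S1 t + (- (c * p2 - s * p1)).
pose G1 t := c * S21 t + (- s) * S11 t; pose G2 t := c * S22 t + (- s) * S12 t.
have c1 : `|c| <= 1.
  by rewrite -[leRHS]normr1 -ler_sqr ?nnegrE// !real_normK ?num_real//; have := sqr_ge0 s; lra.
have s1 : `|s| <= 1.
  by rewrite -[leRHS]normr1 -ler_sqr ?nnegrE// !real_normK ?num_real//; have := sqr_ge0 c; lra.
have s1' : `|- s| <= 1 by rewrite normrN.
have tF : tame (2 * Gam) D F F1 F2 by exact: tame_lin.
have tG : tame (2 * Gam) D G G1 G2 by exact: tame_lin.
have JE t : jac F1 F2 G1 G2 t = H t.
  rewrite /jac /F1 /F2 /G1 /G2.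
  rewrite (_ : _ - _ = (c ^+ 2 + s ^+ 2) * (S11 t * S22 t - S12 t * S21 t)); last by ring.
  by rewrite cs mul1r.
have mlin (f g : T2 -> R) (u v w : R) : measurable_fun [set: T2] f -> measurable_fun [set: T2] g ->
    measurable_fun [set: T2] (fun t => u * f t + v * g t + w).
  by move=> mf mg; apply: measurable_funD => //; apply: measurable_funD; apply: measurable_funM.
have mF : measurable_fun [set: T2] F by exact: mlin.
have mG : measurable_fun [set: T2] G by exact: mlin.
have mJ : measurable_fun [set: T2] (jac F1 F2 G1 G2).
  have -> : jac F1 F2 G1 G2 = fun t => S11 t * S22 t - S12 t * S21 t.
    by apply/funext => t; rewrite JE.
  by apply: measurable_funB; apply: measurable_funM.
set B := A `&` _.
have BE : B = A `&` ([set t | `|F t| < X] `&` [set t | `|G t| < Y]).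
  apply/seteqP; split => t [At] /= [h1 h2]; split => //; split => /=.
  - by move: h1; rewrite /F (_ : _ + _ + _ = c * (S1 t - p1) + s * (S2 t - p2))//; ring.
  - by move: h2; rewrite /G (_ : _ + _ + _ = c * (S2 t - p2) - s * (S1 t - p1))//; ring.
  - by move: h1; rewrite /F (_ : _ + _ + _ = c * (S1 t - p1) + s * (S2 t - p2))//; ring.
  - by move: h2; rewrite /G (_ : _ + _ + _ = c * (S2 t - p2) - s * (S1 t - p1))//; ring.
have mB : measurable (B : set T2).
  rewrite BE; apply: measurableI => //; apply: measurableI; rewrite -[X in measurable X]setTI.
    by apply: measurable_fun_ltr => //; apply: measurableT_comp.
  by apply: measurable_fun_ltr => //; apply: measurableT_comp.
have := hC b D F F1 F2 G G1 G2 del B `](- X), X[%classic `](- Y), Y[%classic hb tF tG del0 del1.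
move=> /(_ (interval_open _ _) (interval_open _ _) mB mF mG mJ).
move=> /(_ isT isT isT isT (fun t s Bt => hA0 (AA0 _ Bt.1))).
have hJB t : B t -> del <= `|jac F1 F2 G1 G2 t| by move=> [At _]; rewrite JE; exact: hH.
move=> /(_ hJB).
have hFB t : B t -> `](- X), X[%classic (F t).
  by rewrite BE => -[_ [h _]] /=; rewrite in_itv/= -ltr_norml.
have hGB t : B t -> `](- Y), Y[%classic (G t).
  by rewrite BE => -[_ [_ h]] /=; rewrite in_itv/= -ltr_norml.
move=> /(_ hFB hGB).
rewrite !lebesgue_measure_itv/= !lte_fin !ifT; [|lra|lra].
rewrite -!EFinB -!EFinM => hI.
have lB : (del%:E * lam2 R B <= \int[lam2 R]_(t in B) `|jac F1 F2 G1 G2 t|%:E)%E.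
  rewrite -(integral_cst (lam2 R) mB); apply: ge0_integral_mono => t Bt /=; rewrite lee_fin ?(ltW del0)//.
  exact: hJB.
have := le_trans lB hI; rewrite -(@lee_pmul2l _ del^-1%:E)//; last by rewrite lte_fin invr_gt0.
rewrite muleA -EFinM mulVf ?gt_eqF// mul1e => h; apply: le_trans h _.
rewrite -EFinM lee_fin.
have -> : del `^ (- (1 + e)) = del^-1 * del `^ (- e).
  by rewrite opprD powRD ?(gt_eqF del0) ?implybT// powR_inv1// ltW.
have d0 : 0 <= del^-1 * del `^ (- e) * (X * Y).
  by rewrite !mulr_ge0 ?powR_ge0 ?invr_ge0 ?(ltW del0) ?(ltW X0) ?(ltW Y0).
rewrite [leLHS](_ : _ = 4 * C * (del^-1 * del `^ (- e) * (X * Y))); last by ring.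
rewrite (_ : (4 * C + 1) * _ * X * Y = 4 * C * (del^-1 * del `^ (- e) * (X * Y)) + del^-1 * del `^ (- e) * (X * Y)); last by ring.
by rewrite lerDl.
Qed.

(** The substitution [x3 = w + S (x' - z0)] turns the first hit into [w] lying in the slice over
    [z0], and the two others into [F x' + w] and [G x' + w] lying in the slices over [z1] and [z2].
    For fixed [w] the map [(F, G)] has Jacobian [tri], so the area inequality applies with
    translated slices as targets; this is where open slices are used. *)
Lemma triangle_bound (e : R) : 0 < e -> exists2 C : R, 0 < C &
  forall (rho : R) (A : set T2) (E : set T3), 0 < rho -> rho <= 1 -> measurable A -> A `<=` A0 ->
  measurable E -> (forall y : T2, open (xsection E y : set R)) ->
  forall z, (\int[lam3 R]_x kern3 S S1 S2 A E rho (x, z) <=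
    (C * rho `^ (- e))%:E * (leb (xsection E z.1.1) * leb (xsection E z.1.2) * leb (xsection E z.2)))%E.
Proof.
move=> e0; have [C C0 hC] := area_eps Gam2 e0; exists C => //.
move=> rho A E rho0 rho1 mA AA0 mE oE z.
set z0 := z.1.1; set z1 := z.1.2; set z2 := z.2.
have mk3 : measurable_fun [set: T3] (fun x : T3 => kern3 S S1 S2 A E rho (x, z)).
  exact: (measurableT_comp (measurable_kern3 mS mS1 mS2 mA mE rho) (measurable_pair2 z)).
have k0 x : (0 <= kern3 S S1 S2 A E rho (x, z))%E by exact: kern3_ge0.
rewrite [leLHS](fubini_tonelli1 _ mk3 k0) /fubini_F.
pose f2 (p : T3) : \bar R := kern3 S S1 S2 A E rho ((p.1, p.2 + S (sub2 p.1 z0)), z).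
have msub y : measurable_fun [set: T2] (fun x : T2 => sub2 x y).
  exact: (measurableT_comp (@measurable_sub2 R) (measurable_pair2 y)).
have mf2 : measurable_fun [set: T3] f2.
  have h : measurable_fun [set: T3] (fun p : T3 => (p.1, p.2 + S (sub2 p.1 z0)) : T3).
    apply: measurable_fun_pair; first exact: measurable_fst.
    apply: measurable_funD; first exact: measurable_snd.
    exact: (measurableT_comp mS (measurableT_comp (msub z0) measurable_fst)).
  exact: (measurableT_comp mk3 h).
have f20 p : (0 <= f2 p)%E by exact: k0.
have -> : (\int[lam2 R]_x' \int[leb]_x3 kern3 S S1 S2 A E rho ((x', x3), z) =
   \int[lam2 R]_x' \int[leb]_w f2 (x', w))%E.
  apply: eq_integral => x' _; rewrite -[LHS](@integral_addr R (S (sub2 x' z0)))//.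
  exact: (measurableT_comp mk3 (measurable_pair1 x')).
rewrite (fubini_tonelli f2 mf2 f20).
have m1 : measurable (xsection E z0) by exact: measurable_xsection.
have -> : (leb (xsection E z0) = \int[leb]_w (\1_(xsection E z0) w)%:E)%E by exact: measure_indic.
have cm (u v v1 v2 : \bar R) : (u * (v * v1 * v2) = v * (u * (v1 * v2)))%E.
  by rewrite !muleA (muleC u v).
rewrite cm -ge0_integralZr//; last 2 first.
- by apply/measurable_EFinP; exact: measurable_indic.
- by rewrite mule_ge0// ?mule_ge0// lee_fin mulr_ge0 ?powR_ge0// ltW.
apply: ge0_integral_mono => w _; first by apply: integral_ge0.
have hitE x' y v : hits S A E ((x', v), y) -> A (sub2 x' y) /\ xsection E y (v - S (sub2 x' y)).
  by move=> [h1 h2]; split => //; apply/xsectionP.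
rewrite indicE; have [|/negP] := boolP (w \in _); rewrite inE => Ew; last first.
  rewrite mul0e integral0_eq// => x' _; rewrite /f2 /kern3/= [X in _ * (X * _ * _)]indicE memNset ?mul0r ?mulr0//.
  by move=> /hitE[_]; rewrite addrK.
rewrite mul1e.
pose F x := S (x - z0) - S (x - z1); pose G x := S (x - z0) - S (x - z2).
pose F1 x := S1 (x - z0) - S1 (x - z1); pose F2 x := S2 (x - z0) - S2 (x - z1).
pose G1 x := S1 (x - z0) - S1 (x - z2); pose G2 x := S2 (x - z0) - S2 (x - z2).
pose D' : set (R * R) := [set x | [/\ D (x - z0), D (x - z1) & D (x - z2)]].
have JE x : jac F1 F2 G1 G2 x = tri S1 S2 (x - z0) (x - z1) (x - z2).
  by rewrite /jac /tri /F1 /F2 /G1 /G2; ring.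
have diff y1 : (forall x, D' x -> D (x - y1)) -> tame (2 * Gam) D' (fun x => S (x - z0) - S (x - y1))
    (fun x => S1 (x - z0) - S1 (x - y1)) (fun x => S2 (x - z0) - S2 (x - y1)).
  move=> hD; have t0 := tame_subdomain (D' := D') (fun x h => let: And3 a _ _ := h in a) (tame_shift z0 tS).
  have t1 := tame_subdomain (D' := D') hD (tame_shift y1 tS).
  have := tame_lin (c := 1) (s := -1) 0 _ _ t0 t1; rewrite normrN normr1 => /(_ (lexx _) (lexx _)).
  congr (tame _ _ _ _ _); apply/funext => x; ring.
have tF : tame (2 * Gam) D' F F1 F2 by apply: diff => x [].
have tG : tame (2 * Gam) D' G G1 G2 by apply: diff => x [].
(* The bound depends on [z0], but the constant of the area inequality does not depend on this
   bound. *)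
have bD' x : D' x -> n1 x <= b + n1 (z0 : R * R).
  by move=> [/hb h _ _]; have := n1D (x - z0) z0; rewrite subrK; lra.
have mm (f : T2 -> R) y : measurable_fun [set: T2] f -> measurable_fun [set: T2] (fun x : T2 => f (x - y)).
  by move=> mf; exact: (measurableT_comp mf (msub y)).
have mF : measurable_fun [set: T2] F by apply: measurable_funB; exact: mm.
have mG : measurable_fun [set: T2] G by apply: measurable_funB; exact: mm.
have mJ : measurable_fun [set: T2] (jac F1 F2 G1 G2).
  by apply: measurable_funB; apply: measurable_funM; apply: measurable_funB; exact: mm.
pose V1 : set R := [set v | xsection E z1 (v + w)]; pose V2 : set R := [set v | xsection E z2 (v + w)].
have oV y : open [set v : R | xsection E y (v + w)].
  apply: (@open_comp _ _ (fun v : R => v + w)); last exact: oE.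
  by move=> v _; apply: cvgD; [exact: cvg_id|exact: cvg_cst].
have lV y : leb [set v : R | xsection E y (v + w)] = leb (xsection E y).
  by apply: leb_addr; exact: measurable_xsection.
pose B : set T2 := [set x | [/\ A (x - z0), A (x - z1) & A (x - z2)] /\
   [/\ rho <= `|jac F1 F2 G1 G2 x|, V1 (F x) & V2 (G x)]].
have mpre (y : T2) : measurable [set x : T2 | A (x - y)].
  by rewrite -[X in measurable X]setTI; exact: (msub y).
have mB : measurable B.
  have -> : B = ([set x : T2 | A (x - z0)] `&` ([set x : T2 | A (x - z1)] `&` [set x : T2 | A (x - z2)])) `&`
     ([set x : T2 | rho <= `|jac F1 F2 G1 G2 x|] `&` (F @^-1` V1 `&` G @^-1` V2)).
    by apply/seteqP; split => [x [[? ? ?] [? ? ?]]|x [[? [? ?]] [? [? ?]]]].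
  apply: measurableI; first by repeat apply: measurableI.
  apply: measurableI; last apply: measurableI; rewrite -[X in measurable X]setTI.
  - by apply: measurable_fun_ler => //; apply: measurableT_comp.
  - by apply: mF => //; apply: open_measurable; exact: oV.
  - by apply: mG => //; apply: open_measurable; exact: oV.
have hB t s : B t -> n1 (s - t) <= (160 * (2 * Gam) ^+ 2)^-1 -> D' s.
  move=> [[a0 a1 a2] _] st.
  have sh y : A (t - y) -> D (s - y).
    move=> /AA0 h; apply: (hA0 h); rewrite (_ : s - y - (t - y) = s - t)//.
    by rewrite opprB addrA subrK.
  by split; exact: sh.
have := hC _ D' F F1 F2 G G1 G2 rho B V1 V2 bD' tF tG rho0 rho1 (oV z1) (oV z2) mB mF mG mJ hB
  (fun x Bx => let: conj _ (And3 h _ _) := Bx in h) (fun x Bx => let: conj _ (And3 _ h _) := Bx in h)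
  (fun x Bx => let: conj _ (And3 _ _ h) := Bx in h).
rewrite !lV; apply: le_trans.
rewrite [leRHS]integral_mkcond; apply: ge0_integral_mono => x' _; first exact: f20.
rewrite /f2 /kern3/=.
have P0 : (0 <= ((fun x : T2 => `|jac F1 F2 G1 G2 x|%:E) \_ B) x')%E by rewrite /patch; case: ifPn.
have [h0|h0] := pselect (hits S A E ((x', w + S (sub2 x' z0)), z0)); last first.
  have -> : \1_(hits S A E) (x', w + S (sub2 x' z0), z.1.1) = 0 :> R by rewrite indicE memNset.
  by rewrite ?(mul0r, mulr0).
have [h1|h1] := pselect (hits S A E ((x', w + S (sub2 x' z0)), z1)); last first.
  have -> : \1_(hits S A E) (x', w + S (sub2 x' z0), z.1.2) = 0 :> R by rewrite indicE memNset.
  by rewrite ?(mul0r, mulr0).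
have [h2|h2] := pselect (hits S A E ((x', w + S (sub2 x' z0)), z2)); last first.
  have -> : \1_(hits S A E) (x', w + S (sub2 x' z0), z.2) = 0 :> R by rewrite indicE memNset.
  by rewrite ?(mul0r, mulr0).
have [a0 _] := hitE _ _ _ h0; have [a1 b1] := hitE _ _ _ h1; have [a2 b2] := hitE _ _ _ h2.
have le1 (i j k : bool) (y : R) : 0 <= y -> y * (i%:R * j%:R * k%:R) <= y.
  by move=> y0; case: i; case: j; case: k; rewrite ?(mulr0, mul0r, mulr1, mul1r)// y0.
rewrite !indicE; apply: (@le_trans _ _ (kern S1 S2 rho (x', w + S (sub2 x' z0)) z)%:E).
  by rewrite lee_fin; apply: le1; exact: kern_ge0.
rewrite /kern/= -/z0 -/z1 -/z2.
have JE' : tri S1 S2 (sub2 x' z0) (sub2 x' z1) (sub2 x' z2) = jac F1 F2 G1 G2 x' by rewrite JE.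
rewrite JE'; have [rj|rj] := leP rho `|jac F1 F2 G1 G2 x'|; last first.
  by rewrite mulr0; exact: P0.
rewrite mulr1 /patch ifT// inE; split; first by split.
split => //.
- by rewrite /V1 /F /= (_ : _ + w = w + S (sub2 x' z0) - S (sub2 x' z1))//; rewrite /sub2; ring.
- by rewrite /V2 /G /= (_ : _ + w = w + S (sub2 x' z0) - S (sub2 x' z2))//; rewrite /sub2; ring.
Qed.

(** With [kap] of size [del^-(1 + e)] and the cut-off [rho = lam / (64 kap)], the product
    [kap rho^-e] is a multiple of [kap^(1 + e) lam^-e], hence the exponent [(1 + e)^2]. The
    threshold [lam = min(1, V)] is low enough for small averages to be treated trivially. *)
Lemma quartic_bound (e : R) : 0 < e -> exists2 C : R, 0 < C &
  forall (del V : R) (A : set T2) (E : set T3), 0 < del -> del <= 1 -> measurable A -> A `<=` A0 ->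
  (lam2 R A <= 1)%E -> (forall t, A t -> del <= `|H t|) ->
  measurable E -> (forall y : T2, open (xsection E y : set R)) -> 0 < V -> (lam3 R E <= V%:E)%E ->
  (\int[lam3 R]_x (fine (avg S A E x) ^+ 4)%:E <=
    (C * del `^ (- (1 + e) ^+ 2) * Num.min 1 V `^ (- e) * V ^+ 3)%:E)%E.
Proof.
move=> e0; have [C1 C11_ h1] := strip_bound e0; have [C2 C20 h2] := triangle_bound e0.
have C10 : 0 < C1 by lra.
pose C3 := 128 * C2 * 64 `^ e * C1 `^ (1 + e).
have C30 : 0 < C3 by rewrite /C3 !mulr_gt0 ?powR_gt0.
exists (C3 + 1); first by lra.
move=> del V A E del0 del1 mA AA0 A1 hH mE oE V0 EV.
have G0 : 0 < Gam by have := Gam1; lra.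
pose kap := C1 * del `^ (- (1 + e)).
have pw1 (x y : R) : 0 < x -> x <= 1 -> 0 <= y -> 1 <= x `^ (- y).
  move=> x0 x1 y0; rewrite -[leLHS](powRr0 x); apply: ger_powR; first by rewrite x0.
  by rewrite oppr_le0.
have dp : 1 <= del `^ (- (1 + e)) by apply: pw1 => //; lra.
have kap1 : 1 <= kap by rewrite -[leLHS]mulr1; apply: ler_pM.
have kap0 : 0 < kap by lra.
pose lam := Num.min 1 V.
have lam0 : 0 < lam by rewrite lt_min V0 ltr01.
have lam1 : lam <= 1 by rewrite ge_min lexx.
have lamV : lam <= V by rewrite ge_min lexx orbT.
pose rho : R := lam / (64 * kap).
have k64 : 1 <= 64 * kap by lra.
have rho0 : 0 < rho by rewrite divr_gt0// mulr_gt0.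
have rho1 : rho <= 1 by rewrite /rho ler_pdivrMr; lra.
have Afin : (lam2 R A < +oo)%E by apply: le_lt_trans A1 (ltry _).
have b1 t : A t -> `|S1 t| <= Gam by move=> /AA0/A0D Dt; have [] := tS.1 _ _ Dt Dt.
have b2 t : A t -> `|S2 t| <= Gam by move=> /AA0/A0D Dt; have [] := tS.1 _ _ Dt Dt.
have Mt0 : 0 <= C2 * rho `^ (- e) by rewrite mulr_ge0 ?powR_ge0// ltW.
have hstrip := h1 del A del0 del1 mA AA0 hH.
have htri := h2 rho A E rho0 rho1 mA AA0 mE oE.
have Q := quartic_scheme mS mS1 mS2 mA mE kap0 G0 rho0 lam0 Mt0 (lexx _) Afin b1 b2 hstrip htri.
pose a x := fine (avg S A E x).
have a0 x : 0 <= a x by rewrite fine_ge0// avg_ge0.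
have aE x : avg S A E x = (a x)%:E.
  rewrite /a fineK// ge0_fin_numE ?avg_ge0//.
  by apply: le_lt_trans Afin; exact: avg_le.
have ma : measurable_fun [set: T3] a.
  by apply: measurableT_comp => //; exact: measurable_avg.
have mhigh : measurable [set x | lam <= a x].
  by rewrite -[X in measurable X]setTI; apply: measurable_fun_ler.
have mlow : measurable [set x | a x < lam].
  by rewrite -[X in measurable X]setTI; apply: measurable_fun_ltr.
have ma4 D' : measurable_fun D' (fun x => (a x ^+ 4)%:E).
  by apply: measurable_funTS; apply/measurable_EFinP; apply: measurable_funX.
have -> : (\int[lam3 R]_x (a x ^+ 4)%:E = \int[lam3 R]_(x in [set x | (lam <= a x)%R]) (a x ^+ 4)%:E +
    \int[lam3 R]_(x in [set x | (a x < lam)%R]) (a x ^+ 4)%:E)%E.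
  rewrite -ge0_integral_setU//.
  - by congr (integral _ _ _); apply/seteqP; split => x //= _; case: (leP lam (a x)); [left|right].
  - by move=> x _; rewrite lee_fin exprn_ge0.
  - by apply/disj_setPS => x [/= h3 h4]; move: (le_lt_trans h3 h4); rewrite ltxx.
(* Where [a < lam], [a^4] is at most [lam^3 a], whose integral is at most [lam^3 V <= V^3], both for
   [V <= 1] and for [V > 1]. *)
have Qlow : (\int[lam3 R]_(x in [set x | (a x < lam)%R]) (a x ^+ 4)%:E <= (V ^+ 3)%:E)%E.
  apply: (@le_trans _ _ (\int[lam3 R]_x ((lam ^+ 3)%:E * (a x)%:E))%E).
    rewrite integral_mkcond; apply: ge0_integral_mono => x _; rewrite /patch.
      by case: ifPn => // _; rewrite lee_fin exprn_ge0.
    case: ifPn => [/[!inE]/= xl|_]; last by rewrite -EFinM lee_fin mulr_ge0// exprn_ge0// ltW.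
    by rewrite -EFinM lee_fin exprSr ler_wpM2r// ler_pXn2r ?nnegrE// ltW.
  rewrite ge0_integralZl//; last by rewrite lee_fin exprn_ge0// ltW.
    under eq_integral do rewrite -aE.
    rewrite integral_avg//.
    apply: (@le_trans _ _ ((lam ^+ 3)%:E * (1 * V%:E))%E).
      by apply: lee_wpmul2l; [rewrite lee_fin exprn_ge0// ltW|apply: lee_pmul].
    rewrite mul1e -EFinM lee_fin exprS -mulrA [leRHS]exprS.
    have [V1|V1] := leP V 1.
      apply: (@le_trans _ _ (V * (V ^+ 2 * 1))); last by rewrite mulr1.
      apply: ler_pM => //; [exact: ltW|by rewrite mulr_ge0 ?exprn_ge0// ltW|].
      by apply: ler_pM => //; [rewrite exprn_ge0// ltW|exact: ltW|rewrite ler_pXn2r ?nnegrE// ltW].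
    apply: (@le_trans _ _ (1 * (1 * V))).
      apply: ler_pM => //; [exact: ltW|by rewrite mulr_ge0 ?exprn_ge0// ltW|].
      by apply: ler_wpM2r; [exact: ltW|rewrite exprn_ile1// ltW].
    rewrite !mul1r ler_pMr//; rewrite exprn_ege1//; exact: ltW.
    by apply/measurable_EFinP.
  by move=> x _; rewrite lee_fin.
apply: (le_trans (leeD Q Qlow)).
have W : (128 * kap * (C2 * rho `^ (- e)))%:E%E = (C3 * del `^ (- (1 + e) ^+ 2) * lam `^ (- e))%:E%E.
  congr EFin; rewrite /rho powRM ?(ltW lam0) ?invr_ge0//; last lra.
  have -> : (64 * kap)^-1 `^ (- e) = 64 `^ e * kap `^ e.
    rewrite -powR_inv1; last lra.
    by rewrite -powRrM mulrNN mul1r powRM// ltW.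
  have -> : kap `^ e = kap^-1 * (C1 `^ (1 + e) * del `^ (- (1 + e) ^+ 2)).
    have -> : C1 `^ (1 + e) * del `^ (- (1 + e) ^+ 2) = kap `^ (1 + e).
      by rewrite /kap powRM ?powR_ge0 ?(ltW C10)// -powRrM; congr (_ * _ `^ _); ring.
    rewrite powRD ?(gt_eqF kap0) ?implybT// powRr1 ?(ltW kap0)// mulrA mulVf ?mul1r// gt_eqF//.
  by rewrite /C3; field; rewrite gt_eqF.
rewrite W.
apply: (@le_trans _ _ ((C3 * del `^ (- (1 + e) ^+ 2) * lam `^ (- e))%:E * (V%:E * V%:E * V%:E) + (V ^+ 3)%:E)%E).
  apply: leeD => //; apply: lee_wpmul2l; first by rewrite lee_fin !mulr_ge0 ?powR_ge0// ltW.
  by apply: lee_pmul; rewrite ?mule_ge0//; apply: lee_pmul.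
rewrite -!EFinM -EFinD lee_fin -/lam.
have w1 : 1 <= del `^ (- (1 + e) ^+ 2) by apply: pw1; rewrite ?sqr_ge0.
have w2 : 1 <= lam `^ (- e) by apply: pw1 => //; exact: ltW.
have w3 : 1 <= del `^ (- (1 + e) ^+ 2) * lam `^ (- e) by rewrite -[leLHS]mulr1; apply: ler_pM.
have v3 : 0 <= V ^+ 3 by rewrite exprn_ge0// ltW.
have := ler_wpM2r v3 w3; rewrite mul1r => w4.
have -> : V * V * V = V ^+ 3 by ring.
by rewrite !mulrDl !mul1r lerD2l.
Qed.

End quartic_bound.

(** * Double power series *)

Section double_sums.
Variable R : realType.
Implicit Types (a b : nat -> nat -> R).

(** Every convergence question is reduced to this one ratio, which gives explicit errors [2^-n] for
    the square partial sums; other ratios are absorbed by shrinking the square of evaluation. *)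
Definition dom (K : R) a := forall i j, `|a i j| <= K * 2^-1 ^+ (i + j).

Definition psq a n := \sum_(i < n) \sum_(j < n) a i j.

Definition dsum a : R := limn (psq a).

Lemma dom_ge0 K a : dom K a -> 0 <= K.
Proof. by move=> /(_ 0%N 0%N); rewrite expr0 mulr1; exact: le_trans. Qed.

Lemma sum_half n : \sum_(i < n) (2^-1 : R) ^+ i = 2 - 2 * 2^-1 ^+ n.
Proof.
elim: n => [|n IH]; first by rewrite big_ord0 expr0 mulr1 subrr.
by rewrite big_ord_recr/= IH exprS; field.
Qed.

Lemma sum_half_le n : \sum_(i < n) (2^-1 : R) ^+ i <= 2.
Proof. by rewrite sum_half lerBlDr lerDl mulr_ge0// exprn_ge0. Qed.

Lemma psq_step K a n : dom K a -> `|psq a n.+1 - psq a n| <= 4 * K * 2^-1 ^+ n.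
Proof.
move=> aK; have K0 := dom_ge0 aK.
have -> : psq a n.+1 - psq a n = \sum_(i < n) a i n + \sum_(j < n.+1) a n j.
  rewrite /psq big_ord_recr/=.
  under eq_bigr do rewrite big_ord_recr/=.
  by rewrite big_split/=; ring.
apply: le_trans (ler_normD _ _) _.
have h (f : nat -> R) m : (forall i, `|f i| <= K * 2^-1 ^+ (i + n)) ->
    `|\sum_(i < m) f i| <= 2 * K * 2^-1 ^+ n.
  move=> hf; apply: le_trans (ler_norm_sum _ _ _) _.
  apply: (@le_trans _ _ (\sum_(i < m) K * 2^-1 ^+ n * 2^-1 ^+ i)).
    by apply: ler_sum => i _; apply: le_trans (hf _) _; rewrite exprD [_ ^+ i * _]mulrC mulrA.
  rewrite -mulr_sumr; have := sum_half_le m.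
  have p0 : 0 <= K * 2^-1 ^+ n by rewrite mulr_ge0// exprn_ge0.
  by move=> /(ler_wpM2l p0); lra.
have := h (fun i => a i n) n (fun i => aK i n).
have := h (fun j => a n j) n.+1; move=> /(_ _) h2 h1.
have h3 : forall j, `|a n j| <= K * 2^-1 ^+ (j + n) by move=> j; rewrite addnC.
by have := h2 h3; lra.
Qed.

Lemma dsum_approx K a n : dom K a -> `|psq a n - dsum a| <= 8 * K * 2^-1 ^+ n.
Proof.
move=> aK; have h20 : 0 <= (2^-1 : R) by lra.
have h21 : (2^-1 : R) < 1 by lra.
have [l hl] := geometric_limit h20 h21 (fun m => psq_step m aK).
have e : 4 * K / (1 - 2^-1) = 8 * K by field.
rewrite e in hl; suff -> : dsum a = l by exact: hl.
apply: cvg_lim => //; apply/cvgrPdist_lt => eps eps0.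
have [m hm] := geometric_small (8 * K) h20 h21 eps0.
exists m => // k /= mk; rewrite distrC; apply: le_lt_trans (hl k) _.
apply: le_lt_trans hm; rewrite ler_wpM2l ?mulr_ge0 ?(dom_ge0 aK)//.
by apply: ler_wiXn2l => //; lra.
Qed.

Lemma dsum_uniq (K L : R) a l : dom K a -> (forall n, `|psq a n - l| <= L * 2^-1 ^+ n) -> dsum a = l.
Proof.
move=> aK hl; apply/eqP; rewrite -subr_eq0 -normr_le0.
apply: (@le0_geometric R _ (8 * K + L) 2^-1); [lra|lra|] => n.
have := dsum_approx n aK; have := hl n.
rewrite (_ : dsum a - l = (psq a n - l) - (psq a n - dsum a)); last by ring.
by move=> h1 h2; apply: le_trans (ler_normB _ _) _; lra.
Qed.

Lemma dsum_bound K a : dom K a -> `|dsum a| <= 8 * K.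
Proof.
by move=> /(dsum_approx 0); rewrite /psq big_ord0 sub0r normrN expr0 mulr1.
Qed.

Lemma dom_lin K L (x y : R) a b : dom K a -> dom L b ->
  dom (`|x| * K + `|y| * L) (fun i j => x * a i j + y * b i j).
Proof.
move=> aK bL i j; apply: le_trans (ler_normD _ _) _; rewrite !normrM mulrDl -!mulrA.
by apply: lerD; apply: ler_wpM2l.
Qed.

Lemma dsum_lin K L (x y : R) a b : dom K a -> dom L b ->
  dsum (fun i j => x * a i j + y * b i j) = x * dsum a + y * dsum b.
Proof.
move=> aK bL; apply: (@dsum_uniq _ (8 * (`|x| * K + `|y| * L)) _ _ (dom_lin x y aK bL)) => n.
have -> : psq (fun i j => x * a i j + y * b i j) n = x * psq a n + y * psq b n.
  rewrite /psq !mulr_sumr -big_split/=; apply: eq_bigr => i _.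
  by rewrite !mulr_sumr -big_split/=.
rewrite (_ : _ - _ = x * (psq a n - dsum a) + y * (psq b n - dsum b)); last by ring.
apply: le_trans (ler_normD _ _) _; rewrite !normrM.
have := ler_wpM2l (normr_ge0 x) (dsum_approx n aK).
by have := ler_wpM2l (normr_ge0 y) (dsum_approx n bL); lra.
Qed.

Lemma dsum_scale K (x : R) a : dom K a -> dsum (fun i j => x * a i j) = x * dsum a.
Proof.
move=> aK; have := dsum_lin x 0 aK aK; rewrite mul0r addr0 => <-.
by congr dsum; apply/funext => i; apply/funext => j; rewrite mul0r addr0.
Qed.

Lemma dsum0 : dsum (fun _ _ => 0) = 0 :> R.
Proof.
have d0 : dom 0 (fun _ _ => 0) by move=> i j; rewrite normr0 mul0r.
by apply: (@dsum_uniq 0 0 _ _ d0) => n; rewrite mul0r /psq big1 ?subrr ?normr0// => i _; rewrite big1.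
Qed.

Lemma dsum_sum (I : Type) (K : I -> R) (r : seq I) (x : I -> R) (a : I -> nat -> nat -> R) :
  (forall k, dom (K k) (a k)) ->
  dsum (fun i j => \sum_(k <- r) x k * a k i j) = \sum_(k <- r) x k * dsum (a k).
Proof.
move=> aK; elim: r => [|k r IH].
  rewrite big_nil -[RHS]dsum0; congr dsum; apply/funext => i; apply/funext => j.
  by rewrite big_nil.
rewrite big_cons -IH.
have [L bL] : exists L, dom L (fun i j => \sum_(k <- r) x k * a k i j).
  elim: r {IH} => [|m r [L IH]].
    by exists 0 => i j; rewrite big_nil normr0 mul0r.
  exists (`|x m| * K m + `|1| * L); have := dom_lin (x m) 1 (aK m) IH.
  by congr dom; apply/funext => i; apply/funext => j; rewrite big_cons mul1r.
rewrite -[X in _ + X]mul1r -(dsum_lin (x k) 1 (aK k) bL).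
by congr dsum; apply/funext => i; apply/funext => j; rewrite big_cons mul1r.
Qed.

Definition sh1 a i j := if i is i'.+1 then a i' j else 0.
Definition sh2 a i j := if j is j'.+1 then a i j' else 0.

Lemma dom_sh1 K a : dom K a -> dom (2 * K) (sh1 a).
Proof.
move=> aK [|i] j; rewrite /sh1.
  by rewrite normr0 !mulr_ge0 ?(dom_ge0 aK)// exprn_ge0.
by apply: le_trans (aK i j) _; rewrite addSn exprS; lra.
Qed.

Lemma dom_sh2 K a : dom K a -> dom (2 * K) (sh2 a).
Proof.
move=> aK i [|j]; rewrite /sh2.
  by rewrite normr0 !mulr_ge0 ?(dom_ge0 aK)// exprn_ge0.
by apply: le_trans (aK i j) _; rewrite addnS exprS; lra.
Qed.

Lemma dsum_tr K a : dom K a -> dsum (fun i j => a j i) = dsum a.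
Proof.
move=> aK; have aK' : dom K (fun i j => a j i) by move=> i j; rewrite addnC; exact: aK.
apply: (@dsum_uniq _ (8 * K) _ _ aK') => n.
rewrite (_ : psq (fun i j => a j i) n = psq a n); first exact: dsum_approx.
by rewrite /psq exchange_big.
Qed.

Lemma dsum_sh1 K a : dom K a -> dsum (sh1 a) = dsum a.
Proof.
move=> aK; have K0 := dom_ge0 aK.
have hsum (f : nat -> R) m n : (forall i, `|f i| <= K * 2^-1 ^+ (i + n)) ->
    `|\sum_(i < m) f i| <= 2 * K * 2^-1 ^+ n.
  move=> hf; apply: le_trans (ler_norm_sum _ _ _) _.
  apply: (@le_trans _ _ (\sum_(i < m) K * 2^-1 ^+ n * 2^-1 ^+ i)).
    by apply: ler_sum => i _; apply: le_trans (hf _) _; rewrite exprD [_ ^+ i * _]mulrC mulrA.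
  rewrite -mulr_sumr; have := sum_half_le m.
  have p0 : 0 <= K * 2^-1 ^+ n by rewrite mulr_ge0// exprn_ge0.
  by move=> /(ler_wpM2l p0); lra.
apply: (@dsum_uniq _ (20 * K) _ _ (dom_sh1 aK)) => -[|n].
  rewrite /psq big_ord0 sub0r normrN expr0 mulr1; apply: le_trans (dsum_bound aK) _; lra.
have -> : psq (sh1 a) n.+1 = psq a n + \sum_(i < n) a i n.
  rewrite /psq big_ord_recl/= big1 ?add0r//.
  under eq_bigr do rewrite /= big_ord_recr/=.
  by rewrite big_split.
rewrite (_ : _ - _ = (psq a n - dsum a) + \sum_(i < n) a i n); last by ring.
apply: le_trans (ler_normD _ _) _.
have h2 := hsum (fun i => a i n) n n (fun i => aK i n).
by have h1 := dsum_approx n aK; rewrite exprS; lra.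
Qed.

Lemma dsum_sh2 K a : dom K a -> dsum (sh2 a) = dsum a.
Proof.
move=> aK; have aK' : dom K (fun i j => a j i) by move=> i j; rewrite addnC; exact: aK.
have := dsum_tr (dom_sh1 aK'); rewrite (dsum_sh1 aK') (dsum_tr aK) => <-.
by congr dsum.
Qed.

(** On coefficients, multiplication by [x^k y^l]. *)
Definition shift k l a i j := if (k <= i)%N && (l <= j)%N then a (i - k)%N (j - l)%N else 0.

Lemma shift_iter k l a : shift k l a = iter k sh1 (iter l sh2 a).
Proof.
apply/funext => i; apply/funext => j; rewrite /shift; elim: k i => [|k IH] i.
  rewrite subn0 /=; elim: l j => [|l IHl] j /=; first by rewrite subn0.
  by case: j => [|j]//=; rewrite -IHl subSS.
by case: i => [|i] //=; rewrite -IH subSS.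
Qed.

Lemma dom_shift K k l a : dom K a -> dom (2 ^+ (k + l) * K) (shift k l a).
Proof.
move=> aK; rewrite shift_iter.
have h2 : dom (2 ^+ l * K) (iter l sh2 a).
  elim: l => [|l IH]; first by rewrite expr0 mul1r.
  by rewrite exprS -mulrA; exact: dom_sh2.
elim: k => [|k IH]; first by rewrite add0n.
by rewrite addSn exprS -mulrA; exact: dom_sh1.
Qed.

Lemma dsum_shift K k l a : dom K a -> dsum (shift k l a) = dsum a.
Proof.
move=> aK; rewrite shift_iter.
have h2 : dom (2 ^+ l * K) (iter l sh2 a) /\ dsum (iter l sh2 a) = dsum a.
  elim: l => [|l [IH1 IH2]]; first by rewrite expr0 mul1r.
  by rewrite exprS -mulrA /= (dsum_sh2 IH1); split => //; exact: dom_sh2.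
suff : dom (2 ^+ (k + l) * K) (iter k sh1 (iter l sh2 a)) /\
   dsum (iter k sh1 (iter l sh2 a)) = dsum a by case.
elim: k => [|k [IH1 IH2]]; first by rewrite add0n.
by rewrite addSn exprS -mulrA /= (dsum_sh1 IH1); split => //; exact: dom_sh1.
Qed.

Definition conv a b i j := \sum_(k < i.+1) \sum_(l < j.+1) a k l * b (i - k)%N (j - l)%N.

(** A ratio [1/4] keeps a spare [1/2] per index, which pays for the number of terms of the Cauchy
    product [conv]. *)
Definition dom4 (K : R) a := forall i j, `|a i j| <= K * 4^-1 ^+ (i + j).

Lemma expr4 n : (4^-1 : R) ^+ n = 2^-1 ^+ n * 2^-1 ^+ n.
Proof. by rewrite -exprMn; congr (_ ^+ _); field. Qed.

Lemma dom4_dom K a : dom4 K a -> dom K a.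
Proof.
move=> aK i j; apply: le_trans (aK i j) _.
have K0 : 0 <= K by have := aK 0%N 0%N; rewrite expr0 mulr1; exact: le_trans.
rewrite ler_wpM2l// expr4 ler_piMr ?exprn_ge0//.
by rewrite exprn_ile1//; lra.
Qed.

Lemma conv_dom K L a b : dom K a -> dom4 L b -> dom (4 * K * L) (conv a b).
Proof.
move=> aK bL i j; have K0 := dom_ge0 aK; have L0 := dom_ge0 (dom4_dom bL).
apply: (@le_trans _ _ (\sum_(k < i.+1) \sum_(l < j.+1)
    K * L * 2^-1 ^+ (i + j) * 2^-1 ^+ (i - k) * 2^-1 ^+ (j - l))).
  apply: le_trans (ler_norm_sum _ _ _) _; apply: ler_sum => k _.
  apply: le_trans (ler_norm_sum _ _ _) _; apply: ler_sum => l _.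
  rewrite normrM; apply: le_trans (ler_pM _ _ (aK _ _) (bL _ _)) _ => //.
  rewrite expr4 (_ : (i + j = k + l + (i - k + (j - l)))%N); last first.
    by have := ltn_ord k; have := ltn_ord l; lia.
  by rewrite !exprD le_eqVlt; apply/orP; left; apply/eqP; ring.
have rev n : \sum_(k < n.+1) (2^-1 : R) ^+ (n - k) <= 2.
  rewrite (reindex_inj rev_ord_inj)/=.
  rewrite (eq_bigr (fun k : 'I_n.+1 => 2^-1 ^+ k)); first exact: sum_half_le.
  by move=> k _; congr (_ ^+ _); have := ltn_ord k; lia.
under eq_bigr do rewrite -mulr_sumr.
rewrite -mulr_suml -mulr_sumr.
have p0 : 0 <= K * L * 2^-1 ^+ (i + j) by rewrite !mulr_ge0// exprn_ge0.
have s0 n : 0 <= \sum_(k < n.+1) (2^-1 : R) ^+ (n - k) by apply: sumr_ge0 => k _; rewrite exprn_ge0.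
rewrite -mulrA (_ : 4 * K * L * _ = K * L * 2^-1 ^+ (i + j) * (2 * 2)); last by ring.
by apply: ler_wpM2l => //; apply: ler_pM.
Qed.

(** If [a] is cut to the square [N * N], the product is a finite combination of shifts of [b] and
    the claim is linearity. The rest of [a] is dominated with constant [K 2^-N], again thanks to the
    spare ratio. *)
Lemma dsum_conv K L a b : dom4 K a -> dom4 L b -> dsum (conv a b) = dsum a * dsum b.
Proof.
move=> aK bL; have bd := dom4_dom bL; have ad := dom4_dom aK.
have K0 := dom_ge0 ad; have L0 := dom_ge0 bd.
pose tr N i j := if (i < N)%N && (j < N)%N then a i j else 0.
have trK N : dom4 K (tr N).
  by move=> i j; rewrite /tr; case: ifP => _ //; rewrite normr0 mulr_ge0// exprn_ge0.
apply/eqP; rewrite -subr_eq0 -normr_le0.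
apply: (@le0_geometric R _ (32 * K * L + 8 * K * (8 * L)) 2^-1); [lra|lra|] => N.
have E : dsum (conv (tr N) b) = psq a N * dsum b.
  pose D n m := (fun p : 'I_N * 'I_N => shift p.1 p.2 b n m).
  transitivity (dsum (fun i j => \sum_(p : 'I_N * 'I_N) a p.1 p.2 * shift p.1 p.2 b i j)).
    congr dsum; apply/funext => i; apply/funext => j.
    rewrite /conv.
    transitivity (\sum_(k < N) \sum_(l < N) a k l * shift k l b i j); last by rewrite pair_bigA.
    transitivity (\sum_(k < i.+1) \sum_(l < N) tr N k l * shift k l b i j).
      apply: eq_bigr => k _.
      rewrite (big_ord_widen (N + j.+1) (fun l => tr N k l * b (i - k)%N (j - l)%N)) ?leq_addl//.
      rewrite (big_ord_widen (N + j.+1) (fun l => tr N k l * shift k l b i j)) ?leq_addr//.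
      rewrite big_mkcond [RHS]big_mkcond; apply: eq_bigr => l _.
      rewrite /shift /tr; have := ltn_ord k; rewrite ltnS => -> /=; rewrite ltnS.
      by case: (ltnP l N) => lN; case: (leqP l j) => lj; rewrite ?(andbT, andbF, mul0r, mulr0)//.
    rewrite (big_ord_widen (N + i.+1) (fun k => \sum_(l < N) tr N k l * shift k l b i j)) ?leq_addl//.
    rewrite (big_ord_widen (N + i.+1) (fun k => \sum_(l < N) a k l * shift k l b i j)) ?leq_addr//.
    rewrite big_mkcond [RHS]big_mkcond; apply: eq_bigr => k _; rewrite ltnS.
    case: (ltnP k N) => kN; case: (leqP k i) => ki //.
    - by apply: eq_bigr => l _; rewrite /tr kN ltn_ord.
    - by rewrite big1// => l _; rewrite /shift leqNgt ki/= mulr0.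
    - by rewrite big1// => l _; rewrite /tr ltnNge kN/= mul0r.
  rewrite (@dsum_sum _ (fun p : 'I_N * 'I_N => 2 ^+ (p.1 + p.2) * L)); last first.
    by move=> p; exact: dom_shift.
  under eq_bigr do rewrite (dsum_shift _ _ bd).
  rewrite -mulr_suml /psq; congr (_ * _).
  by rewrite (pair_bigA _ (fun k l : 'I_N => a k l)).
have Rd : dom (4 * (K * 2^-1 ^+ N) * L) (fun i j => 1 * conv a b i j + (-1) * conv (tr N) b i j).
  have r : dom (K * 2^-1 ^+ N) (fun i j => a i j - tr N i j).
    move=> i j; rewrite /tr; case: ifPn => [_|ij].
      by rewrite subrr normr0 !mulr_ge0// exprn_ge0.
    rewrite subr0; apply: le_trans (aK i j) _; rewrite expr4 -mulrA ler_wpM2l//.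
    rewrite ler_wpM2r ?exprn_ge0//; apply: ler_wiXn2l => //; first by lra.
    by move: ij; rewrite negb_and -!leqNgt; lia.
  have := conv_dom r bL; congr dom; apply/funext => i; apply/funext => j.
  rewrite mul1r mulN1r /conv -sumrB; apply: eq_bigr => k _; rewrite -sumrB.
  by apply: eq_bigr => l _; rewrite mulrBl.
have := dsum_bound Rd.
rewrite (dsum_lin 1 (-1) (conv_dom ad bL) (conv_dom (dom4_dom (trK N)) bL)) E mul1r mulN1r => h1.
have h2 := dsum_approx N ad.
have := ler_wpM2r (normr_ge0 (dsum b)) h2; rewrite -normrM => h3.
have h4 := dsum_bound bd.
have h5 : 8 * K * 2^-1 ^+ N * `|dsum b| <= 8 * K * 2^-1 ^+ N * (8 * L).
  by rewrite ler_wpM2l// !mulr_ge0// exprn_ge0.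
rewrite (_ : dsum (conv a b) - _ = (dsum (conv a b) - psq a N * dsum b) + (psq a N - dsum a) * dsum b); last by ring.
apply: le_trans (ler_normD _ _) _; move: h1 h3 h5; lra.
Qed.

End double_sums.

(** * Power series with geometric bounds on the coefficients *)

Section power_series.
Variable R : realType.
Implicit Types (c d : nat -> nat -> R) (t s : R * R).

Definition geo (C rho : R) c := forall i j, `|c i j| <= C * rho ^+ (i + j).

Definition ev c t := dsum (fun i j => c i j * t.1 ^+ i * t.2 ^+ j).

Definition dx c i j := i.+1%:R * c i.+1 j.
Definition dy c i j := j.+1%:R * c i j.+1.

Definition box (tau : R) : set (R * R) := [set t | `|t.1| <= tau /\ `|t.2| <= tau].

Lemma geo_ge0 C rho c : geo C rho c -> 0 <= C.
Proof. by move=> /(_ 0%N 0%N); rewrite expr0 mulr1; exact: le_trans. Qed.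

Lemma geo_le (C C' rho rho' : R) c : C <= C' -> 0 <= rho -> rho <= rho' -> geo C rho c -> geo C' rho' c.
Proof.
move=> CC r0 rr cg i j; apply: le_trans (cg i j) _; have C0 := geo_ge0 cg.
by apply: ler_pM => //; rewrite ?exprn_ge0// lerXn2r// nnegrE// (le_trans r0).
Qed.

Lemma term_le (C rho x y q : R) c i j : geo C rho c -> 0 <= rho ->
  rho * `|x| <= q -> rho * `|y| <= q -> `|c i j * x ^+ i * y ^+ j| <= C * q ^+ (i + j).
Proof.
move=> cg r0 hx hy; have C0 := geo_ge0 cg.
rewrite !normrM !normrX; apply: (@le_trans _ _ (C * rho ^+ (i + j) * `|x| ^+ i * `|y| ^+ j)).
  by apply: ler_wpM2r; [rewrite exprn_ge0|apply: ler_wpM2r; [rewrite exprn_ge0|exact: cg]].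
rewrite (_ : _ * _ = C * ((rho * `|x|) ^+ i * (rho * `|y|) ^+ j)); last by rewrite !exprMn exprD; ring.
rewrite ler_wpM2l// exprD; apply: ler_pM; rewrite ?exprn_ge0 ?mulr_ge0//.
  by rewrite lerXn2r// nnegrE ?mulr_ge0// (le_trans _ hx)// mulr_ge0.
by rewrite lerXn2r// nnegrE ?mulr_ge0// (le_trans _ hy)// mulr_ge0.
Qed.

Section at_box.
Variables (rho tau : R).
Hypotheses (rho0 : 0 <= rho) (tau0 : 0 < tau).

Lemma ev_dom C c t : rho * tau <= 2^-1 -> geo C rho c -> box tau t ->
  dom C (fun i j => c i j * t.1 ^+ i * t.2 ^+ j).
Proof.
move=> rt cg [t1 t2] i j; apply: (term_le i j cg rho0).
- by apply: le_trans rt; rewrite ler_wpM2l.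
- by apply: le_trans rt; rewrite ler_wpM2l.
Qed.

Lemma ev_bound C c t : rho * tau <= 2^-1 -> geo C rho c -> box tau t -> `|ev c t| <= 8 * C.
Proof. by move=> rt cg bt; apply: dsum_bound; exact: ev_dom. Qed.

Lemma ev_lin C C' c d (x y : R) t : rho * tau <= 2^-1 -> geo C rho c -> geo C' rho d -> box tau t ->
  ev (fun i j => x * c i j + y * d i j) t = x * ev c t + y * ev d t.
Proof.
move=> rt cg dg bt; rewrite -(dsum_lin x y (ev_dom rt cg bt) (ev_dom rt dg bt)).
by congr dsum; apply/funext => i; apply/funext => j; ring.
Qed.

Lemma ev_conv C C' c d t : rho * tau <= 4^-1 -> geo C rho c -> geo C' rho d -> box tau t ->
  ev (conv c d) t = ev c t * ev d t.
Proof.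
move=> rt cg dg [t1 t2].
have d4 C0 c0 : geo C0 rho c0 -> dom4 C0 (fun i j => c0 i j * t.1 ^+ i * t.2 ^+ j).
  move=> c0g i j; apply: (term_le i j c0g rho0); apply: le_trans rt; exact: ler_wpM2l.
rewrite -(dsum_conv (d4 _ _ cg) (d4 _ _ dg)); congr dsum; apply/funext => i; apply/funext => j.
rewrite /conv !mulr_suml; apply: eq_bigr => k _; rewrite !mulr_suml; apply: eq_bigr => l _.
have ki : (k <= i)%N by have := ltn_ord k; lia.
have lj : (l <= j)%N by have := ltn_ord l; lia.
have e1 : t.1 ^+ i = t.1 ^+ k * t.1 ^+ (i - k) by rewrite -exprD subnKC.
have e2 : t.2 ^+ j = t.2 ^+ l * t.2 ^+ (j - l) by rewrite -exprD subnKC.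
by rewrite e1 e2; ring.
Qed.

Lemma ev_shift C c k t : rho * tau <= 2^-1 -> geo C rho c -> box tau t ->
  ev (shift k 0 c) t = t.1 ^+ k * ev c t.
Proof.
move=> rt cg bt; have dm := ev_dom rt cg bt.
rewrite /ev -[in RHS](dsum_shift k 0 dm) -(dsum_scale _ (dom_shift k 0 dm)).
congr dsum; apply/funext => i; apply/funext => j; rewrite /shift/= subn0 andbT.
case: ifP => ki; last by rewrite !mul0r mulr0.
have e1 : t.1 ^+ i = t.1 ^+ k * t.1 ^+ (i - k) by rewrite -exprD subnKC.
by rewrite e1; ring.
Qed.

End at_box.

Lemma geo_lin C C' rho c d (x y : R) : geo C rho c -> geo C' rho d ->
  geo (`|x| * C + `|y| * C') rho (fun i j => x * c i j + y * d i j).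
Proof.
move=> cg dg i j; apply: le_trans (ler_normD _ _) _; rewrite !normrM mulrDl -!mulrA.
by apply: lerD; apply: ler_wpM2l.
Qed.

Lemma succ_le_expr2 n : n.+1%:R <= 2 ^+ n :> R.
Proof. by rewrite -natrX ler_nat; exact: ltn_expl. Qed.

Lemma geo_dx C rho c : 0 <= rho -> geo C rho c -> geo (C * rho) (2 * rho) (dx c).
Proof.
move=> r0 cg i j; rewrite /dx normrM ger0_norm//; have C0 := geo_ge0 cg.
apply: (@le_trans _ _ (2 ^+ (i + j) * (C * rho ^+ (i.+1 + j)))); last first.
  by rewrite exprMn addSn exprS; lra.
apply: ler_pM => //; apply: le_trans (succ_le_expr2 i) _.
by rewrite ler_weXn2l ?leq_addr//; lra.
Qed.

Lemma geo_dy C rho c : 0 <= rho -> geo C rho c -> geo (C * rho) (2 * rho) (dy c).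
Proof.
move=> r0 cg i j; rewrite /dy normrM ger0_norm//; have C0 := geo_ge0 cg.
apply: (@le_trans _ _ (2 ^+ (i + j) * (C * rho ^+ (i + j.+1)))); last first.
  by rewrite exprMn addnS exprS; lra.
apply: ler_pM => //; apply: le_trans (succ_le_expr2 j) _.
by rewrite ler_weXn2l ?leq_addl//; lra.
Qed.

Lemma geo_conv C C' rho c d : 0 < rho -> geo C rho c -> geo C' rho d ->
  geo (4 * C * C') (2 * rho) (conv c d).
Proof.
move=> r0 cg dg i j.
have r4 : 0 < 4 * rho by lra.
have d4 C0 c0 : geo C0 rho c0 -> dom4 C0 (fun i j => c0 i j / (4 * rho) ^+ (i + j)).
  move=> c0g k l; rewrite normrM normfV [`|(4 * rho) ^+ _|]ger0_norm ?exprn_ge0 ?(ltW r4)//.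
  rewrite ler_pdivrMr ?exprn_gt0//; apply: le_trans (c0g k l) _.
  rewrite -mulrA -exprMn (_ : 4^-1 * (4 * rho) = rho)//; by field.
have := conv_dom (dom4_dom (d4 _ _ cg)) (d4 _ _ dg) i j.
have -> : conv (fun i j => c i j / (4 * rho) ^+ (i + j)) (fun i j => d i j / (4 * rho) ^+ (i + j)) i j
    = conv c d i j / (4 * rho) ^+ (i + j).
  rewrite /conv mulr_suml; apply: eq_bigr => k _; rewrite mulr_suml; apply: eq_bigr => l _.
  have ki : (k <= i)%N by have := ltn_ord k; lia.
  have lj : (l <= j)%N by have := ltn_ord l; lia.
  rewrite (_ : (i + j = (k + l) + (i - k + (j - l)))%N); last by lia.
  rewrite [in RHS]exprD; field.
  by rewrite !expf_neq0// gt_eqF.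
rewrite normrM normfV [`|(4 * rho) ^+ _|]ger0_norm ?exprn_ge0 ?(ltW r4)//.
rewrite ler_pdivrMr ?exprn_gt0// => h; apply: le_trans h _.
by rewrite -[leLHS]mulrA -exprMn (_ : 2^-1 * (4 * rho) = 2 * rho)//; field.
Qed.

Lemma dxdyC c : dx (dy c) = dy (dx c).
Proof. by apply/funext => i; apply/funext => j; rewrite /dx /dy; ring. Qed.

Section monomials.
Variables (tau : R).
Hypothesis tau0 : 0 < tau.

(** Multiplied by [tau], so that the exponent [i - 1] does not appear and [i = 0] needs no separate
    statement. *)
Lemma expr_lip (x y : R) i : `|x| <= tau -> `|y| <= tau ->
  tau * `|x ^+ i - y ^+ i| <= i%:R * tau ^+ i * `|x - y|.
Proof.
move=> hx hy; elim: i => [|i IH]; first by rewrite subrr normr0 mulr0 !mul0r.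
rewrite (_ : x ^+ i.+1 - y ^+ i.+1 = x * (x ^+ i - y ^+ i) + (x - y) * y ^+ i); last by rewrite !exprS; ring.
have h1 : tau * `|x * (x ^+ i - y ^+ i)| <= tau * (i%:R * tau ^+ i * `|x - y|).
  by rewrite normrM mulrCA; apply: ler_pM => //; rewrite mulr_ge0// ltW.
have h2 : tau * `|(x - y) * y ^+ i| <= tau * (tau ^+ i * `|x - y|).
  rewrite ler_wpM2l ?(ltW tau0)// normrM mulrC ler_wpM2r// normrX lerXn2r// nnegrE//.
  exact: ltW.
have := ler_wpM2l (ltW tau0) (ler_normD (x * (x ^+ i - y ^+ i)) ((x - y) * y ^+ i)).
have := ltW tau0 => t0; rewrite -natr1 exprS; lra.
Qed.

(** For [i = 0] the truncated exponent [i.-1] is harmless because its coefficient is zero. *)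
Lemma expr_taylor (x y : R) i : `|x| <= tau -> `|y| <= tau ->
  tau ^+ 2 * `|x ^+ i - y ^+ i - i%:R * y ^+ i.-1 * (x - y)| <= i%:R ^+ 2 * tau ^+ i * `|x - y| ^+ 2.
Proof.
move=> hx hy; elim: i => [|i IH]; first by rewrite !mul0r subrr sub0r normrN normr0 mulr0 expr0n/= !mul0r.
rewrite (_ : _ - _ = x * (x ^+ i - y ^+ i - i%:R * y ^+ i.-1 * (x - y)) + i%:R * y ^+ i.-1 * (x - y) ^+ 2); last first.
  rewrite -natr1 !exprS expr0; case: i {IH} => [|i] /=; first by ring.
  by rewrite !exprS; ring.
have t0 := ltW tau0.
have h1 : tau ^+ 2 * `|x * (x ^+ i - y ^+ i - i%:R * y ^+ i.-1 * (x - y))| <= tau * (i%:R ^+ 2 * tau ^+ i * `|x - y| ^+ 2).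
  by rewrite normrM mulrCA; apply: ler_pM => //; rewrite mulr_ge0// exprn_ge0.
have h2 : tau ^+ 2 * `|i%:R * y ^+ i.-1 * (x - y) ^+ 2| <= tau * (i%:R * tau ^+ i * `|x - y| ^+ 2).
  rewrite !normrM ger0_norm// !normrX.
  case: i {IH h1} => [|i]; first by rewrite !mul0r !mulr0.
  rewrite /= !exprS expr0 (_ : tau * (tau * 1) * _ = tau * (tau * (i.+1%:R * (`|y| ^+ i) * `|x - y| ^+ 2))); last by rewrite !exprS expr0; ring.
  rewrite ler_wpM2l//.
  rewrite (_ : i.+1%:R * (tau * tau ^+ i) * _ = tau * (i.+1%:R * tau ^+ i * `|x - y| ^+ 2)); last by rewrite !exprS expr0; ring.
  rewrite ler_wpM2l// ler_wpM2r ?exprn_ge0// ler_wpM2l// lerXn2r// nnegrE//.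
apply: le_trans (ler_wpM2l (exprn_ge0 2 t0) (ler_normD _ _)) _.
have p : 0 <= tau * (tau ^+ i * `|x - y| ^+ 2) * (i%:R + 1) by rewrite !mulr_ge0 ?exprn_ge0// addr_ge0.
rewrite -natr1 [tau ^+ i.+1]exprS; move: h1 h2 p; rewrite mulrDr; lra.
Qed.

End monomials.
End power_series.

(** * Power series as tame functions *)

Section analytic.
Variable R : realType.
Implicit Types (c d : nat -> nat -> R) (t s : R * R).

Section C11_series.
Variables (tau : R).
Hypotheses (tau0 : 0 < tau) (tau1 : tau <= 1).

Lemma natr_le2 n : n%:R <= 2 ^+ n :> R.
Proof. by apply: le_trans (succ_le_expr2 R n); rewrite ler_nat. Qed.

Lemma ev_lip (rho C : R) c s t : 0 <= rho -> rho * tau <= 4^-1 -> geo C rho c -> box tau s -> box tau t ->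
  `|ev c s - ev c t| <= 8 * C / tau * n1 (s - t).
Proof.
move=> rho0 rt cg bs bt; have C0 := geo_ge0 cg; have t0 := ltW tau0.
have rt2 : rho * tau <= 2^-1 by lra.
have e : ev c s - ev c t = dsum (fun i j => 1 * (c i j * s.1 ^+ i * s.2 ^+ j) + (-1) * (c i j * t.1 ^+ i * t.2 ^+ j)).
  by rewrite (dsum_lin 1 (-1) (ev_dom rho0 rt2 cg bs) (ev_dom rho0 rt2 cg bt)) mul1r mulN1r.
rewrite e (_ : 8 * C / tau * _ = 8 * (C / tau * n1 (s - t))); last by ring.
apply: dsum_bound => i j.
have [s1 s2] := bs; have [t1 t2] := bt.
have n0 := n1_ge0 (s - t).
have m : tau * `|s.1 ^+ i * s.2 ^+ j - t.1 ^+ i * t.2 ^+ j| <= (2 * tau) ^+ (i + j) * n1 (s - t).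
  rewrite (_ : _ - _ = (s.1 ^+ i - t.1 ^+ i) * s.2 ^+ j + t.1 ^+ i * (s.2 ^+ j - t.2 ^+ j)); last by ring.
  apply: le_trans (ler_wpM2l t0 (ler_normD _ _)) _; rewrite mulrDr !normrM.
  have x1 := expr_lip tau0 i s1 t1; have x2 := expr_lip tau0 j s2 t2.
  have y2 : `|s.2 ^+ j| <= tau ^+ j by rewrite normrX lerXn2r// nnegrE.
  have y1 : `|t.1 ^+ i| <= tau ^+ i by rewrite normrX lerXn2r// nnegrE.
  have z1 : tau * (`|s.1 ^+ i - t.1 ^+ i| * `|s.2 ^+ j|) <= i%:R * tau ^+ i * `|s.1 - t.1| * tau ^+ j.
    by rewrite mulrA; apply: ler_pM => //; rewrite mulr_ge0.
  have z2 : tau * (`|t.1 ^+ i| * `|s.2 ^+ j - t.2 ^+ j|) <= tau ^+ i * (j%:R * tau ^+ j * `|s.2 - t.2|).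
    by rewrite mulrCA; apply: ler_pM => //; rewrite mulr_ge0.
  apply: le_trans (lerD z1 z2) _.
  have p0 : 0 <= tau ^+ (i + j) by rewrite exprn_ge0.
  rewrite exprMn (_ : _ + _ = tau ^+ (i + j) * (i%:R * `|s.1 - t.1| + j%:R * `|s.2 - t.2|)); last by rewrite exprD; ring.
  rewrite [2 ^+ _ * _]mulrC -mulrA ler_wpM2l// /n1/= mulrDr.
  apply: lerD; apply: ler_wpM2r => //; apply: le_trans (natr_le2 _) _;
    rewrite ler_weXn2l ?leq_addl ?leq_addr//; lra.
rewrite (_ : _ + _ = c i j * (s.1 ^+ i * s.2 ^+ j - t.1 ^+ i * t.2 ^+ j)); last by ring.
rewrite normrM -(@ler_pM2l _ tau)// mulrCA.
apply: le_trans (ler_pM _ _ (cg i j) m) _ => //; first by rewrite mulr_ge0.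
rewrite [leLHS](_ : _ = C * n1 (s - t) * (2 * (rho * tau)) ^+ (i + j)); last by rewrite !exprMn; ring.
rewrite (_ : tau * _ = C * n1 (s - t) * 2^-1 ^+ (i + j)); last by field; rewrite gt_eqF.
rewrite ler_wpM2l ?mulr_ge0// lerXn2r// ?nnegrE ?mulr_ge0//; lra.
Qed.

(** Termwise estimates. The factors [i^2], [j^2] and [i j] of second order are at most [4^(i + j)],
    so the series needs [4 rho tau <= 1/2]. *)
Lemma C11_ev (rho C : R) c (Gam : R) : 0 <= rho -> rho * tau <= 8^-1 -> geo C rho c -> 8 * C / tau ^+ 2 <= Gam ->
  C11 Gam (box tau) (ev c) (ev (dx c)) (ev (dy c)).
Proof.
move=> rho0 rt cg hG; have C0 := geo_ge0 cg; have t0 := ltW tau0.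
have rt2 : rho * tau <= 2^-1 by lra.
have cgx := geo_dx rho0 cg; have cgy := geo_dy rho0 cg.
have r20 : 0 <= 2 * rho by rewrite mulr_ge0.
have rtx : 2 * rho * tau <= 4^-1 by lra.
have rtx2 : 2 * rho * tau <= 2^-1 by lra.
have G1 : 8 * (C * rho) / tau <= Gam.
  apply: le_trans hG; rewrite ler_pdivrMr// (_ : 8 * C / tau ^+ 2 * tau = 8 * C / tau); last by field; rewrite gt_eqF.
  rewrite ler_pdivlMr//; have := ler_wpM2l C0 rt; lra.
have G2 : 8 * (C * rho) <= Gam.
  apply: le_trans G1; rewrite ler_pdivlMr// ler_piMr// mulr_ge0// mulr_ge0//.
move=> s t bs bt; have n0 := n1_ge0 (s - t).
split; last first.
- exact: le_trans (ev_bound r20 rtx2 cgy bt) G2.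
- exact: le_trans (ev_bound r20 rtx2 cgx bt) G2.
- exact: le_trans (ev_lip r20 rtx cgy bs bt) (ler_wpM2r n0 G1).
- exact: le_trans (ev_lip r20 rtx cgx bs bt) (ler_wpM2r n0 G1).
have d1 := ev_dom rho0 rt2 cg bs; have d2 := ev_dom rho0 rt2 cg bt.
(* Shifting the differentiated series by one index aligns its terms with those of the series itself,
   so the Taylor remainder becomes a single double series. *)
have d3 := dom_sh1 (ev_dom r20 rtx2 cgx bt); have d4 := dom_sh2 (ev_dom r20 rtx2 cgy bt).
have e : ev c s - ev c t - (ev (dx c) t * (s.1 - t.1) + ev (dy c) t * (s.2 - t.2)) =
   dsum (fun i j => 1 * (1 * (c i j * s.1 ^+ i * s.2 ^+ j) + (-1) * (c i j * t.1 ^+ i * t.2 ^+ j)) +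
     (-1) * ((s.1 - t.1) * sh1 (fun i j => dx c i j * t.1 ^+ i * t.2 ^+ j) i j +
         (s.2 - t.2) * sh2 (fun i j => dy c i j * t.1 ^+ i * t.2 ^+ j) i j)).
  rewrite (dsum_lin _ _ (dom_lin 1 (-1) d1 d2) (dom_lin _ _ d3 d4)).
  rewrite (dsum_lin 1 (-1) d1 d2) (dsum_lin _ _ d3 d4).
  rewrite (dsum_sh1 (ev_dom r20 rtx2 cgx bt)) (dsum_sh2 (ev_dom r20 rtx2 cgy bt)) -/(ev c s) -/(ev c t).
  by rewrite -/(ev (dx c) t) -/(ev (dy c) t); ring.
rewrite e; apply: (@le_trans _ _ (8 * (C / tau ^+ 2 * n1 (s - t) ^+ 2))); last first.
  by rewrite mulrA ler_wpM2r ?exprn_ge0// mulrA.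
apply: dsum_bound => i j.
have [s1 s2] := bs; have [t1 t2] := bt.
rewrite (_ : _ + _ = c i j * ((s.1 ^+ i - t.1 ^+ i - i%:R * t.1 ^+ i.-1 * (s.1 - t.1)) * t.2 ^+ j +
   t.1 ^+ i * (s.2 ^+ j - t.2 ^+ j - j%:R * t.2 ^+ j.-1 * (s.2 - t.2)) +
   (s.1 ^+ i - t.1 ^+ i) * (s.2 ^+ j - t.2 ^+ j))); last first.
  by rewrite /sh1 /sh2 /dx /dy; case: i => [|i]; case: j => [|j] /=; ring.
rewrite normrM -(@ler_pM2l _ (tau ^+ 2)) ?exprn_gt0// mulrCA.
set d1' := `|s.1 - t.1|; set d2' := `|s.2 - t.2|.
have m : tau ^+ 2 * `|(s.1 ^+ i - t.1 ^+ i - i%:R * t.1 ^+ i.-1 * (s.1 - t.1)) * t.2 ^+ j +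
   t.1 ^+ i * (s.2 ^+ j - t.2 ^+ j - j%:R * t.2 ^+ j.-1 * (s.2 - t.2)) +
   (s.1 ^+ i - t.1 ^+ i) * (s.2 ^+ j - t.2 ^+ j)| <= (4 * tau) ^+ (i + j) * n1 (s - t) ^+ 2.
  have x1 := expr_lip tau0 i s1 t1; have x2 := expr_lip tau0 j s2 t2.
  have w1 := expr_taylor tau0 i s1 t1; have w2 := expr_taylor tau0 j s2 t2.
  have y2 : `|t.2 ^+ j| <= tau ^+ j by rewrite normrX lerXn2r// nnegrE.
  have y1 : `|t.1 ^+ i| <= tau ^+ i by rewrite normrX lerXn2r// nnegrE.
  have tt0 : 0 <= tau ^+ 2 by rewrite exprn_ge0.
  apply: le_trans (ler_wpM2l tt0 (ler_normD _ _)) _.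
  apply: le_trans (ler_wpM2l tt0 (lerD (ler_normD _ _) (lexx _))) _.
  rewrite !normrM mulrDr mulrDr.
  have z1 := ler_pM (mulr_ge0 tt0 (normr_ge0 _)) (normr_ge0 _) w1 y2.
  have z2 := ler_pM (normr_ge0 _) (mulr_ge0 tt0 (normr_ge0 _)) y1 w2.
  have z3 := ler_pM (mulr_ge0 t0 (normr_ge0 _)) (mulr_ge0 t0 (normr_ge0 _)) x1 x2.
  rewrite -/d1' -/d2' in z1 z2 z3 *.
  apply: (@le_trans _ _ (tau ^+ (i + j) * (i%:R ^+ 2 * d1' ^+ 2 + j%:R ^+ 2 * d2' ^+ 2 + i%:R * j%:R * (d1' * d2')))).
    rewrite [leRHS]mulrDr [X in _ <= X + _]mulrDr; apply: lerD; first apply: lerD.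
    - rewrite mulrA; apply: le_trans z1 _.
      by rewrite exprD le_eqVlt; apply/orP; left; apply/eqP; ring.
    - rewrite mulrCA; apply: le_trans z2 _.
      by rewrite exprD le_eqVlt; apply/orP; left; apply/eqP; ring.
    - rewrite [tau ^+ 2]expr2 mulrACA; apply: le_trans z3 _.
      by rewrite exprD le_eqVlt; apply/orP; left; apply/eqP; ring.
  rewrite (_ : (4 * tau) ^+ (i + j) = tau ^+ (i + j) * (2 ^+ (i + j)) ^+ 2); last first.
    by rewrite exprMn mulrC; congr (_ * _); rewrite -exprM mulnC exprM; congr (_ ^+ _); ring.
  rewrite -[leRHS]mulrA ler_wpM2l ?exprn_ge0//; set Q := 2 ^+ (i + j) : R.
  have iQ : i%:R <= Q by apply: le_trans (natr_le2 _) _; rewrite ler_weXn2l ?leq_addr//; lra.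
  have jQ : j%:R <= Q by apply: le_trans (natr_le2 _) _; rewrite ler_weXn2l ?leq_addl//; lra.
  have Q0 : 0 <= Q by rewrite exprn_ge0.
  have dd1 : 0 <= d1' by exact: normr_ge0.
  have dd2 : 0 <= d2' by exact: normr_ge0.
  have q1 : i%:R ^+ 2 * d1' ^+ 2 <= Q ^+ 2 * d1' ^+ 2 by rewrite ler_wpM2r ?exprn_ge0// lerXn2r// nnegrE.
  have q2 : j%:R ^+ 2 * d2' ^+ 2 <= Q ^+ 2 * d2' ^+ 2 by rewrite ler_wpM2r ?exprn_ge0// lerXn2r// nnegrE.
  have q3 : i%:R * j%:R * (d1' * d2') <= Q ^+ 2 * (d1' * d2') by rewrite ler_wpM2r ?mulr_ge0// expr2; apply: ler_pM.
  have q4 : 0 <= Q ^+ 2 * (d1' * d2') by rewrite mulr_ge0 ?exprn_ge0// mulr_ge0.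
  rewrite /n1/= -/d1' -/d2' (_ : Q ^+ 2 * (d1' + d2') ^+ 2 = Q ^+ 2 * d1' ^+ 2 + Q ^+ 2 * d2' ^+ 2 + 2 * (Q ^+ 2 * (d1' * d2'))); last by ring.
  by move: q1 q2 q3 q4; clear; lra.
apply: le_trans (ler_pM _ _ (cg i j) m) _ => //; first by rewrite mulr_ge0// exprn_ge0.
rewrite [leLHS](_ : _ = C * n1 (s - t) ^+ 2 * (4 * (rho * tau)) ^+ (i + j)); last by rewrite !exprMn; ring.
rewrite (_ : tau ^+ 2 * _ = C * n1 (s - t) ^+ 2 * 2^-1 ^+ (i + j)); last by field; rewrite gt_eqF.
rewrite ler_wpM2l ?mulr_ge0 ?exprn_ge0// lerXn2r// ?nnegrE ?mulr_ge0//; lra.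
Qed.

End C11_series.

Definition trunc n c i j := if (i < n)%N && (j < n)%N then c i j else 0.

Lemma dsum_finite n (a : nat -> nat -> R) :
  (forall i j, ~~ ((i < n)%N && (j < n)%N) -> a i j = 0) -> dsum a = psq a n.
Proof.
move=> a0; have E m : (n <= m)%N -> psq a m = psq a n.
  move=> nm; rewrite /psq (big_ord_widen m (fun i => \sum_(j < n) a i j))//.
  rewrite [RHS]big_mkcond; apply: eq_bigr => i _; case: ifPn => [iN|iN].
    rewrite [RHS](big_ord_widen m (fun j => a i j))// [RHS]big_mkcond; apply: eq_bigr => j _.
    by case: ifPn => // jN; rewrite a0// negb_and jN orbT.
  by rewrite big1// => j _; rewrite a0// negb_and iN.
apply: cvg_lim => //; apply/cvgrPdist_lt => e e0; exists n => // m /= nm.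
by rewrite E// subrr normr0.
Qed.

Lemma ev_trunc n c t : ev (trunc n c) t = \sum_(i < n) \sum_(j < n) c i j * t.1 ^+ i * t.2 ^+ j.
Proof.
rewrite /ev (@dsum_finite n); last by move=> i j ij; rewrite /trunc (negbTE ij) !mul0r.
by apply: eq_bigr => i _; apply: eq_bigr => j _; rewrite /trunc !ltn_ord.
Qed.

(** Both exponents are at most [k / 2], so the total degree is at most [k]. *)
Lemma polyf_trunc k c : polyf k (ev (trunc (k./2).+1 c)).
Proof.
have -> : ev (trunc (k./2).+1 c) = fun t => \sum_(i < (k./2).+1) \sum_(j < (k./2).+1) c i j * t.1 ^+ i * t.2 ^+ j.
  by apply/funext => t; rewrite ev_trunc.
apply: polyf_sum => i; apply: polyf_sum => j.
apply: (@polyf_le R (i + j)); first by have := ltn_ord i; have := ltn_ord j; lia.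
by under eq_fun do rewrite -mulrA; apply: polyf_scale; exact: polyf_monomial.
Qed.

Lemma geo_trunc C rho n c : 0 <= rho -> geo C rho c -> geo C rho (trunc n c).
Proof.
move=> r0 cg i j; rewrite /trunc; case: ifP => _; first exact: cg.
by rewrite normr0 mulr_ge0 ?(geo_ge0 cg)// exprn_ge0.
Qed.

(** Only terms with [i + j >= n] remain, and for these a factor 4 in the ratio is worth [4^-n] in
    the constant. *)
Lemma geo_tail C rho n c : 0 <= rho -> geo C rho c ->
  geo (C * 4^-1 ^+ n) (4 * rho) (fun i j => 1 * c i j + (-1) * trunc n c i j).
Proof.
move=> r0 cg i j; have C0 := geo_ge0 cg; rewrite mul1r mulN1r /trunc.
case: ifPn => [_|ij].
  by rewrite subrr normr0 !mulr_ge0 ?exprn_ge0// mulr_ge0.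
rewrite subr0; apply: le_trans (cg i j) _; rewrite -mulrA ler_wpM2l// exprMn mulrA.
rewrite ler_peMl ?exprn_ge0// exprVn mulrC ler_pdivlMr ?exprn_gt0// mul1r ler_weXn2l//; first lra.
by move: ij; rewrite negb_and -!leqNgt; lia.
Qed.

(** The approximant of index [k] is the truncation at [n = k / 2 + 1], with tail constant
    [4^-n <= 2^-k]. The tail has ratio [4 rho]; the condition [32 rho tau <= 1] leaves room for
    differentiating it and bounds the constant [8 * (4 rho)] of the result by [1 / tau]. *)
Lemma tame_ev (tau rho C Gam : R) c : 0 < tau -> tau <= 1 -> 0 <= rho -> rho * tau <= 32^-1 ->
  geo C rho c -> 8 * C / tau ^+ 2 <= Gam ->
  tame Gam (box tau) (ev c) (ev (dx c)) (ev (dy c)).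
Proof.
move=> tau0 tau1 r0 rt cg hG; have C0 := geo_ge0 cg.
have rt8 : rho * tau <= 8^-1 by lra.
split; first exact: (C11_ev tau0 tau1 r0 rt8 cg hG).
move=> k; set n := (k./2).+1; pose c' := trunc n c.
have cg' : geo C rho c' by exact: geo_trunc.
exists (ev c'), (ev (dx c')), (ev (dy c')); split; first exact: polyf_trunc.
  exact: (C11_ev tau0 tau1 r0 rt8 cg' hG).
have p4 : (4^-1 : R) ^+ n <= 2^-1 ^+ k.
  rewrite expr4 -exprD; apply: ler_wiXn2l; [lra|lra|].
  by rewrite /n; lia.
have tl := geo_tail n r0 cg.
have r40 : 0 <= 4 * rho by lra.
have CG : C / tau <= Gam.
  apply: le_trans hG; rewrite expr2 invfM mulrA ler_wpM2r ?invr_ge0 ?(ltW tau0)//.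
  rewrite ler_pdivlMr//; have := ler_wpM2l C0 tau1; lra.
have C8G : 8 * C <= Gam.
  apply: le_trans hG; rewrite ler_pdivlMr ?exprn_gt0// ler_piMr ?mulr_ge0//.
  by rewrite exprn_ile1// ltW.
have fin (x : R) : x <= 8 * (C * 4^-1 ^+ n * (4 * rho)) -> x <= Gam * 2^-1 ^+ k.
  move/le_trans; apply; apply: (@le_trans _ _ (C / tau * 4^-1 ^+ n)); last first.
    by apply: ler_pM => //; rewrite ?divr_ge0 ?exprn_ge0// ltW.
  rewrite (_ : 8 * _ = C * 4^-1 ^+ n * (32 * rho)); last by ring.
  rewrite [leRHS]mulrAC ler_wpM2l ?mulr_ge0 ?exprn_ge0// -[tau^-1]mul1r ler_pdivlMr//; lra.
move=> t bt; split.
- have rt2 : rho * tau <= 2^-1 by lra.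
  have := ev_lin r0 1 (-1) rt2 cg cg' bt; rewrite mul1r mulN1r => <-.
  have rt3 : 4 * rho * tau <= 2^-1 by lra.
  apply: le_trans (ev_bound r40 rt3 tl bt) _; rewrite mulrA.
  by apply: ler_pM => //; rewrite ?mulr_ge0 ?exprn_ge0.
- have r20 : 0 <= 2 * rho by lra.
  have rt2 : 2 * rho * tau <= 2^-1 by lra.
  have := ev_lin r20 1 (-1) rt2 (geo_dx r0 cg) (geo_dx r0 cg') bt; rewrite mul1r mulN1r => <-.
  have tlx := geo_dx r40 tl.
  have -> : (fun i j => 1 * dx c i j + (-1) * dx c' i j) = dx (fun i j => 1 * c i j + (-1) * c' i j).
    by apply/funext => i; apply/funext => j; rewrite /dx; ring.
  have rt3 : 2 * (4 * rho) * tau <= 2^-1 by lra.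
  have r80 : 0 <= 2 * (4 * rho) by lra.
  by apply: fin; exact: (ev_bound r80 rt3 tlx bt).
- have r20 : 0 <= 2 * rho by lra.
  have rt2 : 2 * rho * tau <= 2^-1 by lra.
  have := ev_lin r20 1 (-1) rt2 (geo_dy r0 cg) (geo_dy r0 cg') bt; rewrite mul1r mulN1r => <-.
  have tlx := geo_dy r40 tl.
  have -> : (fun i j => 1 * dy c i j + (-1) * dy c' i j) = dy (fun i j => 1 * c i j + (-1) * c' i j).
    by apply/funext => i; apply/funext => j; rewrite /dy; ring.
  have rt3 : 2 * (4 * rho) * tau <= 2^-1 by lra.
  have r80 : 0 <= 2 * (4 * rho) by lra.
  by apply: fin; exact: (ev_bound r80 rt3 tlx bt).
Qed.

Lemma cvg_quadratic (f : R -> R) (x l Gam eta : R) : 0 < eta ->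
  (forall h, `|h| < eta -> `|f (h + x) - f x - l * h| <= Gam * h ^+ 2) ->
  (fun h : R => h^-1 *: (f (h + x) - f x)) @ 0^' --> l.
Proof.
move=> eta0 hf; apply/cvgrPdist_lt => e e0; rewrite near_withinE.
pose G := `|Gam| + 1.
have G0 : 0 < G by rewrite ltr_wpDl.
have d0 : 0 < Num.min eta (e / G) by rewrite lt_min eta0 divr_gt0.
exists (Num.min eta (e / G)) => // h /=; rewrite sub0r normrN lt_min => /andP[h1 h2] h0.
have hn0 : 0 < `|h| by rewrite normr_gt0.
have := hf h h1; rewrite -(@ltr_pM2l _ `|h|)// -normrM => h3.
rewrite (_ : h * _ = - (f (h + x) - f x - l * h)); last first.
  by rewrite /GRing.scale/= mulrBr mulrA divff// mul1r; ring.
rewrite normrN; apply: le_lt_trans h3 _; rewrite -[h ^+ 2]real_normK ?num_real// expr2 mulrA mulrC ltr_pM2l//.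
apply: (@le_lt_trans _ _ (`|h| * G)); last by rewrite -ltr_pdivlMr.
by rewrite mulrC ler_wpM2l//; apply: le_trans (ler_norm _) _; rewrite /G lerDl.
Qed.

Lemma derive1_quadratic (f : R -> R) (x l Gam eta : R) : 0 < eta ->
  (forall h, `|h| < eta -> `|f (h + x) - f x - l * h| <= Gam * h ^+ 2) -> derive1 f x = l.
Proof. by move=> eta0 hf; apply: cvg_lim => //; exact: cvg_quadratic eta0 hf. Qed.

Lemma sq0_box (tau : R) t : sq0 tau t -> box tau t.
Proof. by move=> [t1 t2]; split; apply: ltW. Qed.

Lemma sq0_le (a b : R) t : a <= b -> sq0 a t -> sq0 b t.
Proof. by move=> ab [t1 t2]; split; [exact: lt_le_trans ab|exact: lt_le_trans ab]. Qed.

Section partials.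
Variables (tau rho C : R) (c : nat -> nat -> R) (f : R * R -> R).
Hypotheses (tau0 : 0 < tau) (tau1 : tau <= 1) (rho0 : 0 <= rho) (rt : rho * tau <= 8^-1).
Hypotheses (cg : geo C rho c) (fe : forall t, sq0 tau t -> f t = ev c t).

Lemma sq0_small t : sq0 tau t -> exists2 e' : R, 0 < e' &
  forall h, `|h| < e' -> sq0 tau (h + t.1, t.2) /\ sq0 tau (t.1, h + t.2).
Proof.
move=> [t1 t2]; exists (Num.min (tau - `|t.1|) (tau - `|t.2|)).
  by rewrite lt_min !subr_gt0 t1.
move=> h; rewrite lt_min => /andP[h1 h2].
have := ler_normD h t.1; have := ler_normD h t.2.
by move=> a1 a2; split; split => //=; lra.
Qed.

Lemma d1_ev t : sq0 tau t -> d1 f t = ev (dx c) t.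
Proof.
move=> st; have [e e0 he] := sq0_small st.
have cc := C11_ev tau0 tau1 rho0 rt cg (lexx _).
rewrite /d1; apply: (@derive1_quadratic _ _ _ (8 * C / tau ^+ 2) e e0) => h hh.
have [sh _] := he h hh; rewrite fe// fe; last by case: st.
have [+ _ _ _ _] := cc _ _ (sq0_box sh) (sq0_box st).
rewrite -!surjective_pairing /n1/= subrr mulr0 addr0 normr0 addr0 addrK real_normK ?num_real//.
Qed.

Lemma d2_ev t : sq0 tau t -> d2 f t = ev (dy c) t.
Proof.
move=> st; have [e e0 he] := sq0_small st.
have cc := C11_ev tau0 tau1 rho0 rt cg (lexx _).
rewrite /d2; apply: (@derive1_quadratic _ _ _ (8 * C / tau ^+ 2) e e0) => h hh.
have [_ sh] := he h hh; rewrite fe// fe; last by case: st.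
have [+ _ _ _ _] := cc _ _ (sq0_box sh) (sq0_box st).
rewrite -!surjective_pairing /n1/= subrr mulr0 add0r normr0 add0r addrK real_normK ?num_real//.
Qed.

End partials.

(** Cauchy's estimate: absolute convergence at the point [(r / 2, r / 2)] bounds every single term
    by the sum. *)
Lemma analytic_ev (f : R * R -> R) : analytic_near0 f ->
  exists C rho r c, [/\ 0 < rho, 0 < r, geo C rho c & forall t, sq0 r t -> f t = ev c t].
Proof.
move=> [r r0 [c hc]]; pose s : R := r / 2.
have s0 : 0 < s by rewrite divr_gt0.
have sr : s < r by rewrite /s; lra.
have ns : `|s| = s by rewrite gtr0_norm.
have [cv _] := hc (s, s) (eq_ind_r (fun x => x < r) sr ns) (eq_ind_r (fun x => x < r) sr ns).
set u := (X in cvgn X) in cv; pose C := limn u.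
have nd : nondecreasing_seq u.
  apply/nondecreasing_seqP => n; rewrite /u/= !ns big_ord_recr/=.
  rewrite -[leLHS]addr0 lerD//; last by apply: sumr_ge0 => j _; rewrite !mulr_ge0 ?exprn_ge0// ltW.
  apply: ler_sum => i _; rewrite big_ord_recr/= lerDl !mulr_ge0 ?exprn_ge0// ltW//.
have uC n : u n <= C by exact: nondecreasing_cvgn_le.
exists C, s^-1, r, c; split => //; first by rewrite invr_gt0.
  move=> i j; rewrite exprVn ler_pdivlMr ?exprn_gt0// exprD mulrA.
  apply: le_trans (uC (maxn i j).+1); rewrite /u/= !ns.
  have li : (i < (maxn i j).+1)%N by rewrite ltnS leq_maxl.
  have lj : (j < (maxn i j).+1)%N by rewrite ltnS leq_maxr.
  rewrite (bigD1 (Ordinal li))//= (bigD1 (Ordinal lj))//= -[leLHS]addr0 -addrA lerD//.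
  apply: addr_ge0; apply: sumr_ge0 => k _; last (apply: sumr_ge0 => l _);
    by rewrite !mulr_ge0 ?exprn_ge0// ltW.
by move=> t [t1 t2]; have [_ cv'] := hc t t1 t2; rewrite /ev /dsum; apply/esym; exact: cvg_lim.
Qed.

Lemma measurable_sq0 (r : R) : measurable (sq0 r : set (TR2 R)).
Proof.
rewrite (_ : sq0 r = `]-r, r[%classic `*` `]-r, r[%classic); first exact: measurableX.
by apply/seteqP; split => t; rewrite /sq0 /setX/= !in_itv/= -!ltr_norml.
Qed.

Lemma measurable_box (r : R) : measurable (box r : set (TR2 R)).
Proof.
rewrite (_ : box r = `[-r, r]%classic `*` `[-r, r]%classic); first exact: measurableX.
by apply/seteqP; split => t; rewrite /box /setX/= !in_itv/= -!ler_norml.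
Qed.

Lemma measurable_ev (rho tau C : R) c : 0 <= rho -> rho * tau <= 2^-1 -> geo C rho c ->
  measurable_fun (box tau : set (TR2 R)) (ev c).
Proof.
move=> r0 rt cg.
apply: (@measurable_fun_cvg _ (TR2 R) R (box tau) (fun n t => \sum_(i < n) \sum_(j < n) c i j * t.1 ^+ i * t.2 ^+ j)).
  move=> n; apply: measurable_sum => i; apply: measurable_sum => j.
  apply: measurable_funM; first apply: measurable_funM => //.
    by apply: measurable_funX; apply: measurable_funTS; exact: measurable_fst.
  by apply: measurable_funX; apply: measurable_funTS; exact: measurable_snd.
move=> t bt; have h := fun n => dsum_approx n (ev_dom r0 rt cg bt).
have C0 := geo_ge0 cg.
apply/cvgrPdist_le => /= e e0; have [m hm] := @geometric_small R (8 * C) 2^-1 e ltac:(lra) ltac:(lra) e0.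
exists m => // n /= mn; rewrite distrC; apply: le_trans (h n) _; apply: le_trans (ltW hm).
by rewrite ler_wpM2l ?mulr_ge0//; apply: ler_wiXn2l => //; lra.
Qed.

End analytic.

(** * Weierstrass division *)

Section weierstrass.
Variable R : realType.
Variables (q f : nat -> nat -> R) (d : nat).
Implicit Types A : nat -> nat -> R.

(** The coefficient of [x^i y^(j + d)] in [A q = f], solved for [A i j], when [q] has no terms [y^l]
    with [l < d] and its coefficient of [y^d] is 1. *)
Definition wstep A i j :=
  f i (j + d)%N - \sum_(l < j) A i l * q 0 (j + d - l)%N -
  \sum_(k < i) \sum_(l < (j + d).+1) A k l * q (i - k)%N (j + d - l)%N.

Definition witer n := iter n wstep (fun _ _ => 0).

(** Well-founded recursion on the weight [(d + 1) i + j], expressed by iteration from zero: an entry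
    is stable once the number of iterations exceeds its weight. *)
Definition wquo i j := witer (d.+1 * i + j).+1 i j.

Lemma weight_lt i j k l : (k < i)%N -> (l < (j + d).+1)%N -> (d.+1 * k + l < d.+1 * i + j)%N.
Proof. nia. Qed.

(* The right-hand side of the recursion only involves coefficients of smaller weight [(d+1) i + j]. *)
Lemma wstep_ext A A' i j :
  (forall k l, (d.+1 * k + l < d.+1 * i + j)%N -> A k l = A' k l) -> wstep A i j = wstep A' i j.
Proof.
move=> AA'; rewrite /wstep; congr (_ - _ - _).
  by apply: eq_bigr => l _; rewrite AA'// ltn_add2l.
apply: eq_bigr => k _; apply: eq_bigr => l _; rewrite AA'//.
exact: weight_lt.
Qed.

Lemma witer_stable n i j : (d.+1 * i + j < n)%N -> witer n.+1 i j = witer n i j.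
Proof.
elim: n i j => // n IH i j w.
rewrite /witer !iterS; apply: wstep_ext => k l kl; apply: IH; lia.
Qed.

Lemma witer_wquo n i j : (d.+1 * i + j < n)%N -> witer n i j = wquo i j.
Proof.
elim: n => // n IH; rewrite ltnS leq_eqVlt => /orP[/eqP <-//|w].
by rewrite witer_stable// IH.
Qed.

Lemma wquoE i j : wquo i j = wstep wquo i j.
Proof. by rewrite {1}/wquo /witer iterS; apply: wstep_ext => k l /witer_wquo. Qed.

Lemma conv_wquo i j : (forall l, (l < d)%N -> q 0 l = 0) -> q 0 d = 1 ->
  conv wquo q i (j + d)%N = f i (j + d)%N.
Proof.
move=> q0 q1; rewrite /conv big_ord_recr/= subnn.
have -> : \sum_(l < (j + d).+1) wquo i l * q 0 (j + d - l)%N =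
    \sum_(l < j) wquo i l * q 0 (j + d - l)%N + wquo i j.
  have -> : wquo i j = wquo i j * q 0 (j + d - j)%N by rewrite addKn q1 mulr1.
  rewrite -(@big_ord_recr R 0 _ j (fun l => wquo i l * q 0 (j + d - l)%N)).
  rewrite [RHS](big_ord_widen (j + d).+1 (fun l => wquo i l * q 0 (j + d - l)%N)); last by rewrite ltnS leq_addr.
  rewrite [RHS]big_mkcond; apply: eq_bigr => l _; case: ifPn => //; rewrite -leqNgt => jl.
  by rewrite q0 ?mulr0//; have := ltn_ord l; lia.
by rewrite [wquo i j]wquoE /wstep; ring.
Qed.

Lemma sum_geometric_le (rho sig : R) n : 0 < rho -> 2 * rho <= sig ->
  \sum_(l < n.+1) sig ^+ l * rho ^+ (n - l) <= 2 * sig ^+ n.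
Proof.
move=> r0 rs; have s0 : 0 < sig by lra.
elim: n => [|n IH]; first by rewrite big_ord_recr big_ord0/= !expr0; lra.
rewrite big_ord_recr/= subnn expr0 mulr1.
have -> : \sum_(i < n.+1) sig ^+ i * rho ^+ (n.+1 - i) = rho * \sum_(i < n.+1) sig ^+ i * rho ^+ (n - i).
  rewrite mulr_sumr; apply: eq_bigr => i _; rewrite subSn ?exprS; first ring.
  by rewrite -ltnS.
have := ler_wpM2l (ltW r0) IH; have := ler_wpM2r (exprn_ge0 n (ltW s0)) rs.
by rewrite exprS; lra.
Qed.

Lemma sum_geometric_lt (rho sig : R) n : 0 < rho -> 2 * rho <= sig ->
  sig * \sum_(l < n) sig ^+ l * rho ^+ (n - l) <= 2 * rho * sig ^+ n.
Proof.
move=> r0 rs; have s0 : 0 < sig by lra.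
case: n => [|n]; first by rewrite big_ord0 mulr0 expr0 mulr1 mulr_ge0// ltW.
have -> : \sum_(i < n.+1) sig ^+ i * rho ^+ (n.+1 - i) = rho * \sum_(i < n.+1) sig ^+ i * rho ^+ (n - i).
  rewrite mulr_sumr; apply: eq_bigr => i _; rewrite subSn ?exprS; first ring.
  by rewrite -ltnS.
rewrite mulrA exprS (_ : 2 * rho * _ = sig * rho * (2 * sig ^+ n)); last by ring.
by rewrite ler_wpM2l ?mulr_ge0 ?(ltW s0) ?(ltW r0)// sum_geometric_le.
Qed.

Section wquo_bound.
Variables (Cq Cf rho sig P : R).
Hypotheses (rho0 : 0 < rho) (qg : geo Cq rho q) (fg : geo Cf rho f).
Hypotheses (s1 : 2 * rho <= sig) (s2 : 6 * Cq * rho ^+ d.+1 <= sig).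
Hypotheses (P1 : 2 * rho <= P) (P2 : 12 * Cq * rho * sig ^+ d <= P).

Let K := 3 * Cf * rho ^+ d.

(** Induction on the weight, each of the three terms of [wstep] taking one third of the bound: [K]
    is made for [f], [s2] for the sum in row [i], [P2] for the earlier rows. Those reach up to
    column [j + d] and lose [sig^d], so the ratio [P] in [x] is chosen after the ratio [sig] in
    [y]. *)
Lemma wquo_le i j : `|wquo i j| <= K * P ^+ i * sig ^+ j.
Proof.
have [n] := ubnP (d.+1 * i + j); elim: n i j => // n IH i j; rewrite ltnS => w.
have Cq0 := geo_ge0 qg; have Cf0 := geo_ge0 fg; have r0 := ltW rho0.
have s0 : 0 < sig by have := rho0; have := s1; lra.
have p0 : 0 < P by have := rho0; have := P1; lra.
have K0 : 0 <= K by rewrite /K !mulr_ge0// exprn_ge0.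
rewrite wquoE /wstep.
have -> : K * P ^+ i * sig ^+ j = K * P ^+ i * sig ^+ j / 3 + K * P ^+ i * sig ^+ j / 3 + K * P ^+ i * sig ^+ j / 3 by field.
have Ps0 : 0 <= P ^+ i * sig ^+ j by rewrite mulr_ge0// exprn_ge0// ltW.
apply: le_trans (ler_normB _ _) _; apply: lerD; first (apply: le_trans (ler_normB _ _) _; apply: lerD).
- apply: le_trans (fg _ _) _; rewrite (_ : K * _ * _ / 3 = Cf * (rho ^+ d * (P ^+ i * sig ^+ j))); last by rewrite /K; field.
  rewrite ler_wpM2l// addnA addnC exprD ler_wpM2l ?exprn_ge0// exprD.
  by apply: ler_pM; rewrite ?exprn_ge0// lerXn2r ?nnegrE ?(ltW p0) ?(ltW s0)//; have := s1; have := P1; have := rho0; lra.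
- apply: (@le_trans _ _ (\sum_(l < j) K * P ^+ i * Cq * rho ^+ d * (sig ^+ l * rho ^+ (j - l)))).
    apply: le_trans (ler_norm_sum _ _ _) _; apply: ler_sum => l _; rewrite normrM.
    have lj := ltn_ord l.
    rewrite (_ : K * P ^+ i * Cq * _ * _ = K * P ^+ i * sig ^+ l * (Cq * rho ^+ (0 + (j + d - l)))); last first.
      by rewrite add0n -addnBAC ?(ltnW lj)// exprD; ring.
    have wl : (d.+1 * i + l < n)%N by apply: leq_trans w; rewrite ltn_add2l.
    exact: ler_pM (normr_ge0 _) (normr_ge0 _) (IH _ _ wl) (qg 0 _).
  rewrite -mulr_sumr -(@ler_pM2l _ sig)//.
  have := sum_geometric_lt j rho0 s1; set U := \sum_(l < j) _ => hU.
  rewrite (_ : sig * (_ * _ * _ * _ * U) = K * P ^+ i * Cq * rho ^+ d * (sig * U)); last by ring.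
  apply: (@le_trans _ _ (K * P ^+ i * Cq * rho ^+ d * (2 * rho * sig ^+ j))).
    by rewrite ler_wpM2l// !mulr_ge0 ?exprn_ge0// ltW.
  rewrite (_ : K * _ * _ * _ * _ = K * (P ^+ i * sig ^+ j) / 3 * (6 * Cq * rho ^+ d.+1)); last by rewrite exprS; field.
  rewrite (_ : sig * _ = K * (P ^+ i * sig ^+ j) / 3 * sig); last by field.
  by rewrite ler_wpM2l// divr_ge0// mulr_ge0.
- apply: (@le_trans _ _ (\sum_(k < i) \sum_(l < (j + d).+1) K * Cq * (P ^+ k * rho ^+ (i - k)) * (sig ^+ l * rho ^+ (j + d - l)))).
    apply: le_trans (ler_norm_sum _ _ _) _; apply: ler_sum => k _.
    apply: le_trans (ler_norm_sum _ _ _) _; apply: ler_sum => l _; rewrite normrM.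
    have ki := ltn_ord k; have lj := ltn_ord l.
    rewrite (_ : K * Cq * _ * _ = K * P ^+ k * sig ^+ l * (Cq * rho ^+ (i - k + (j + d - l)))); last first.
      by rewrite exprD; ring.
    have wl : (d.+1 * k + l < n)%N by apply: leq_trans w; exact: weight_lt.
    exact: ler_pM (normr_ge0 _) (normr_ge0 _) (IH _ _ wl) (qg _ _).
  have -> : \sum_(k < i) \sum_(l < (j + d).+1) K * Cq * (P ^+ k * rho ^+ (i - k)) * (sig ^+ l * rho ^+ (j + d - l)) =
     K * Cq * (\sum_(k < i) P ^+ k * rho ^+ (i - k)) * (\sum_(l < (j + d).+1) sig ^+ l * rho ^+ (j + d - l)).
    rewrite [K * Cq * \sum_(_ < _) _]mulr_sumr mulr_suml; apply: eq_bigr => k _.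
    by rewrite mulr_sumr.
  have hV := sum_geometric_le (j + d) rho0 s1; have hU := sum_geometric_lt i rho0 P1.
  move: hU hV; set U := \sum_(k < i) _; set V := \sum_(l < _) _ => hU hV.
  have U0 : 0 <= U by apply: sumr_ge0 => k _; rewrite mulr_ge0// exprn_ge0// ltW.
  have V0 : 0 <= V by apply: sumr_ge0 => k _; rewrite mulr_ge0// exprn_ge0// ltW.
  rewrite -(@ler_pM2l _ P)// (_ : P * (_ * _ * U * V) = K * Cq * ((P * U) * V)); last by ring.
  apply: (@le_trans _ _ (K * Cq * (2 * rho * P ^+ i * (2 * sig ^+ (j + d))))).
    exact: (ler_wpM2l (mulr_ge0 K0 Cq0) (ler_pM (mulr_ge0 (ltW p0) U0) V0 hU hV)).
  rewrite (_ : K * _ * _ = K * (P ^+ i * sig ^+ j) / 3 * (12 * Cq * rho * sig ^+ d)); last by rewrite exprD; field.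
  rewrite (_ : P * _ = K * (P ^+ i * sig ^+ j) / 3 * P); last by field.
  by rewrite ler_wpM2l// divr_ge0// mulr_ge0.
Qed.

End wquo_bound.

End weierstrass.

Section division.
Variable R : realType.
Implicit Types q f : nat -> nat -> R.

(** The quotient is the recursively defined one for [q] divided by its coefficient of [y^d]; the
    remainder is defined as [f - A q], and the recursion says that it has degree below [d] in
    [y]. *)
Lemma weierstrass_division q f d Cq Cf (rho : R) : 0 < rho -> geo Cq rho q -> geo Cf rho f ->
  (forall l, (l < d)%N -> q 0 l = 0) -> q 0 d != 0 ->
  exists A B C (rho' : R), [/\ rho <= rho', geo C rho' A, geo C rho' B,
    f = (fun i j => 1 * conv A q i j + 1 * B i j) & forall i j, (d <= j)%N -> B i j = 0].
Proof.
move=> r0 qg fg q0 qd; pose z := q 0 d.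
pose q' i j := z^-1 * q i j.
have qg' : geo (`|z^-1| * Cq) rho q'.
  by move=> i j; rewrite normrM -mulrA ler_wpM2l.
have q0' l : (l < d)%N -> q' 0 l = 0 by move=> ld; rewrite /q' q0 ?mulr0.
have qd' : q' 0 d = 1 by rewrite /q' mulVf.
set Cq' := `|z^-1| * Cq in qg'.
pose sig := Num.max (2 * rho) (6 * Cq' * rho ^+ d.+1).
pose P := Num.max (2 * rho) (12 * Cq' * rho * sig ^+ d).
have s1 : 2 * rho <= sig by rewrite le_max lexx.
have s2 : 6 * Cq' * rho ^+ d.+1 <= sig by rewrite le_max lexx orbT.
have P1 : 2 * rho <= P by rewrite le_max lexx.
have P2 : 12 * Cq' * rho * sig ^+ d <= P by rewrite le_max lexx orbT.
have bd := wquo_le r0 qg' fg s1 s2 P1 P2.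
set K := 3 * Cf * rho ^+ d in bd.
have Cf0 := geo_ge0 fg.
have K0 : 0 <= K by rewrite /K !mulr_ge0// exprn_ge0// ltW.
pose M := Num.max P sig.
have MP : P <= M by rewrite le_max lexx.
have Ms : sig <= M by rewrite le_max lexx orbT.
pose A i j := z^-1 * wquo q' f d i j.
have Ag : geo (`|z^-1| * K) M A.
  move=> i j; rewrite normrM -mulrA ler_wpM2l// exprD mulrA; apply: le_trans (bd i j) _.
  by apply: ler_pM; rewrite ?mulr_ge0 ?exprn_ge0// ?ler_wpM2l ?lerXn2r ?nnegrE//; lra.
have rM : rho <= M by lra.
have M0 : 0 < M by lra.
have Aq : conv A q = conv (wquo q' f d) q'.
  apply/funext => i; apply/funext => j; apply: eq_bigr => k _; apply: eq_bigr => l _.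
  by rewrite /A /q'; ring.
have qgM : geo Cq M q by apply: geo_le qg => //; exact: ltW.
have fgM : geo Cf M f by apply: geo_le fg => //; exact: ltW.
have cg := geo_conv M0 Ag qgM.
have M20 : 0 <= 2 * M by lra.
have fg2 : geo Cf (2 * M) f by apply: geo_le fgM => //; lra.
pose B i j := 1 * f i j + (-1) * conv A q i j.
have Bg := geo_lin 1 (-1) fg2 cg.
exists A, B, (Num.max (`|z^-1| * K) (`|1| * Cf + `|-1| * (4 * (`|z^-1| * K) * Cq))), (2 * M); split.
- lra.
- by apply: geo_le Ag; rewrite ?le_max ?lexx//; lra.
- by apply: geo_le Bg; rewrite ?le_max ?lexx ?orbT//.
- by apply/funext => i; apply/funext => j; rewrite /B; ring.
- move=> i j dj; rewrite /B Aq -(subnK dj) conv_wquo//; ring.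
Qed.

End division.

(** * Curves of common zeros *)

Section germs.
Variable R : realType.
Implicit Types (c d q h : nat -> nat -> R) (t : R * R) (Z : set (R * R)) (P : R * R -> Prop).

Definition near0 P := exists2 r : R, 0 < r & forall t, sq0 r t -> P t.

Lemma near0_and P P' : near0 P -> near0 P' -> near0 (fun t => P t /\ P' t).
Proof.
move=> [r r0 h] [r' r0' h']; exists (Num.min r r'); first by rewrite lt_min r0.
by move=> t st; split; [apply: h|apply: h']; apply: sq0_le st; rewrite ge_min lexx ?orbT.
Qed.

Lemma near0_imp P P' : (forall t, P t -> P' t) -> near0 P -> near0 P'.
Proof. by move=> PP [r r0 h]; exists r => // t /h/PP. Qed.

Lemma near0_all (k : nat) (P : nat -> R * R -> Prop) :
  (forall j, (j < k)%N -> near0 (P j)) -> near0 (fun t => forall j, (j < k)%N -> P j t).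
Proof.
elim: k => [|k IH] h; first by exists 1.
have h1 := IH (fun j jk => h j (ltn_trans jk (ltnSn k))).
apply: near0_imp (near0_and h1 (h k (ltnSn k))) => t [a b] j.
by rewrite ltnS leq_eqVlt => /orP[/eqP ->//|]; exact: a.
Qed.

Definition germ c := exists C rho : R, 0 < rho /\ geo C rho c.

Lemma germ_dy c : germ c -> germ (dy c).
Proof.
move=> [C [rho [r0 cg]]]; exists (C * rho), (2 * rho); split; first by rewrite mulr_gt0.
by apply: geo_dy => //; exact: ltW.
Qed.

Lemma germ_iter_dy c j : germ c -> germ (iter j (@dy R) c).
Proof. by move=> cg; elim: j => // j; rewrite iterS; exact: germ_dy. Qed.

Lemma germ2 c d : germ c -> germ d -> exists C rho : R, [/\ 0 < rho, geo C rho c & geo C rho d].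
Proof.
move=> [C [rho [r0 cg]]] [C' [rho' [r0' dg]]].
exists (Num.max C C'), (Num.max rho rho'); split; first by rewrite lt_max r0.
  by apply: geo_le cg; rewrite ?le_max ?lexx//; exact: ltW.
by apply: geo_le dg; rewrite ?le_max ?lexx ?orbT//; exact: ltW.
Qed.

Lemma small_radius (rho e : R) : 0 < rho -> 0 < e -> exists2 tau : R, 0 < tau <= 1 & rho * tau <= e.
Proof.
move=> r0 e0; exists (Num.min 1 (e / rho)).
  by rewrite lt_min ltr01 divr_gt0//= ge_min lexx.
by rewrite mulrC -ler_pdivlMr// ge_min lexx orbT.
Qed.

Lemma near0_ev_lin c d (x y : R) : germ c -> germ d ->
  near0 (fun t => ev (fun i j => x * c i j + y * d i j) t = x * ev c t + y * ev d t).
Proof.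
move=> cg dg; have [C [rho [r0 cg' dg']]] := germ2 cg dg.
have [tau /andP[t0 t1] rt] := small_radius r0 (ltac:(lra) : 0 < (2^-1 : R)).
by exists tau => // t /sq0_box bt; exact: (ev_lin (ltW r0) x y rt cg' dg' bt).
Qed.

Lemma near0_ev_conv c d : germ c -> germ d -> near0 (fun t => ev (conv c d) t = ev c t * ev d t).
Proof.
move=> cg dg; have [C [rho [r0 cg' dg']]] := germ2 cg dg.
have [tau /andP[t0 t1] rt] := small_radius r0 (ltac:(lra) : 0 < (4^-1 : R)).
by exists tau => // t /sq0_box bt; exact: (ev_conv (ltW r0) t0 rt cg' dg' bt).
Qed.

Lemma germ_conv c d : germ c -> germ d -> germ (conv c d).
Proof.
move=> cg dg; have [C [rho [r0 cg' dg']]] := germ2 cg dg.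
exists (4 * C * C), (2 * rho); split; first by rewrite mulr_gt0.
exact: geo_conv.
Qed.

Lemma germ_lin c d (x y : R) : germ c -> germ d -> germ (fun i j => x * c i j + y * d i j).
Proof.
move=> cg dg; have [C [rho [r0 cg' dg']]] := germ2 cg dg.
by exists (`|x| * C + `|y| * C), rho; split => //; exact: geo_lin.
Qed.

Lemma near0_ev_shift c k : germ c -> near0 (fun t => ev (shift k 0 c) t = t.1 ^+ k * ev c t).
Proof.
move=> [C [rho [r0 cg]]].
have [tau /andP[t0 t1] rt] := small_radius r0 (ltac:(lra) : 0 < (2^-1 : R)).
by exists tau => // t /sq0_box bt; exact: (ev_shift (ltW r0) k rt cg bt).
Qed.

Lemma ev0 c : ev c 0 = c 0%N 0%N.
Proof.
rewrite /ev (@dsum_finite _ 1) /psq.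
  by rewrite !big_ord_recr !big_ord0/= !expr0 !add0r !mulr1.
move=> i j; case: i => [|i]; case: j => [|j]//= _.
all: by rewrite [X in _ * X ^+ _ * _]/GRing.zero/= [X in _ * X ^+ _]/GRing.zero/= ?expr0 ?expr0n/= ?mulr0 ?mul0r.
Qed.

Lemma germ_lip c : germ c -> exists L : R, exists2 tau : R, 0 < tau &
  forall s t, box tau s -> box tau t -> `|ev c s - ev c t| <= L * n1 (s - t).
Proof.
move=> [C [rho [r0 cg]]].
have [tau /andP[t0 t1] rt] := small_radius r0 (ltac:(lra) : 0 < (4^-1 : R)).
by exists (8 * C / tau), tau => // s t bs bt; exact: (ev_lip t0 (ltW r0) rt cg bs bt).
Qed.

Lemma near0_ev_neq0 c : germ c -> c 0%N 0%N != 0 -> near0 (fun t => ev c t != 0).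
Proof.
move=> cg c0; have [L [tau t0 hL]] := germ_lip cg.
pose e := `|c 0%N 0%N| / (2 * (`|L| + 1)).
have a0 : 0 < `|c 0%N 0%N| by rewrite normr_gt0.
have L0 : 0 < `|L| + 1 by rewrite ltr_wpDl.
have e0 : 0 < e by rewrite divr_gt0// mulr_gt0.
exists (Num.min tau e); first by rewrite lt_min t0.
move=> t st; have st1 : sq0 tau t by apply: sq0_le st; rewrite ge_min lexx.
have [a2 b2] : sq0 e t by apply: sq0_le st; rewrite ge_min lexx orbT.
have b0 : box tau (0 : R * R) by split; rewrite /= normr0 ltW.
have := hL t 0 (sq0_box st1) b0; rewrite ev0 subr0 => h.
apply/eqP => t00; move: h; rewrite t00 sub0r normrN => h.
have : `|c 0%N 0%N| < `|c 0%N 0%N|; last by rewrite ltxx.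
apply: le_lt_trans h _; apply: (@le_lt_trans _ _ ((`|L| + 1) * n1 t)).
  rewrite ler_wpM2r ?n1_ge0//; apply: le_trans (ler_norm _) _; by rewrite lerDl.
rewrite -[ltRHS](@mulfVK _ (2 * (`|L| + 1))) ?gt_eqF ?mulr_gt0// -/e mulrC.
by rewrite (_ : e * _ = (2 * e) * (`|L| + 1)) ?ltr_pM2r//; [rewrite /n1; lra|ring].
Qed.

Definition adherent0 Z := forall r : R, 0 < r -> exists2 t, Z t & sq0 r t.

Definition vanishes c Z := near0 (fun t => Z t -> ev c t = 0).

Definition yorder c n := (forall l, (l < n)%N -> c 0%N l = 0) /\ c 0%N n != 0.

Lemma yorder_exists c l : c 0%N l != 0 -> exists2 n, (n <= l)%N & yorder c n.
Proof.
move=> cl; have ex : exists n, c 0%N n != 0 by exists l.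
case: (ex_minnP ex) => n cn mn; exists n; first exact: mn.
by split=> // k kn; apply/eqP; apply: contraLR kn => /mn; rewrite -leqNgt.
Qed.

(** The first nonzero row gives the power of [x] to remove. What remains does not vanish identically
    on the axis [x = 0], as Weierstrass division requires. *)
Lemma factor_x c i j : germ c -> c i j != 0 ->
  exists b c' l, [/\ germ c', c = shift b 0 c', c' 0%N l != 0 & forall k l', c' k l' = c (k + b)%N l'].
Proof.
move=> [C [rho [r0 cg]]] cij; pose P b := `[< exists l, c b l != 0 >].
have ex : exists b, P b by exists i; apply/asboolP; exists j.
case: (ex_minnP ex) => b /asboolP[l cbl] mb.
exists b, (fun k l' => c (k + b)%N l'), l; split => //.
- exists (C * rho ^+ b), rho; split=> // k l'; apply: le_trans (cg _ _) _.
  by rewrite -mulrA -exprD addnCA addnA.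
- apply/funext => k; apply/funext => l'; rewrite /shift andbT subn0; case: leqP => [bk|kb].
    by rewrite subnK.
  apply/eqP; apply: contraTT kb => ckl; rewrite -leqNgt; apply: mb.
  by apply/asboolP; exists l'.
Qed.

(** Among all series vanishing on a part of [Z] that still accumulates at the origin, [q] has least
    order [d] in [y]. The remainder of [f j] on division by [q] vanishes on that part and has degree
    below [d], so it is zero by minimality. As [dy q] has order [d - 1], by minimality it cannot
    vanish on all of that part near the origin. This replaces a factorisation into irreducible
    germs. *)
Theorem common_zeros_curve (f : nat -> nat -> nat -> R) (k : nat) Z m :
  (0 < k)%N -> (forall j, germ (f j)) -> f 0%N 0%N m != 0 ->
  adherent0 Z -> (forall t, Z t -> t.1 != 0) ->
  (forall j, (j < k)%N -> vanishes (f j) Z) ->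
  exists q, [/\ germ q,
    near0 (fun t => ev q t = 0 -> forall j, (j < k)%N -> ev (f j) t = 0) &
    adherent0 [set t | [/\ Z t, ev q t = 0 & ev (dy q) t != 0]]].
Proof.
move=> k0 fg fm Zacc Z1 fZ.
pose P (d : nat) := `[< exists Z' q, [/\ Z' `<=` Z, adherent0 Z', germ q, yorder q d & vanishes q Z'] >].
have ex : exists d : nat, P d.
  have [n _ yn] := yorder_exists fm; exists n; apply/asboolP; exists Z, (f 0%N); split => //.
  exact: fZ.
case: (ex_minnP ex) => d /asboolP[Z' [q [ZZ Zacc' qg [q0 qd] qv]]] md.
have noV (Z'' : set (R * R)) q' (d' : nat) : Z'' `<=` Z' -> adherent0 Z'' -> germ q' -> yorder q' d' ->
    vanishes q' Z'' -> (d <= d')%N.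
  move=> Z1'' acc2 qg' yq' v'; apply: md; apply/asboolP; exists Z'', q'; split => //.
  exact: subset_trans ZZ.
have d0 : (0 < d)%N.
  case: d qd {q0 md noV} => // qd; exfalso.
  have [r r0 hr] := near0_and qv (near0_ev_neq0 qg qd).
  by have [t Zt st] := Zacc' r r0; have [a b] := hr t st; move: b; rewrite (a Zt) eqxx.
exists q; split => //.
- have : near0 (fun t => forall j, (j < k)%N -> ev q t = 0 -> ev (f j) t = 0).
    apply: near0_all => j jk.
    have [C [rho [r0 qg' fg']]] := germ2 qg (fg j).
    have [A [B [C' [rho' [rr Ag Bg fE Bd]]]]] := weierstrass_division r0 qg' fg' q0 qd.
    have gA : germ A by exists C', rho'; split => //; exact: lt_le_trans rr.
    have gB : germ B by exists C', rho'; split => //; exact: lt_le_trans rr.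
    have L := near0_ev_lin 1 1 (germ_conv gA qg) gB; rewrite -fE in L.
    have Cv := near0_ev_conv gA qg.
    have vB : vanishes B Z'.
      apply: near0_imp (near0_and L (near0_and Cv (near0_and qv (fZ j jk)))) => t [e1 [e2 [e3 e4]]] Zt.
      by move: e1; rewrite e2 e3// e4; [rewrite mulr0 !mul1r add0r => <-|exact: ZZ].
    (* A nonzero remainder, freed from its power of [x], would still vanish on [Z'], where [x] is
       not zero, with an order in [y] below [d]. *)
    have B0 : B = fun _ _ => 0.
      apply: contrapT => Bn; have [i [j' Bij]] : exists i j', B i j' != 0.
        apply: contrapT => h; apply: Bn; apply/funext => i; apply/funext => j'.
        by apply/eqP; apply: contrapT => /negP Bij; apply: h; exists i, j'.
      have [b [B' [l [gB' BE B'l B'E]]]] := factor_x gB Bij.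
      have [n nl yn] := yorder_exists B'l.
      have vB' : vanishes B' Z'.
        apply: near0_imp (near0_and vB (near0_ev_shift b gB')) => t [e1 e2] Zt.
        move: e2; rewrite -BE e1// => /esym/eqP; rewrite mulf_eq0 expf_eq0 (negbTE (Z1 t (ZZ _ Zt))) andbF/=.
        by move/eqP.
      have dn := noV Z' B' n (@subset_refl _ _) Zacc' gB' yn vB'.
      by move: B'l; rewrite B'E Bd ?eqxx// (leq_trans dn nl).
    apply: near0_imp (near0_and L Cv) => t [e1 e2] qt.
    rewrite e1 e2 qt mulr0 mulr0 add0r B0 mul1r /ev.
    by rewrite -[RHS](@dsum0 R); congr dsum; apply/funext => i; apply/funext => j'; rewrite !mul0r.
  by apply: near0_imp => t h qt j jk; exact: h.
- move=> r r0; apply: contrapT => no.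
  have [rq rq0 hq] := qv.
  (* If no simple zero of [q] in [Z] were close to the origin, this set would accumulate there and
     [dy q] would contradict the minimality of [d]. *)
  pose Z'' := [set t | Z' t /\ ev (dy q) t = 0].
  have acc2 : adherent0 Z''.
    move=> e e0; have m0 : 0 < Num.min e (Num.min r rq) by rewrite !lt_min e0 r0.
    have [t Zt st] := Zacc' _ m0.
    have st1 : sq0 e t by apply: sq0_le st; rewrite ge_min lexx.
    have st2 : sq0 r t by apply: sq0_le st; rewrite !ge_min lexx orbT.
    have st3 : sq0 rq t by apply: sq0_le st; rewrite !ge_min lexx !orbT.
    exists t => //; split => //; apply/eqP; apply: contrapT => /negP n0; apply: no.
    by exists t => //; split => //; [exact: ZZ|exact: hq].
  have yd : yorder (dy q) d.-1.
    split=> [l ld|]; rewrite /dy; first by rewrite q0 ?mulr0//; lia.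
    by rewrite prednK// mulf_neq0// pnatr_eq0 -lt0n.
  have vd : vanishes (dy q) Z'' by exists 1 => // t _ [].
  have := noV Z'' (dy q) d.-1 (fun t zt => zt.1) acc2 (germ_dy qg) yd vd; lia.
Qed.

End germs.

(** * Sublevel sets on a line *)

Section chain.
Variable R : realType.

Lemma is_derive_quadratic (f : R -> R) (x l Gam eta : R) : 0 < eta ->
  (forall h, `|h| < eta -> `|f (h + x) - f x - l * h| <= Gam * h ^+ 2) -> is_derive x 1 f l.
Proof.
move=> eta0 hf; have cv := cvg_quadratic eta0 hf.
have e : (fun h => h^-1 *: (f (h *: 1 + x) - f x)) = (fun h : R => h^-1 *: (f (h + x) - f x)).
  by apply/funext => h; rewrite /GRing.scale/= mulr1.
have df : derivable f x 1 by rewrite /derivable e; apply/cvg_ex; exists l.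
by apply: DeriveDef => //; rewrite -derive1E /derive1; exact: cvg_lim cv.
Qed.

Variables (tau : R) (F : nat -> R -> R) (k : nat).
Hypothesis dF : forall j (y : R), (j < k)%N -> `|y| < tau -> is_derive y (1 : R) (F j) (F j.+1 y).

Lemma chain_mvt j a b : (j < k)%N -> a < b -> `|a| < tau -> `|b| < tau ->
  exists2 c, a < c < b & F j b - F j a = F j.+1 c * (b - a).
Proof.
move=> jk ab ha hb.
have inn c : a <= c -> c <= b -> `|c| < tau.
  by move=> ac cb; move: ha hb; rewrite !ltr_norml => /andP[a1 a2] /andP[b1 b2]; apply/andP; split; lra.
have [||c cab e] := @MVT R (F j) (F j.+1) a b ab.
- by move=> c /[!in_itv]/= /andP[ac cb]; apply: dF => //; apply: inn; exact: ltW.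
- apply: derivable_within_continuous => c /[!in_itv]/= /andP[ac cb].
  by have := dF jk (inn c ac cb).
by exists c => //; move: cab; rewrite in_itv.
Qed.

(** The mean value theorem, applied from [F k] down to [F 0], gains one factor of the distance to
    [y0] at each level. *)
Lemma taylor_flat (M y0 y : R) : 0 <= M -> `|y0| < tau -> `|y| < tau ->
  (forall z, `|z| < tau -> `|F k z| <= M) -> (forall j, (j < k)%N -> F j y0 = 0) ->
  `|F 0 y| <= M * `|y - y0| ^+ k.
Proof.
move=> M0 hy0 hy hM F0.
suff h n (z : R) : (n <= k)%N -> `|z| < tau -> `|F (k - n)%N z| <= M * `|z - y0| ^+ n.
  by have := h k y (leqnn k) hy; rewrite subnn.
elim: n z => [|n IH] z nk hz; first by rewrite subn0 expr0 mulr1; exact: hM.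
have kn : (k - n.+1 < k)%N by lia.
have e : (k - n.+1).+1 = (k - n)%N by lia.
have bet (c : R) : `|c| < tau -> `|c - y0| <= `|z - y0| -> F (k - n.+1)%N z = F (k - n)%N c * (z - y0) ->
    `|F (k - n.+1)%N z| <= M * `|z - y0| ^+ n.+1.
  move=> hc cz ->; rewrite normrM exprSr mulrA ler_wpM2r//.
  apply: le_trans (IH c _ hc) _; first lia.
  by rewrite ler_wpM2l// lerXn2r// nnegrE.
have [zy|yz|zy] := ltgtP z y0.
- have [c /andP[c1 c2] ec] := chain_mvt kn zy hz hy0; apply: (bet c).
  + by move: hz hy0; rewrite !ltr_norml => /andP[a1 a2] /andP[b1 b2]; apply/andP; split; lra.
  + rewrite ltr0_norm ?subr_lt0// ltr0_norm ?subr_lt0//; lra.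
  + by move: ec; rewrite F0// e; lra.
- have [c /andP[c1 c2] ec] := chain_mvt kn yz hy0 hz; apply: (bet c).
  + by move: hz hy0; rewrite !ltr_norml => /andP[a1 a2] /andP[b1 b2]; apply/andP; split; lra.
  + rewrite gtr0_norm ?subr_gt0// gtr0_norm ?subr_gt0//; lra.
  + by move: ec; rewrite F0// e; lra.
- by rewrite zy F0// normr0 mulr_ge0// exprn_ge0.
Qed.

(** Van der Corput's constant in units of [s]: each derivative costs an interval of length [4 s] and
    leaves two pieces. *)
Fixpoint vdc (j : nat) : R := if j is j'.+1 then 4 + 2 * vdc j' else 0.

Lemma vdc_ge0 j : 0 <= vdc j.
Proof. by elim: j => //= j IH; lra. Qed.

Local Notation leb := (@lebesgue_measure R).

(* Where [|F_(j+1)| >= c], the set [|F_j| < c s] lies in an interval of length [4 s], and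
   [|F_j| >= c s] on the two intervals that remain. *)
Lemma sublevel_cover n j (I : set R) (c s del : R) : (n + j <= k)%N ->
  (forall a b y, I a -> I b -> a <= y <= b -> I y) -> (forall y, I y -> `|y| < tau) ->
  0 < c -> 0 < s -> del < c * s ^+ j ->
  (forall y, I y -> c <= `|F (n + j)%N y|) ->
  exists2 B : set R, measurable B & (leb B <= (vdc j * s)%:E)%E /\
    forall y, I y -> `|F n y| <= del -> B y.
Proof.
move=> + + + + s0; elim: j I c => [|j IH] I c nk cI It c0 dc hF.
  exists set0 => //; rewrite measure0 mul0r; split => // y Iy /le_lt_trans /(_ dc).
  by rewrite expr0 mulr1 ltNge -[n]addn0 hF.
have nk' : (n + j < k)%N by rewrite -ltnS; lia.
have sep a b : I a -> I b -> c * `|a - b| <= `|F (n + j)%N a - F (n + j)%N b|.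
  have key u v : I u -> I v -> u < v -> c * `|u - v| <= `|F (n + j)%N u - F (n + j)%N v|.
    move=> Iu Iv uv; have [w /andP[w1 w2] e] := chain_mvt nk' uv (It _ Iu) (It _ Iv).
    rewrite distrC [leRHS]distrC e normrM ler_wpM2r// -addnS.
    by apply: hF; apply: (cI u v) => //; rewrite !ltW.
  move=> Ia Ib; have [ab|ba|->] := ltgtP a b.
  - exact: key.
  - by rewrite distrC [leRHS]distrC; exact: key.
  - by rewrite subrr normr0 mulr0.
pose Z := [set y | I y /\ `|F (n + j)%N y| < c * s].
have ccs : 0 < c * s by rewrite mulr_gt0.
have dcs : del < c * s * s ^+ j by rewrite -mulrA -exprS.
have [[z0 [Iz0 Fz0]]|Z0] := pselect (exists y, Z y); last first.
  have [y Iy|B mB [lB hB]] := IH I (c * s) (ltnW nk') cI It ccs dcs.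
    by rewrite leNgt; apply/negP => h; apply: Z0; exists y.
  exists B => //; split => //; apply: le_trans lB _.
  by rewrite lee_fin ler_wpM2r ?(ltW s0)//=; have := vdc_ge0 j; lra.
have near z : Z z -> `|z - z0| <= 2 * s.
  move=> [Iz Fz]; have := sep z z0 Iz Iz0; have := ler_normB (F (n + j)%N z) (F (n + j)%N z0).
  by move=> h1 h2; rewrite -(@ler_pM2l _ c)//; lra.
pose I1 := [set y | I y /\ forall z, Z z -> y < z].
pose I2 := [set y | I y /\ forall z, Z z -> z < y].
have [||y Iy|B1 mB1 [lB1 hB1]] := IH I1 (c * s) (ltnW nk') _ _ ccs dcs.
- move=> a b y [Ia ha] [Ib hb] /andP[ay yb]; split; first by apply: (cI a b) => //; rewrite ay.
  by move=> z /hb; exact: le_lt_trans.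
- by move=> y [/It].
- by rewrite leNgt; apply/negP => h; case: Iy => Iy /(_ y (conj Iy h)); rewrite ltxx.
have [||y Iy|B2 mB2 [lB2 hB2]] := IH I2 (c * s) (ltnW nk') _ _ ccs dcs.
- move=> a b y [Ia ha] [Ib hb] /andP[ay yb]; split; first by apply: (cI a b) => //; rewrite ay.
  by move=> z /ha za; exact: lt_le_trans ay.
- by move=> y [/It].
- by rewrite leNgt; apply/negP => h; case: Iy => Iy /(_ y (conj Iy h)); rewrite ltxx.
exists (`[z0 - 2 * s, z0 + 2 * s] `|` (B1 `|` B2)).
  by apply: measurableU => //; exact: measurableU.
split.
  have -> : vdc j.+1 * s = 4 * s + (vdc j * s + vdc j * s) by rewrite /=; ring.
  rewrite EFinD EFinD; apply: le_trans (measureU2 _ _ _) _ => //; first exact: measurableU.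
  apply: leeD.
    by rewrite [leLHS]lebesgue_measure_itv/= lte_fin; case: ifP => _; rewrite -?EFinD lee_fin; lra.
  by apply: le_trans (measureU2 _ _ _) _ => //; exact: leeD.
move=> y Iy Fy.
have [[z1 Zz1 z1y]|n1] := pselect (exists2 z, Z z & z <= y); last first.
  right; left; apply: hB1 => //; split => // z Zz; rewrite ltNge; apply/negP => zy.
  by apply: n1; exists z.
have [[z2 Zz2 yz2]|n2] := pselect (exists2 z, Z z & y <= z); last first.
  right; right; apply: hB2 => //; split => // z Zz; rewrite ltNge; apply/negP => zy.
  by apply: n2; exists z.
left; have := near _ Zz1; have := near _ Zz2; rewrite /= in_itv/= !ler_norml => /andP[a1 a2] /andP[b1 b2].
by apply/andP; split; lra.
Qed.

End chain.

(** * Order of vanishing and sublevel sets *)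

Section lower.
Variable R : realType.
Implicit Types (c h q : nat -> nat -> R) (t s : R * R).
Local Notation leb := (@lebesgue_measure R).

Lemma norm_lt_half (a d : R) : `|a| < d / 2 -> `|a| < d.
Proof. by have := normr_ge0 a; lra. Qed.

Lemma norm_lt_twice (a b c d e : R) : `|a - b| < c -> c <= d / 2 -> `|b| <= d / 2 -> d <= e -> `|a| < e.
Proof. by have := ler_normD (a - b) b; rewrite subrK; lra. Qed.

Lemma lam2_sections_ge (E : set (TR2 R)) (x0 u w : R) : 0 < u -> 0 < w -> measurable E ->
  (forall x, `|x - x0| < u -> exists y0, forall y, `|y - y0| < w -> E (x, y)) ->
  ((2 * u * (2 * w))%:E <= lam2 R E)%E.
Proof.
move=> u0 w0 mE hE; rewrite /lam2 /sprodm/= /sprod /product_measure1.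
pose I : set (measurableTypeR R) := `]x0 - u, x0 + u[%classic.
have mI : measurable I by exact: measurable_itv.
apply: (@le_trans _ _ (\int[leb]_(x in I) (cst (2 * w)%:E x))%E).
  rewrite integral_cst// /I [X in (_ * X)%E]lebesgue_measure_itv/= lte_fin ifT; last by lra.
  by rewrite -EFinB -EFinM lee_fin; lra.
apply: (@le_trans _ _ (\int[leb]_(x in I) (leb \o xsection E) x)%E); last first.
  by apply: ge0_integral_subset => // x _; exact: measure_ge0.
apply: ge0_integral_mono => x; rewrite /I/= in_itv/= => /andP[x1 x2].
  by rewrite lee_fin mulr_ge0// ltW.
have [|y0 hy] := hE x; first by rewrite ltr_norml; apply/andP; split; lra.
apply: (@le_trans _ _ (leb `]y0 - w, y0 + w[)).
  rewrite lebesgue_measure_itv/= lte_fin ifT; last by lra.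
  by rewrite -EFinB lee_fin; lra.
apply: le_measure; rewrite ?inE//; first exact: measurable_xsection.
move=> y /=; rewrite in_itv/= => /andP[y1 y2]; rewrite /xsection/= inE; apply: hy.
by rewrite ltr_norml; apply/andP; split; lra.
Qed.

Lemma is_derive_C11 (Gam tau : R) (Q Q1 Q2 : R * R -> R) t :
  C11 Gam (box tau) Q Q1 Q2 -> sq0 tau t -> is_derive t.2 (1 : R) (fun y => Q (t.1, y)) (Q2 t).
Proof.
move=> cc st; have [e e0 he] := sq0_small st.
apply: (@is_derive_quadratic R _ _ _ Gam e e0) => z hz.
have [_ sh] := he z hz; have [+ _ _ _ _] := cc _ _ (sq0_box sh) (sq0_box st).
by rewrite -!surjective_pairing /n1/= subrr mulr0 add0r normr0 add0r addrK real_normK ?num_real.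
Qed.

(** Only existence on each vertical line is required, so the intermediate value theorem suffices. At
    heights [t.2 + h] and [t.2 - h] the term [b h] dominates: [h] is chosen to keep the quadratic
    error below [|b| h / 4], and [u] to do the same for the horizontal displacement. *)
Lemma implicit_zero (Gam tau : R) (Q Q1 Q2 : R * R -> R) t :
  C11 Gam (box tau) Q Q1 Q2 -> sq0 tau t -> Q t = 0 -> Q2 t != 0 ->
  exists2 u : R, 0 < u & forall x, `|x - t.1| < u -> exists2 y, sq0 tau (x, y) & Q (x, y) = 0.
Proof.
move=> cc st Qt Q2t.
have [_ _ _ G1 G2] := cc _ _ (sq0_box st) (sq0_box st).
set b := Q2 t in Q2t G2; have b0 : 0 < `|b| by rewrite normr_gt0.
have G0 : 0 < Gam by exact: lt_le_trans G2.
have [e e0 he] : exists2 e : R, 0 < e & forall x y, `|x - t.1| <= e -> `|y - t.2| <= e -> sq0 tau (x, y).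
  case: (st) => t1 t2; pose e := Num.min (tau - `|t.1|) (tau - `|t.2|) / 2.
  have m0 : 0 < Num.min (tau - `|t.1|) (tau - `|t.2|) by rewrite lt_min !subr_gt0 t1.
  have m1 : Num.min (tau - `|t.1|) (tau - `|t.2|) <= tau - `|t.1| by rewrite ge_min lexx.
  have m2 : Num.min (tau - `|t.1|) (tau - `|t.2|) <= tau - `|t.2| by rewrite ge_min lexx orbT.
  exists e => [|x y hx hy]; first by rewrite /e; lra.
  split => /=; [have := ler_normD (x - t.1) t.1|have := ler_normD (y - t.2) t.2]; rewrite subrK /e in hx hy *; lra.
pose h := Num.min e (`|b| / (16 * Gam)).
have h0 : 0 < h by rewrite lt_min e0 divr_gt0// mulr_gt0.
have he' : h <= e by rewrite ge_min lexx.
have hb : 16 * Gam * h <= `|b| by rewrite mulrC -ler_pdivlMr ?mulr_gt0// ge_min lexx orbT.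
pose u := Num.min h (`|b| * h / (4 * Gam)).
have u0 : 0 < u by rewrite lt_min h0 divr_gt0 ?mulr_gt0.
exists u => // x; rewrite lt_min => /andP[xh xb].
have xb' : Gam * `|x - t.1| <= `|b| * h / 4.
  by move: xb; rewrite ltr_pdivlMr ?mulr_gt0// => /ltW; lra.
have xe : `|x - t.1| <= e by apply: le_trans he'; exact: ltW.
have est (z : R) : `|z| = h -> `|Q (x, t.2 + z) - b * z| <= `|b| * h / 2.
  move=> zh; have sz : sq0 tau (x, t.2 + z) by apply: he => //; rewrite addrAC subrr add0r zh.
  have [+ _ _ _ _] := cc _ _ (sq0_box sz) (sq0_box st).
  rewrite Qt subr0 /n1/= [t.2 + z - t.2]addrAC subrr add0r zh -/b => k1.
  have k2 : Gam * (`|x - t.1| + h) ^+ 2 <= `|b| * h / 4.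
    apply: (@le_trans _ _ (Gam * (2 * h) ^+ 2)).
      by rewrite ler_wpM2l ?(ltW G0)// lerXn2r ?nnegrE ?addr_ge0 ?(ltW h0)//; lra.
    rewrite (_ : Gam * _ = (16 * Gam * h) * h / 4); last by field.
    by rewrite ler_wpM2r// ler_wpM2r// ltW.
  have k3 : `|Q1 t * (x - t.1)| <= `|b| * h / 4.
    by rewrite normrM; apply: le_trans xb'; rewrite ler_wpM2r.
  have := ler_normD (Q (x, t.2 + z) - (Q1 t * (x - t.1) + b * z)) (Q1 t * (x - t.1)).
  rewrite (_ : _ - _ + Q1 t * (x - t.1) = Q (x, t.2 + z) - b * z); last by ring.
  by move=> k4; lra.
have hh : `|h| = h by rewrite gtr0_norm.
have hN : `|- h| = h by rewrite normrN.
have := est h hh; have := est (- h) hN; rewrite !ler_norml => /andP[n1' n2'] /andP[p1 p2].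
have cont : {within `[t.2 - h, t.2 + h], continuous (fun y => Q (x, y))}.
  apply: derivable_within_continuous => y; rewrite in_itv/= => /andP[y1 y2].
  have sy : sq0 tau (x, y) by apply: he => //; apply: le_trans he'; rewrite ler_distl y1.
  by have [] := is_derive_C11 cc sy.
have ab : t.2 - h <= t.2 + h by move: h0; clear; lra.
have bh : 0 < `|b| * h by rewrite mulr_gt0.
have [|y yi Qy] := @IVT R (fun y => Q (x, y)) _ _ 0 ab cont.
  rewrite ge_min le_max; have [bp|bn] := leP 0 b.
    have nb : `|b| = b by rewrite ger0_norm.
    move: bh n1' n2' p1 p2; rewrite nb; clear => *; apply/andP; split; apply/orP; [left|right]; lra.
  have nb : `|b| = - b by rewrite ltr0_norm.
  move: bh n1' n2' p1 p2; rewrite nb; clear => *; apply/andP; split; apply/orP; [right|left]; lra.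
exists y => //; apply: he => //; apply: le_trans he'; move: yi; rewrite in_itv/= => /andP[y1 y2].
by rewrite ler_distl y1.
Qed.

Lemma germ_C11 c : germ c -> exists Gam : R, exists2 tau : R, 0 < tau &
  forall r, r <= tau -> C11 Gam (box r) (ev c) (ev (dx c)) (ev (dy c)).
Proof.
move=> [C [rho [r0 cg]]].
have [tau /andP[t0 t1] rt] := small_radius r0 (ltac:(lra) : 0 < (8^-1 : R)).
exists (8 * C / tau ^+ 2), tau => // r rtau s t [s1 s2] [t1' t2'].
by apply: (C11_ev t0 t1 (ltW r0) rt cg (lexx _)); split; apply: le_trans rtau.
Qed.

Lemma germ_bounded c : germ c -> exists2 M : R, 0 < M & near0 (fun t => `|ev c t| <= M).
Proof.
move=> [C [rho [r0 cg]]]; have C0 := geo_ge0 cg.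
have [tau /andP[t0 t1] rt] := small_radius r0 (ltac:(lra) : 0 < (2^-1 : R)).
exists (8 * C + 1); first lra.
exists tau => // t /sq0_box bt; have := ev_bound (ltW r0) rt cg bt; lra.
Qed.

Lemma germ_measurable c : germ c -> exists2 tau : R, 0 < tau &
  forall r, r <= tau -> measurable_fun (sq0 r : set (TR2 R)) (ev c).
Proof.
move=> [C [rho [r0 cg]]].
have [tau /andP[t0 t1] rt] := small_radius r0 (ltac:(lra) : 0 < (2^-1 : R)).
exists tau => // r rt'; apply: measurable_funS (measurable_ev (ltW r0) rt cg) => //.
  exact: measurable_box.
by move=> t [a b]; split; apply: ltW; apply: lt_le_trans rt'.
Qed.

Definition sublevel (r : R) (f : R * R -> R) (d : R) : set (TR2 R) := [set t | sq0 r t /\ `|f t| <= d].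

Lemma measurable_sublevel r f (d : R) : measurable_fun (sq0 r : set (TR2 R)) f -> measurable (sublevel r f d).
Proof.
move=> mf; have -> : sublevel r f d = sq0 r `&` (fun t => `|f t|) @^-1` `]-oo, d]%classic.
  by apply/seteqP; split => t; rewrite /sublevel /= in_itv/=.
apply: (measurableT_comp (@normr_measurable R setT) mf) => //; exact: measurable_sq0.
Qed.

Lemma powR_exponent_le1 (c K w0 s : R) : 0 < c -> 0 < w0 ->
  (forall w, 0 < w -> w <= w0 -> c * w <= K * w `^ s) -> s <= 1.
Proof.
move=> c0 w00 hw; rewrite leNgt; apply/negP => s1.
have K0 : 0 < K.
  rewrite ltNge; apply/negP => K0; have := hw w0 w00 (lexx _).
  have := mulr_gt0 c0 w00; have := mulr_le0_ge0 K0 (powR_ge0 w0 s); lra.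
have sm : 0 < s - 1 by lra.
pose v := (c / (2 * K)) `^ ((s - 1)^-1); pose w := Num.min w0 v.
have v0 : 0 < v by rewrite powR_gt0// divr_gt0// mulr_gt0.
have wp : 0 < w by rewrite lt_min w00.
have := hw w wp; rewrite ge_min lexx => /(_ isT).
have -> : s = (s - 1) + 1 by ring.
rewrite powRD; last by rewrite [w == 0]gt_eqF ?implybT.
rewrite powRr1 ?(ltW wp)// mulrA ler_pM2r//.
have : w `^ (s - 1) <= c / (2 * K).
  apply: (@le_trans _ _ (v `^ (s - 1))).
    by apply: ge0_ler_powR; rewrite ?nnegrE ?(ltW wp) ?(ltW v0) ?(ltW sm)// /w ge_min lexx orbT.
  by rewrite /v -powRrM mulVf ?gt_eqF// powRr1// divr_ge0// ?mulr_ge0// ltW.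
rewrite ler_pdivlMr ?mulr_gt0//; lra.
Qed.

Definition sublevel_bound (f : R * R -> R) (r e : R) := exists C : R,
  forall d, 0 < d -> d <= 1 -> (lam2 R (sublevel r f d) <= (C * d `^ e)%:E)%E.

Definition sublevel_near (f : R * R -> R) (e : R) :=
  exists2 r : R, 0 < r & forall r', 0 < r' -> r' <= r -> sublevel_bound f r' e.

(** The last hypothesis is what a zero of order [n] along a curve provides: a neighbourhood of width
    [w] has area comparable to [w], and [|f| <= M w^n] on it. *)
Lemma exponent_le1 (n : nat) f (r e c M w0 : R) : 0 < c -> 0 < w0 -> 0 < M -> 0 < e -> sublevel_bound f r e ->
  (forall w, 0 < w -> w <= w0 -> ((c * w)%:E <= lam2 R (sublevel r f (M * w ^+ n)))%E) -> n%:R * e <= 1.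
Proof.
move=> c0 w00 M0 e0 [C hC] hw; case: n hw => [|n] hw; first by rewrite mul0r.
pose w1 := Num.min w0 (Num.min 1 M^-1).
have w10 : 0 < w1 by rewrite !lt_min w00 ltr01 invr_gt0.
apply: (@powR_exponent_le1 c (C * M `^ e) w1) => // w wp; rewrite !le_min => /and3P[ww0 wl1 wM].
have Mw : M * w ^+ n.+1 <= 1.
  apply: (@le_trans _ _ (M * w)); last by rewrite mulrC -ler_pdivlMr// mul1r.
  by rewrite ler_wpM2l ?(ltW M0)// exprS ler_piMr ?(ltW wp)// exprn_ile1// ltW.
have Mw0 : 0 < M * w ^+ n.+1 by rewrite mulr_gt0// exprn_gt0.
have := le_trans (hw w wp ww0) (hC _ Mw0 Mw); rewrite lee_fin.
by rewrite powRM ?(ltW M0) ?exprn_ge0 ?(ltW wp)// -powR_mulrn ?(ltW wp)// -powRrM mulrA.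
Qed.

Section vanishing.
Variables (h h1 : nat -> nat -> R) (a m : nat).
Hypotheses (gh : germ h) (gh1 : germ h1) (hE : h = shift a 0 h1) (h1m : h1 0%N m != 0).

Let f j := iter j (@dy R) h1.

Lemma near0_h : near0 (fun t => ev h t = t.1 ^+ a * ev h1 t).
Proof. by rewrite hE; exact: near0_ev_shift. Qed.

(** The factor [x^a] makes the axis a curve of zeros of order at least [a]. *)
Lemma axis_exponent (e : R) : 0 < e -> sublevel_near (ev h) e -> a%:R * e <= 1.
Proof.
move=> e0 [r r0 sb]; have [M M0 hM] := germ_bounded gh1.
have [tau t0 htau] := near0_and near0_h hM.
have [tau' t0' hm] := germ_measurable gh.
pose w0 := Num.min r (Num.min tau tau').
have w00 : 0 < w0 by rewrite !lt_min r0 t0.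
have wr : w0 <= r by rewrite ge_min lexx.
have wt : w0 <= tau by rewrite !ge_min lexx orbT.
have wt' : w0 <= tau' by rewrite !ge_min lexx !orbT.
have sb' := sb _ w00 wr.
apply: (@exponent_le1 a (ev h) w0 e (4 * w0) M w0) => //; first by rewrite mulr_gt0.
move=> w wp ww; rewrite (_ : 4 * w0 * w = 2 * w * (2 * w0)); last by ring.
apply: (@lam2_sections_ge _ 0) => //; first by apply: measurable_sublevel; exact: hm.
move=> x; rewrite subr0 => xw; exists 0 => y; rewrite subr0 => yw.
have sxy : sq0 w0 (x, y) by split => //=; exact: lt_le_trans ww.
split => //; have [-> b] := htau _ (sq0_le wt sxy).
rewrite normrM mulrC normrX; apply: ler_pM => //; rewrite ?exprn_ge0//.
by rewrite lerXn2r// ?nnegrE ?ltW.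
Qed.

(** Otherwise points off the axis where [k] successive derivatives vanish accumulate at the origin.
    Near a simple zero of the series [q] they produce, each vertical line carries such a point, and
    Taylor's formula bounds [ev h] by [M w^k] within distance [w] of it; the area then forces
    [k e <= 1]. *)
Lemma vertical_zeros (k : nat) (e : R) : (0 < k)%N -> 0 < e -> 1 < k%:R * e ->
  sublevel_near (ev h) e ->
  near0 (fun t => t.1 != 0 -> exists2 j, (j < k)%N & ev (f j) t != 0).
Proof.
move=> k0 e0 ke [r r0 sb]; apply: contrapT => no.
pose Z := [set t : R * R | t.1 != 0 /\ forall j, (j < k)%N -> ev (f j) t = 0].
have Zacc : adherent0 Z.
  move=> s s0; apply: contrapT => ns; apply: no; exists s => // t st t1.
  apply: contrapT => nj; apply: ns; exists t => //; split => // j jk.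
  by apply/eqP; apply: contrapT => /negP fj; apply: nj; exists j.
have gf j : germ (f j) by exact: germ_iter_dy.
have Z1 t : Z t -> t.1 != 0 by case.
have fZ j : (j < k)%N -> vanishes (f j) Z by move=> jk; exists 1 => // t _ [_]; exact.
have [q [gq near_q accq]] := @common_zeros_curve R f k Z m k0 gf h1m Zacc Z1 fZ.
have [Gam [tau t0 hC11]] := germ_C11 gq.
have [M M0 hM] := germ_bounded (gf k).
have hder : near0 (fun t => forall j, (j < k)%N -> is_derive t.2 (1 : R) (fun y => ev (f j) (t.1, y)) (ev (f j.+1) t)).
  apply: near0_all => j jk; have [Gj [tj tj0 hj]] := germ_C11 (gf j).
  by exists tj => // t st; exact: is_derive_C11 (hj _ (lexx _)) st.
have [ra ra0 hra] := near0_and near_q (near0_and hM (near0_and hder near0_h)).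
have [rm rm0 hrm] := germ_measurable gh.
pose r1 := Num.min (Num.min r 1) (Num.min tau (Num.min ra rm)).
have r10 : 0 < r1 by rewrite !lt_min r0 t0 ra0 rm0 ltr01.
have r1r : r1 <= r by rewrite !ge_min lexx.
have r11 : r1 <= 1 by rewrite !ge_min lexx !orbT.
have r1t : r1 <= tau by rewrite !ge_min lexx !orbT.
have r1a : r1 <= ra by rewrite !ge_min lexx !orbT.
have r1m : r1 <= rm by rewrite !ge_min lexx !orbT.
have sb' := sb _ r10 r1r.
have r20 : 0 < r1 / 2 by rewrite divr_gt0.
have [t0' [Zt qt dqt] st] := accq _ r20.
have r2t : r1 / 2 <= tau by lra.
have [u u0 hu] := implicit_zero (hC11 _ r2t) st qt dqt.
suff : k%:R * e <= 1 by lra.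
have cu0 : 0 < 2 * u * 2 by lra.
apply: (@exponent_le1 k (ev h) r1 e (2 * u * 2) M (r1 / 2)) => // w wp wr.
rewrite -mulrA; apply: (@lam2_sections_ge _ t0'.1) => //; first by apply: measurable_sublevel; exact: hrm.
move=> x xu; have [y0 [/= sx sy] qy] := hu x xu; exists y0 => y yw.
have sxy : sq0 r1 (x, y) by split; [exact: norm_lt_half sx|exact: norm_lt_twice yw wr (ltW sy) (lexx _)].
split => //; have [_ [_ [_ ->]]] := hra _ (sq0_le r1a sxy).
have sxz z : `|z| < r1 -> sq0 ra (x, z) by move=> zr; split; [exact: lt_le_trans (norm_lt_half sx) r1a|exact: lt_le_trans zr r1a].
have sxy0 : sq0 r1 (x, y0) by split; [exact: norm_lt_half sx|exact: norm_lt_half sy].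
have [hq _] := hra _ (sq0_le r1a sxy0).
rewrite normrM -[leRHS]mul1r; apply: ler_pM => //.
  by rewrite normrX exprn_ile1//; case: sxy => /= *; lra.
have [sxx syy] := sxy; have [_ syy0] := sxy0; rewrite /= in sxx syy syy0.
apply: le_trans (@taylor_flat R r1 (fun j y => ev (f j) (x, y)) k _ M y0 y (ltW M0) syy0 syy _ _) _.
- by move=> j z jk hz; have [_ [_ [hd _]]] := hra (x, z) (sxz z hz); exact: hd.
- by move=> z hz; have [_ [hb _]] := hra (x, z) (sxz z hz).
- exact: hq.
by rewrite ler_wpM2l ?(ltW M0)// lerXn2r ?nnegrE ?(ltW wp) ?(ltW yw).
Qed.

End vanishing.
End lower.

(** * Uniform sublevel estimates *)

Section uniform.
Variable R : realType.
Implicit Types (c h : nat -> nat -> R) (t s : R * R).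
Local Notation leb := (@lebesgue_measure R).

Definition nb (t0 : R * R) (rho : R) : set (TR2 R) := [set t | `|t.1 - t0.1| < rho /\ `|t.2 - t0.2| < rho].

Lemma measurable_nb t0 rho : measurable (nb t0 rho).
Proof.
rewrite (_ : nb t0 rho = `]t0.1 - rho, t0.1 + rho[%classic `*` `]t0.2 - rho, t0.2 + rho[%classic); first exact: measurableX.
by apply/seteqP; split => t; rewrite /nb /setX/= !in_itv/= !ltr_distl.
Qed.

Lemma open_nb (t0 : R * R) (rho : R) : open (nb t0 rho : set (R * R)).
Proof.
have -> : nb t0 rho = (`]t0.1 - rho, t0.1 + rho[%classic `*` `]t0.2 - rho, t0.2 + rho[%classic : set (R * R)).
  by apply/seteqP; split => t; rewrite /nb /setX/= !in_itv/= !ltr_distl.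
have -> : `]t0.1 - rho, t0.1 + rho[%classic `*` `]t0.2 - rho, t0.2 + rho[%classic =
    (fst @^-1` `]t0.1 - rho, t0.1 + rho[%classic) `&` (snd @^-1` `]t0.2 - rho, t0.2 + rho[%classic) :> set (R * R) by [].
apply: openI; apply: open_comp => [t _|]; [exact: cvg_fst|exact: interval_open|exact: cvg_snd|exact: interval_open].
Qed.

Lemma nbhs_sq0 (r : R) : 0 < r -> nbhs (0 : R * R) (sq0 r).
Proof.
move=> r0; have -> : sq0 r = nb 0 r by apply/seteqP; split => t; rewrite /sq0 /nb/= !subr0.
by apply: open_nbhs_nbhs; split; [exact: open_nb|split; rewrite subrr normr0].
Qed.

Lemma lam2_sq0 (r : R) : 0 < r -> (lam2 R (sq0 r) <= (4 * r ^+ 2)%:E)%E.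
Proof.
move=> r0; rewrite (_ : 4 * r ^+ 2 = 2 * r * (2 * r)); last by ring.
have r20 : 0 <= 2 * r by lra.
apply: (@lam2_sections R _ (- r)) => //; first exact: measurable_sq0.
  by move=> t [+ _]; rewrite ltr_norml => /andP[a b]; apply/andP; split; lra.
by move=> u; exists (- r) => t [_ +] _; rewrite ltr_norml => /andP[a b]; apply/andP; split; lra.
Qed.

Lemma lam2_cover (A : set (TR2 R)) (x0 rho L : R) : 0 <= rho -> 0 <= L -> measurable A ->
  (forall t, A t -> `|t.1 - x0| < rho) ->
  (forall x, `|x - x0| < rho -> exists2 B : set R, measurable B & (leb B <= L%:E)%E /\ forall y, A (x, y) -> B y) ->
  (lam2 R A <= (2 * rho * L)%:E)%E.
Proof.
move=> r0 L0 mA h1 h2; rewrite /lam2 /sprodm/= /sprod /product_measure1.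
pose I : set (measurableTypeR R) := `[x0 - rho, x0 + rho]%classic.
have mI : measurable I by exact: measurable_itv.
apply: (@le_trans _ _ (\int[leb]_x (L%:E * (\1_I x)%:E))%E); last first.
  rewrite ge0_integralZl//; last exact/measurable_EFinP.
  rewrite integral_indic// setIT /I [X in (_ * X)%E]lebesgue_measure_itv/= lte_fin.
  case: ifP => _; last by rewrite mule0 lee_fin !mulr_ge0.
  by rewrite -EFinB -EFinM lee_fin; lra.
apply: ge0_integral_mono => x _; first exact: measure_ge0.
rewrite indicE; have [xI|xI] := ltP `|x - x0| rho; last first.
  rewrite /= (_ : xsection A x = set0) ?measure0 ?mule_ge0//.
  apply/seteqP; split => // y; rewrite /xsection/= inE => /h1 /=; by rewrite ltNge xI.
rewrite mem_set; last by move: xI; rewrite /I/= in_itv/= ltr_distl => /andP[a b]; rewrite !ltW.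
rewrite mule1 /=; have [B mB [lB AB]] := h2 x xI; apply: le_trans lB.
apply: le_measure; rewrite ?inE//; first exact: measurable_xsection.
by move=> y; rewrite /xsection/= inE; exact: AB.
Qed.

(** A length [S d^e] is long enough for a function of order [n] to exceed the level [D d], because
    [d <= d^(n e)]. For [n = 0] the length is irrelevant and [d] has to be small instead. *)
Lemma pow_choice (n : nat) (c D e : R) : 0 < c -> 0 < D -> n%:R * e <= 1 ->
  exists2 S : R, 0 < S & exists2 d0 : R, 0 < d0 & forall d, 0 < d -> d <= 1 -> d < d0 -> D * d < c * (S * d `^ e) ^+ n.
Proof.
move=> c0 D0 ne; pose S := Num.max 1 (2 * D / c).
have S1 : 1 <= S by rewrite le_max lexx.
have SD : 2 * D <= c * S by rewrite [c * S]mulrC -ler_pdivrMr// le_max lexx orbT.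
have S0 : 0 < S by lra.
exists S => //; exists (c / D) => [|d d0 d1 dd]; first by rewrite divr_gt0.
case: n ne => [|n] ne.
  by rewrite expr0 mulr1 mulrC -ltr_pdivlMr.
rewrite exprMn -[(d `^ e) ^+ _]powR_mulrn ?powR_ge0// -powRrM mulrA.
have p1 : d <= d `^ (e * n.+1%:R) by apply: ger1_powR; rewrite ?d0// mulrC.
apply: (@lt_le_trans _ _ (c * S ^+ n.+1 * d)); last by rewrite ler_wpM2l// mulr_ge0 ?exprn_ge0 ?ltW.
rewrite ltr_pM2r//; apply: (@lt_le_trans _ _ (2 * D)); first lra.
apply: le_trans SD _; rewrite ler_wpM2l ?(ltW c0)// exprS ler_peMr ?(ltW S0)//; exact: exprn_ege1.
Qed.

Lemma norm_lt_add (a b c : R) : `|a - b| < c - `|b| -> `|a| < c.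
Proof. by have := ler_normD (a - b) b; rewrite subrK; lra. Qed.

Lemma norm_half_le (L a b u v : R) : `|u - v| <= L * (a + b) ->
  a * (4 * L) < `|u| -> b * (4 * L) < `|u| -> `|u| / 2 <= `|v|.
Proof. by have := lerB_dist u v; lra. Qed.

Lemma dist_convex (c d u v y : R) : `|u - c| < d -> `|v - c| < d -> u <= y <= v -> `|y - c| < d.
Proof. by rewrite !ltr_distl => /andP[? ?] /andP[? ?] /andP[? ?]; apply/andP; split; lra. Qed.

Lemma norm_ge_half (a x d : R) : `|x - a| < d -> d <= `|a| / 2 -> `|a| / 2 <= `|x|.
Proof. by have := lerB_dist a x; rewrite distrC; lra. Qed.

Lemma norm_itv (s u : R) : `|u| <= s -> - s <= u <= - s + 2 * s.
Proof. by rewrite ler_norml => /andP[? ?]; apply/andP; split; lra. Qed.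

Lemma dist_itv (c d u : R) : `|u - c| < d -> c - d <= u <= c - d + 2 * d.
Proof. by rewrite ltr_distl => /andP[? ?]; apply/andP; split; lra. Qed.

Section local.
Variables (f : R * R -> R) (r e : R).

(** The threshold [d0] may depend on the point; levels above it are covered by the total area once
    finitely many pieces are collected. *)
Definition local_bound (A : set (TR2 R)) := exists C : R, exists2 d0 : R, 0 < d0 &
  forall d, 0 < d -> d <= 1 -> d < d0 -> (lam2 R (sublevel r f d `&` A) <= (C * d `^ e)%:E)%E.

Hypothesis mf : forall d, measurable (sublevel r f d).

Lemma local_boundU A B : measurable A -> measurable B ->
  local_bound A -> local_bound B -> local_bound (A `|` B).
Proof.
move=> mA mB [C [d0 d00 hA]] [C' [d0' d00' hB]].
exists (C + C'); exists (Num.min d0 d0'); first by rewrite lt_min d00.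
move=> d dp d1; rewrite lt_min => /andP[dd dd']; rewrite setIUr.
apply: le_trans (measureU2 _ _ _) _; [exact: measurableI|exact: measurableI|].
rewrite mulrDl EFinD; exact: leeD (hA _ dp d1 dd) (hB _ dp d1 dd').
Qed.

Lemma local_bound_compact : 0 < e -> 0 < r ->
  (forall t, box r t -> exists2 rho : R, 0 < rho & local_bound (nb t rho)) -> sublevel_bound f r e.
Proof.
move=> e0 r0 loc.
have h t : exists rho : R, box r t -> 0 < rho /\ local_bound (nb t rho).
  have [bt|nbt] := pselect (box r t); last by exists 0.
  by have [rho rho0 l] := loc t bt; exists rho.
pose g t := projT1 (cid (h t)); have gP t : box r t -> 0 < g t /\ local_bound (nb t (g t)) := projT2 (cid (h t)).
have cb : compact (box r : set (R * R)).
  rewrite (_ : box r = `[-r, r]%classic `*` `[-r, r]%classic).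
    by apply: compact_setX; exact: segment_compact.
  by apply/seteqP; split => t; rewrite /box /setX/= !in_itv/= -!ler_norml.
(* The filter of large finite lists of centres; with it the covering form of compactness yields a
   finite subcover. *)
pose F (A : set (seq (R * R))) :=
  exists l : seq (R * R), forall l' : seq (R * R), {subset l <= l'} -> A l'.
have FF : Filter F.
  split; first by exists [::].
    move=> A B [l hl] [l' hl']; exists (l ++ l') => k kl; split; [apply: hl|apply: hl'] => t tl;
      by apply: kl; rewrite mem_cat tl ?orbT.
  by move=> A B AB [l hl]; exists l => k /hl /AB.
have [|l0 /(_ l0 (fun t => id)) cov0] := (iffLR (compact_near_coveringP _) cb _ F
    (fun (l : seq (R * R)) t => exists2 i, i \in l & box r i /\ nb i (g i) t) FF).
  move=> t bt; exists (nb t (g t), [set l : seq (R * R) | t \in l]).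
    split => /=; last by exists [:: t] => l; apply; exact: mem_head.
    apply: open_nbhs_nbhs; split; first exact: open_nb.
    by have [g0 _] := gP t bt; split; rewrite subrr normr0.
  by move=> [t' l] /= [nt tl]; exists t.
pose fs := [seq i <- l0 | `[< box r i >]].
have fsb : {in fs, forall t, box r t} by move=> t; rewrite mem_filter => /andP[/asboolP].
have cov t : box r t -> exists2 i, i \in fs & nb i (g i) t.
  by move=> /cov0[i il [bi ni]]; exists i => //; rewrite mem_filter il andbT; apply/asboolP.
have L (l : seq (R * R)) : {in l, forall t, box r t} ->
    measurable ([set t | exists2 i, i \in l & nb i (g i) t] : set (TR2 R)) /\
    local_bound [set t | exists2 i, i \in l & nb i (g i) t].
  elim: l => [|i l IH] hl.
    rewrite (_ : [set t | _] = set0); last by apply/seteqP; split => // t [].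
    by split => //; exists 0, 1 => // d _ _ _; rewrite setI0 measure0 mul0r.
  have [|m1 l1] := IH; first by move=> t tl; apply: hl; rewrite inE tl orbT.
  rewrite (_ : [set t | _] = nb i (g i) `|` [set t | exists2 i, i \in l & nb i (g i) t]); last first.
    apply/seteqP; split => t /=.
      by move=> [j]; rewrite inE => /orP[/eqP ->|jl] H; [left|right; exists j].
    by move=> [H|[j jl H]]; [exists i => //; rewrite inE eqxx|exists j => //; rewrite inE jl orbT].
  have mi : measurable (nb i (g i)) by exact: measurable_nb.
  split; first exact: measurableU.
  by apply: local_boundU => //; have [] := gP i (hl i (mem_head _ _)).
have [mU [C [d0 d00 hC]]] := L fs fsb.
exists (`|C| + 4 * r ^+ 2 / d0 `^ e) => d dp d1.
have de0 : 0 <= d `^ e by exact: powR_ge0.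
have d0e : 0 < d0 `^ e by exact: powR_gt0.
have [dd|dd] := ltP d d0.
  apply: (@le_trans _ _ (C * d `^ e)%:E).
    rewrite (_ : sublevel r f d = sublevel r f d `&` [set t | exists2 i, i \in fs & nb i (g i) t]); first exact: hC.
    apply/seteqP; split => t /=; last by case.
    move=> [st ft]; split => //; have [i ifs nbi] := cov t (sq0_box st).
    by exists i.
  rewrite lee_fin ler_wpM2r//; apply: le_trans (ler_norm _) _.
  by rewrite lerDl divr_ge0// ?(ltW d0e)// mulr_ge0// exprn_ge0// ltW.
apply: (@le_trans _ _ (4 * r ^+ 2)%:E).
  apply: le_trans (lam2_sq0 r0); apply: le_measure; rewrite ?inE//; first exact: measurable_sq0.
  by move=> t [].
rewrite lee_fin [leRHS]mulrDl; have : d0 `^ e <= d `^ e by apply: ge0_ler_powR; rewrite ?nnegrE ?(ltW e0) ?(ltW d00) ?(ltW dp).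
move=> le; apply: (@le_trans _ _ (4 * r ^+ 2 / d0 `^ e * d `^ e)); last by rewrite lerDr mulr_ge0.
rewrite [leRHS]mulrAC ler_pdivlMr//.
by rewrite ler_wpM2l// mulr_ge0// exprn_ge0// ltW.
Qed.

End local.

Section sublevel_uniform.
Variables (h h1 : nat -> nat -> R) (a m : nat) (eta : R).
Hypotheses (gh : germ h) (gh1 : germ h1) (hE : h = shift a 0 h1) (h1m : h1 0%N m != 0).
Hypothesis eta0 : 0 < eta.
Hypothesis near_eta : forall e : R, 0 < e -> e < eta -> sublevel_near (ev h) e.

Let f j := iter j (@dy R) h1.

(** On the axis the series is [y^n] times a series [g] with nonzero constant term. *)
Lemma near0_axis : near0 (fun t => t.2 != 0 -> ev h1 (0, t.2) != 0).
Proof.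
have [n _ [n0 nn]] := yorder_exists h1m; have [C [rho [rho0 hg]]] := gh1.
pose g i j := if i == 0%N then h1 0%N (n + j)%N else 0.
have gg : geo (C * rho ^+ n) rho g.
  move=> i j; rewrite /g; case: eqP => [->|_].
    by apply: le_trans (hg _ _) _; rewrite -mulrA -exprD add0n.
  by rewrite normr0 !mulr_ge0 ?exprn_ge0 ?(geo_ge0 hg)// ltW.
have [tau /andP[t0 t1] rt] := small_radius rho0 (ltac:(lra) : 0 < (2^-1 : R)).
have g0 : g 0%N 0%N != 0 by rewrite /g eqxx addn0.
have germg : germ g by exists (C * rho ^+ n), rho.
have [r r0 hr] := near0_ev_neq0 germg g0.
exists (Num.min tau r) => [|t st t2]; first by rewrite lt_min t0.
have [_ s1] : sq0 tau t by apply: sq0_le st; rewrite ge_min lexx.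
have [_ s2] : sq0 r t by apply: sq0_le st; rewrite ge_min lexx orbT.
have sr : sq0 r (0, t.2) by split; rewrite /= ?normr0.
have bt : box tau (0, t.2) by split; rewrite /= ?normr0 ltW.
have dg := ev_dom (ltW rho0) rt gg bt.
suff -> : ev h1 (0, t.2) = t.2 ^+ n * ev g (0, t.2) by rewrite mulf_neq0 ?expf_neq0// hr.
rewrite /ev -(dsum_shift 0 n dg) -(dsum_scale _ (dom_shift 0 n dg)).
congr dsum; apply/funext => i; apply/funext => j; rewrite /shift/= subn0 /g.
case: (leqP n j) => nj; last first.
  case: i => [|i]; first by rewrite n0// !mul0r mulr0.
  by rewrite expr0n/= mulr0 mul0r mulr0.
case: i => [|i]/=; last by rewrite expr0n/= !mulr0 !mul0r mulr0.
by rewrite subnKC// mulrCA -exprD subnKC.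
Qed.

(** The radius has to be fixed before [e]. Only at the origin does the bound come from the
    hypothesis with a radius depending on [e]; at all other points of the closed square it follows
    from orders of vanishing, and compactness collects constants that may depend on [e]. *)
Lemma sublevel_uniform : exists r : R, [/\ 0 < r, forall d, measurable (sublevel r (ev h) d) & forall e : R, 0 < e -> e < eta -> sublevel_bound (ev h) r e].
Proof.
have [k k1 kmin] : exists2 k : nat, 1 < k%:R * eta & forall j : nat, (j < k)%N -> j%:R * eta <= 1.
  have ex : exists k : nat, 1 < k%:R * eta.
    exists (Num.bound (eta^-1)); rewrite -ltr_pdivrMr// mul1r.
    by apply: archi_boundP; rewrite invr_ge0 ltW.
  case: (ex_minnP ex) => k k1 mk; exists k => // j jk.
  by rewrite leNgt; apply: contraTN jk => /mk; rewrite -leqNgt.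
have k0 : (0 < k)%N by case: k k1 {kmin} => //; rewrite mul0r ltr10.
(* This single exponent determines a square free of zeros of order [k] off the axis, for the least
   [k] with [k eta > 1]. *)
have [e1 [e10 e1eta ke1]] : exists e1 : R, [/\ 0 < e1, e1 < eta & 1 < k%:R * e1].
  have kp : 0 < k%:R :> R by rewrite ltr0n.
  have ki : 0 < k%:R^-1 :> R by rewrite invr_gt0.
  have kl : k%:R^-1 < eta by rewrite -[k%:R^-1]mul1r ltr_pdivrMr// mulrC.
  exists ((eta + k%:R^-1) / 2); split; [lra|lra|].
  have : k%:R * k%:R^-1 = 1 :> R by rewrite divff// gt_eqF.
  by lra.
have vz := vertical_zeros gh gh1 hE h1m k0 e10 ke1 (near_eta e10 e1eta).
have gf j : germ (f j) by exact: germ_iter_dy.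
have hder : near0 (fun t => forall j, (j < k)%N -> is_derive t.2 (1 : R) (fun y => ev (f j) (t.1, y)) (ev (f j.+1) t)).
  apply: near0_all => j jk; have [Gj [tj tj0 hj]] := germ_C11 (gf j).
  by exists tj => // t st; exact: is_derive_C11 (hj _ (lexx _)) st.
have hlip : near0 (fun t => forall j, (j < k)%N -> exists2 L : R, 0 < L & exists2 tau : R, sq0 tau t &
    forall s, sq0 tau s -> `|ev (f j) s - ev (f j) t| <= L * n1 (s - t)).
  apply: near0_all => j jk; have [L [tau tau0 hL]] := germ_lip (gf j).
  exists tau => // t st; exists (`|L| + 1); first by rewrite ltr_wpDl.
  exists tau => // s ss; apply: le_trans (hL _ _ (sq0_box ss) (sq0_box st)) _.
  by rewrite ler_wpM2r ?n1_ge0//; apply: le_trans (ler_norm _) _; rewrite lerDl.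
have [R0 R00 hR0] := near0_and vz (near0_and near0_axis (near0_and hder (near0_and hlip (near0_h gh1 hE)))).
have [rm rm0 hrm] := germ_measurable gh.
pose R1 := Num.min R0 rm; have R10 : 0 < R1 by rewrite lt_min R00.
have R1R : R1 <= R0 by rewrite ge_min lexx.
have R1m : R1 <= rm by rewrite ge_min lexx orbT.
pose r := R1 / 2; have r0 : 0 < r by rewrite divr_gt0.
have rrm : r <= rm by rewrite /r; lra.
have ms d : measurable (sublevel r (ev h) d) by apply: measurable_sublevel; exact: hrm.
exists r; split => // e e0 eeta.
apply: local_bound_compact => // t0 [b1 b2].
have st0 : sq0 R0 t0 by split; rewrite /r in b1 b2; lra.
have [vz0 [ax0 [_ [lip0 _]]]] := hR0 _ st0.
have propagate j : (j < k)%N -> ev (f j) t0 != 0 -> exists2 c : R, 0 < c & exists2 rho : R, 0 < rho &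
    forall t, nb t0 rho t -> c <= `|ev (f j) t|.
  move=> jk fj; have [L L0 [tau st hL]] := lip0 j jk.
  have n0 : 0 < `|ev (f j) t0| by rewrite normr_gt0.
  exists (`|ev (f j) t0| / 2); first by rewrite divr_gt0.
  pose m0 := Num.min (tau - `|t0.1|) (tau - `|t0.2|).
  have m00 : 0 < m0 by case: st => *; rewrite lt_min !subr_gt0; apply/andP.
  exists (Num.min m0 (`|ev (f j) t0| / (4 * L))) => [|t].
    by rewrite lt_min m00 divr_gt0// mulr_gt0.
  rewrite /nb/= !lt_min => -[/andP[/andP[u1 u2] u3] /andP[/andP[v1 v2] v3]].
  have stt : sq0 tau t.
    by split; [exact: norm_lt_add u1|exact: norm_lt_add v2].
  have := hL t stt; rewrite distrC => hh.
  move: u3 v3; rewrite !ltr_pdivlMr ?mulr_gt0// => u3 v3.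
  exact: norm_half_le hh u3 v3.
have nbR rho t : rho <= r -> nb t0 rho t -> sq0 R0 t.
  by move=> rr [u v]; split; [exact: norm_lt_twice u rr b1 R1R|exact: norm_lt_twice v rr b2 R1R].
have mA rho d : measurable (sublevel r (ev h) d `&` nb t0 rho) by apply: measurableI => //; exact: measurable_nb.
(* Off the axis some derivative of order [j < k] does not vanish, [j e <= 1] by minimality of [k],
   and vertical lines are covered one by one; [D] compensates for the factor [x^a]. *)
have [x0|x0] := eqVneq t0.1 0; last first.
  have [j jk fj] := vz0 x0; have [c c0 [rho rho0 hc]] := propagate j jk fj.
  have nx : 0 < `|t0.1| by rewrite normr_gt0.
  pose rho1 := Num.min rho (Num.min r (`|t0.1| / 2)).
  have rho10 : 0 < rho1 by rewrite !lt_min rho0 r0 divr_gt0.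
  have q1 : rho1 <= rho by rewrite ge_min lexx.
  have q2 : rho1 <= r by rewrite !ge_min lexx orbT.
  have q3 : rho1 <= `|t0.1| / 2 by rewrite !ge_min lexx !orbT.
  exists rho1 => //.
  pose D := (`|t0.1| / 2) ^- a; have D0 : 0 < D by rewrite invr_gt0 exprn_gt0 ?divr_gt0.
  have je : j%:R * e <= 1.
    by apply: le_trans (kmin j jk); rewrite ler_wpM2l// ltW.
  have [S S0 [d0 d00 hS]] := pow_choice c0 D0 je.
  exists (2 * rho1 * (vdc R j * S)), d0 => // d dp d1 dd.
  rewrite -[_ * d `^ e]mulrA -[_ * S * _]mulrA.
  have s0 : 0 < S * d `^ e by rewrite mulr_gt0// powR_gt0.
  apply: (@lam2_cover _ t0.1 rho1) => //; first exact: ltW.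
  - by rewrite mulr_ge0 ?vdc_ge0// ltW.
  - by move=> t [_ []].
  move=> x xr.
  pose I := [set y : R | `|y - t0.2| < rho1].
  have xI y : I y -> sq0 R0 (x, y) by move=> Iy; apply: (nbR rho1).
  have [xR0 _] := xI t0.2 (ltac:(by rewrite /I/= subrr normr0)).
  have dF j' (y : R) : (j' < k)%N -> `|y| < R0 -> is_derive y (1 : R) (fun y => ev (f j') (x, y)) (ev (f j'.+1) (x, y)).
    by move=> jk' yR; have [_ [_ [hd _]]] := hR0 (x, y) (conj xR0 yR); exact: hd.
  have cI (u v y : R) : I u -> I v -> u <= y <= v -> I y.
    exact: dist_convex.
  have hF (y : R) : I y -> c <= `|ev (f (0 + j)%N) (x, y)|.
    by move=> Iy; apply: hc; split => /=; [exact: lt_le_trans xr q1|exact: lt_le_trans Iy q1].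
  have IR (y : R) : I y -> `|y| < R0 by move=> /xI[].
  have jk0 : (0 + j <= k)%N by rewrite add0n ltnW.
  have [B mB [lB hB]] := @sublevel_cover R R0 (fun j y => ev (f j) (x, y)) k dF 0 j I c _ _ jk0 cI IR c0 s0 (hS d dp d1 dd) hF.
  exists B => //; split => // y [[_ hd] [_ yI]]; apply: hB => //.
  have [_ [_ [_ [_ he]]]] := hR0 _ (xI y yI); rewrite he normrM normrX/= in hd.
  have xg : `|t0.1| / 2 <= `|x| by exact: norm_ge_half xr q3.
  rewrite /D mulrC ler_pdivlMr ?exprn_gt0 ?divr_gt0//; apply: le_trans hd; rewrite mulrC ler_wpM2r//.
  by rewrite lerXn2r ?nnegrE ?divr_ge0.
have [y0|y0] := eqVneq t0.2 0.
  have [r1 r10 hr1] := near_eta e0 eeta.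
  pose rho := Num.min r r1; have rho0 : 0 < rho by rewrite lt_min r0.
  exists rho => //; have [C hC] := hr1 rho rho0 (ltac:(by rewrite ge_min lexx orbT)).
  exists C, 1 => // d dp d1 _; apply: le_trans (hC d dp d1); apply: le_measure; rewrite ?inE//.
    by apply: measurable_sublevel; apply: hrm; apply: le_trans rrm; rewrite ge_min lexx.
  by move=> t [[_ ht] [u v]]; split => //; move: u v; rewrite x0 y0 !subr0.
(* On the axis away from the origin only [x^a] vanishes: the sublevel set lies in the strip
   [|x| <= S d^e], by [a e <= 1]. *)
have fj : ev (f 0%N) t0 != 0.
  by have := ax0 y0; rewrite -[X in (X, _)]x0 -surjective_pairing.
have [c c0 [rho rho0 hc]] := propagate 0%N k0 fj.
pose rho1 := Num.min rho r.
have rho10 : 0 < rho1 by rewrite !lt_min rho0 r0.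
have q1 : rho1 <= rho by rewrite ge_min lexx.
have q2 : rho1 <= r by rewrite !ge_min lexx orbT.
exists rho1 => //.
have ae := axis_exponent gh gh1 hE e0 (near_eta e0 eeta).
have [S S0 [d0 d00 hS]] := pow_choice c0 ltr01 ae.
exists (2 * S * (2 * rho1)), d0 => // d dp d1 dd.
have s0 : 0 < S * d `^ e by rewrite mulr_gt0// powR_gt0.
rewrite (_ : _ * _ `^ e = 2 * (S * d `^ e) * (2 * rho1)); last by ring.
have key t : (sublevel r (ev h) d `&` nb t0 rho1) t -> `|t.1| <= S * d `^ e.
  move=> [[_ ht] nt]; have [_ [_ [_ [_ he]]]] := hR0 _ (nbR _ _ q2 nt).
  have ct : c <= `|ev h1 t| by apply: (hc t); case: nt => u v; split; exact: lt_le_trans q1.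
  rewrite leNgt; apply/negP => lt.
  have := hS d dp d1 dd; rewrite mul1r => hd.
  have : c * (S * d `^ e) ^+ a <= `|t.1 ^+ a * ev h1 t|.
    rewrite normrM normrX mulrC; apply: ler_pM => //; rewrite ?exprn_ge0 ?(ltW c0) ?(ltW s0)//.
    by rewrite lerXn2r ?nnegrE ?(ltW s0) ?(ltW lt).
  by rewrite -he => /(lt_le_trans hd)/lt_le_trans/(_ ht); rewrite ltxx.
apply: (@lam2_sections R _ (- (S * d `^ e))) => //.
- by rewrite mulr_ge0// ltW.
- by rewrite mulr_ge0// ltW.
- by move=> t /key; exact: norm_itv.
- by move=> u; exists (t0.2 - rho1) => t [_ [_ v]] _; exact: dist_itv v.
Qed.

End sublevel_uniform.
End uniform.

(** * Interpolation *)

Section interpolation.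
Context d (T : measurableType d) (R : realType) (mu : {measure set T -> \bar R}).

Lemma powR_prod_le (x y th : R) : 0 <= x -> 0 <= y -> 0 <= th -> th <= 1 -> x `^ th * y `^ (1 - th) <= x + y.
Proof.
move=> x0 y0 th0 th1; pose z := Num.max x y.
have xz : x <= z by rewrite le_max lexx.
have yz : y <= z by rewrite le_max lexx orbT.
have z0 : 0 <= z by exact: le_trans xz.
apply: (@le_trans _ _ z); last by rewrite ge_max lerDl lerDr y0.
have th' : 0 <= 1 - th by lra.
apply: (@le_trans _ _ (z `^ th * z `^ (1 - th))).
  by apply: ler_pM; rewrite ?powR_ge0//; apply: ge0_ler_powR; rewrite ?nnegrE.
by rewrite -powRD ?subrKC ?oner_eq0// powRr1.
Qed.

(** [u^q] is the product of [u^((1 - a - b) q)], at most a power of [M], and of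
    [u^th (u^4)^(1 - th)] with [th = a q]. After division by [X] and [Y] the latter is at most the
    sum of its two bases, whose integrals are at most 1; hence the factor 2. *)
Lemma integral_interpolate (u : T -> R) (M X Y q a b : R) :
  measurable_fun [set: T] u -> (forall x, 0 <= u x) -> (forall x, u x <= M) ->
  0 < X -> 0 < Y -> 0 < a -> 0 < b -> a + b / 4 = q^-1 -> 0 < q -> a + b <= 1 ->
  (\int[mu]_x (u x)%:E <= X%:E)%E -> (\int[mu]_x (u x ^+ 4)%:E <= Y%:E)%E ->
  (\int[mu]_x (u x `^ q)%:E <= (2 * (M `^ (1 - a - b) * X `^ a * Y `^ (b / 4)) `^ q)%:E)%E.
Proof.
move=> mu_ u0 uM X0 Y0 a0 b0 abq q0 ab hX hY.
have M0 : 0 <= M by apply: le_trans (uM point).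
pose th := a * q; pose K := M `^ ((1 - a - b) * q) * (X `^ th * Y `^ (1 - th)).
have q1 : q * q^-1 = 1 by rewrite divff// gt_eqF.
have th0 : 0 < th by rewrite mulr_gt0.
have thb : 1 - th = b / 4 * q by have := q1; rewrite -abq /th; lra.
have th1 : 0 < 1 - th by rewrite thb mulr_gt0// divr_gt0.
have K0 : 0 <= K by rewrite !mulr_ge0 ?powR_ge0.
have cq : 0 <= (1 - a - b) * q by rewrite mulr_ge0 ?(ltW q0)//; lra.
have pt x : u x `^ q <= K * (X^-1 * u x + Y^-1 * u x ^+ 4).
  have -> : u x `^ q = u x `^ ((1 - a - b) * q) * (u x `^ th * (u x ^+ 4) `^ (1 - th)).
    rewrite -powR_mulrn// -powRrM -powRD; last by rewrite gt_eqF// addr_gt0// mulr_gt0.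
    have s0 : 0 < th + 4 * (1 - th) by rewrite addr_gt0// mulr_gt0.
    rewrite -powRD; last by rewrite gt_eqF// ltr_wpDl.
    by congr powR; rewrite thb /th; field.
  rewrite /K -mulrA; apply: ler_pM; rewrite ?powR_ge0 ?mulr_ge0 ?powR_ge0//.
    by apply: ge0_ler_powR; rewrite ?nnegrE.
  have -> : u x `^ th * (u x ^+ 4) `^ (1 - th) = X `^ th * Y `^ (1 - th) *
     ((X^-1 * u x) `^ th * (Y^-1 * u x ^+ 4) `^ (1 - th)).
    rewrite -[X in X `^ th](mulVKf (lt0r_neq0 X0) (u x)) mulrC.
    rewrite [in LHS](powRM _ (ltW X0)) ?mulr_ge0 ?invr_ge0 ?(ltW X0)//.
    rewrite -[u x ^+ 4 in LHS](mulVKf (lt0r_neq0 Y0)) [in LHS](powRM _ (ltW Y0)) ?mulr_ge0 ?exprn_ge0 ?invr_ge0 ?(ltW Y0)//.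
    by ring.
  rewrite ler_wpM2l ?mulr_ge0 ?powR_ge0//; apply: powR_prod_le; try lra.
    by rewrite mulr_ge0// invr_ge0 ltW.
  by rewrite mulr_ge0 ?exprn_ge0// invr_ge0 ltW.
apply: (@le_trans _ _ (\int[mu]_x (K * (X^-1 * u x + Y^-1 * u x ^+ 4))%:E)%E).
  by apply: ge0_integral_mono => x _; rewrite lee_fin ?powR_ge0.
have m4 : measurable_fun [set: T] (fun x => u x ^+ 4) by exact: measurable_funX.
have iX : 0 <= X^-1 by rewrite invr_ge0 ltW.
have iY : 0 <= Y^-1 by rewrite invr_ge0 ltW.
rewrite (_ : (fun x => _) = (fun x => K%:E * (X^-1%:E * (u x)%:E + Y^-1%:E * (u x ^+ 4)%:E))%E); last first.
  by apply/funext => x; rewrite EFinM EFinD !EFinM.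
rewrite ge0_integralZl//; last 2 first.
- apply: emeasurable_funD; apply: measurable_funeM; exact/measurable_EFinP.
- by move=> x _; rewrite adde_ge0// mule_ge0// lee_fin// exprn_ge0.
rewrite ge0_integralD//; last 4 first.
- by move=> x _; rewrite mule_ge0// lee_fin.
- by apply: measurable_funeM; exact/measurable_EFinP.
- by move=> x _; rewrite mule_ge0// lee_fin// exprn_ge0.
- by apply: measurable_funeM; exact/measurable_EFinP.
rewrite ge0_integralZl//; last 2 first.
- exact/measurable_EFinP.
- by move=> x _; rewrite lee_fin.
rewrite ge0_integralZl//; last 2 first.
- exact/measurable_EFinP.
- by move=> x _; rewrite lee_fin exprn_ge0.
have h1 : (X^-1%:E * \int[mu]_x (u x)%:E <= 1)%E.
  apply: (@le_trans _ _ (X^-1%:E * X%:E)%E); first by apply: lee_wpmul2l => //; rewrite lee_fin.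
  by rewrite -EFinM mulVf ?gt_eqF.
have h2 : (Y^-1%:E * \int[mu]_x (u x ^+ 4)%:E <= 1)%E.
  apply: (@le_trans _ _ (Y^-1%:E * Y%:E)%E); first by apply: lee_wpmul2l => //; rewrite lee_fin.
  by rewrite -EFinM mulVf ?gt_eqF.
have K0e : (0 <= K%:E)%E by rewrite lee_fin.
apply: le_trans (lee_wpmul2l K0e (leeD h1 h2)) _.
rewrite -EFinD -EFinM lee_fin /K mulrC.
by rewrite !powRM ?mulr_ge0 ?powR_ge0// -!powRrM -thb -mulrA.
Qed.

Lemma sum_geometric_le_inv (th : R) n : 0 <= th -> th < 1 -> \sum_(i < n) th ^+ i <= (1 - th)^-1.
Proof.
move=> th0 th1; rewrite -[leRHS]mul1r ler_pdivlMr ?subr_gt0//.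
suff -> : (\sum_(i < n) th ^+ i) * (1 - th) = 1 - th ^+ n by rewrite gerBl exprn_ge0.
elim: n => [|n IH]; first by rewrite big_ord0 mul0r expr0 subrr.
by rewrite big_ord_recr/= mulrDl IH exprS; ring.
Qed.

(** Instead of the triangle inequality: every [v i] is at most [th^i] times the [q]-norm over [k] of
    [v k / th^k]. Of the decay [th^(2 i)], one factor [th^i] pays for summing this pointwise bound,
    the other for summing the integrals. *)
Lemma integral_series_powR (th q : R) : 0 < th -> th < 1 -> 0 < q ->
  exists2 K : R, 0 < K & forall (u : T -> R) (v : nat -> T -> R) (B : R), 0 <= B ->
    (forall x, 0 <= u x) -> (forall i x, 0 <= v i x) -> (forall i, measurable_fun [set: T] (v i)) ->
    (forall x, (u x)%:E <= \sum_(i <oo) (v i x)%:E)%E ->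
    (forall i, \int[mu]_x (v i x `^ q)%:E <= ((B * (th ^+ 2) ^+ i) `^ q)%:E)%E ->
    (\int[mu]_x (u x `^ q)%:E <= (K * B `^ q)%:E)%E.
Proof.
move=> th0 th1 q0; pose W := (1 - th)^-1.
have W0 : 0 < W by rewrite invr_gt0 subr_gt0.
have thq0 : 0 < th `^ q by exact: powR_gt0.
have thq1 : th `^ q < 1.
  have := @gt0_ltr_powR R q q0 th 1; rewrite !nnegrE powR1 => -> //; exact: ltW.
pose K := W `^ q * (1 - th `^ q)^-1.
exists K; first by rewrite mulr_gt0 ?powR_gt0// invr_gt0 subr_gt0.
move=> u v B B0 u0 v0 mv uv hv.
pose g i x := (v i x / th ^+ i) `^ q.
have g0 i x : 0 <= g i x by exact: powR_ge0.
have mg i : measurable_fun [set: T] (fun x => (g i x)%:E).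
  apply/measurable_EFinP; apply: (measurableT_comp (measurable_powR _)).
  by apply: measurable_funM.
have geoW n : \sum_(i < n) th ^+ i <= W by apply: sum_geometric_le_inv => //; exact: ltW.
have pt x : ((u x `^ q)%:E <= (W `^ q)%:E * \sum_(i <oo) (g i x)%:E)%E.
  have s0 : (0 <= \sum_(i <oo) (g i x)%:E)%E by apply: nneseries_ge0 => i _ _; rewrite lee_fin.
  move: s0; case E : (\sum_(i <oo) (g i x)%:E)%E => [s| |]// s0; last first.
    by rewrite gt0_muley ?leey// lte_fin powR_gt0.
  rewrite lee_fin in s0; rewrite -EFinM lee_fin.
  have q1 : q * q^-1 = 1 by rewrite divff// gt_eqF.
  have vs i : v i x <= s `^ q^-1 * th ^+ i.
    have gs : g i x <= s.
      rewrite -lee_fin -E; apply: le_trans (@nneseries_lim_ge _ (fun i => (g i x)%:E) xpredT 0 i.+1 _).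
        by rewrite big_nat_recr//= leeDr// sume_ge0// => j _; rewrite lee_fin.
      by move=> j _; rewrite lee_fin.
    rewrite -ler_pdivrMr ?exprn_gt0//.
    have vt0 : 0 <= v i x / th ^+ i by rewrite divr_ge0// exprn_ge0// ltW.
    rewrite -[leLHS](powRr1 vt0) -q1 powRrM.
    by apply: ge0_ler_powR; rewrite ?invr_ge0 ?nnegrE ?powR_ge0 ?(ltW q0).
  have us : u x <= s `^ q^-1 * W.
    rewrite -lee_fin; apply: le_trans (uv x) _.
    apply: lime_le; first by apply: is_cvg_nneseries => i _ _; rewrite lee_fin.
    apply: nearW => n; rewrite big_mkord sumEFin lee_fin.
    apply: (@le_trans _ _ (\sum_(i < n) s `^ q^-1 * th ^+ i)); first by apply: ler_sum.
    by rewrite -mulr_sumr ler_wpM2l ?powR_ge0.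
  apply: (@le_trans _ _ ((s `^ q^-1 * W) `^ q)).
    by apply: ge0_ler_powR; rewrite ?nnegrE ?mulr_ge0 ?powR_ge0 ?(ltW q0) ?(ltW W0).
  by rewrite powRM ?powR_ge0 ?(ltW W0)// -powRrM mulVf ?gt_eqF// powRr1// mulrC.
apply: (@le_trans _ _ (\int[mu]_x ((W `^ q)%:E * \sum_(i <oo) (g i x)%:E))%E).
  by apply: ge0_integral_mono => x _; rewrite ?lee_fin ?powR_ge0//; exact: pt.
rewrite ge0_integralZl//; last 3 first.
- by apply: ge0_emeasurable_sum => // i x _ _; rewrite lee_fin.
- by move=> x _; apply: nneseries_ge0 => i _ _; rewrite lee_fin.
- by rewrite lee_fin powR_ge0.
rewrite integral_nneseries//; last by move=> i x _; rewrite lee_fin.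
rewrite /K -mulrA EFinM; apply: lee_wpmul2l; first by rewrite lee_fin powR_ge0.
have gi i : (\int[mu]_x (g i x)%:E <= (B `^ q * (th `^ q) ^+ i)%:E)%E.
  have ti0 : 0 < th ^+ i by rewrite exprn_gt0.
  rewrite (_ : (fun x => _) = (fun x => ((th ^+ i)^-1 `^ q)%:E * (v i x `^ q)%:E)%E); last first.
    by apply/funext => x; rewrite -EFinM /g powRM ?invr_ge0 ?(ltW ti0)// mulrC.
  rewrite ge0_integralZl//; last 3 first.
  - by apply/measurable_EFinP; exact: (measurableT_comp (measurable_powR _)).
  - by move=> x _; rewrite lee_fin powR_ge0.
  - by rewrite lee_fin powR_ge0.
  apply: le_trans (lee_wpmul2l _ (hv i)) _; first by rewrite lee_fin powR_ge0.
  rewrite -EFinM lee_fin -powRM ?invr_ge0 ?(ltW ti0)//; last by rewrite mulr_ge0// exprn_ge0// exprn_ge0// ltW.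
  rewrite (_ : _^-1 * _ = B * th ^+ i); last first.
    by rewrite -exprM mulnC exprM expr2; field; rewrite gt_eqF.
  by rewrite -[(th `^ q) ^+ i]powR_mulrn ?powR_ge0// powRAC powR_mulrn ?(ltW th0)// -powRM ?(ltW ti0).
apply: (@le_trans _ _ (\sum_(i <oo) (B `^ q * (th `^ q) ^+ i)%:E)%E).
  by apply: lee_nneseries => [i _ _|i _]; [apply: integral_ge0 => x _; rewrite lee_fin|exact: gi].
apply: lime_le.
  by apply: is_cvg_nneseries => i _ _; rewrite lee_fin mulr_ge0 ?powR_ge0// exprn_ge0// powR_ge0.
apply: nearW => n; rewrite big_mkord sumEFin lee_fin -mulr_sumr mulrC ler_wpM2r ?powR_ge0//.
by apply: sum_geometric_le_inv => //; exact: ltW.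
Qed.
End interpolation.

(** * Analytic data *)

Section setup.
Variable R : realType.
Implicit Types (c h : nat -> nat -> R) (t s : R * R).

Lemma tame_eq (Gam : R) (D : set (R * R)) F F1 F2 G G1 G2 :
  (forall t, D t -> F t = G t) -> (forall t, D t -> F1 t = G1 t) -> (forall t, D t -> F2 t = G2 t) ->
  tame Gam D F F1 F2 -> tame Gam D G G1 G2.
Proof.
move=> e e1 e2 [hF aF]; split.
  by move=> s t Ds Dt; rewrite -!e// -!e1// -!e2//; exact: hF.
move=> n; have [P [P1 [P2 [Pn hP dP]]]] := aF n; exists P, P1, P2; split => // t Dt.
by rewrite -e// -e1// -e2//; exact: dP.
Qed.

(** Chebyshev's inequality; the value infinity at the zeros of [g] is compatible with it. *)
Lemma integrable_sublevel (g : R * R -> R) (e e' r r' : R) : 0 < e' -> e' <= e -> r' <= r ->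
  (@leb2 R).-integrable (sq0 r) (fun t => if g t == 0 then +oo%E else (`|g t| `^ (- e))%:E) ->
  (forall d, measurable (sublevel r' g d)) -> sublevel_bound g r' e'.
Proof.
pose F t := (if g t == 0 then +oo%E else (`|g t| `^ (- e))%:E).
move=> e0 ee rr /integrableP[_] Ioo mg.
have {}Ioo : (\int[lam2 R]_(t in sq0 r) `|F t| < +oo)%E by exact: Ioo.
have I0 : (0 <= \int[lam2 R]_(t in sq0 r) `|F t|)%E by apply: integral_ge0.
pose I := fine (\int[lam2 R]_(t in sq0 r) `|F t|)%E.
have IE : (\int[lam2 R]_(t in sq0 r) `|F t|)%E = I%:E by rewrite fineK// ge0_fin_numE.
have I0' : 0 <= I by rewrite -lee_fin -IE.
exists I => d d0 d1.
have de0 : 0 < d `^ e by exact: powR_gt0.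
apply: (@le_trans _ _ (I * d `^ e)%:E); last first.
  by rewrite lee_fin ler_wpM2l// ger_powR// d0.
rewrite EFinM muleC -lee_pdivrMl// -powRN -IE.
rewrite -(integral_cst (lam2 R) (mg d)).
apply: (@le_trans _ _ (\int[lam2 R]_(t in sublevel r' g d) `|F t|)%E); last first.
  by apply: ge0_integral_subset => // t [st _]; exact: sq0_le st.
apply: ge0_integral_mono => t [_ gd]; first by rewrite lee_fin powR_ge0.
rewrite /F; case: ifPn => [_|g0]; first by rewrite leey.
rewrite /= ger0_norm ?powR_ge0// lee_fin !powRN lef_pV2 ?posrE ?powR_gt0 ?normr_gt0//.
by apply: ge0_ler_powR; rewrite ?nnegrE ?normr_ge0 ?(ltW d0)//; apply: le_trans ee; exact: ltW.
Qed.

Lemma integrability_exponent_gt (g : R * R -> R) (e : R) : 0 < e -> e < integrability_exponent g ->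
  exists2 e' : R, e <= e' & neg_pow_integrable_near0 g e'.
Proof.
move=> e0 h; have [X0|X0] := pselect ([set e : R | 0 < e /\ neg_pow_integrable_near0 g e] !=set0).
  by have [e' [_ he'] lt] := sup_gt X0 h; exists e' => //; exact: ltW.
move: h; rewrite /integrability_exponent (_ : [set e : R | _] = set0).
  by rewrite sup0 => /(lt_trans e0); rewrite ltxx.
by apply/seteqP; split => // x hx; apply: X0; exists x.
Qed.

(** If the set of exponents is empty or unbounded, [sup] takes its default value 0. *)
Lemma integrability_exponent_ge0 (g : R * R -> R) : 0 <= integrability_exponent g.
Proof.
rewrite /integrability_exponent; set X := [set _ | _].
have [[[x Xx] ub]|/sup_out ->//] := pselect (has_sup X).
by apply: le_trans (ub_le_sup ub Xx); case: Xx => /ltW.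
Qed.

Lemma germ_dx c : germ c -> germ (dx c).
Proof.
move=> [C [rho [r0 cg]]]; exists (C * rho), (2 * rho); split; first by rewrite mulr_gt0.
by apply: geo_dx => //; exact: ltW.
Qed.

(** All that the estimates need about [S], on one square. [Sx] is [S] extended by zero from a box,
    since averages require a function measurable on the whole plane. *)
Lemma analytic_setup (S : R * R -> R) : analytic_near0 S -> ~ zero_near0 (hessian S) ->
  exists (r : R) (Sx : R * R -> R), [/\ 0 < r, 4 * r ^+ 2 <= 1, measurable_fun [set: TR2 R] Sx &
    [/\ forall t, sq0 r t -> Sx t = S t, measurable_fun (sq0 r : set (TR2 R)) (hessian S),
      forall e : R, 0 < e -> e < integrability_exponent (hessian S) -> sublevel_bound (hessian S) r e &
      forall e : R, 0 < e -> exists2 C : R, 0 < C & forall (del V : R) (A : set (TR2 R)) (E : set (TR3 R)),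
        0 < del -> del <= 1 -> measurable A -> A `<=` sq0 r -> (forall t, A t -> del <= `|hessian S t|) ->
        measurable E -> (forall y, open (xsection E y)) -> 0 < V -> (lam3 R E <= V%:E)%E ->
        (\int[lam3 R]_x (fine (avg Sx A E x) ^+ 4)%:E <= (C * del `^ (- (1 + e) ^+ 2) * Num.min 1 V `^ (- e) * V ^+ 3)%:E)%E]].
Proof.
move=> /analytic_ev[C [rho [ra [c [rho0 ra0 cg Se]]]]] Hn0.
have r32 : 0 < 128^-1 :> R by rewrite invr_gt0.
have [tau0 /andP[tau00 tau01] rt0] := small_radius rho0 r32.
pose tau := Num.min tau0 ra.
have t0 : 0 < tau by rewrite lt_min tau00.
have t1 : tau <= 1 by rewrite ge_min tau01.
have tra : tau <= ra by rewrite ge_min lexx orbT.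
have rt : rho * tau <= 128^-1.
  by apply: le_trans rt0; rewrite ler_wpM2l ?(ltW rho0)// ge_min lexx.
have C0 := geo_ge0 cg; have r0 := ltW rho0; have r20 : 0 <= 2 * rho by lra.
have r40 : 0 <= 2 * (2 * rho) by lra.
have cx := geo_dx r0 cg; have cy := geo_dy r0 cg.
have a1 : rho * tau <= 32^-1 by lra.
have a2 : 2 * rho * tau <= 32^-1 by lra.
have b1 : rho * tau <= 8^-1 by lra.
have b2 : 2 * rho * tau <= 8^-1 by lra.
have c1 : rho * tau <= 2^-1 by lra.
have c2 : 2 * rho * tau <= 2^-1 by lra.
have c4 : 2 * (2 * rho) * tau <= 2^-1 by lra.
have Se' t : sq0 tau t -> S t = ev c t by move=> st; apply: Se; exact: sq0_le st.
have S1e := d1_ev t0 t1 r0 b1 cg Se'.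
have S2e := d2_ev t0 t1 r0 b1 cg Se'.
have S11e := d1_ev t0 t1 r20 b2 cx S1e.
have S22e := d2_ev t0 t1 r20 b2 cy S2e.
have S12e := d1_ev t0 t1 r20 b2 cy S2e.
have He t : sq0 tau t -> hessian S t = ev (dx (dx c)) t * ev (dy (dy c)) t - ev (dx (dy c)) t ^+ 2.
  by move=> st; rewrite /hessian S11e// S22e// S12e.
(* The last two terms are the constants of [S] and of its first derivatives; [tau^-1] makes the
   margin [1 / (160 (2 Gam)^2)] of the area inequality at most [tau / 2]. *)
pose Gam := 1 + tau^-1 + 8 * C / tau ^+ 2 + 8 * (C * rho) / tau ^+ 2.
have ti : 0 < tau^-1 by rewrite invr_gt0.
have G1 : 0 <= 8 * C / tau ^+ 2 by rewrite divr_ge0 ?exprn_ge0 ?(ltW t0)// mulr_ge0.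
have G2 : 0 <= 8 * (C * rho) / tau ^+ 2 by rewrite divr_ge0 ?exprn_ge0 ?(ltW t0)// !mulr_ge0.
have Gam1 : 1 <= Gam by rewrite /Gam; move: ti G1 G2; clear; lra.
have GamC : 8 * C / tau ^+ 2 <= Gam by rewrite /Gam; move: ti G2; clear; lra.
have GamC' : 8 * (C * rho) / tau ^+ 2 <= Gam by rewrite /Gam; move: ti G1; clear; lra.
have Gamt : tau^-1 <= Gam by rewrite /Gam; move: G1 G2; clear; lra.
pose tr (g : R * R -> R) : R * R -> R := g \_ (box tau).
have trE g t : box tau t -> tr g t = g t by move=> bt; rewrite /tr /patch mem_set.
have mtr (rh K : R) g : 0 <= rh -> rh * tau <= 2^-1 -> geo K rh g -> measurable_fun [set: TR2 R] (tr (ev g)).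
  by move=> rh0 rht gg; exact: ((measurable_restrictT (ev g) (@measurable_box R tau)).1 (measurable_ev rh0 rht gg)).
have tame_tr K rh g : 0 <= rh -> rh * tau <= 32^-1 -> geo K rh g -> 8 * K / tau ^+ 2 <= Gam ->
    tame Gam (box tau) (tr (ev g)) (tr (ev (dx g))) (tr (ev (dy g))).
  move=> rh0 rht gg KG; apply: (tame_eq _ _ _ (tame_ev t0 t1 rh0 rht gg KG)) => t bt; by rewrite trE.
have hb t : box tau t -> n1 t <= 2 * tau by move=> [u v]; rewrite /n1; move: u v; clear; lra.
have hA0 t s : sq0 (tau / 2) t -> n1 (s - t) <= (160 * (2 * Gam) ^+ 2)^-1 -> box tau s.
  move=> [u v] hn.
  have big : (160 * (2 * Gam) ^+ 2)^-1 <= tau / 2.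
    have Gp : 0 < Gam by exact: lt_le_trans Gam1.
    have tG : 1 <= Gam * tau by rewrite -ler_pdivrMr// mul1r.
    have GG : Gam * tau <= Gam ^+ 2 * tau by rewrite expr2 -mulrA ler_peMl// mulr_ge0// ltW.
    have pp : 0 < 160 * (2 * Gam) ^+ 2 by rewrite mulr_gt0// exprn_gt0// mulr_gt0.
    rewrite -[leLHS]mul1r ler_pdivrMr// exprMn.
    by move: tG GG; clear; lra.
  move: hn; rewrite /n1/= => hn.
  have := ler_normD (s.1 - t.1) t.1; have := ler_normD (s.2 - t.2) t.2; rewrite !subrK.
  have := normr_ge0 (s.1 - t.1); have := normr_ge0 (s.2 - t.2).
  by move: hn big u v; clear => *; split; lra.
pose hc i j := 1 * conv (dx (dx c)) (dy (dy c)) i j + (-1) * conv (dx (dy c)) (dx (dy c)) i j.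
have gc : germ c by exists C, rho.
have gy2 : germ (dy (dy c)) by do 2 apply: germ_dy.
have gx2 : germ (dx (dx c)) by do 2 apply: germ_dx.
have gxy : germ (dx (dy c)) by apply: germ_dx; exact: germ_dy.
have ghc : germ hc by apply: germ_lin; exact: germ_conv.
have Hhc : near0 (fun t => hessian S t = ev hc t).
  have h1 : near0 (sq0 tau) by exists tau.
  apply: near0_imp (near0_and h1 (near0_and (near0_ev_lin 1 (-1) (germ_conv gx2 gy2) (germ_conv gxy gxy))
    (near0_and (near0_ev_conv gx2 gy2) (near0_ev_conv gxy gxy)))) => t [st [e1 [e2 e3]]].
  by rewrite He// /hc e1 e2 e3; ring.
have [rh rh0 hHhc] := Hhc.
have [rm rm0 hrm] := germ_measurable ghc.
have [i [j hij]] : exists i j, hc i j != 0.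
  apply: contrapT => no; apply: Hn0; rewrite /zero_near0.
  have hc0 : hc = fun _ _ => 0.
    apply/funext => i; apply/funext => j; apply/eqP; apply: contrapT => /negP hij.
    by apply: no; exists i, j.
  near=> t; rewrite hHhc; last by near: t; exact: nbhs_sq0.
  rewrite hc0 /ev -[RHS](@dsum0 R); congr dsum.
  by apply/funext => i; apply/funext => j; rewrite !mul0r.
have [a [h1 [m [gh1 hE h1m _]]]] := factor_x ghc hij.
set eta := integrability_exponent (hessian S).
have mH r : r <= rh -> r <= rm -> measurable_fun (sq0 r : set (TR2 R)) (hessian S).
  move=> rr1 rr2; apply: (eq_measurable_fun (ev hc)) (hrm r rr2) => t; rewrite inE => st.
  by rewrite hHhc//; exact: sq0_le st.
have slE r d : r <= rh -> sublevel r (ev hc) d = sublevel r (hessian S) d.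
  move=> rr; apply/seteqP; split => t [st ht]; split => //; move: ht; rewrite hHhc//; exact: sq0_le st.
have [r1 [r10 mr1 hr1]] : exists r : R, [/\ 0 < r, forall d, measurable (sublevel r (ev hc) d) &
    forall e : R, 0 < e -> e < eta -> sublevel_bound (ev hc) r e].
  (* Without a positive exponent there is no [e] to treat, and any radius with measurability will
     do. *)
  have [eta0|eta0] := ltP 0 eta; last first.
    exists rm; split => // [d|e e0 /lt_le_trans/(_ eta0)/(lt_trans e0)]; last by rewrite ltxx.
    by apply: measurable_sublevel; exact: hrm.
  apply: (sublevel_uniform ghc gh1 hE h1m eta0) => e e0 eeta.
  have [e' ee' [r r00 hr]] := integrability_exponent_gt e0 eeta.
  pose r2 := Num.min r (Num.min rh rm).
  exists r2; first by rewrite !lt_min r00 rh0.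
  move=> r' r'0; rewrite !le_min => /and3P[q1 q2 q3].
  have ms d : measurable (sublevel r' (hessian S) d) by apply: measurable_sublevel; exact: mH.
  have [K hK] := integrable_sublevel e0 ee' q1 hr ms.
  by exists K => d dp d1; rewrite slE//; exact: hK.
pose r := Num.min (Num.min r1 (tau / 2)) (Num.min rh rm).
have q1 : r <= r1 by rewrite !ge_min lexx.
have q2 : r <= tau / 2 by rewrite !ge_min lexx orbT.
have q3 : r <= rh by rewrite !ge_min lexx !orbT.
have q4 : r <= rm by rewrite !ge_min lexx !orbT.
have rp : 0 < r by rewrite !lt_min r10 rh0 rm0 divr_gt0.
have rtau : r <= tau by move: q2 t0; clear; lra.
have r41 : 4 * r ^+ 2 <= 1.
  have r2 : r <= 2^-1 by move: q2 t1; clear; lra.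
  have : r * r <= 2^-1 * 2^-1 by exact: (ler_pM (ltW rp) (ltW rp) r2 r2).
  by rewrite expr2; clear; lra.
exists r, (tr (ev c)); split; [exact: rp|exact: r41|exact: mtr cg|split].
- by move=> t st; rewrite trE ?Se'//; [exact: sq0_le st|apply: sq0_box; exact: sq0_le st].
- exact: mH.
- move=> e e0 eeta; have [K hK] := hr1 e e0 eeta; exists K => d dp d1.
  rewrite -slE//; apply: le_trans (hK d dp d1); apply: le_measure; rewrite ?inE//.
    by apply: measurable_sublevel; exact: hrm.
  by move=> t [st ht]; split => //; exact: sq0_le st.
- move=> e e0.
  have [C' C'0 hC'] := quartic_bound Gam1 hb (tame_tr _ _ _ r0 a1 cg GamC) (tame_tr _ _ _ r20 a2 cx GamC')
    (tame_tr _ _ _ r20 a2 cy GamC') (mtr _ _ _ r0 c1 cg) (mtr _ _ _ r20 c2 cx) (mtr _ _ _ r20 c2 cy)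
    (mtr _ _ _ r40 c4 (geo_dx r20 cx)) (mtr _ _ _ r40 c4 (geo_dy r20 cx))
    (mtr _ _ _ r40 c4 (geo_dx r20 cy)) (mtr _ _ _ r40 c4 (geo_dy r20 cy)) hA0 e0.
  exists C'; first exact: C'0.
  move=> del V A E d0 d1 mA Ar Hd mE oE V0 EV; apply: (hC' del V A E d0 d1 mA _ _ _ mE oE V0 EV).
  + by move=> t /Ar st; exact: sq0_le st.
  + apply: (@le_trans _ _ (lam2 R (sq0 r))); last by apply: le_trans (lam2_sq0 rp) _; rewrite lee_fin.
    by apply: le_measure; rewrite ?inE//; exact: measurable_sq0.
  + move=> t At; have st : sq0 tau t by apply: sq0_le (Ar t At).
    have bt := sq0_box st; rewrite /jac !trE// -dxdyC -expr2 -He//; exact: Hd.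
Unshelve. all: by end_near. Qed.

End setup.

(** * Restricted estimates *)

Section restricted.
Variable R : realType.
Variables (r eta : R) (S H : R * R -> R).
Hypotheses (r0 : 0 < r) (r41 : 4 * r ^+ 2 <= 1) (mS : measurable_fun [set: TR2 R] S).
Hypotheses (mH : measurable_fun (sq0 r : set (TR2 R)) H) (eta0 : 0 < eta).
Hypothesis subH : forall e : R, 0 < e -> e < eta -> sublevel_bound H r e.
Hypothesis quartH : forall e : R, 0 < e -> exists2 C : R, 0 < C &
  forall (del V : R) (A : set (TR2 R)) (E : set (TR3 R)),
    0 < del -> del <= 1 -> measurable A -> A `<=` sq0 r -> (forall t, A t -> del <= `|H t|) ->
    measurable E -> (forall y, open (xsection E y)) -> 0 < V -> (lam3 R E <= V%:E)%E ->
    (\int[lam3 R]_x (fine (avg S A E x) ^+ 4)%:E <= (C * del `^ (- (1 + e) ^+ 2) * Num.min 1 V `^ (- e) * V ^+ 3)%:E)%E.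

(** Shell 0 has no upper bound and takes all of [|H| >= 1]. *)
Definition shell (j : nat) : set (TR2 R) :=
  [set t | sq0 r t /\ (2^-1 ^+ j <= `|H t| /\ (j != 0%N -> `|H t| < 2^-1 ^+ j.-1))].

Lemma measurable_shell j : measurable (shell j).
Proof.
have mN : measurable_fun (sq0 r : set (TR2 R)) (fun t => `|H t|) := measurableT_comp (@normr_measurable R setT) mH.
have ms : measurable (sq0 r : set (TR2 R)) by exact: measurable_sq0.
case: j => [|j].
  rewrite (_ : shell 0 = sq0 r `&` (fun t => `|H t|) @^-1` `[2^-1 ^+ 0, +oo[%classic); first exact: mN.
  apply/seteqP; split => t; rewrite /shell/= in_itv/= andbT; first by move=> [st [h _]].
  by move=> [st h].
rewrite (_ : shell j.+1 = sq0 r `&` (fun t => `|H t|) @^-1` `[2^-1 ^+ j.+1, 2^-1 ^+ j[%classic); first exact: mN.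
apply/seteqP; split => t; rewrite /shell/= in_itv/=; first by move=> [st [h /(_ isT) h']]; rewrite h h'.
by move=> [st /andP[h h']].
Qed.

Lemma lam2_shell (e : R) : 0 < e -> e < eta -> exists2 C : R, 0 < C &
  forall j, (lam2 R (shell j) <= (C * (2^-1 ^+ j) `^ e)%:E)%E.
Proof.
move=> e0 ee; have [C hC] := subH e0 ee.
pose K := Num.max 1 (C * 2 `^ e).
have K1 : 1 <= K by rewrite le_max lexx.
have KC : C * 2 `^ e <= K by rewrite le_max lexx orbT.
exists K; first exact: lt_le_trans K1.
have h0 n : 0 < 2^-1 ^+ n :> R by rewrite exprn_gt0.
have h1 n : 2^-1 ^+ n <= 1 :> R by rewrite exprn_ile1//; lra.
move=> [|j].
  rewrite expr0 powR1 mulr1; apply: (@le_trans _ _ (lam2 R (sq0 r))).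
    apply: le_measure; rewrite ?inE; [exact: measurable_shell|exact: measurable_sq0|by move=> t []].
  by apply: le_trans (lam2_sq0 r0) _; rewrite lee_fin; apply: le_trans r41 _.
apply: (@le_trans _ _ (lam2 R (sublevel r H (2^-1 ^+ j)))).
  apply: le_measure; rewrite ?inE; [exact: measurable_shell|exact: measurable_sublevel|].
  by move=> t [st [_ /(_ isT) h]]; split => //; exact: ltW.
apply: le_trans (hC _ (h0 j) (h1 j)) _; rewrite lee_fin.
have -> : (2^-1 ^+ j) `^ e = 2 `^ e * (2^-1 ^+ j.+1) `^ e :> R.
  by rewrite -powRM ?(ltW (h0 _))// exprS mulrA divff// mul1r.
by rewrite mulrA ler_wpM2r ?powR_ge0.
Qed.

Lemma measurable_degenerate : measurable ([set t | sq0 r t /\ H t = 0] : set (TR2 R)).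
Proof.
rewrite (_ : [set t | _] = sublevel r H 0); first exact: measurable_sublevel.
apply/seteqP; split => t [st Ht]; split => //; first by rewrite Ht normr0.
by apply/eqP; rewrite -normr_le0.
Qed.

(** The shells leave out the zeros of [H]; the sublevel bound at levels [2^-n] makes them
    negligible. *)
Lemma lam2_degenerate : lam2 R [set t | sq0 r t /\ H t = 0] = 0%E.
Proof.
have e2 : 0 < eta / 2 by rewrite divr_gt0.
have e2l : eta / 2 < eta by lra.
have [C hC] := subH e2 e2l; set Z := [set _ | _].
have ZE d : 0 < d -> (lam2 R Z <= lam2 R (sublevel r H d))%E.
  move=> d0; apply: le_measure; rewrite ?inE; [exact: measurable_degenerate|exact: measurable_sublevel|].
  by move=> t [st Ht]; split => //; rewrite Ht normr0 ltW.
have h2 n : 0 < 2^-1 ^+ n :> R by rewrite exprn_gt0.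
have h1 n : 2^-1 ^+ n <= 1 :> R by rewrite exprn_ile1//; lra.
have bd n := le_trans (ZE _ (h2 n)) (hC _ (h2 n) (h1 n)).
have fZ : lam2 R Z \is a fin_num by rewrite ge0_fin_numE//; apply: le_lt_trans (bd 0%N) (ltry _).
have ht0 : 0 < (2^-1 : R) `^ (eta / 2) by rewrite powR_gt0.
have ht1 : (2^-1 : R) `^ (eta / 2) < 1.
  have := @gt0_ltr_powR R (eta / 2) e2 2^-1 1; rewrite !nnegrE powR1 => -> //; lra.
apply/eqP; rewrite eq_le measure_ge0 andbT -(fineK fZ) lee_fin.
apply: (@le0_geometric R _ C ((2^-1 : R) `^ (eta / 2))) => // n; rewrite -lee_fin fineK//; apply: le_trans (bd n) _.
by rewrite lee_fin -powR_mulrn// powRAC powR_mulrn ?powR_ge0.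
Qed.

Lemma avg_fin A E x : measurable A -> measurable E -> A `<=` sq0 r -> avg S A E x \is a fin_num.
Proof.
move=> mA mE Ar; rewrite ge0_fin_numE//; apply: le_lt_trans (avg_le mS mA mE x) _.
apply: (@le_lt_trans _ _ (lam2 R (sq0 r))); first by apply: le_measure; rewrite ?inE//; exact: measurable_sq0.
by apply: le_lt_trans (lam2_sq0 r0) _; rewrite ltry.
Qed.

Lemma avg_shells E x : measurable E -> (avg S (sq0 r) E x <= \sum_(j <oo) avg S (shell j) E x)%E.
Proof.
move=> mE; have mK : measurable (sq0 r : set (TR2 R)) by exact: measurable_sq0.
pose Z : set (TR2 R) := [set t | sq0 r t /\ H t = 0].
have mZ : measurable Z by exact: measurable_degenerate.
pose N := [set y : TR2 R | Z (sub2 x.1 y)].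
have mN : measurable N.
  have h : measurable_fun [set: TR2 R] (sub2 x.1).
    exact: (measurableT_comp (@measurable_sub2 R) (measurable_pair1 _)).
  by rewrite -[X in measurable X]setTI; exact: h.
have N0 : lam2 R N = 0%E by rewrite lam2_subl// lam2_degenerate.
have mX A : measurable A -> measurable (xsection (hits S A E) x).
  by move=> mA; apply: measurable_xsection; exact: measurable_hits.
have mF j : measurable (xsection (hits S (shell j) E) x `|` N).
  by apply: measurableU => //; apply: mX; exact: measurable_shell.
apply: (@le_trans _ _ (\sum_(j <oo) lam2 R (xsection (hits S (shell j) E) x `|` N))%E); last first.
  apply: lee_nneseries => // j _; apply: le_trans (measureU2 _ _ _) _ => //.
    by apply: mX; exact: measurable_shell.
  by rewrite [X in (_ + X)%E]N0 adde0.
apply: measure_sigma_subadditive => //; first exact: mX.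
move=> y; rewrite /xsection/= inE => -[/= sy Ey].
have [H0|H0] := eqVneq (H (sub2 x.1 y)) 0; first by exists 0%N => //; right.
have n0 : 0 < `|H (sub2 x.1 y)| by rewrite normr_gt0.
have ex : exists j, 2^-1 ^+ j <= `|H (sub2 x.1 y)|.
  have [j hj] := @geometric_small R 1 2^-1 _ ltac:(lra) ltac:(lra) n0.
  by exists j; rewrite mul1r in hj; exact: ltW.
case: (ex_minnP ex) => j hj mj; exists j => //; left; rewrite /xsection/= inE; split => //=.
split => //; split => // j0; rewrite ltNge; apply/negP => /mj; case: j j0 {hj mj} => // j _.
by rewrite ltnn.
Qed.

(** Interpolation on each shell, with [M] the area of the shell: the supremum bound gives
    [M^(1 - a - b)], the integral [(M V)^a], the quartic bound the power [b / 4]. Together they give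
    [M^(1 - b)] and [V^(a + 3 b / 4)]. *)
Lemma restricted_estimate (a b q e0 : R) : 0 < a -> 0 < b -> a + b < 1 -> a + b / 4 = q^-1 -> 0 < q ->
  b / 4 < eta * (1 - b) -> 0 < e0 ->
  exists2 C : R, 0 < C & forall (V : R) (E : set (TR3 R)), measurable E -> (forall y, open (xsection E y)) ->
    0 < V -> (lam3 R E <= V%:E)%E ->
    (\int[lam3 R]_x (fine (avg S (sq0 r) E x) `^ q)%:E <=
       ((C * V `^ (a + 3 * b / 4) * Num.min 1 V `^ (- e0)) `^ q)%:E)%E.
Proof.
move=> a0 b0 ab abq q0 beta e00.
have half1 : (2^-1 : R) <= 1 by lra.
have b1 : 0 < 1 - b by lra.
(* Midway between the smallest exponent for which the shells sum and the largest for which they are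
   controlled. *)
pose e := (eta + b / 4 / (1 - b)) / 2.
have be : b / 4 / (1 - b) < eta by rewrite ltr_pdivrMr.
have be0 : 0 < b / 4 / (1 - b) by rewrite !divr_gt0.
have ep : 0 < e by rewrite /e; lra.
have el : e < eta by rewrite /e; lra.
have ebb : b / 4 < e * (1 - b) by rewrite -ltr_pdivrMr// /e; lra.
pose g := e * (1 - b) - b / 4; have g0 : 0 < g by rewrite /g; lra.
pose ee := Num.min 1 (Num.min e0 g).
have ee0 : 0 < ee by rewrite !lt_min ltr01 e00.
have ee1 : ee <= 1 by rewrite !ge_min lexx.
have eee : ee <= e0 by rewrite !ge_min lexx !orbT.
have eeg : ee <= g by rewrite !ge_min lexx !orbT.
have eb : - e0 <= - ee * (b / 4).
  have : ee * b <= e0 * 1 by apply: ler_pM; lra.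
  by lra.
(* The net exponent of [2^-j] on shell [j]. It is positive since [(1 + ee)^2 <= 1 + 3 ee] and [ee]
   is at most the gap [g]. *)
pose kap := e * (1 - b) - (1 + ee) ^+ 2 * (b / 4).
have kap0 : 0 < kap.
  have s1 : (1 + ee) ^+ 2 <= 1 + 3 * ee.
    have : ee * ee <= ee * 1 by rewrite ler_wpM2l// ltW.
    by rewrite expr2; lra.
  have s2 : (1 + ee) ^+ 2 * (b / 4) <= (1 + 3 * ee) * (b / 4) by rewrite ler_wpM2r// divr_ge0// ltW.
  have s3 : ee * b <= g * 1 by apply: ler_pM; lra.
  by rewrite /kap; move: s2 s3; rewrite /g; lra.
have [Cq Cq0 hCq] := quartH ee0; have [Cm Cm0 hCm] := lam2_shell ep el.
pose th := (2^-1 : R) `^ (kap / 2).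
have th0 : 0 < th by rewrite powR_gt0.
have th1 : th < 1.
  have k2 : 0 < kap / 2 by rewrite divr_gt0.
  have := @gt0_ltr_powR R (kap / 2) k2 2^-1 1; rewrite !nnegrE powR1 => -> //; lra.
have [K K0 hK] := integral_series_powR (lam3 R) th0 th1 q0.
pose K' := 2 `^ q^-1 * (Cm `^ (1 - b) * Cq `^ (b / 4)).
have K'0 : 0 < K' by rewrite !mulr_gt0// powR_gt0.
exists (K `^ q^-1 * K'); first by rewrite mulr_gt0// powR_gt0.
move=> V E mE oE V0 EV.
pose v := Num.min 1 V; have v0 : 0 < v by rewrite lt_min ltr01.
have v1 : v <= 1 by rewrite ge_min lexx.
pose B := K' * V `^ (a + 3 * b / 4) * v `^ (- e0).
have B0 : 0 <= B by rewrite !mulr_ge0 ?powR_ge0 ?(ltW K'0).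
have -> : (K `^ q^-1 * K' * V `^ (a + 3 * b / 4) * v `^ (- e0)) `^ q = K * B `^ q.
  rewrite (_ : _ * v `^ _ = K `^ q^-1 * B); last by rewrite /B; ring.
  by rewrite powRM ?powR_ge0// -powRrM mulVf ?gt_eqF// powRr1// ltW.
have mK : measurable (sq0 r : set (TR2 R)) by exact: measurable_sq0.
have msh j : measurable (shell j) by exact: measurable_shell.
have shr j : shell j `<=` sq0 r by move=> t [].
have finj j x : avg S (shell j) E x \is a fin_num by exact: (avg_fin x (msh j) mE (shr j)).
have finK x : avg S (sq0 r) E x \is a fin_num by exact: (avg_fin x mK mE (@subset_refl _ _)).
apply: (hK _ (fun j x => fine (avg S (shell j) E x))); first exact: B0.
- by move=> x; rewrite fine_ge0.
- by move=> j x; rewrite fine_ge0.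
- by move=> j; apply: measurableT_comp => //; exact: measurable_avg.
- move=> x; rewrite [leLHS](fineK (finK x)).
  have -> : (\sum_(j <oo) (fine (avg S (shell j) E x))%:E = \sum_(j <oo) avg S (shell j) E x)%E.
    by apply: eq_eseriesr => j _; exact: fineK (finj j x).
  exact: avg_shells.
move=> j; pose d : R := 2^-1 ^+ j.
have d0 : 0 < d by rewrite exprn_gt0.
have d1 : d <= 1 by rewrite exprn_ile1.
pose M := Cm * d `^ e; have M0 : 0 < M by rewrite mulr_gt0// powR_gt0.
have avM x : fine (avg S (shell j) E x) <= M.
  rewrite -lee_fin (fineK (finj j x)); apply: le_trans (avg_le mS (msh j) mE x) _; exact: hCm.
pose Y := Cq * d `^ (- (1 + ee) ^+ 2) * v `^ (- ee) * V ^+ 3.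
have Y0 : 0 < Y by rewrite !mulr_gt0 ?powR_gt0// exprn_gt0.
have hX : (\int[lam3 R]_x (fine (avg S (shell j) E x))%:E <= (M * V)%:E)%E.
  rewrite (_ : (\int[lam3 R]_x _)%E = (\int[lam3 R]_x avg S (shell j) E x)%E); last first.
    by apply: eq_integral => x _; rewrite (fineK (finj j x)).
  rewrite integral_avg// EFinM; apply: lee_pmul => //; exact: hCm.
have hY : (\int[lam3 R]_x (fine (avg S (shell j) E x) ^+ 4)%:E <= Y%:E)%E.
  by apply: hCq => // t [_ []].
apply: le_trans (integral_interpolate _ _ avM (mulr_gt0 M0 V0) Y0 a0 b0 abq q0 (ltW ab) hX hY) _.
- by apply: measurableT_comp => //; exact: measurable_avg.
- by move=> x; rewrite fine_ge0.
rewrite lee_fin.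
have -> : 2 * (M `^ (1 - a - b) * (M * V) `^ a * Y `^ (b / 4)) `^ q =
    (2 `^ q^-1 * (M `^ (1 - a - b) * (M * V) `^ a * Y `^ (b / 4))) `^ q.
  by rewrite [RHS]powRM ?mulr_ge0 ?powR_ge0// -powRrM mulVf ?gt_eqF// powRr1.
apply: ge0_ler_powR; rewrite ?nnegrE ?(ltW q0) ?mulr_ge0 ?powR_ge0// ?exprn_ge0 ?(ltW th0)//.
have Mab : M `^ (1 - a - b) * (M * V) `^ a = Cm `^ (1 - b) * d `^ (e * (1 - b)) * V `^ a.
  rewrite [(M * V) `^ a]powRM ?(ltW M0) ?(ltW V0)// mulrA -powRD; last by rewrite [M == 0]gt_eqF ?implybT.
  rewrite (_ : 1 - a - b + a = 1 - b); last by ring.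
  by rewrite /M powRM ?powR_ge0 ?(ltW Cm0)// -powRrM.
have Yb : Y `^ (b / 4) = Cq `^ (b / 4) * d `^ (- (1 + ee) ^+ 2 * (b / 4)) * v `^ (- ee * (b / 4)) * V `^ (3 * b / 4).
  rewrite /Y !powRM ?mulr_ge0 ?powR_ge0 ?exprn_ge0 ?(ltW Cq0) ?(ltW V0)// -!powRrM.
  have Vn0 z : z ==> (V != 0) by rewrite gt_eqF ?implybT.
  by rewrite -!powRD ?Vn0//; congr (_ * _ `^ _); field.
have dk : d `^ (e * (1 - b)) * d `^ (- (1 + ee) ^+ 2 * (b / 4)) = (th ^+ 2) ^+ j.
  rewrite -powRD; last by rewrite [d == 0]gt_eqF ?implybT.
  rewrite (_ : _ + _ = kap); last by rewrite /kap; ring.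
  rewrite /d -[2^-1 ^+ j]powR_mulrn// powRAC powR_mulrn ?powR_ge0//; congr (_ ^+ _).
  by rewrite /th -powR_mulrn ?powR_ge0// -powRrM divfK.
have vk : v `^ (- ee * (b / 4)) <= v `^ (- e0).
  apply: ger_powR; first by rewrite v0.
  exact: eb.
rewrite Mab Yb.
rewrite [leLHS](_ : _ = K' * (V `^ a * V `^ (3 * b / 4)) * (d `^ (e * (1 - b)) * d `^ (- (1 + ee) ^+ 2 * (b / 4))) * v `^ (- ee * (b / 4))); last first.
  by rewrite /K'; ring.
rewrite dk -powRD; last by rewrite [V == 0]gt_eqF ?implybT.
rewrite /B [leRHS]mulrAC -!mulrA.
by do 5 (rewrite ler_wpM2l ?powR_ge0 ?exprn_ge0 ?exprn_ge0 ?(ltW th0)//).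
Qed.

End restricted.

(** * Level sets of continuous functions *)

Section levels.
Variable R : realType.

Definition cube (q1 q2 q3 : rat) (n : nat) : set (TR3 R) :=
  [set z | [/\ `|z.1.1 - ratr q1| < 2^-1 ^+ n, `|z.1.2 - ratr q2| < 2^-1 ^+ n & `|z.2 - ratr q3| < 2^-1 ^+ n]].

Lemma measurable_cube q1 q2 q3 n : measurable (cube q1 q2 q3 n).
Proof.
rewrite (_ : cube q1 q2 q3 n = (`]ratr q1 - 2^-1 ^+ n, ratr q1 + 2^-1 ^+ n[%classic `*`
  `]ratr q2 - 2^-1 ^+ n, ratr q2 + 2^-1 ^+ n[%classic) `*` `]ratr q3 - 2^-1 ^+ n, ratr q3 + 2^-1 ^+ n[%classic).
  by apply: measurableX => //; exact: measurableX.
apply/seteqP; split => z; rewrite /cube /setX/= !in_itv/= !ltr_distl.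
  by move=> [].
by move=> [[]].
Qed.

Lemma rat_approx (x e : R) : 0 < e -> exists q : rat, `|x - ratr q| < e.
Proof.
move=> e0; have [|q] := @rat_in_itvoo R (x - e) (x + e); first by lra.
by rewrite in_itv/= => /andP[h1 h2]; exists q; rewrite distrC ltr_distl h1.
Qed.

(** The measurable structure is that of the product, so an open set is written as a countable union
    of cubes with rational centres. *)
Lemma open_measurable3 (O : set (R * R * R)) : open O -> measurable (O : set (TR3 R)).
Proof.
move=> oO; pose F q1 q2 q3 n := if `[< cube q1 q2 q3 n `<=` O >] then cube q1 q2 q3 n else set0.
rewrite (_ : O = \bigcup_q1 \bigcup_q2 \bigcup_q3 \bigcup_n F q1 q2 q3 n).
  do 3 (apply: bigcupT_measurable_rat => ?); apply: bigcupT_measurable => n.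
  by rewrite /F; case: ifP => _ //; exact: measurable_cube.
apply/seteqP; split => z; last first.
  by move=> [q1 _ [q2 _ [q3 _ [n _]]]]; rewrite /F; case: ifPn => // /asboolP; exact.
move=> Oz; have /nbhs_ballP[e /= e0 hb] := open_nbhs_nbhs (conj oO Oz).
have [n hn] := @geometric_small R 2 2^-1 _ ltac:(lra) ltac:(lra) e0.
have p0 : 0 < 2^-1 ^+ n :> R by rewrite exprn_gt0.
have [q1 h1] := rat_approx z.1.1 p0; have [q2 h2] := rat_approx z.1.2 p0; have [q3 h3] := rat_approx z.2 p0.
exists q1 => //; exists q2 => //; exists q3 => //; exists n => //.
rewrite /F ifT//; apply/asboolP => w [k1 k2 k3]; apply: hb.
have near (u v q : R) : `|u - q| < 2^-1 ^+ n -> `|v - q| < 2^-1 ^+ n -> `|u - v| < e.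
  by move=> a b; have := ler_distD q u v; rewrite [`|q - v|]distrC; lra.
by split; [split|]; rewrite /ball/=; [exact: near h1 k1|exact: near h2 k2|exact: near h3 k3].
Qed.

(** All integral powers of 2 listed along the natural numbers: nonnegative powers at even indices,
    negative ones at odd indices. Decay away from level 1 in both directions becomes decay in
    [i]. *)
Definition lev (i : nat) : R := if odd i then 2^-1 ^+ (i./2).+1 else 2 ^+ i./2.

Lemma lev_gt0 i : 0 < lev i. Proof. by rewrite /lev; case: ifP => _; rewrite exprn_gt0. Qed.

Lemma lev_between (v : R) : 0 < v -> exists i, lev i < v <= 2 * lev i.
Proof.
move=> v0; have [v1|v1] := leP v 1.
  have ex : exists n, 2^-1 ^+ n.+1 < v.
    have [n hn] := @geometric_small R 1 2^-1 _ ltac:(lra) ltac:(lra) v0; exists n.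
    apply: le_lt_trans hn; rewrite mul1r; apply: ler_wiXn2l => //; lra.
  case: (ex_minnP ex) => n hn mn; exists n.*2.+1; rewrite /lev/= odd_double/= uphalf_double hn/=.
  rewrite exprS mulrA divff// mul1r; case: n hn mn => [|n] hn mn; first by rewrite expr0.
  by rewrite leNgt; apply/negP => /mn; rewrite ltnn.
have ex : exists n, v <= 2 ^+ n.+1.
  have vi : 0 < v^-1 by rewrite invr_gt0.
  have [n hn] := @geometric_small R 1 2^-1 _ ltac:(lra) ltac:(lra) vi; exists n.
  apply: (@le_trans _ _ (2 ^+ n)); last by apply: ler_weXn2l => //; lra.
  by move: hn; rewrite mul1r exprVn ltf_pV2 ?posrE ?exprn_gt0// => /ltW.
case: (ex_minnP ex) => n hn mn; exists n.*2; rewrite /lev odd_double doubleK -exprS hn andbT.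
case: n hn mn => [|n] hn mn; first by rewrite expr0.
by rewrite ltNge; apply/negP => /mn; rewrite ltnn.
Qed.

Lemma lev_min i : Num.min (lev i) (lev i)^-1 = 2^-1 ^+ uphalf i.
Proof.
have le1 n : 2^-1 ^+ n <= 1 :> R by rewrite exprn_ile1//; lra.
have ge1 n : 1 <= 2 ^+ n :> R by rewrite exprn_ege1//; lra.
rewrite /lev uphalf_half; case: (odd i); rewrite ?add1n ?add0n.
  by rewrite -[in X in Num.min _ X]exprVn invrK; apply/min_idPl; exact: le_trans (le1 _) (ge1 _).
by rewrite -exprVn; apply/min_idPr; exact: le_trans (le1 _) (ge1 _).
Qed.

Variables (f : R * R * R -> R) (x Lam : R).
Hypotheses (cf : continuous f) (x0 : 0 < x) (Lam0 : 0 < Lam).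
Hypothesis fLam : (\int[lam3 R]_z (`|f z| `^ x^-1)%:E <= (Lam `^ x^-1)%:E)%E.

Definition levset i : set (TR3 R) := [set z | lev i * Lam < `|f z|].

Lemma open_levset i : open (levset i : set (R * R * R)).
Proof.
rewrite (_ : levset i = (fun z => `|f z|) @^-1` `]lev i * Lam, +oo[%classic); last first.
  by apply/seteqP; split => z; rewrite /levset/= in_itv/= andbT.
apply: open_comp; last exact: interval_open.
by move=> z _; apply: continuous_comp; [exact: cf|exact: norm_continuous].
Qed.

Lemma measurable_levset i : measurable (levset i).
Proof. by apply: open_measurable3; exact: open_levset. Qed.

Lemma open_levset_slice i (y : TR2 R) : open (xsection (levset i) y).
Proof.
rewrite (_ : xsection _ _ = (fun s : R => (y, s) : R * R * R) @^-1` levset i); last first.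
  by apply/seteqP; split => s; rewrite /xsection/= inE.
apply: open_comp; last exact: open_levset.
have cy (w : R * R) : continuous (fun s : R => (w, s) : R * R * R).
  by move=> s; exact: (@cvg_pair _ _ _ (nbhs s) (nbhs w) (nbhs s) _ _ _ (cst w) id (cvg_cst w) cvg_id).
by move=> s _; exact: (cy y).
Qed.

Lemma lam3_levset i : (lam3 R (levset i) <= (lev i `^ (- x^-1))%:E)%E.
Proof.
have c0 : 0 < lev i * Lam by rewrite mulr_gt0// lev_gt0.
have p0 : 0 < (lev i * Lam) `^ x^-1 by rewrite powR_gt0.
have : (((lev i * Lam) `^ x^-1)%:E * lam3 R (levset i) <= (Lam `^ x^-1)%:E)%E.
  apply: le_trans fLam; rewrite -integral_cst; last exact: measurable_levset.
  apply: (@le_trans _ _ (\int[lam3 R]_(z in levset i) (`|f z| `^ x^-1)%:E)%E).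
    apply: ge0_integral_mono => z hz; rewrite lee_fin ?powR_ge0//.
    by apply: ge0_ler_powR; rewrite ?nnegrE ?invr_ge0 ?(ltW x0) ?(ltW c0) ?(ltW hz).
  by apply: ge0_integral_subset => // z _; rewrite lee_fin powR_ge0.
rewrite -lee_pdivlMl// -EFinM powRM ?(ltW (lev_gt0 i)) ?(ltW Lam0)//.
rewrite powRN invfM -mulrA mulVf ?mulr1//.
by rewrite gt_eqF// powR_gt0.
Qed.

Lemma levset_cover z : (`|f z|%:E <= \sum_(i <oo) ((2 * (lev i * Lam)) * \1_(levset i) z)%:E)%E.
Proof.
have t0 i : (0 <= ((2 * (lev i * Lam)) * \1_(levset i) z)%:E)%E.
  by rewrite lee_fin !mulr_ge0 ?(ltW (lev_gt0 i)) ?(ltW Lam0).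
have [->|n0] := eqVneq (f z) 0; first by rewrite normr0; apply: nneseries_ge0.
have v0 : 0 < `|f z| / Lam by rewrite divr_gt0// normr_gt0.
have [i /andP[l1 l2]] := lev_between v0.
apply: le_trans (@nneseries_lim_ge _ _ xpredT 0 i.+1 _); last by move=> *; exact: t0.
rewrite big_nat_recr//=; apply: (@le_trans _ _ ((2 * (lev i * Lam)) * \1_(levset i) z)%:E); last first.
  by rewrite leeDr// sume_ge0.
rewrite indicE mem_set; last by move: l1; rewrite ltr_pdivlMr.
by rewrite mulr1 lee_fin mulrA -ler_pdivrMr.
Qed.

End levels.

(** * Strong estimates *)

Lemma le_uphalf_double i : (i <= (uphalf i).*2)%N.
Proof. by rewrite uphalf_half; have := odd_double_half i; lia. Qed.

Section strong.
Variable R : realType.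
Variables (r eta : R) (S H : R * R -> R).
Hypotheses (r0 : 0 < r) (r41 : 4 * r ^+ 2 <= 1) (mS : measurable_fun [set: TR2 R] S).
Hypotheses (mH : measurable_fun (sq0 r : set (TR2 R)) H) (eta0 : 0 < eta).
Hypothesis subH : forall e : R, 0 < e -> e < eta -> sublevel_bound H r e.
Hypothesis quartH : forall e : R, 0 < e -> exists2 C : R, 0 < C &
  forall (del V : R) (A : set (TR2 R)) (E : set (TR3 R)),
    0 < del -> del <= 1 -> measurable A -> A `<=` sq0 r -> (forall t, A t -> del <= `|H t|) ->
    measurable E -> (forall y, open (xsection E y)) -> 0 < V -> (lam3 R E <= V%:E)%E ->
    (\int[lam3 R]_x (fine (avg S A E x) ^+ 4)%:E <= (C * del `^ (- (1 + e) ^+ 2) * Num.min 1 V `^ (- e) * V ^+ 3)%:E)%E.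

Variables (x y : R).
Hypotheses (y0 : 0 < y) (yx : y < x) (xy3 : x / 3 < y) (xy2 : 3 * x - 2 < y).
Hypothesis xyeta : (x - y) / 2 < eta * (1 - 2 * (x - y)).

(* The estimates at two nearby exponents on the same horizontal line gain a power of [V] or [1/V]. *)
Lemma two_point : exists kap C : R, [/\ 0 < kap, 0 < C & forall (V : R) (E : set (TR3 R)),
  measurable E -> (forall y, open (xsection E y)) -> 0 < V -> (lam3 R E <= V%:E)%E ->
  (\int[lam3 R]_z (fine (avg S (sq0 r) E z) `^ y^-1)%:E <= ((C * (V `^ x * Num.min V V^-1 `^ kap)) `^ y^-1)%:E)%E].
Proof.
have hy := y0; have hyx := yx; have hxy3 := xy3; have hxy2 := xy2; have he := eta0.
pose g := eta * (1 - 2 * (x - y)) - (x - y) / 2.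
have g0 : 0 < g by rewrite /g; have := xyeta; lra.
have p1 : 0 < (x - y) / 2 by lra.
have p2 : 0 < (3 * y - x) / 2 by lra.
have p3 : 0 < (2 + y - 3 * x) / 6 by lra.
(* Moving [x] by [del] preserves all strict inequalities; the last entry handles the exponent
   condition, which moves by at most [(2 eta + 1/2) del]. *)
pose del := Num.min (Num.min ((x - y) / 2) ((3 * y - x) / 2)) (Num.min ((2 + y - 3 * x) / 6) (g / (2 * eta + 1))).
have e1 : 0 < 2 * eta + 1 by lra.
have d0 : 0 < del by rewrite !lt_min p1 p2 p3 divr_gt0.
have dl1 : del <= (x - y) / 2 by rewrite !ge_min lexx.
have dl2 : del <= (3 * y - x) / 2 by rewrite !ge_min lexx !orbT.
have dl3 : del <= (2 + y - 3 * x) / 6 by rewrite !ge_min lexx !orbT.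
have dl4 : del * (2 * eta + 1) <= g by rewrite -ler_pdivlMr// !ge_min lexx !orbT.
have point x' : `|x' - x| <= del -> exists2 C : R, 0 < C & forall (V : R) (E : set (TR3 R)),
    measurable E -> (forall y, open (xsection E y)) -> 0 < V -> (lam3 R E <= V%:E)%E ->
    (\int[lam3 R]_z (fine (avg S (sq0 r) E z) `^ y^-1)%:E <= ((C * V `^ x' * Num.min 1 V `^ (- (del / 2))) `^ y^-1)%:E)%E.
  rewrite ler_distl => /andP[x1 x2].
  have k : eta * (x' - x) <= eta * del by rewrite ler_wpM2l ?(ltW he)//; lra.
  (* The solution of [a + b / 4 = y] and [a + 3 b / 4 = x']. Its conditions [a > 0], [b > 0] and
     [a + b < 1] are [y > x' / 3], [y < x'] and [y > 3 x' - 2]. *)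
  have [||||||| C C0 hC] := @restricted_estimate R r eta S H r0 r41 mS mH eta0 subH quartH
    ((3 * y - x') / 2) (2 * (x' - y)) y^-1 (del / 2).
  - lra.
  - lra.
  - lra.
  - by rewrite invrK; field.
  - by rewrite invr_gt0.
  - by move: k dl4; rewrite /g; lra.
  - lra.
  rewrite (_ : (3 * y - x') / 2 + 3 * (2 * (x' - y)) / 4 = x') in hC; last by field.
  by exists C; [exact: C0|exact: hC].
have nd : `|del| = del by rewrite gtr0_norm.
have [|C1 C10 h1] := point (x + del); first by rewrite addrAC subrr add0r nd.
have [|C2 C20 h2] := point (x - del); first by rewrite addrAC subrr add0r normrN nd.
have k0 : 0 < del / 2 by rewrite divr_gt0.
have C0 : 0 < Num.max C1 C2 by rewrite lt_max C10.
have iy : 0 <= y^-1 by rewrite invr_ge0 ltW.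
exists (del / 2), (Num.max C1 C2); split; [exact: k0|exact: C0|] => V E mE oE V0 EV.
(* Small sets use the exponent [x + del], where the loss [V^-(del / 2)] leaves half of the gain;
   large ones use [x - del], where there is no loss. *)
have [V1|V1] := leP V 1.
  have m1 : Num.min 1 V = V by apply/min_idPr.
  have iV1 : 1 <= V^-1 by rewrite -[V^-1]mul1r ler_pdivlMr// mul1r.
  have m2 : Num.min V V^-1 = V by apply/min_idPl; exact: le_trans V1 iV1.
  apply: le_trans (h1 V E mE oE V0 EV) _; rewrite lee_fin m1 m2.
  apply: ge0_ler_powR; rewrite ?nnegrE ?mulr_ge0 ?powR_ge0 ?(ltW C10) ?(ltW C0)//.
  have Vn0 z : z ==> (V != 0) by rewrite gt_eqF ?implybT.
  rewrite -mulrA -!powRD ?Vn0// (_ : x + del + - (del / 2) = x + del / 2); last by field.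
  by rewrite ler_wpM2r ?powR_ge0// le_max lexx.
have m1 : Num.min 1 V = 1 by apply/min_idPl; exact: ltW.
have m2 : Num.min V V^-1 = V^-1.
  have iV1 : V^-1 <= 1 by rewrite -[V^-1]mul1r ler_pdivrMr// mul1r ltW.
  by apply/min_idPr; exact: le_trans iV1 (ltW V1).
apply: le_trans (h2 V E mE oE V0 EV) _; rewrite lee_fin m1 m2 powR1 mulr1.
have iV : 0 <= V^-1 by rewrite invr_ge0 ltW.
apply: ge0_ler_powR; rewrite ?nnegrE ?mulr_ge0 ?powR_ge0 ?(ltW C20) ?(ltW C0)//.
apply: ler_pM; rewrite ?powR_ge0 ?(ltW C20) ?le_max ?lexx ?orbT//.
have Vn0 z : z ==> (V != 0) by rewrite gt_eqF ?implybT.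
rewrite -powR_inv1 ?(ltW V0)// -powRrM -powRD ?Vn0//; apply: ler_powR; first exact: ltW.
by lra.
Qed.

Variables (S0 phi : R * R -> R) (M : R).
Hypotheses (SS0 : forall t, sq0 r t -> S t = S0 t) (M0 : 0 < M) (phiM : forall t, `|phi t| <= M).
Hypothesis phi_supp : forall t, phi t != 0 -> sq0 r t.

(** If the right-hand side is infinite there is nothing to show; otherwise the positive and negative
    parts have finite integrals and [fine] acts on real numbers. *)
Lemma fine_integral_le {d : measure_display} {T : measurableType d} (mu : {measure set T -> \bar R}) (g : T -> R) :
  (`|fine (\int[mu]_t (g t)%:E)|%:E <= \int[mu]_t `|g t|%:E)%E.
Proof.
set I := (\int[mu]_t `|g t|%:E)%E.
have I0 : (0 <= I)%E by apply: integral_ge0 => t _; rewrite lee_fin.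
have [->|] := eqVneq I +oo%E; first by rewrite leey.
rewrite -ltey => Ioo; rewrite integralE.
set a := (X in fine (X - _)%E); set b := (X in fine (_ - X)%E).
have a0 : (0 <= a)%E by apply: integral_ge0.
have b0 : (0 <= b)%E by apply: integral_ge0.
have aI : (a <= I)%E.
  apply: ge0_integral_mono => // t _; rewrite funeposE -EFin_max lee_fin ge_max normr_ge0 andbT; exact: ler_norm.
have bI : (b <= I)%E.
  by apply: ge0_integral_mono => // t _; rewrite funenegE -EFinN -EFin_max lee_fin ge_max normr_ge0 andbT -normrN; exact: ler_norm.
have fa : a \is a fin_num by rewrite ge0_fin_numE//; exact: le_lt_trans Ioo.
have fb : b \is a fin_num by rewrite ge0_fin_numE//; exact: le_lt_trans Ioo.
have fI : I \is a fin_num by rewrite ge0_fin_numE.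
rewrite fineB// -(fineK fI) lee_fin ler_norml.
have := fine_le fa fI aI; have := fine_le fb fI bI; have := fine_ge0 a0; have := fine_ge0 b0.
by move=> *; apply/andP; split; lra.
Qed.

(** [|f|] is at most the sum over its level sets and [|phi| <= M] on the square; the reflection
    [t -> z.1 - t] then turns each integral into an average of a level set. *)
Lemma Top_le (f : R * R * R -> R) (Lam : R) (z : TR3 R) : continuous f -> 0 < Lam ->
  (`|Top S0 phi f z|%:E <=
    \sum_(i <oo) (M * (2 * (lev R i * Lam)) * fine (avg S (sq0 r) (levset f Lam i) z))%:E)%E.
Proof.
move=> cf Lam0; have mK : measurable (sq0 r : set (TR2 R)) by exact: measurable_sq0.
pose X i : set (TR2 R) := xsection (hits S (sq0 r) (levset f Lam i)) z.
have mE i : measurable (levset f Lam i) by exact: measurable_levset.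
have mX i : measurable (X i) by apply: measurable_xsection; exact: measurable_hits.
pose c i := M * (2 * (lev R i * Lam)).
have c0 i : 0 <= c i by rewrite !mulr_ge0 ?(ltW M0) ?(ltW Lam0) ?(ltW (lev_gt0 R i)).
pose h i (t : TR2 R) : \bar R := ((c i)%:E * (\1_(X i) t)%:E)%E.
have h0 i t : (0 <= h i t)%E by rewrite mule_ge0// lee_fin.
have mI i : measurable_fun [set: TR2 R] (fun t : TR2 R => (\1_(X i) t)%:E : \bar R).
  by apply/measurable_EFinP; exact: measurable_indic.
have mh i : measurable_fun [set: TR2 R] (h i) by apply: measurable_funeM.
have msub : measurable_fun [set: TR2 R] (fun t : TR2 R => (z.1.1 - t.1, z.1.2 - t.2) : TR2 R).
  by apply: measurable_fun_pair; apply: measurable_funB.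
apply: le_trans (fine_integral_le (lam2 R) _) _.
apply: (@le_trans _ _ (\int[lam2 R]_t \sum_(i <oo) h i (z.1.1 - t.1, z.1.2 - t.2)%R)%E).
  apply: ge0_integral_mono => t _; first by rewrite lee_fin.
  have [p0|p0] := eqVneq (phi t) 0; first by rewrite p0 mulr0 normr0; apply: nneseries_ge0.
  have st := phi_supp p0.
  set w := (z.1.1 - t.1, z.1.2 - t.2, z.2 - S0 t).
  rewrite normrM mulrC EFinM; apply: (@le_trans _ _ (M%:E * `|f w|%:E)%E).
    by apply: lee_wpmul2r; rewrite lee_fin.
  apply: (@le_trans _ _ (M%:E * \sum_(i <oo) ((2 * (lev R i * Lam)) * \1_(levset f Lam i) w)%:E)%E).
    by apply: lee_wpmul2l; [rewrite lee_fin ltW|exact: levset_cover].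
  rewrite -nneseriesZl; last first.
    by move=> i _; rewrite lee_fin !mulr_ge0 ?(ltW Lam0) ?(ltW (lev_gt0 R i)).
  apply: lee_nneseries => [i _ _|i _].
    by rewrite mule_ge0// lee_fin ?(ltW M0)// !mulr_ge0 ?(ltW Lam0) ?(ltW (lev_gt0 R i)).
  rewrite /h -!EFinM lee_fin (_ : M * (_ * _) = c i * \1_(levset f Lam i) w); last by rewrite /c mulrA.
  rewrite ler_wpM2l// !indicE.
  case: (boolP (w \in _)) => //; rewrite inE => wE.
  rewrite (_ : (_, _) \in X i)//; rewrite /X /xsection/= inE /hits/= inE /sub2/= !subKr.
  by rewrite -surjective_pairing SS0.
rewrite integral_nneseries//; last by move=> i; exact: (measurableT_comp (mh i) msub).
apply: lee_nneseries => [i _ _|i _]; first by apply: integral_ge0.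
rewrite (integral_subl2 z.1 (mh i) (h0 i)) /h ge0_integralZl//; last by rewrite lee_fin.
have fin := avg_fin r0 mS z mK (mE i) (@subset_refl _ _).
by rewrite -(measure_indic (lam2 R) (mX i)) [leRHS]EFinM (fineK fin).
Qed.

(** For the measure [V = lev^(-1 / x)] of a level set the product [lev V^x] is 1, so all levels
    would count equally; the extra factor [min(V, 1 / V)^kap] makes them summable. *)
Lemma strong_estimate : exists2 C : R, 0 < C & forall (f : R * R * R -> R) (Lam : R), continuous f -> 0 < Lam ->
  (\int[lam3 R]_z (`|f z| `^ x^-1)%:E <= (Lam `^ x^-1)%:E)%E ->
  (\int[lam3 R]_z (`|Top S0 phi f z| `^ y^-1)%:E <= ((C * Lam) `^ y^-1)%:E)%E.
Proof.
have hy := y0; have hyx := yx.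
have x0 : 0 < x by lra.
have [kap [C2 [kap0 C20 hC2]]] := two_point.
pose s := kap / x; have s0 : 0 < s by rewrite divr_gt0.
pose th := (2^-1 : R) `^ (s / 4).
have th0 : 0 < th by rewrite powR_gt0.
have th1 : th < 1.
  have k2 : 0 < s / 4 by rewrite divr_gt0.
  have := @gt0_ltr_powR R (s / 4) k2 2^-1 1; rewrite !nnegrE powR1 => -> //; lra.
have q0 : 0 < y^-1 by rewrite invr_gt0.
have [K K0 hK] := integral_series_powR (lam3 R) th0 th1 q0.
exists (K `^ y * (2 * M * C2)); first by rewrite !mulr_gt0// powR_gt0.
move=> f Lam cf Lam0 fLam.
have -> : (K `^ y * (2 * M * C2) * Lam) `^ y^-1 = K * (2 * M * C2 * Lam) `^ y^-1.
  have B0 : 0 <= 2 * M * C2 * Lam by rewrite !mulr_ge0// ltW.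
  by rewrite -mulrA powRM ?powR_ge0// -powRrM divff ?gt_eqF// powRr1// ltW.
have mK : measurable (sq0 r : set (TR2 R)) by exact: measurable_sq0.
have mE i : measurable (levset f Lam i) by exact: measurable_levset.
have mav i : measurable_fun [set: TR3 R] (fun z => fine (avg S (sq0 r) (levset f Lam i) z)).
  by apply: measurableT_comp => //; exact: measurable_avg.
have av0 i z : 0 <= fine (avg S (sq0 r) (levset f Lam i) z) by rewrite fine_ge0.
have c0 i : 0 <= M * (2 * (lev R i * Lam)) by rewrite !mulr_ge0 ?(ltW M0) ?(ltW Lam0) ?(ltW (lev_gt0 R i)).
apply: (hK _ (fun i z => M * (2 * (lev R i * Lam)) * fine (avg S (sq0 r) (levset f Lam i) z))).
- by rewrite !mulr_ge0// ltW.
- by [].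
- by move=> i z; rewrite mulr_ge0.
- by move=> i; apply: measurable_funM.
- by move=> z; exact: Top_le.
move=> i; have l0 := lev_gt0 R i; pose V := lev R i `^ (- x^-1).
have V0 : 0 < V by rewrite powR_gt0.
have hV := hC2 V _ (mE i) (@open_levset_slice R f Lam cf i) V0 (lam3_levset cf x0 Lam0 fLam i).
rewrite (_ : (fun z => _) = (fun z => ((M * (2 * (lev R i * Lam))) `^ y^-1)%:E *
   (fine (avg S (sq0 r) (levset f Lam i) z) `^ y^-1)%:E)%E); last first.
  by apply/funext => z; rewrite -EFinM powRM.
rewrite ge0_integralZl//; last 3 first.
- by apply/measurable_EFinP; exact: (measurableT_comp (measurable_powR _)).
- by move=> z _; rewrite lee_fin powR_ge0.
- by rewrite lee_fin powR_ge0.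
apply: le_trans (lee_wpmul2l _ hV) _; first by rewrite lee_fin powR_ge0.
have mV0 : 0 <= Num.min V V^-1 by rewrite le_min (ltW V0) invr_ge0 ltW.
rewrite -EFinM lee_fin -powRM ?(c0 i) ?mulr_ge0 ?powR_ge0 ?(ltW C20)//.
have Vx : V `^ x = (lev R i)^-1.
  by rewrite /V -powRrM mulNr mulVf ?gt_eqF// powR_inv1// ltW.
have Ve : (lev R i)^-1 `^ x^-1 = V by rewrite -[(lev R i)^-1]powR_inv1 ?(ltW l0)// -powRrM mulN1r.
(* The minimum is [2^-(uphalf i / x)], and [i <= 2 uphalf i] converts this into a geometric rate in
   [i]. *)
have mV : Num.min V V^-1 `^ kap <= (th ^+ 2) ^+ i.
  have m1 : Num.min V V^-1 <= (2^-1 ^+ uphalf i) `^ x^-1.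
    rewrite -lev_min; case: (leP (lev R i) (lev R i)^-1) => _.
      by rewrite ge_min /V powRN invrK lexx orbT.
    by rewrite ge_min Ve lexx.
  apply: (@le_trans _ _ (((2^-1 ^+ uphalf i) `^ x^-1) `^ kap)).
    by apply: ge0_ler_powR; rewrite ?nnegrE ?powR_ge0 ?(ltW kap0).
  rewrite -[2^-1 ^+ uphalf i]powR_mulrn// -!powRrM -exprM -[th ^+ _]powR_mulrn ?(ltW th0)// /th -powRrM.
  apply: ger_powR; first by apply/andP; split; lra.
  have iu : i%:R <= 2 * (uphalf i)%:R :> R.
    by rewrite -natrM ler_nat mul2n le_uphalf_double.
  have := ler_wpM2l (ltW s0) iu.
  rewrite (_ : (uphalf i)%:R * (x^-1 * kap) = s * (uphalf i)%:R); last by rewrite /s; ring.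
  by rewrite natrM; lra.
apply: ge0_ler_powR; rewrite ?nnegrE ?(ltW q0) ?mulr_ge0 ?exprn_ge0 ?powR_ge0 ?(ltW C20) ?(ltW M0) ?(ltW Lam0) ?(ltW l0) ?(ltW th0)//.
rewrite Vx [leLHS](_ : _ = 2 * M * C2 * Lam * Num.min V V^-1 `^ kap); last by field; rewrite gt_eqF.
by rewrite ler_wpM2l// !mulr_ge0// ltW.
Qed.

End strong.

(** * Boundedness of the operator *)

Section operator.
Variable R : realType.

Lemma smooth_continuous {V : normedModType R} (f : V -> R) : smooth_fun f -> continuous f.
Proof. by move=> sf v; apply: differentiable_continuous; exact: (sf [::] v). Qed.

Lemma bump_bounded (phi : R * R -> R) : bump_function phi -> exists2 M : R, 0 < M & forall t, `|phi t| <= M.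
Proof.
move=> [sphi cphi]; have cc := smooth_continuous sphi.
have cim : compact (phi @` closure [set t | phi t != 0]).
  by apply: continuous_compact => //; exact: continuous_subspaceT.
have [M [_ hM]] := compact_bounded cim; exists (`|M| + 1); first by rewrite ltr_wpDl.
move=> t; have [->|n0] := eqVneq (phi t) 0; first by rewrite normr0 addr_ge0.
apply: (hM (`|M| + 1)); first by apply: le_lt_trans (ler_norm _) _; rewrite ltrDl.
by exists t => //; exact: subset_closure.
Qed.

Lemma Lnorm_powR (g : R * R * R -> R) (p : R) :
  Lnorm (@leb3 R) p%:E (fun z => (g z)%:E) = poweR (\int[lam3 R]_z (`|g z| `^ p)%:E)%E p^-1.
Proof. by rewrite unlock. Qed.

(** From [w / (1 - w) < eta <= 2 eta' / (1 + 2 eta')] follows [w (1 + 2 eta') < 2 eta' (1 - w)],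
    that is [w < 2 eta' (1 - 2 w)]. With [w = x - y] this is where the side of the trapezoid
    involving [eta] is used. *)
Lemma trapezoid_gap (eta eta' w : R) : 0 <= eta -> 0 <= eta' -> eta <= 2 * eta' / (1 + 2 * eta') ->
  0 < w -> w < 1 -> w < eta / (eta + 1) -> 0 < eta' /\ w / 2 < eta' * (1 - 2 * w).
Proof.
move=> e0 e0' ee w0 w1.
have d0 : 0 < eta + 1 by lra.
have d0' : 0 < 1 + 2 * eta' by lra.
rewrite ltr_pdivlMr// => we; move: ee; rewrite ler_pdivlMr// => ee.
have h : eta * (1 + 2 * eta') * (1 - w) <= 2 * eta' * (1 - w) by rewrite ler_wpM2r//; lra.
have k : w * (1 + 2 * eta') < eta * (1 - w) * (1 + 2 * eta') by rewrite ltr_pM2r//; lra.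
have we0 : 0 <= w * eta' by rewrite mulr_ge0// ltW.
by split; lra.
Qed.

End operator.

Theorem theorem1p3 (R : realType) (S : R * R -> R) :
  analytic_near0 S -> ~ zero_near0 S ->
  S 0 = 0 -> d1 S 0 = 0 -> d2 S 0 = 0 ->
  hessian S 0 = 0 -> ~ zero_near0 (hessian S) ->
  let eta := integrability_exponent S in
  let eta' := integrability_exponent (hessian S) in
  eta <= 2 * eta' / (1 + 2 * eta') ->
  exists2 U : set (R * R), nbhs (0 : R * R) U &
    forall phi : R * R -> R, bump_function phi ->
      closure [set t | phi t != 0] `<=` U ->
      forall x y : R, trapezoid_interior eta x y ->
        LpLq_bounded (Top S phi) x^-1 y^-1.
Proof.
move=> anS _ _ _ _ _ nH eta eta' hEta.
have [r [Sx [r0 r41 mS [SE mH sub quart]]]] := analytic_setup anS nH.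
exists (sq0 r); first exact: nbhs_sq0.
move=> phi bphi supp x y [yx xe x3 xy2].
have x0 : 0 < x by lra.
have y0 : 0 < y by lra.
have [|||eta0 gap] := @trapezoid_gap R eta eta' (x - y) (integrability_exponent_ge0 S)
  (integrability_exponent_ge0 (hessian S)) hEta; [lra|lra|lra|].
have [M M0 phiM] := bump_bounded bphi.
have phi_supp t : phi t != 0 -> sq0 r t by move=> pt; apply: supp; exact: subset_closure.
have [C C0 hC] := strong_estimate r0 r41 mS mH eta0 sub quart y0 yx x3 xy2 gap SE M0 phiM phi_supp.
exists C => f [/smooth_continuous cf _].
rewrite !Lnorm_powR !invrK.
set I := (\int[lam3 R]_z (`|f z| `^ x^-1)%:E)%E.
have I0 : (0 <= I)%E by apply: integral_ge0 => z _; rewrite lee_fin powR_ge0.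
move: I0; case EI : I => [i| |]// i0; last first.
  by rewrite poweRyr ?gt_eqF// gt0_muley ?leey// lte_fin.
rewrite poweR_EFin -EFinM; rewrite lee_fin in i0.
apply/lee_addgt0Pr => e e0.
(* The estimate needs a positive [Lam], while the norm of [f] may vanish; the excess costs [e] in
   the result and is arbitrary. *)
pose Lam := i `^ x + e / C.
have Lam0 : 0 < Lam by rewrite ltr_wpDl ?powR_ge0// divr_gt0.
have fL : (I <= (Lam `^ x^-1)%:E)%E.
  rewrite EI lee_fin; have -> : i = (i `^ x) `^ x^-1 by rewrite -powRrM divff ?gt_eqF// powRr1.
  apply: ge0_ler_powR; rewrite ?nnegrE ?powR_ge0 ?invr_ge0 ?(ltW x0) ?(ltW Lam0)//.
  by rewrite lerDl divr_ge0// ltW.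
have := hC f Lam cf Lam0 fL; set J := (\int[lam3 R]_z _)%E.
have J0 : (0 <= J)%E by apply: integral_ge0 => z _; rewrite lee_fin powR_ge0.
move: J0; case: J => [j| |]// j0; rewrite !lee_fin in j0 * => hj.
have CL0 : 0 <= C * Lam by rewrite mulr_ge0// ltW.
apply: (@le_trans _ _ (((C * Lam) `^ y^-1) `^ y)).
  by apply: ge0_ler_powR; rewrite ?nnegrE ?powR_ge0 ?(ltW y0).
rewrite -powRrM mulVf ?gt_eqF// powRr1// /Lam mulrDr lerD2l mulrC divfK// gt_eqF//.
Qed.
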